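(* Let $n\ge 3$, $M>0$, and let $D,V\in C(2M,\infty)$ satisfy $$0\le D(r)\le \mu_1 r^{-\beta},\qquad 0\le V(r)\le \mu_2 r^{-\gamma},\qquad r>2M,$$ for some constants $\mu_1,\mu_2\ge 0$, $\beta>1$, $\gamma>2$. Let $u_0,u_1$ be nonnegative, nontrivial functions on $\Omega$ with $$\operatorname{supp} u_0,\ \operatorname{supp} u_1\subset\{2M+R_1\le r\le 2M+R_2\}\times\mathbb{S}^{n-1}$$ for some constants $0<R_1<R_2$, and let $R>0$ be such that this support condition implies $\operatorname{supp} u_0,\operatorname{supp} u_1\subset\{|s|\le R\}\times\mathbb{S}^{n-1}$. Consider the Cauchy problem $$\square_{g_S}u+D(r)u_t+V(r)u=|u|^p\ \text{ in } (0,T)\times\Omega,\qquad u(0,x)=\varepsilon u_0(x),\quad u_t(0,x)=\varepsilon u_1(x),\ x\in\Omega .$$ Then for any $1<p<p_S(n)$, any weak solution $u$ of this problem satisfying $$\operatorname{supp} u(t,\cdot)\subset\{|s|\le t+R\}\times\mathbb{S}^{n-1}\quad\text{for all } t\in(0,T_\varepsilon)$$ blows up in finite time. In addition, there exist positive constants $C,\varepsilon_0$ (independent of $\varepsilon$) such that the lifespan $T_\varepsilon$ satisfies, for any $0<\varepsilon\le\varepsilon_0$, $$T_\varepsilon\le\begin{cases} C\varepsilon^{-\frac{2(p-1)}{n+1-(n-1)p}}, & 1<p\le\frac{n}{n-1},\\[4pt] C\varepsilon^{-\frac{2p(p-1)}{\gamma(p,n)}}, & \frac{n}{n-1}<p<p_S(n).\end{cases}$$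 Moreover, when $V=0$ and $p=p_S(n)$, there exist positive constants $C,\varepsilon_0$ such that for any $0<\varepsilon\le\varepsilon_0$, $$T_\varepsilon\le\exp\big(C\varepsilon^{-p(p-1)}\big).$$
   Context: Let $F(r)=1-\frac{2M}{r}$ and $\Omega=\{(r,\omega): r>2M,\ \omega\in\mathbb{S}^{n-1}\}=(2M,\infty)\times\mathbb{S}^{n-1}$, with points of $\Omega$ denoted $x$, $|x|=r$. The operator is $$\square_{g_S}u=\frac1F\partial_t^2u-\Delta_{g_S}u,\qquad \Delta_{g_S}u=\frac{1}{r^{n-1}}\partial_r\big(r^{n-1}F\,\partial_r u\big)+\frac{1}{r^2}\Delta_{\mathbb{S}^{n-1}}u,$$ where $\Delta_{\mathbb{S}^{n-1}}$ is the standard Laplace-Beltrami operator on $\mathbb{S}^{n-1}$. The tortoise coordinate is $s=r+2M\ln(r-2M)$; $r\mapsto s$ is a bijection $(2M,\infty)\to\mathbb{R}$, with inverse $r(s)$. The set $\{|s|\le\rho\}\times\mathbb{S}^{n-1}$ is the set of $(r,\omega)\in\Omega$ whose tortoise coordinate $s$ has $|s|\le\rho$. Write $\gamma(p,n)=2+(n+1)p-(n-1)p^2$ (not to be confused with the decay exponent $\gamma$ of $V$); $p_S(n)$ is the positive root $p$ of $\gamma(p,n)=0$. Weak solution on $(0,T)$, in the usual sense: $u\in L^p_{loc}([0,T)\times\Omega)$ such that for all compactly supported $C^2$ functions $\varphi$ on $[0,T)\times\Omega$ (with respect to the measure $r^{n-1}dr\,d\omega\,dt$) $$\int_0^T\!\!\int_\Omega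 |u|^p\varphi\, r^{n-1}dr\,d\omega\, dt+\varepsilon\int_\Omega\Big(\frac{u_1\varphi(0)-u_0\varphi_t(0)}{F}+Du_0\varphi(0)\Big)r^{n-1}dr\,d\omega=\int_0^T\!\!\int_\Omega u\Big(\frac{\varphi_{tt}}{F}-\Delta_{g_S}\varphi-D\varphi_t+V\varphi\Big)r^{n-1}dr\,d\omega\, dt ,$$ where $u_0,u_1$ are (at least) locally integrable. The size of the data is $\varepsilon>0$, and $T_\varepsilon$ denotes the lifespan, i.e. the supremum of the times $T$ for which such a solution, satisfying the stated support condition, exists on $(0,T)$; ''blows up in finite time'' means $T_\varepsilon<\infty$. *)

(* Defs.v *)
From HB Require Import structures.
From mathcomp Require Import all_boot all_order all_algebra.
From mathcomp Require Import all_classical all_reals all_analysis.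
From mathcomp Require Import measurable_realfun.
Set Implicit Arguments.
Unset Strict Implicit.
Unset Printing Implicit Defensive.
Import Order.TTheory GRing.Theory Num.Theory numFieldNormedType.Exports.
Local Open Scope classical_set_scope.
Local Open Scope ring_scope.

Definition rV_display (d : measure_display) : measure_display.
Proof. exact: d. Qed.

Section rV_measurable.
Context {d} {T : measurableType d} (n : nat).

Let coord (i : 'I_n) (x : 'rV[T]_n) : T := x 0 i.

Let rV_set0 : g_sigma_preimage coord set0.
Proof. exact: sigma_algebra0. Qed.

Let rV_setC A : g_sigma_preimage coord A -> g_sigma_preimage coord (~` A).
Proof. exact: sigma_algebraC. Qed.

Let rV_bigcup (F : (set 'rV[T]_n)^nat) :
  (forall i, g_sigma_preimage coord (F i)) ->
  g_sigma_preimage coord (\bigcup_i F i).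
Proof. exact: sigma_algebra_bigcup. Qed.

(* The product sigma-algebra; for T = R it is the Borel one. *)
HB.instance Definition _ := @isMeasurable.Build (rV_display d) 'rV[T]_n
  (g_sigma_preimage coord) rV_set0 rV_setC rV_bigcup.

Lemma measurable_coord (i : 'I_n) :
  measurable_fun [set: 'rV[T]_n] (fun x : 'rV[T]_n => x 0 i).
Proof.
move=> _ Y mY; rewrite setTI; apply: sub_sigma_algebra => /=.
rewrite -bigcup_seq/=; exists i => /=; first by rewrite mem_index_enum.
by exists Y => //; rewrite setTI.
Qed.

Lemma measurable_fun_rV d' (T' : measurableType d') (f : T' -> 'rV[T]_n) :
  (forall i, measurable_fun [set: T'] (fun x => f x 0 i)) ->
  measurable_fun [set: T'] f.
Proof.
move=> mf _ A mA; rewrite setTI.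
suff: (g_sigma_preimage coord) `<=` image_set_system setT f measurable.
  by move=> /(_ _ mA); rewrite /image_set_system/= setTI.
apply: smallest_sub.
  by apply: sigma_algebra_image; exact: sigma_algebra_measurable.
rewrite -bigcup_seq; apply: bigcup_sub => i _ _ [Y mY <-].
rewrite /image_set_system/= !setTI; have := mf i measurableT Y mY; rewrite setTI.
exact.
Qed.

End rV_measurable.

(* The library only makes a product of sigma-finite measures canonically a
   measure: its SigmaFiniteMeasure instance on \x is shadowed by the one for
   subprobabilities. *)
Section product_sigma_finite.
Context d1 d2 (T1 : measurableType d1) (T2 : measurableType d2) (R : realType).
Variable m1 : {sigma_finite_measure set T1 -> \bar R}.
Variable m2 : {sigma_finite_measure set T2 -> \bar R}.

Lemma sigma_finite_product : sigma_finite setT (m1 \x m2)%E.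
Proof.
have /sigma_finiteP[F [TF ndF Foo]] := sigma_finiteT m1.
have /sigma_finiteP[G [TG ndG Goo]] := sigma_finiteT m2.
exists (fun n => F n `*` G n).
  rewrite -setXTT TF TG predeqE => -[x y]; split.
    move=> [/= [n _ Fnx] [k _ Gky]]; exists (maxn n k) => //; split.
    - by move: x Fnx; exact/subsetPset/ndF/leq_maxl.
    - by move: y Gky; exact/subsetPset/ndG/leq_maxr.
  by move=> [n _ []/= ? ?]; split; exists n.
move=> k; have [? ?] := Foo k; have [? ?] := Goo k.
split; first exact: measurableX.
by rewrite product_measure1E// lte_mul_pinfty// ge0_fin_numE.
Qed.

Definition sprod : set (T1 * T2) -> \bar R := (m1 \x m2)%E.

HB.instance Definition _ := Measure.on sprod.
HB.instance Definition _ :=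
  Measure_isSigmaFinite.Build _ _ _ sprod sigma_finite_product.

End product_sigma_finite.

Section lebesgue_R.
Context {R : realType}.

(* lebesgue_measure is declared on measurableTypeR R, whose measurable
   structure is convertible, but not canonically equal, to that of R. *)
Definition lebesgue_R : set R -> \bar R := @lebesgue_measure R.

Let lebesgue_R0 : lebesgue_R set0 = 0%E.
Proof. exact: (@measure0 _ _ _ (@lebesgue_measure R)). Qed.

Let lebesgue_R_ge0 A : (0 <= lebesgue_R A)%E.
Proof. exact: (@measure_ge0 _ _ _ (@lebesgue_measure R)). Qed.

Let lebesgue_R_sigma_additive : semi_sigma_additive lebesgue_R.
Proof. exact: (@measure_semi_sigma_additive _ _ _ (@lebesgue_measure R)). Qed.

HB.instance Definition _ := isMeasure.Build _ _ _ lebesgue_R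
  lebesgue_R0 lebesgue_R_ge0 lebesgue_R_sigma_additive.

Let lebesgue_R_sigma_finite : sigma_finite setT lebesgue_R.
Proof. exact: (@sigma_finiteT _ _ _ (@lebesgue_measure R)). Qed.

HB.instance Definition _ :=
  Measure_isSigmaFinite.Build _ _ _ lebesgue_R lebesgue_R_sigma_finite.

End lebesgue_R.

Section lebesgue_rV.
Context {R : realType}.

Definition cons_rV n (z : R * 'rV[R]_n) : 'rV[R]_n.+1 :=
  \row_i oapp (fun j => z.2 0 j) z.1 (unlift ord0 i).

Lemma cons_rVE n (x : R) (v : 'rV[R]_n) : cons_rV (x, v) 0 ord0 = x /\
  forall j, cons_rV (x, v) 0 (lift ord0 j) = v 0 j.
Proof. by split => [|j]; rewrite mxE ?unlift_none ?liftK. Qed.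

Lemma measurable_cons_rV n : measurable_fun setT (@cons_rV n).
Proof.
apply: measurable_fun_rV => i.
case: (unliftP ord0 i) => [j ->|->].
- under eq_fun do rewrite mxE liftK /=.
  exact: (measurableT_comp (measurable_coord j) measurable_snd).
- under eq_fun do rewrite mxE unlift_none /=.
  exact: measurable_fst.
Qed.

Section step.
Context {n : nat} (mu : {sigma_finite_measure set 'rV[R]_n -> \bar R}).

Definition lebesgue_step : set 'rV[R]_n.+1 -> \bar R :=
  pushforward (sprod lebesgue_R mu) (@cons_rV n).

Let step0 : lebesgue_step set0 = 0%E.
Proof. by rewrite /lebesgue_step /pushforward preimage_set0 measure0. Qed.

Let step_ge0 A : (0 <= lebesgue_step A)%E.
Proof. exact: (measure_ge0 (sprod lebesgue_R mu)). Qed.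

Let step_sigma_additive : semi_sigma_additive lebesgue_step.
Proof.
exact: (@measure_semi_sigma_additive _ _ _
  (measure_function_pushforward__canonical__measure_function_Measure
    (sprod lebesgue_R mu) (@measurable_cons_rV n))).
Qed.

HB.instance Definition _ := isMeasure.Build _ _ _ lebesgue_step
  step0 step_ge0 step_sigma_additive.

Let step_sigma_finite : sigma_finite setT lebesgue_step.
Proof.
have [F TF Foo] := sigma_finiteT (sprod lebesgue_R mu).
pose g (x : 'rV[R]_n.+1) : R * 'rV[R]_n :=
  (x 0 ord0, \row_j x 0 (lift ord0 j)).
have mg : measurable_fun setT g.
  apply: measurable_fun_pair; first exact: measurable_coord.
  apply: measurable_fun_rV => j; under eq_fun do rewrite mxE.
  exact: measurable_coord.
have gK z : g (cons_rV z) = z.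
  case: z => x v; have [e0 eS] := cons_rVE x v; rewrite /g e0; congr pair.
  by apply/rowP => j; rewrite mxE eS.
exists (fun k => g @^-1` F k).
  by rewrite -preimage_bigcup -TF preimage_setT.
move=> k; have [mF Fk] := Foo k; split.
  by rewrite -[X in measurable X]setTI; exact: mg.
rewrite /lebesgue_step /pushforward (_ : _ @^-1` _ = F k)//.
by apply/seteqP; split => z /=; rewrite gK.
Qed.

HB.instance Definition _ :=
  Measure_isSigmaFinite.Build _ _ _ lebesgue_step step_sigma_finite.

End step.

(* n-dimensional Lebesgue measure: the n-fold product of lebesgue_measure. *)
Fixpoint lebesgue_rV n : {sigma_finite_measure set 'rV[R]_n -> \bar R} :=
  if n is n'.+1 then lebesgue_step (lebesgue_rV n') else \d_(0 : 'rV[R]_0).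

Lemma lebesgue_rV_cube n (a : R) :
  measurable [set x : 'rV[R]_n | forall i, `|x 0 i| <= a] /\
  (lebesgue_rV n [set x | forall i, (`|x 0 i| <= a)%R] < +oo)%E.
Proof.
have mA m : measurable [set x : 'rV[R]_m | forall i, `|x 0 i| <= a].
  rewrite (_ : [set _ | _] = \bigcap_(i in setT)
    ((fun x : 'rV[R]_m => x 0 i) @^-1` `[- a, a])); last first.
    apply/seteqP; split => x /= H i; first by rewrite /= in_itv/= -ler_norml.
    by have := H i I; rewrite /= in_itv/= -ler_norml.
  apply: fin_bigcap_measurable; first exact: finite_finset.
  move=> i _; rewrite -[X in measurable X]setTI.
  by apply: measurable_coord => //; exact: measurable_itv.
split; first exact: mA.
elim: n => [|n IH] /=.
  by rewrite diracE; case: (_ \in _) => /=; rewrite ltry.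
rewrite /lebesgue_step /pushforward.
rewrite (_ : _ @^-1` _ = `[- a, a] `*` [set x : 'rV[R]_n | forall i, `|x 0 i| <= a]);
  last first.
  apply/seteqP; split => -[x v] /=; have [e0 eS] := cons_rVE x v.
    move=> H; rewrite in_itv/= -ler_norml -{1}e0; split; first exact: H.
    by move=> i; rewrite -eS.
  rewrite in_itv/= -ler_norml => -[xa va] i.
  by case: (unliftP ord0 i) => [j ->|->]; rewrite ?e0 ?eS.
rewrite /sprod product_measure1E//; [|exact: mA].
have I_fin : (lebesgue_R `[(- a)%R, a]%classic < +oo)%E.
  rewrite [ltLHS](lebesgue_measure_itv `[(- a)%R, a]) /=.
  by case: ifPn => _; rewrite ?ltry// -EFinD ltry.
by rewrite lte_mul_pinfty// ge0_fin_numE.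
Qed.

End lebesgue_rV.

Section sphere.
Context {R : realType} (n : nat).
Implicit Types x w : 'rV[R]_n.

Definition enorm x : R := Num.sqrt (\sum_i x 0 i ^+ 2).

(* S^{n-1}; the library norm on 'rV[R]_n is the sup norm. *)
Definition sphere : set 'rV[R]_n := [set x | enorm x = 1].

Definition to_sphere x : 'rV[R]_n := (enorm x)^-1 *: x.

Definition punctured_ball : set 'rV[R]_n := [set x | 0 < enorm x <= 1].

Lemma measurable_enorm : measurable_fun setT enorm.
Proof.
rewrite (_ : enorm = fun x => (\sum_i x 0 i ^+ 2) `^ 2^-1); last first.
  apply/funext => x; rewrite powR12_sqrt//.
  by apply: sumr_ge0 => i _; exact: sqr_ge0.
apply: (measurableT_comp (@measurable_powR R 2^-1)).
apply: measurable_sum => i; apply: measurable_funX.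
exact: measurable_coord.
Qed.

Lemma measurable_to_sphere : measurable_fun setT to_sphere.
Proof.
apply: measurable_fun_rV => i.
rewrite (_ : (fun _ => _) = fun x => enorm x `^ (-1) * x 0 i); last first.
  by apply/funext => x; rewrite mxE powR_inv1// sqrtr_ge0.
apply: measurable_funM; last exact: measurable_coord.
exact: (measurableT_comp (@measurable_powR R (-1)) measurable_enorm).
Qed.

Lemma measurable_punctured_ball : measurable punctured_ball.
Proof.
rewrite (_ : punctured_ball = enorm @^-1` `]0, 1]); last first.
  by apply/seteqP; split => x /=; rewrite in_itv.
by rewrite -[X in measurable X]setTI; exact: measurable_enorm.
Qed.

(* Surface measure, as the cone measure
   sigma(A) = n * |{x : 0 < |x| <= 1, x / |x| \in A}|. *)
Definition sphere_measure (A : set 'rV[R]_n) : \bar R :=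
  (n%:R%:E * lebesgue_rV n (to_sphere @^-1` A `&` punctured_ball))%E.

Let m_cone : {measure set 'rV[R]_n -> \bar R} :=
  mscale n%:R%:nng
    (measure_function_pushforward__canonical__measure_function_Measure
      (mrestr (lebesgue_rV n) measurable_punctured_ball) measurable_to_sphere).

Let sphere_measure0 : sphere_measure set0 = 0%E.
Proof. exact: (measure0 m_cone). Qed.

Let sphere_measure_ge0 A : (0 <= sphere_measure A)%E.
Proof. exact: (measure_ge0 m_cone). Qed.

Let sphere_measure_sigma_additive : semi_sigma_additive sphere_measure.
Proof. exact: (@measure_semi_sigma_additive _ _ _ m_cone). Qed.

HB.instance Definition _ := isMeasure.Build _ _ _ sphere_measure
  sphere_measure0 sphere_measure_ge0 sphere_measure_sigma_additive.

Let sphere_measure_finite : fin_num_fun sphere_measure.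
Proof.
apply: lty_fin_num_fun => /=.
rewrite /sphere_measure (_ : to_sphere @^-1` _ = setT)// setTI.
rewrite lte_mul_pinfty// ?lee_fin//.
have [mC C_fin] := @lebesgue_rV_cube R n 1.
apply: le_lt_trans C_fin; apply: le_measure.
- by rewrite inE; exact: measurable_punctured_ball.
- by rewrite inE.
move=> x /andP[_ x1] i /=.
rewrite -(ler_pXn2r (_ : 0 < 2)%N)// ?nnegrE// expr1n real_normK ?num_real//.
rewrite (le_trans (_ : _ <= \sum_j x 0 j ^+ 2))//.
  by rewrite (bigD1 i)//= lerDl sumr_ge0// => j _; exact: sqr_ge0.
by move: x1; rewrite /enorm -{1}sqrtr1 ler_sqrt.
Qed.

HB.instance Definition _ :=
  Measure_isFinite.Build _ _ _ sphere_measure sphere_measure_finite.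

(* Laplace-Beltrami operator of the round metric, as the Euclidean Laplacian
   of the extension of f that is homogeneous of degree 0. Only the values of f
   on the sphere are used. *)
Definition laplace_sphere (f : 'rV[R]_n -> R) w : R :=
  \sum_i 'D_(delta_mx 0 i) ('D_(delta_mx 0 i) (f \o to_sphere)) w.

End sphere.
Arguments sphere {R} n.
Arguments sphere_measure {R} n.

(* Meant for finite-dimensional V and open U, where the continuity of all
   directional derivatives of order <= k is the usual notion. *)
Fixpoint is_Ck {R : realType} {V : normedModType R} (k : nat) (U : set V)
    (f : V -> R) : Prop :=
  {within U, continuous f} /\
  if k is k'.+1 then
    forall v, (forall x, U x -> derivable f x v) /\ is_Ck k' U ('D_v f)
  else True.

Section schwarzschild.
Context {R : realType} (n : nat) (M : R).
Local Notation space := (R * 'rV[R]_n)%type.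
Local Notation spacetime := (R * (R * 'rV[R]_n))%type.
Implicit Types (x : space) (z : spacetime).

Definition lapse (r : R) : R := 1 - 2 * M / r.

Definition tortoise (r : R) : R := r + 2 * M * ln (r - 2 * M).

(* A point of Omega is a pair (r, w) with r > 2M and w on the sphere. *)
Definition Omega : set space := [set x | 2 * M < x.1 /\ sphere n x.2].

Definition slab (T : R) : set spacetime :=
  [set z | 0 <= z.1 < T /\ Omega z.2].

Definition tortoise_ball (rho : R) : set space :=
  [set x | Omega x /\ `|tortoise x.1| <= rho].

Definition annulus (R1 R2 : R) : set space :=
  [set x | Omega x /\ 2 * M + R1 <= x.1 <= 2 * M + R2].

(* dr dw and dt dr dw; the density r^{n-1} is written in the integrands. *)
Definition dr_dw : {measure set space -> \bar R} :=
  sprod lebesgue_R (sphere_measure n).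

Definition dt_dr_dw : {measure set spacetime -> \bar R} :=
  sprod lebesgue_R (sprod lebesgue_R (sphere_measure n)).

Definition ae_Omega (P : space -> Prop) : Prop :=
  {ae dr_dw, forall x, Omega x -> P x}.

(* Support in Omega of a function defined almost everywhere: the complement
   of the largest open set where it vanishes almost everywhere. *)
Definition ess_supp (f : space -> R) : set space :=
  [set x | Omega x /\
    forall U, nbhs x U -> ~ ae_Omega (fun y => U y -> f y = 0)].

Definition L1loc_Omega (f : space -> R) : Prop :=
  measurable_fun Omega f /\
  forall K : set space, compact K -> K `<=` Omega ->
    dr_dw.-integrable K (fun x => (f x * x.1 ^+ n.-1)%:E).

Definition Lploc_slab (T p : R) (u : spacetime -> R) : Prop :=
  measurable_fun (slab T) u /\
  forall K : set spacetime, compact K -> K `<=` slab T ->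
    dt_dr_dw.-integrable K (fun z => (`|u z| `^ p * z.2.1 ^+ n.-1)%:E).

Definition laplace_gS (f : space -> R) x : R :=
  (x.1 ^+ n.-1)^-1 *
    derive1 (fun r => r ^+ n.-1 * lapse r *
                      derive1 (fun s => f (s, x.2)) r) x.1 +
  (x.1 ^+ 2)^-1 * laplace_sphere (fun w => f (x.1, w)) x.2.

Definition dt (phi : spacetime -> R) z : R :=
  derive1 (fun t => phi (t, z.2)) z.1.

(* Compactly supported C^2 functions on [0, T) x Omega. C^2 up to t = 0 means
   being the restriction of a C^2 function on (-oo, T) x Omega; smoothness in
   the angular variable is that of the extension homogeneous of degree 0. *)
Definition test_function (T : R) (phi : spacetime -> R) : Prop :=
  is_Ck 2 [set z : spacetime | [/\ z.1 < T, 2 * M < z.2.1 & z.2.2 != 0]]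
    (fun z => phi (z.1, (z.2.1, to_sphere z.2.2))) /\
  exists K : set spacetime, [/\ compact K, K `<=` slab T &
    forall z, slab T z -> ~ K z -> phi z = 0].

Section problem.
Variables (D V : R -> R) (p : R) (u0 u1 : space -> R).

Definition weak_solution (eps T : R) (u : spacetime -> R) : Prop :=
  Lploc_slab T p u /\
  forall phi, test_function T phi ->
    \int[dt_dr_dw]_(z in slab T) (`|u z| `^ p * phi z * z.2.1 ^+ n.-1) +
    eps * \int[dr_dw]_(x in Omega)
      (((u1 x * phi (0, x) - u0 x * dt phi (0, x)) / lapse x.1 +
        D x.1 * u0 x * phi (0, x)) * x.1 ^+ n.-1) =
    \int[dt_dr_dw]_(z in slab T)
      (u z * (dt (dt phi) z / lapse z.2.1 -
              laplace_gS (fun x => phi (z.1, x)) z.2 -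
              D z.2.1 * dt phi z + V z.2.1 * phi z) * z.2.1 ^+ n.-1).

(* rho is the constant R of the support condition on u. *)
Definition admissible_time (rho eps T : R) : Prop :=
  0 < T /\ exists2 u, weak_solution eps T u &
    forall t, 0 < t < T ->
      ess_supp (fun x => u (t, x)) `<=` tortoise_ball (t + rho).

Definition lifespan (rho eps : R) : \bar R :=
  ereal_sup [set T%:E | T in admissible_time rho eps].

End problem.
End schwarzschild.

Definition gamma_poly {R : realType} (p : R) (n : nat) : R :=
  2 + (n%:R + 1) * p - (n%:R - 1) * p ^+ 2.

Definition strauss_exponent {R : realType} (n : nat) (pS : R) : Prop :=
  0 < pS /\ gamma_poly pS n = 0.

(* Main.v *)
Require Import Defs.
From HB Require Import structures.
From mathcomp Require Import all_boot all_order all_algebra.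
From mathcomp Require Import all_classical all_reals all_analysis.
From mathcomp Require Import measurable_realfun ring lra.
Set Implicit Arguments.
Unset Strict Implicit.
Unset Printing Implicit Defensive.
Import Order.TTheory GRing.Theory Num.Theory numFieldNormedType.Exports.
Local Open Scope classical_set_scope.
Local Open Scope ring_scope.

(** The proof is a test function argument: the equation is paired with positive
    functions that solve the adjoint equation exactly except where a time cutoff
    is active, and the resulting inequalities are played off against each other.

    Time function. Let F = 1 - 2M/r and let g (delay) be a nonnegative
    decreasing radial harmonic function, r^(n-1) F g' = const; it tends to +oo
    at the horizon. Put w = t + g(r) (wtime). The level sets of w are
    space-like, and the part of the solution's cone with w <= T stays at a
    positive distance from the horizon and within r <= T + const, so functions
    of w cut off at T, times radial functions, are compactly supported test
    functions, although t itself offers no cutoff near the horizon.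

    Test functions. For 0 <= lambda <= 1 consider mode = exp(- lambda w) z(r).
    It solves the adjoint equation, damping and potential included, if z solves
    a linear radial equation (m F z')' = m Q z with Q >= 0. The solution
    normalised by z = 1 at the horizon is obtained by monotone iteration of the
    Volterra form of that equation, and an explicit supersolution gives,
    uniformly in lambda, with k = (n-1)/2 and sigma(r) the tortoise coordinate
    plus g,
      1 <= z <= C exp(lambda sigma) (1 + lambda r)^(-k)
    (radial_family); the decay of D and V makes their effect on z bounded.
    Multiplying mode by a cutoff in w / T leaves, in the adjoint equation, only
    commutator terms carried by the window T/2 <= w < T and bounded by
      flow = C mode (1/r + lambda) / T
    (adjoint_mode_bound). Since u vanishes outside the cone, the weak
    formulation becomes (key_inequality)
      mass + eps * data <= integral of |u| flow over the window,
    where mass is the integral of |u|^p times the cut-off mode, and data is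
    nonnegative, and bounded below when lambda = 1 because u1 does not vanish.

    Subcritical powers. Let q be conjugate to p. With lambda = 0, Young's
    inequality absorbs |u| flow into mass and bounds it by a power of T, with
    exponent slope0. With lambda = 1 the data are seen: the right-hand side is
    at most dl * (mass for lambda = 0) + C dl^(1-q) T^slope1 for every dl > 0.
    The optimal dl gives eps <= C T^(- kappa) with kappa > 0 as soon as
    gamma_poly p n > 0, and that is the lifespan bound.

    Critical power. The exponent kappa now vanishes, and a logarithm is gained
    by superposing the modes with lambda = 2^-j and weights lambda^(k - 1/p)
    (super_mode). On the whole cone up to w = T the sum is at least
    c T^(-(k - 1/p)), while Young's inequality for its flow costs only a factor
    ln T instead of a power (super_flow_estimate). If b_m is the mass carried by
    w < 2^m, it follows that
      b_m <= C m,  b_(m+1) - b_m >= c eps^p,  b_(m+1) - b_m >= c b_m^p m^(1-p).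
    This discrete Riccati inequality can hold for at most C eps^(-p(p-1)) values
    of m (growth_bound), which bounds the logarithm of the lifespan. *)

(** * Comparison of integrals *)

Section ge0_le_integral_nomeas.
Local Open Scope ereal_scope.
Context d (T : measurableType d) (R : realType).
Variable mu : {measure set T -> \bar R}.

(** A nonnegative integral is a supremum over simple functions below the
    integrand, so it is monotone for arbitrary integrands. This avoids
    measurability side conditions for integrands that mix u with truncations. *)
Lemma le_integral_nomeas (D : set T) (f1 f2 : T -> \bar R) :
  (forall x, D x -> 0 <= f1 x) -> (forall x, D x -> f1 x <= f2 x) ->
  \int[mu]_(x in D) f1 x <= \int[mu]_(x in D) f2 x.
Proof.
move=> f10 f12.
have f20 x : D x -> 0 <= f2 x by move=> Dx; exact: le_trans (f10 _ Dx) (f12 _ Dx).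
rewrite !ge0_integralE//.
apply: le_ereal_sup => _ /= [h hf <-]; exists h => //= x.
apply: le_trans (hf x) _; rewrite /patch; case: ifPn => //.
by rewrite inE; exact: f12.
Qed.

Lemma subset_integral_nomeas (A B : set T) (f : T -> \bar R) :
  A `<=` B -> (forall x, B x -> 0 <= f x) ->
  \int[mu]_(x in A) f x <= \int[mu]_(x in B) f x.
Proof.
move=> AB f0; rewrite integral_mkcond [leRHS]integral_mkcond.
apply: le_integral_nomeas => x _; rewrite /patch.
  by case: ifPn => //; rewrite inE => /AB; exact: f0.
case: ifPn; first by rewrite inE => /AB Bx; rewrite ifT// inE.
by move=> _; case: ifPn => //; rewrite inE; exact: f0.
Qed.

End ge0_le_integral_nomeas.

Section primitive.
Context {R : realType}.
Local Notation mu := (@lebesgue_measure R).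

Lemma is_derive_continuous (f : R -> R) (x df : R) :
  is_derive x 1 f df -> {for x, continuous f}.
Proof.
by move=> h; apply: differentiable_continuous; apply/derivable1_diffP; exact: ex_derive.
Qed.

Lemma integral_derive_cc (G G' : R -> R) (c b : R) : c < b ->
  (forall x, c <= x <= b -> is_derive x 1 G (G' x)) ->
  (forall x, c <= x <= b -> {for x, continuous G'}) ->
  (\int[mu]_(x in `[c, b]) (G' x)%:E = (G b - G c)%:E)%E.
Proof.
move=> cb dG cG'; rewrite EFinB; apply: continuous_FTC2 => //.
- apply: continuous_in_subspaceT => x; rewrite inE/= in_itv/=; exact: cG'.
- split.
  + move=> x; rewrite in_itv/= => /andP[cx xb]; apply: ex_derive.
    by apply: dG; rewrite !ltW.
  + apply: cvg_at_right_filter; apply: is_derive_continuous.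
    by apply: dG; rewrite lexx ltW.
  + apply: cvg_at_left_filter; apply: is_derive_continuous.
    by apply: dG; rewrite lexx ltW.
- move=> x; rewrite in_itv/= => /andP[cx xb]; rewrite derive1E.
  by have [] : is_derive x 1 G (G' x) by apply: dG; rewrite !ltW.
Qed.

(** The left end is open: in the applications a = 2M is the horizon, where
    the integrand may be singular and the primitive has no value. Nonnegativity
    of G replaces the boundary term, by exhaustion with [a + 1/j, b]. *)
Lemma integral_le_primitive (f G G' : R -> R) (a b : R) : a < b ->
  (forall x, a < x <= b -> 0 <= f x <= G' x) ->
  (forall x, a < x <= b -> is_derive x 1 G (G' x)) ->
  (forall x, a < x <= b -> {for x, continuous G'}) ->
  (forall x, a < x <= b -> 0 <= G x) ->
  (\int[mu]_(x in `]a, b]) (f x)%:E <= (G b)%:E)%E.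
Proof.
move=> ab fG' dG cG' G0.
apply: (@le_trans _ _ (\int[mu]_(x in `]a, b]) (G' x)%:E)%E).
  apply: le_integral_nomeas => x /=; rewrite in_itv/= lee_fin.
    by move=> /fG'/andP[].
  by move=> /fG'/andP[].
(* the exhaustion of the half-open interval by compact ones *)
pose c n : R := a + (b - a) / n.+2%:R.
have c_gt n : a < c n by rewrite ltrDl divr_gt0// subr_gt0.
have c_lt n : c n < b.
  by rewrite -ltrBrDl ltr_pdivrMr// ltr_pMr ?subr_gt0// ltr1n.
have UE : `]a, b]%classic = \bigcup_n `[c n, b]%classic.
  apply/seteqP; split => x /=; rewrite in_itv/=.
    move=> /andP[ax xb].
    have xa0 : 0 < x - a by rewrite subr_gt0.
    have [n nE] : exists n : nat, (b - a) / (x - a) < n%:R.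
      by exists (Num.truncn ((b - a) / (x - a))).+1; exact: truncnS_gt.
    exists n => //=; rewrite in_itv/= xb andbT /c -lerBrDl.
    rewrite ler_pdivrMr// mulrC -ler_pdivrMr//.
    by rewrite (le_trans (ltW nE))// ler_nat -addn2 leq_addr.
  by move=> [n _ /=]; rewrite in_itv/= => /andP[cx ->]; rewrite (lt_le_trans (c_gt n)).
have nd : nondecreasing_seq (fun n => `[c n, b]%classic).
  apply/nondecreasing_seqP => n; rewrite subsetEset => x /=; rewrite !in_itv/=.
  move=> /andP[cx ->]; rewrite andbT; apply: le_trans cx.
  rewrite lerD2l ler_pM2l ?subr_gt0// lef_pV2 ?posrE//.
  by rewrite ler_nat.
have cG'n n : {within `[c n, b], continuous G'}.
  apply: continuous_in_subspaceT => x; rewrite inE/= in_itv/= => /andP[cx xb].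
  by apply: cG'; rewrite xb (lt_le_trans (c_gt n)).
have mG' n : measurable_fun `[c n, b]%classic (EFin \o G').
  apply/measurable_EFinP; apply: subspace_continuous_measurable_fun => //.
have G'0 n x : `[c n, b]%classic x -> (0 <= (G' x)%:E)%E.
  rewrite /= in_itv/= => /andP[cx xb]; rewrite lee_fin.
  have /fG'/andP[] : a < x <= b by rewrite xb (lt_le_trans (c_gt n)).
  exact: le_trans.
have UG := @ge0_nondecreasing_set_cvg_integral _ (measurableTypeR R) R
   (fun n => `[c n, b]%classic) (fun x => (G' x)%:E) mu nd
   (fun=> measurable_itv _) mG' G'0.
rewrite UE -(cvg_lim (@ereal_hausdorff R) UG).
apply: lime_le.
  apply: ereal_nondecreasing_is_cvgn => m n mn.
  apply: subset_integral_nomeas => [|x]; last exact: G'0.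
  by apply/subsetPset; exact: nd.
apply: nearW => n.
have -> : (\int[mu]_(x in `[c n, b]) (G' x)%:E = (G b - G (c n))%:E)%E.
  apply: integral_derive_cc => // x /andP[cx xb].
    by apply: dG; rewrite xb (lt_le_trans (c_gt n)).
  by apply: cG'; rewrite xb (lt_le_trans (c_gt n)).
by rewrite lee_fin gerBl G0// c_gt ltW.
Qed.

End primitive.

(** * Pointwise differentiation *)

Section pointwise_derivation_rules.
Context {R : realType}.
Implicit Types (f g : R -> R) (x a b : R).

Lemma derive_cstP x (c : R) : is_derive x 1 (fun=> c) 0.
Proof. exact: is_derive_cst. Qed.

Lemma derive_idP x : is_derive x 1 (fun y : R => y) 1.
Proof. exact: is_derive_id. Qed.

Lemma derive_addP f g x a b : is_derive x 1 f a -> is_derive x 1 g b ->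
  is_derive x 1 (fun y => f y + g y) (a + b).
Proof. exact: is_deriveD. Qed.

Lemma derive_oppP f x a : is_derive x 1 f a -> is_derive x 1 (fun y => - f y) (- a).
Proof. exact: is_deriveN. Qed.

Lemma derive_mulP f g x a b : is_derive x 1 f a -> is_derive x 1 g b ->
  is_derive x 1 (fun y => f y * g y) (a * g x + f x * b).
Proof.
move=> fa gb; apply: is_derive_eq (is_deriveM fa gb) _.
by rewrite addrC /GRing.scale/= [g x * a]mulrC.
Qed.

Lemma derive_exprnP f (k : nat) x a : is_derive x 1 f a ->
  is_derive x 1 (fun y => f y ^+ k) (k%:R * f x ^+ k.-1 * a).
Proof.
move=> fa; rewrite (_ : (fun y => f y ^+ k) = f ^+ k); last first.
  by apply/funext => y; elim: k => [//|k IH]; rewrite !exprS IH.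
exact: is_derive_eq.
Qed.

Lemma derive_invP f x a : f x != 0 -> is_derive x 1 f a ->
  is_derive x 1 (fun y => (f y)^-1) (- a / f x ^+ 2).
Proof.
move=> f0 fa; apply: is_derive_eq (is_deriveV f0 fa) _.
by rewrite /GRing.scale/= -exprVn exprVn mulrC mulrN mulNr.
Qed.

Lemma derive_compP (h : R -> R) f x a b : is_derive (f x) 1 h b ->
  is_derive x 1 f a -> is_derive x 1 (fun y => h (f y)) (b * a).
Proof. by move=> hb fa; exact: is_derive1_comp. Qed.

Lemma derive_expRP f x a : is_derive x 1 f a ->
  is_derive x 1 (fun y => expR (f y)) (expR (f x) * a).
Proof. by move=> fa; apply: derive_compP => //; exact: is_derive_expR. Qed.

Lemma derive_lnP f x a : 0 < f x -> is_derive x 1 f a ->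
  is_derive x 1 (fun y => ln (f y)) ((f x)^-1 * a).
Proof. by move=> f0 fa; apply: derive_compP => //; exact: is_derive1_ln. Qed.

Lemma derive_powRP f (c : R) x a : 0 < f x -> is_derive x 1 f a ->
  is_derive x 1 (fun y => f y `^ c) (c * f x `^ (c - 1) * a).
Proof. by move=> f0 fa; apply: (@derive_compP (fun y => y `^ c)) => //; exact: is_derive1_powR. Qed.

Lemma is_derive_eq' f x a b : is_derive x 1 f a -> a = b -> is_derive x 1 f b.
Proof. by move=> ? <-. Qed.

End pointwise_derivation_rules.

(** Syntax-directed differentiation at one point. Unlike instance resolution it
    leaves the derivatives of unknown functions to hypotheses in the context and
    the side conditions to the caller. *)
Ltac dstep :=
  lazymatch goal with
  | |- is_derive _ _ (fun y => y) _ => notypeclasses refine (derive_idP _)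
  | |- is_derive _ _ (fun _ => ?c) _ => notypeclasses refine (derive_cstP _ c)
  | |- is_derive _ _ (fun y => @?f y + @?g y) _ =>
      notypeclasses refine (@derive_addP _ f g _ _ _ _ _)
  | |- is_derive _ _ (fun y => - @?f y) _ =>
      notypeclasses refine (@derive_oppP _ f _ _ _)
  | |- is_derive _ _ (fun y => @?f y * @?g y) _ =>
      notypeclasses refine (@derive_mulP _ f g _ _ _ _ _)
  | |- is_derive _ _ (fun y => (@?f y) ^+ ?k) _ =>
      notypeclasses refine (@derive_exprnP _ f k _ _ _)
  | |- is_derive _ _ (fun y => (@?f y)^-1) _ =>
      notypeclasses refine (@derive_invP _ f _ _ _ _)
  | |- is_derive _ _ (fun y => expR (@?f y)) _ =>
      notypeclasses refine (@derive_expRP _ f _ _ _)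
  | |- is_derive _ _ (fun y => ln (@?f y)) _ =>
      notypeclasses refine (@derive_lnP _ f _ _ _ _)
  | |- is_derive _ _ (fun y => powR (@?f y) ?c) _ =>
      notypeclasses refine (@derive_powRP _ f c _ _ _ _)
  | |- is_derive _ _ (fun y => ?h (@?f y)) _ =>
      notypeclasses refine (@derive_compP _ h f _ _ _ _ _)
  end.
Ltac dtac := repeat first [eassumption | dstep].
Ltac derive_eq := notypeclasses refine (is_derive_eq' _ _).

Lemma derive_ge0_homo (R : realType) (f f' : R -> R) (a x y : R) :
  (forall z, a < z -> is_derive z 1 f (f' z)) ->
  (forall z, a < z -> 0 <= f' z) -> a < x -> x <= y -> f x <= f y.
Proof.
move=> df f'0 ax xy.
have [||z] := @MVT_segment R f f' x y xy.
- by move=> z; rewrite in_itv/= => /andP[xz _]; apply: df; exact: lt_trans xz.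
- apply: continuous_in_subspaceT => z; rewrite inE/= in_itv/= => /andP[xz _].
  by apply: is_derive_continuous; apply: df; exact: lt_le_trans xz.
rewrite in_itv/= => /andP[xz _] E; rewrite -subr_ge0 E mulr_ge0// ?subr_ge0//.
by apply: f'0; exact: lt_le_trans xz.
Qed.

(** * The time function w = t + g(r) *)

Section tortoise.
Context {R : realType} (n : nat) (M : R).
Hypothesis n3 : (3 <= n)%N.
Hypothesis M0 : 0 < M.
Implicit Types r : R.

Definition hratio r : R := 2 * M / r.
(** The conserved flux -F g' of the radial harmonic function g, normalised to
    be 1 at the horizon. *)
Definition flux r : R := hratio r ^+ n.-1.

(** The Taylor polynomial of - ln (1 - x) up to degree n - 3: the remainder
    - ln (1 - x) - logtail x has derivative x^(n-3) / (1 - x), which at x = 2M/r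
    makes F g' a multiple of r^(1-n). *)
Definition logtail (x : R) : R := \sum_(1 <= j < n.-2) x ^+ j / j%:R.

(** The radial harmonic function g; the constant 2M logtail 1 makes it
    nonnegative. It delays t by an amount that blows up at the horizon, so that
    the region t + g(r) <= T stays away from it. *)
Definition delay r : R :=
  - (2 * M * ln (lapse M r)) + 2 * M * (logtail 1 - logtail (hratio r)).

(** The logarithmic singularities of the tortoise coordinate and of g at the
    horizon cancel, so sigma lies between r and C r up to constants, and
    t minus the tortoise coordinate is w - sigma. *)
Definition sigma r : R := tortoise M r + delay r.

(** The coefficient of the second derivative in w in the wave operator: 1/F
    from the time derivatives minus F (g')^2 from the radial ones. It stays
    between 1 and 2n because a = flux tends to 1 at the horizon as fast as F
    tends to 0. *)
Definition wave_coef r : R := (1 - flux r ^+ 2) / lapse M r.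

Lemma gt2M_gt0 r : 2 * M < r -> 0 < r.
Proof. by apply: lt_trans; rewrite mulr_gt0. Qed.

Lemma lapse_gt0 r : 2 * M < r -> 0 < lapse M r.
Proof.
move=> hr; rewrite /lapse subr_gt0 ltr_pdivrMr ?mul1r//; exact: gt2M_gt0.
Qed.

Lemma lapseE r : lapse M r = 1 - hratio r. Proof. by []. Qed.

Lemma hratio_gt0 r : 2 * M < r -> 0 < hratio r.
Proof. by move=> hr; rewrite divr_gt0 ?mulr_gt0// gt2M_gt0. Qed.

Lemma hratio_lt1 r : 2 * M < r -> hratio r < 1.
Proof. by move=> /lapse_gt0; rewrite lapseE subr_gt0. Qed.

Lemma lapse_lt1 r : 2 * M < r -> lapse M r < 1.
Proof. by move=> hr; rewrite lapseE ltrBlDr ltrDl hratio_gt0. Qed.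

Lemma derive_hratio r : 2 * M < r -> is_derive r 1 hratio (- hratio r / r).
Proof.
move=> hr; have r0 := gt2M_gt0 hr; rewrite /hratio.
derive_eq; first by dtac; rewrite gt_eqF.
by rewrite /=; field; rewrite gt_eqF.
Qed.

Lemma derive_lapse r : 2 * M < r -> is_derive r 1 (lapse M) (hratio r / r).
Proof.
move=> hr; have := derive_hratio hr => h.
rewrite (_ : lapse M = fun y => 1 - hratio y)//.
by derive_eq; [dtac|rewrite add0r mulNr opprK].
Qed.

Lemma derive_logtail (x : R) : is_derive x 1 logtail (\sum_(1 <= j < n.-2) x ^+ j.-1).
Proof.
rewrite /logtail; elim: n.-2 => [|m IH].
  have -> : (fun x : R => \sum_(1 <= j < 0) x ^+ j / j%:R) = fun=> 0.
    by apply/funext => y; rewrite big_geq.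
  by rewrite big_geq//; exact: derive_cstP.
case: m IH => [_|m IH].
  have -> : (fun x : R => \sum_(1 <= j < 1) x ^+ j / j%:R) = fun=> 0.
    by apply/funext => y; rewrite big_geq.
  by rewrite big_geq//; exact: derive_cstP.
have -> : (fun x : R => \sum_(1 <= j < m.+2) x ^+ j / j%:R) =
   fun x => (\sum_(1 <= j < m.+1) x ^+ j / j%:R) + x ^+ m.+1 / m.+1%:R.
  by apply/funext => y; rewrite big_nat_recr.
rewrite [X in is_derive _ _ _ X]big_nat_recr//=.
derive_eq.
  by notypeclasses refine (derive_addP _ _); [exact: IH|dtac].
by congr (_ + _); rewrite mulr0 addr0 mulr1 mulrAC divff ?mul1r// pnatr_eq0.
Qed.

Lemma derive_delay r : 2 * M < r -> is_derive r 1 delay (- flux r / lapse M r).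
Proof.
move=> hr; have r0 := gt2M_gt0 hr; have F0 := lapse_gt0 hr.
have dF := derive_lapse hr; have dx := derive_hratio hr.
have dP := derive_logtail (hratio r).
rewrite /delay; derive_eq; first by dtac.
(* a finite geometric sum: only the power x^(n-3) survives the subtraction of logtail *)
have E : lapse M r * (\sum_(1 <= j < n.-2) hratio r ^+ j.-1) = 1 - hratio r ^+ n.-2.-1.
  rewrite big_add1/= -subn1 -[1 in RHS](expr1n _ (n.-2 - 1)) subrXX -lapseE; congr (_ * _).
  by rewrite big_mkord; apply: eq_bigr => i _; rewrite expr1n mul1r.
have {}E : \sum_(1 <= j < n.-2) hratio r ^+ j.-1 = (1 - hratio r ^+ n.-2.-1) / lapse M r.
  by rewrite -E mulrAC divff ?mul1r// gt_eqF.
rewrite E /flux.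
have -> : hratio r ^+ n.-1 = hratio r ^+ 2 * hratio r ^+ n.-2.-1.
  by rewrite -exprD; case: n n3 => [//|[//|[//|k _]]].
set y := _ ^+ n.-2.-1; set F := lapse M r.
have -> : 2 * M = hratio r * r by rewrite /hratio divfK// gt_eqF.
by field; rewrite !gt_eqF.
Qed.

Lemma derive_tortoise r : 2 * M < r -> is_derive r 1 (tortoise M) (lapse M r)^-1.
Proof.
move=> hr; have r0 := gt2M_gt0 hr; have F0 := lapse_gt0 hr.
have d0 : 0 < r - 2 * M by rewrite subr_gt0.
rewrite /tortoise; derive_eq; first by dtac.
rewrite /lapse; field; rewrite (gt_eqF r0) (gt_eqF d0) //.
Qed.

Lemma derive_sigma r : 2 * M < r ->
  is_derive r 1 sigma ((1 - flux r) / lapse M r).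
Proof.
move=> hr; have := derive_tortoise hr; have := derive_delay hr => dg ds.
by rewrite /sigma; derive_eq; [dtac|rewrite mulrBl mul1r mulNr].
Qed.

Lemma derive_flux r : 2 * M < r -> is_derive r 1 flux (- (n.-1)%:R * flux r / r).
Proof.
move=> hr; have r0 := gt2M_gt0 hr; have := derive_hratio hr => dx.
rewrite /flux; derive_eq; first by dtac.
have -> : hratio r ^+ n.-1 = hratio r ^+ n.-1.-1 * hratio r.
  by rewrite -exprSr; case: n n3 => [//|[|k]].
by field; rewrite gt_eqF.
Qed.

Lemma flux_gt0 r : 2 * M < r -> 0 < flux r.
Proof. by move=> hr; rewrite exprn_gt0// hratio_gt0. Qed.

Lemma flux_le_sqr r : 2 * M < r -> flux r <= hratio r ^+ 2.
Proof.
move=> hr; rewrite ler_wiXn2l ?ltW ?hratio_gt0 ?hratio_lt1//.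
by case: n n3 => [//|[//|[//|k _]]].
Qed.

Lemma flux_le_hratio r : 2 * M < r -> flux r <= hratio r.
Proof.
move=> hr; apply: le_trans (flux_le_sqr hr) _.
by rewrite expr2 ger_pMr ?hratio_gt0// ltW// hratio_lt1.
Qed.

Lemma flux_lt1 r : 2 * M < r -> flux r < 1.
Proof. by move=> hr; rewrite (le_lt_trans (flux_le_hratio hr))// hratio_lt1. Qed.

Lemma lapse_le_fluxC r : 2 * M < r -> lapse M r <= 1 - flux r.
Proof. by move=> hr; rewrite lapseE lerD2l lerN2 flux_le_hratio. Qed.

Lemma exprn_flux r : 2 * M < r -> r ^+ n.-1 * flux r = (2 * M) ^+ n.-1.
Proof.
by move=> hr; rewrite /flux /hratio expr_div_n mulrC divfK// expf_neq0// gt_eqF// gt2M_gt0.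
Qed.

Lemma wave_coef_ge1 r : 2 * M < r -> 1 <= wave_coef r.
Proof.
move=> hr; rewrite /wave_coef ler_pdivlMr ?lapse_gt0// mul1r.
apply: le_trans (lapse_le_fluxC hr) _; rewrite lerD2l lerN2 expr2.
by rewrite ger_pMr ?flux_gt0// ltW// flux_lt1.
Qed.

Lemma wave_coef_le r : 2 * M < r -> wave_coef r <= 2 * n%:R.
Proof.
move=> hr; rewrite /wave_coef ler_pdivrMr ?lapse_gt0//.
have x0 := hratio_gt0 hr; have x1 := hratio_lt1 hr.
(* (1 - x^(2(n-1))) / (1 - x) is a geometric sum of 2(n-1) terms *)
have -> : 1 - flux r ^+ 2 = lapse M r * (\sum_(i < (n.-1).*2) hratio r ^+ i).
  rewrite /flux -exprM muln2 -[1 in LHS](expr1n _ (n.-1).*2) subrXX lapseE; congr (_ * _).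
  by apply: eq_bigr => i _; rewrite expr1n mul1r.
rewrite mulrC ler_pM2r ?lapse_gt0//.
apply: (@le_trans _ _ (\sum_(i < (n.-1).*2) 1)).
  by apply: ler_sum => i _; rewrite exprn_ile1// ltW.
rewrite sumr_const card_ord -natrM ler_nat -mul2n leq_mul2l leq_pred orbT//.
Qed.

Lemma logtail_ge0 (x : R) : 0 <= x -> 0 <= logtail x.
Proof. by move=> x0; apply: sumr_ge0 => i _; rewrite divr_ge0// exprn_ge0. Qed.

Lemma logtail_le1 (x : R) : 0 <= x <= 1 -> logtail x <= logtail 1.
Proof.
move=> /andP[x0 x1]; apply: ler_sum => i _.
by rewrite ler_wpM2r// expr1n exprn_ile1.
Qed.

Lemma delay_ge_ln r : 2 * M < r -> - (2 * M * ln (lapse M r)) <= delay r.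
Proof.
move=> hr; rewrite /delay lerDl; apply: mulr_ge0; first by rewrite mulr_ge0// ltW.
rewrite subr_ge0 logtail_le1//.
by rewrite !ltW ?hratio_gt0 ?hratio_lt1.
Qed.

Lemma delay_ge0 r : 2 * M < r -> 0 <= delay r.
Proof.
move=> hr; apply: le_trans (delay_ge_ln hr); rewrite oppr_ge0 mulr_ge0_le0//.
  by rewrite mulr_ge0// ltW.
by rewrite ln_le0// ltW// lapse_lt1.
Qed.

Lemma delay_anti r r' : 2 * M < r -> r <= r' -> delay r' <= delay r.
Proof.
move=> hr rr'; rewrite -lerN2.
have D z : 2 * M < z -> is_derive z 1 (fun y => - delay y) (flux z / lapse M z).
  move=> hz; have := derive_delay hz => h; derive_eq; first by dtac.
  by rewrite mulNr opprK.
have P z : 2 * M < z -> 0 <= flux z / lapse M z.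
  by move=> hz; rewrite divr_ge0// ltW// ?flux_gt0// lapse_gt0.
exact: (derive_ge0_homo D P hr rr').
Qed.

Lemma delay_blowup (T : R) : exists r0, 2 * M < r0 /\ T < delay r0.
Proof.
have M20 : 0 < 2 * M by rewrite mulr_gt0.
(* the value of F at which - 2M ln F equals |T| + 1 *)
pose e := expR (- (`|T| + 1) / (2 * M)).
have e1 : e < 1.
  by rewrite expR_lt1 mulNr oppr_lt0 divr_gt0// ltr_wpDl.
have e1' : 0 < 1 - e by rewrite subr_gt0.
pose r0 := 2 * M / (1 - e).
have hr0 : 2 * M < r0.
  by rewrite ltr_pdivlMr// gtr_pMr// ltrBlDr ltrDl expR_gt0.
exists r0; split => //; apply: lt_le_trans (delay_ge_ln hr0).
have -> : lapse M r0 = e.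
  rewrite /lapse /r0; field; rewrite (gt_eqF e1') (gt_eqF M0) //.
rewrite expRK mulrC divfK ?gt_eqF// opprK.
by rewrite (le_lt_trans (ler_norm _))// ltrDl.
Qed.

Lemma sigmaE r : 2 * M < r ->
  sigma r = r + 2 * M * ln r + 2 * M * (logtail 1 - logtail (hratio r)).
Proof.
move=> hr; have r0 := gt2M_gt0 hr.
have d0 : 0 < r - 2 * M by rewrite subr_gt0.
have -> : sigma r = r + 2 * M * (ln (r - 2 * M) - ln (lapse M r)) +
    2 * M * (logtail 1 - logtail (hratio r)).
  by rewrite /sigma /tortoise /delay; ring.
rewrite -ln_div ?posrE ?lapse_gt0//; congr (_ + _ * ln _ + _).
rewrite /lapse; field; rewrite (gt_eqF r0) (gt_eqF d0) //.
Qed.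

Lemma sigma_le r : 2 * M < r -> sigma r <= (1 + 2 * M + logtail 1) * r.
Proof.
move=> hr; have r0 := gt2M_gt0 hr; rewrite (sigmaE hr).
have M20 : 0 < 2 * M by rewrite mulr_gt0.
have l1 : 2 * M * ln r <= 2 * M * r by rewrite ler_pM2l// ltW// ln_sublinear.
have l2 : 2 * M * (logtail 1 - logtail (hratio r)) <= r * logtail 1.
  apply: ler_pM; rewrite ?(ltW M20) ?(ltW hr)//.
    by rewrite subr_ge0 logtail_le1// !ltW ?hratio_gt0 ?hratio_lt1.
  by rewrite gerBl logtail_ge0// ltW// hratio_gt0.
move: l1 l2; set A := 2 * M * ln r; set B := 2 * M * (_ - _); lra.
Qed.

Lemma sigma_ge r : 2 * M < r -> r + 2 * M * ln (2 * M) <= sigma r.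
Proof.
move=> hr; have r0 := gt2M_gt0 hr; rewrite (sigmaE hr).
have M20 : 0 < 2 * M by rewrite mulr_gt0.
rewrite -[leLHS]addr0 lerD//.
  by rewrite lerD2l ler_pM2l// ler_ln ?posrE// ltW.
apply: mulr_ge0; first exact: ltW.
by rewrite subr_ge0 logtail_le1// !ltW ?hratio_gt0 ?hratio_lt1.
Qed.

End tortoise.

(** * A supersolution of the radial equation *)

(** Here X = lambda r, u = 1/(1 + X), Q = r^(-d) and h = r times the part of
    the logarithmic derivative of the supersolution that remains after
    subtracting lambda sigma'. The three terms of h have separate tasks. The
    first, which produces the decay (1 + lambda r)^(-k), leaves a deficit of at
    most (2k - 1) k F X u; the second makes up for it; the third dominates the
    left-hand side, which comes from damping and potential. The squares that
    remain are nonnegative. *)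
Lemma riccati_algebra (R : realFieldType) (k F X u Q mu d h : R) :
  1 <= k -> 0 < F < 1 -> 0 <= X -> u * (1 + X) = 1 -> 0 < Q -> 0 <= mu ->
  0 < d <= 2^-1 ->
  h = - k * X * u + k * (2 * k - 1) * X * u ^+ 2 + 4 * mu * Q ->
  mu * (X * Q + Q) <=
  (1 - F) * h + F * (k * X ^+ 2 * u ^+ 2 - 2 * (k * (2 * k - 1)) * X ^+ 2 * u ^+ 3
     - (1 + d) * (4 * mu * Q)) + F * h ^+ 2 + 2 * X * h + 2 * k * F * h + 2 * k * X.
Proof.
move=> k1 /andP[F0 F1] X0 uE Q0 mu0 /andP[d0 d1] h_def.
have X1 : 0 < 1 + X by lra.
have u0 : 0 < u.
  by rewrite -(pmulr_lgt0 _ X1) uE.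
have u0' := ltW u0. have Q0' := ltW Q0.
have Xu : 1 - X * u = u by rewrite -uE; ring.
have u1 : u <= 1 by have := mulr_ge0 X0 (ltW u0); lra.
have [B BE] : exists B, B = k * (2 * k - 1) by exists (k * (2 * k - 1)).
have B0 : 0 <= B by rewrite BE mulr_ge0//; lra.
rewrite -BE in h_def *.
pose h0 := - k * X * u; pose h1 := B * X * u ^+ 2; pose h2 := 4 * mu * Q.
have h1_ge0 : 0 <= h1 by rewrite ?mulr_ge0// ?exprn_ge0//.
have h2_ge0 : 0 <= h2 by rewrite ?mulr_ge0//.
(* the first term of h: its error is bounded below by this negative quantity *)
have P0 : - ((2 * k - 1) * k * F * X * u) <=
    (1 - F) * h0 + F * (k * X ^+ 2 * u ^+ 2) + F * h0 ^+ 2 + 2 * X * h0 + 2 * k * F * h0 + 2 * k * X.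
  rewrite -subr_ge0 [leRHS](_ : _ = k * X * u * (1 + F * (1 + k) * (X * u))); last first.
    rewrite /h0; have -> : 2 * k * X = 2 * k * X * (u * (1 + X)) by rewrite uE mulr1.
    by ring.
  apply: mulr_ge0; first by rewrite !mulr_ge0//; lra.
  by rewrite addr_ge0// !mulr_ge0//; lra.
(* the second term compensates exactly that quantity *)
have P1 : (2 * k - 1) * k * F * X * u <=
    - (2 * F * B * X ^+ 2 * u ^+ 3) + 2 * F * h0 * h1 + 2 * X * h1 + 2 * k * F * h1.
  have E : - (2 * F * B * X ^+ 2 * u ^+ 3) + 2 * F * h0 * h1 + 2 * X * h1 + 2 * k * F * h1
     = 2 * B * X * u ^+ 2 * (X * (1 - F * u) + k * F * (1 - X * u)).
    by rewrite /h0 /h1; ring.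
  rewrite E Xu.
  apply: (@le_trans _ _ (2 * B * X * u ^+ 2 * (u * (X ^+ 2 + k * F)))); last first.
    apply: ler_wpM2l; first by rewrite ?mulr_ge0// ?exprn_ge0//.
    have : X * (1 - u) <= X * (1 - F * u).
      by rewrite ler_wpM2l// lerD2l lerN2 ger_pMl// ltW.
    have -> : 1 - u = X * u by rewrite -{1}Xu; ring.
    by rewrite mulrDr expr2; set A := X * (1 - F * u); lra.
  have -> : (2 * k - 1) * k * F * X * u = B * X * u ^+ 3 * (F * (1 + X) ^+ 2).
    have -> : (2 * k - 1) * k * F * X * u = (2 * k - 1) * k * F * X * u * (u * (1 + X)) ^+ 2.
      by rewrite uE expr1n mulr1.
    by rewrite BE; ring.
  have -> : 2 * B * X * u ^+ 2 * (u * (X ^+ 2 + k * F)) = B * X * u ^+ 3 * (2 * (X ^+ 2 + k * F)).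
    by ring.
  apply: ler_wpM2l; first by rewrite ?mulr_ge0// ?exprn_ge0//.
  have a1 : 0 <= (1 - F) * X ^+ 2 by rewrite mulr_ge0 ?sqr_ge0//; lra.
  have a2 : 0 <= (k - 1) * F by rewrite mulr_ge0//; lra.
  have a3 : 0 <= F * (1 - X) ^+ 2 by rewrite mulr_ge0 ?sqr_ge0//; lra.
  move: a1 a2 a3; rewrite -subr_ge0 -[in X in _ -> X]subr_ge0.
  have -> : 2 * (X ^+ 2 + k * F) - F * (1 + X) ^+ 2 =
    2 * ((1 - F) * X ^+ 2) + 2 * ((k - 1) * F) + F * (1 - X) ^+ 2 by ring.
  lra.
(* the third term, against damping and potential *)
have P2 : mu * (X * Q + Q) <= (1 - F) * h2 - F * (1 + d) * h2 + 2 * F * h0 * h2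
     + 2 * X * h2 + 2 * k * F * h2.
  have -> : (1 - F) * h2 - F * (1 + d) * h2 + 2 * F * h0 * h2
     + 2 * X * h2 + 2 * k * F * h2 =
     mu * Q * (4 * (1 - F - F * (1 + d) + 2 * X + 2 * k * F * (1 - X * u))).
    by rewrite /h2 /h0; ring.
  rewrite Xu; have -> : mu * (X * Q + Q) = mu * Q * (1 + X) by ring.
  apply: ler_wpM2l; first by rewrite ?mulr_ge0//.
  have b1 : 0 <= (k - 1) * (F * u) by rewrite !mulr_ge0//; lra.
  have b2 : 0 <= (1 - F) * (2 + d - 2 * u) by rewrite mulr_ge0//; lra.
  have b3 : 0 <= u * (7 * X ^+ 2 + 1).
    by rewrite ?(mulr_ge0, addr_ge0, sqr_ge0)//.
  have b4 : u * (7 * X ^+ 2 + 1) = 7 * X - 7 + 8 * u.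
    have -> : 7 * X - 7 + 8 * u = (7 * X - 7) * (u * (1 + X)) + 8 * u by rewrite uE mulr1.
    by ring.
  rewrite b4 in b3.
  have -> : 4 * (1 - F - F * (1 + d) + 2 * X + 2 * k * F * u) =
    8 * ((k - 1) * (F * u)) + 4 * ((1 - F) * (2 + d - 2 * u)) +
    (- 4 - 4 * d + 8 * X + 8 * u) by ring.
  lra.
have P3 : 0 <= (1 - F) * h1 + F * h1 ^+ 2 + F * h2 ^+ 2 + 2 * F * h1 * h2.
  have F0' := ltW F0; have F1' : 0 <= 1 - F by rewrite subr_ge0 ltW.
  by rewrite !addr_ge0 ?mulr_ge0.
have hE : h = h0 + h1 + h2 by exact: h_def.
rewrite hE.
have -> : (1 - F) * (h0 + h1 + h2) +
  F * (k * X ^+ 2 * u ^+ 2 - 2 * B * X ^+ 2 * u ^+ 3 - (1 + d) * (4 * mu * Q)) +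
  F * (h0 + h1 + h2) ^+ 2 + 2 * X * (h0 + h1 + h2) + 2 * k * F * (h0 + h1 + h2) + 2 * k * X
  = ((1 - F) * h0 + F * (k * X ^+ 2 * u ^+ 2) + F * h0 ^+ 2 + 2 * X * h0 + 2 * k * F * h0 + 2 * k * X)
  + (- (2 * F * B * X ^+ 2 * u ^+ 3) + 2 * F * h0 * h1 + 2 * X * h1 + 2 * k * F * h1)
  + ((1 - F) * h2 - F * (1 + d) * h2 + 2 * F * h0 * h2 + 2 * X * h2 + 2 * k * F * h2)
  + ((1 - F) * h1 + F * h1 ^+ 2 + F * h2 ^+ 2 + 2 * F * h1 * h2).
  by rewrite /h2; ring.
move: P0 P1 P2 P3.
set A0 := _ + 2 * k * X; set A1 := _ + 2 * k * F * h1; set A2 := _ + 2 * k * F * h2.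
set A3 := _ + 2 * F * h1 * h2.
lra.
Qed.

(** * Volterra equations by monotone iteration *)

Lemma nondecreasing_emeasurable (R : realType) (D : set R) (f : R -> \bar R) :
  measurable D -> {homo f : x y / x <= y >-> (x <= y)%E} -> measurable_fun D f.
Proof.
move=> mD f_nd.
apply: (measurability (@ErealGenCInfty.G R)) => [|/= _ [_] [r] -> <-].
  exact: ErealGenCInfty.measurableE.
apply: measurableI => //; apply: is_interval_measurable => s t/=.
rewrite !in_itv/= !andbT => fs ft u /andP[su ut].
by rewrite in_itv/= andbT (le_trans fs)// f_nd.
Qed.

Section volterra.
Local Open Scope ereal_scope.
Context {R : realType} (a : R) (w1 w2 : R -> R).
Local Notation mu := (@lebesgue_measure R).
Hypothesis w1_ge0 : forall x, (a < x)%R -> (0 <= w1 x)%R.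
Hypothesis w2_ge0 : forall x, (a < x)%R -> (0 <= w2 x)%R.
Hypothesis mw1 : measurable_fun `]a, +oo[%classic w1.
Hypothesis mw2 : measurable_fun `]a, +oo[%classic w2.

Definition volterra_inner (v : R -> \bar R) (x : R) : \bar R :=
  \int[mu]_(y in `]a, x]) ((w2 y)%:E * v y).

(** The integrated form, from the singular end a, of (v' / w1)' = w2 v with
    v = 1 and vanishing flux at a. Values in \bar R let the iteration run before
    any finiteness is known. *)
Definition volterra (v : R -> \bar R) (r : R) : \bar R :=
  1 + \int[mu]_(x in `]a, r]) ((w1 x)%:E * volterra_inner v x).

Lemma itv_oc_gt x y : `]a, x]%classic y -> (a < y)%R.
Proof. by rewrite /= in_itv/= => /andP[]. Qed.

Let meas_oc (w : R -> R) x : measurable_fun `]a, +oo[%classic w ->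
  measurable_fun `]a, x]%classic (EFin \o w).
Proof.
move=> mw; apply/measurable_EFinP; apply: measurable_funS mw => //.
by move=> y /= /[!in_itv]/= /andP[->].
Qed.

Section fixed_v.
Variable v : R -> \bar R.
Hypothesis v0 : forall x, (a < x)%R -> 0 <= v x.

Lemma volterra_inner_ge0 x : 0 <= volterra_inner v x.
Proof.
apply: integral_ge0 => y /itv_oc_gt ay.
by rewrite mule_ge0 ?lee_fin ?w2_ge0 ?v0.
Qed.

Lemma volterra_inner_homo : {homo volterra_inner v : x y / (x <= y)%R >-> x <= y}.
Proof.
move=> x y xy; apply: subset_integral_nomeas.
  by move=> z /= /[!in_itv]/= /andP[-> /le_trans->].
move=> z /itv_oc_gt az.
by rewrite mule_ge0 ?lee_fin ?w2_ge0 ?v0.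
Qed.

Lemma volterra_ge1 r : 1 <= volterra v r.
Proof.
rewrite /volterra leeDl//; apply: integral_ge0 => x /itv_oc_gt ax.
by rewrite mule_ge0 ?lee_fin ?w1_ge0 ?volterra_inner_ge0.
Qed.

Lemma volterra_homo : {homo volterra v : x y / (x <= y)%R >-> x <= y}.
Proof.
move=> x y xy; rewrite /volterra leeD2l//; apply: subset_integral_nomeas.
  by move=> z /= /[!in_itv]/= /andP[-> /le_trans->].
move=> z /itv_oc_gt az.
by rewrite mule_ge0 ?lee_fin ?w1_ge0 ?volterra_inner_ge0.
Qed.

End fixed_v.

Lemma volterra_inner_le (v v' : R -> \bar R) x :
  (forall x, (a < x)%R -> 0 <= v x) ->
  (forall x, (a < x)%R -> v x <= v' x) -> volterra_inner v x <= volterra_inner v' x.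
Proof.
move=> v0 vv'; apply: le_integral_nomeas => z /itv_oc_gt az.
  by rewrite mule_ge0 ?lee_fin ?w2_ge0 ?v0.
by rewrite lee_wpmul2l ?lee_fin ?w2_ge0 ?vv'.
Qed.

Lemma volterra_le (v v' : R -> \bar R) r :
  (forall x, (a < x)%R -> 0 <= v x) ->
  (forall x, (a < x)%R -> v x <= v' x) -> volterra v r <= volterra v' r.
Proof.
move=> v0 vv'; rewrite /volterra leeD2l//; apply: le_integral_nomeas => z /itv_oc_gt az.
  by rewrite mule_ge0 ?lee_fin ?w1_ge0 ?volterra_inner_ge0.
by rewrite lee_wpmul2l ?lee_fin ?w1_ge0 ?volterra_inner_le.
Qed.

Fixpoint picard (j : nat) : R -> \bar R :=
  if j is j'.+1 then volterra (picard j') else cst 1.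

Lemma picard_ge1 j r : 1 <= picard j r.
Proof.
elim: j r => [|j IH] r //=; apply: volterra_ge1 => x _.
exact: le_trans (IH x).
Qed.

Lemma picard_ge0 j r : 0 <= picard j r.
Proof. exact: le_trans (picard_ge1 j r). Qed.

Lemma picard_homo j : {homo picard j : x y / (x <= y)%R >-> x <= y}.
Proof.
case: j => [//|j] x y xy /=; apply: volterra_homo => // z _; exact: picard_ge0.
Qed.

Lemma picard_nd r : {homo picard^~ r : i j / (i <= j)%N >-> i <= j}.
Proof.
move=> i j ij; have S k s : picard k s <= picard k.+1 s.
  elim: k s => [|k IH] s; first by apply: volterra_ge1 => x _; exact: (picard_ge0 0 x).
  by apply: volterra_le => x _; [exact: picard_ge0|exact: IH].
elim: j ij => [|j IH]; first by rewrite leqn0 => /eqP->.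
rewrite leq_eqVlt => /predU1P[->//|]; rewrite ltnS => /IH/le_trans; apply; exact: S.
Qed.

(** The least solution: the limit of the nondecreasing iterates from 1. *)
Definition volterra_sol (r : R) : \bar R := limn (picard ^~ r).

Let cvg_picard r : cvgn (picard ^~ r).
Proof. by apply: ereal_nondecreasing_is_cvgn; exact: picard_nd. Qed.

Lemma volterra_sol_ge1 r : 1 <= volterra_sol r.
Proof. by apply: lime_ge => //; apply: nearW => j; exact: picard_ge1. Qed.

Let m_picard j (D : set R) : measurable D -> measurable_fun D (picard j).
Proof. by move=> mD; apply: nondecreasing_emeasurable => //; exact: picard_homo. Qed.

Lemma volterra_inner_sol x :
  volterra_inner volterra_sol x = limn (fun j => volterra_inner (picard j) x).
Proof.
rewrite /volterra_inner -(@monotone_convergence _ (measurableTypeR R) R mu).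
- apply: eq_integral => y; rewrite inE => /itv_oc_gt ay.
  by apply/esym/cvg_lim => //; apply: cvgeZl => //; exact: cvg_picard.
- exact: measurable_itv.
- move=> j; apply: emeasurable_funM; first exact: meas_oc.
  exact: m_picard.
- by move=> j y /itv_oc_gt ay; rewrite mule_ge0 ?lee_fin ?w2_ge0 ?picard_ge0.
- move=> y /itv_oc_gt ay i j ij; rewrite lee_wpmul2l ?lee_fin ?w2_ge0//.
  exact: picard_nd.
Qed.

Let cvg_inner x : cvgn (fun j => volterra_inner (picard j) x).
Proof.
apply: ereal_nondecreasing_is_cvgn => i j ij; apply: volterra_inner_le => y _.
  exact: picard_ge0.
exact: picard_nd.
Qed.

Lemma volterra_solE r : volterra volterra_sol r = volterra_sol r.
Proof.
have -> : volterra_sol r = limn (fun j => picard j.+1 r).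
  by apply/esym/cvg_lim => //; rewrite (cvg_shiftS (picard ^~ r)); exact: cvg_picard.
rewrite /= /volterra.
have -> : \int[mu]_(x in `]a, r]) ((w1 x)%:E * volterra_inner volterra_sol x) =
  limn (fun j => \int[mu]_(x in `]a, r]) ((w1 x)%:E * volterra_inner (picard j) x)).
  rewrite -(@monotone_convergence _ (measurableTypeR R) R mu).
  - apply: eq_integral => y; rewrite inE => /itv_oc_gt ay.
    rewrite volterra_inner_sol.
    by apply/esym/cvg_lim => //; apply: cvgeZl => //; exact: cvg_inner.
  - exact: measurable_itv.
  - move=> j; apply: emeasurable_funM; first exact: meas_oc.
    apply: nondecreasing_emeasurable => //; apply: volterra_inner_homo.
    by move=> x _; exact: picard_ge0.
  - move=> j y /itv_oc_gt ay; rewrite mule_ge0 ?lee_fin ?w1_ge0//.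
    by apply: volterra_inner_ge0 => x _; exact: picard_ge0.
  - move=> y /itv_oc_gt ay i j ij; rewrite lee_wpmul2l ?lee_fin ?w1_ge0//.
    apply: volterra_inner_le => z _; [exact: picard_ge0|exact: picard_nd].
apply/esym/cvg_lim => //; apply: cvgeD => //.
- exact: cvg_cst.
- apply: ereal_nondecreasing_is_cvgn => i j ij; apply: le_integral_nomeas => z /itv_oc_gt az.
    rewrite mule_ge0 ?lee_fin ?w1_ge0//.
    by apply: volterra_inner_ge0 => x _; exact: picard_ge0.
  rewrite lee_wpmul2l ?lee_fin ?w1_ge0//.
  apply: volterra_inner_le => y _; [exact: picard_ge0|exact: picard_nd].
Qed.

(** All iterates stay below a supersolution, hence so does their limit. This is
    the only source of upper bounds, and of finiteness, for the solution. *)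
Lemma volterra_sol_le (Z : R -> \bar R) :
  (forall x, (a < x)%R -> 1 <= Z x) ->
  (forall x, (a < x)%R -> volterra Z x <= Z x) ->
  forall x, (a < x)%R -> volterra_sol x <= Z x.
Proof.
move=> Z1 TZ x ax; apply: lime_le => //; apply: nearW => j.
elim: j x ax => [|j IH] x ax /=; first exact: Z1.
apply: le_trans (TZ _ ax); apply: volterra_le => // y _; exact: picard_ge0.
Qed.

End volterra.

(** Once finite, a solution is differentiable: each integration gains
    continuity, and then a derivative by the fundamental theorem of calculus. *)
Section volterra_regularity.
Context {R : realType} (a : R).
Local Notation mu := (@lebesgue_measure R).

Lemma indefinite_integral_continuous (f : R -> R) (x : R) :
  (forall u, mu.-integrable `]a, u]%classic (EFin \o f)) -> a < x ->
  {for x, continuous (fun r => \int[mu]_(t in `]a, r]) f t)}.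
Proof.
move=> intf ax.
have ax1 : a < x + 1 by rewrite (lt_trans ax)// ltrDl.
pose g := f \_ `]a, (x + 1)]%classic.
have gE y : `]a, (x + 1)]%classic y -> g y = f y.
  by move=> ?; rewrite /g patchE mem_set.
have ig : mu.-integrable setT (EFin \o g).
  rewrite (_ : EFin \o g = (EFin \o f) \_ `]a, (x + 1)]%classic); last first.
    by apply/funext => y; rewrite /g /= !patchE; case: ifPn.
  by apply/(integrable_mkcond _ _).1; [exact: measurable_itv|exact: intf].
have E r : r <= x + 1 -> \int[mu]_(t in `]a, r]) f t = \int[mu]_(t in `[a, r]) g t.
  move=> rx; rewrite -Rintegral_itv_obnd_cbnd; last first.
    by apply: integrableS ig => //; exact: measurable_itv.
  apply: eq_Rintegral => y; rewrite inE/= in_itv/= => /andP[ay yr].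
  by rewrite gE//= in_itv/= ay (le_trans yr).
have ig' : mu.-integrable `[a, (x + 1)] (EFin \o g).
  by apply: integrableS ig => //; exact: measurable_itv.
have := parameterized_integral_continuous (ltW ax1) ig'.
move=> /(continuous_within_itvP _ ax1)[+ _ _] => /(_ x).
rewrite in_itv/= ax ltrDl ltr01 => /(_ isT) cg.
rewrite /prop_for /continuous_at E ?lerDl//.
apply: cvg_trans cg; apply: near_eq_cvg.
near=> r; rewrite /parameterized_integral E//; near: r.
have xx1 : x < x + 1 by rewrite ltrDl.
by have := lt_nbhsl xx1; apply: filterS => z /ltW.
Unshelve. all: by end_near. Qed.

Variables (w1 w2 : R -> R) (v : R -> \bar R).
Hypothesis w1_ge0 : forall x, a < x -> 0 <= w1 x.
Hypothesis w2_ge0 : forall x, a < x -> 0 <= w2 x.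
Hypothesis cw1 : forall x, a < x -> {for x, continuous w1}.
Hypothesis cw2 : forall x, a < x -> {for x, continuous w2}.
Hypothesis vE : forall x, a < x -> volterra a w1 w2 v x = v x.
Hypothesis v_ge1 : forall x, a < x -> (1 <= v x)%E.
Hypothesis v_fin : forall x, a < x -> (v x < +oo)%E.
Hypothesis inner_fin : forall x, a < x -> (volterra_inner a w2 v x < +oo)%E.

Let vr x := fine (v x).
Let ir x := fine (volterra_inner a w2 v x).

Let v_ge0 x : a < x -> (0 <= v x)%E.
Proof. by move=> /v_ge1; exact: le_trans. Qed.

Let vrK x : a < x -> (vr x)%:E = v x.
Proof. by move=> ax; rewrite fineK// ge0_fin_numE ?v_fin ?v_ge0. Qed.

Let irK x : a < x -> (ir x)%:E = volterra_inner a w2 v x.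
Proof.
by move=> ax; rewrite fineK// ge0_fin_numE ?inner_fin//; exact: volterra_inner_ge0.
Qed.

Let m_pos (w : R -> R) u : (forall x, a < x -> {for x, continuous w}) ->
  measurable_fun `]a, u]%classic w.
Proof.
move=> cw; apply: (@measurable_funS _ _ _ _ `]a, +oo[%classic) => //.
  by move=> y /= /[!in_itv]/= /andP[->].
apply: open_continuous_measurable_fun; first exact: interval_open.
by move=> y; rewrite inE/= in_itv/= andbT; exact: cw.
Qed.

Let m_posE (w : R -> R) u : (forall x, a < x -> {for x, continuous w}) ->
  measurable_fun `]a, u]%classic (EFin \o w).
Proof. by move=> cw; apply/measurable_EFinP; exact: m_pos. Qed.

Let int_iv u : mu.-integrable `]a, u]%classic (EFin \o (fun y => w2 y * vr y)).
Proof.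
have [au|ua] := ltP a u; last first.
  by rewrite set_itv_ge ?bnd_simp -?leNgt//; exact: integrable_set0.
have E y : `]a, u]%classic y -> ((w2 y * vr y)%:E = (w2 y)%:E * v y)%E.
  by move=> /itv_oc_gt ay; rewrite EFinM vrK.
apply/integrableP; split.
  apply: (@eq_measurable_fun _ _ _ _ _ (fun y => (w2 y)%:E * v y)%E).
    by move=> y; rewrite inE => /E /= ->.
  apply: emeasurable_funM; first exact: m_posE.
  apply: (@eq_measurable_fun _ _ _ _ _ (volterra a w1 w2 v)).
    by move=> y; rewrite inE => /itv_oc_gt ay; rewrite vE.
  by apply: nondecreasing_emeasurable => //; exact: volterra_homo.
apply: le_lt_trans (inner_fin au); apply: le_integral_nomeas => y hy //.
rewrite -E// lee_fin ger0_norm// mulr_ge0 ?w2_ge0 ?fine_ge0 ?v_ge0//;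
  exact: itv_oc_gt hy.
Qed.

Let int_i u : mu.-integrable `]a, u]%classic (EFin \o (fun y => w1 y * ir y)).
Proof.
have [au|ua] := ltP a u; last first.
  by rewrite set_itv_ge ?bnd_simp -?leNgt//; exact: integrable_set0.
have E y : `]a, u]%classic y ->
    ((w1 y * ir y)%:E = (w1 y)%:E * volterra_inner a w2 v y)%E.
  by move=> /itv_oc_gt ay; rewrite EFinM irK.
apply/integrableP; split.
  apply: (@eq_measurable_fun _ _ _ _ _ (fun y => (w1 y)%:E * volterra_inner a w2 v y)%E).
    by move=> y; rewrite inE => /E /= ->.
  apply: emeasurable_funM; first exact: m_posE.
  by apply: nondecreasing_emeasurable => //; exact: volterra_inner_homo.
apply: (@le_lt_trans _ _ (v u)); last exact: v_fin.
rewrite -(vE au) /volterra.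
apply: le_trans (leeDr _ lee01).
apply: le_integral_nomeas => y hy //.
rewrite -E// lee_fin ger0_norm// mulr_ge0 ?w1_ge0 ?fine_ge0//; first exact: itv_oc_gt hy.
exact: volterra_inner_ge0.
Qed.

Let vrE x : a < x -> vr x = 1 + \int[mu]_(y in `]a, x]) (w1 y * ir y).
Proof.
move=> ax; rewrite /vr -vE// /volterra.
have -> : (\int[mu]_(y in `]a, x]) ((w1 y)%:E * volterra_inner a w2 v y) =
   \int[mu]_(y in `]a, x]) (w1 y * ir y)%:E)%E.
  by apply: eq_integral => y; rewrite inE => /itv_oc_gt ay; rewrite EFinM irK.
rewrite /Rintegral fineD//; exact: integrable_fin_num.
Qed.

Let irE x : a < x -> ir x = \int[mu]_(y in `]a, x]) (w2 y * vr y).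
Proof.
move=> ax; rewrite /ir /volterra_inner /Rintegral; congr fine.
by apply: eq_integral => y; rewrite inE => /itv_oc_gt ay; rewrite EFinM vrK.
Qed.

Let near_gt x : a < x -> \forall y \near x, a < y.
Proof. exact: lt_nbhsr. Qed.

Let cvr x : a < x -> {for x, continuous vr}.
Proof.
move=> ax; rewrite /prop_for /continuous_at vrE//.
apply: (@cvg_trans _ (1 + \int[mu]_(t in `]a, y]) (w1 t * ir t) @[y --> x])).
  by apply: near_eq_cvg; near=> y; rewrite vrE//; near: y; exact: near_gt.
apply: (@continuousD R R^o R^o (cst 1) (fun y => \int[mu]_(t in `]a, y]) (w1 t * ir t))).
  exact: cvg_cst.
exact: indefinite_integral_continuous.
Unshelve. all: by end_near. Qed.

Let cir x : a < x -> {for x, continuous ir}.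
Proof.
move=> ax; rewrite /prop_for /continuous_at irE//.
apply: (@cvg_trans _ (\int[mu]_(t in `]a, y]) (w2 t * vr t) @[y --> x])).
  by apply: near_eq_cvg; near=> y; rewrite irE//; near: y; exact: near_gt.
exact: indefinite_integral_continuous.
Unshelve. all: by end_near. Qed.

Lemma volterra_inner_derive x : a < x ->
  is_derive x 1 (fun y => fine (volterra_inner a w2 v y)) (w2 x * fine (v x)).
Proof.
move=> ax.
have [|||dI IE] := @continuous_FTC1 R (fun y => w2 y * vr y) (BRight a) x (x + 1) _ (int_iv _).
- by rewrite ltrDl.
- exact: ax.
- by apply: cvgM; [exact: cw2|exact: cvr].
have D : is_derive x 1 (fun y => \int[mu]_(t in `]a, y]) (w2 t * vr t)) (w2 x * vr x).
  by split; [exact: dI|rewrite -derive1E; exact: IE].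
refine (near_eq_is_derive _ D).
by near=> y; rewrite -irE//; near: y; exact: near_gt.
Unshelve. all: by end_near. Qed.

Lemma volterra_derive x : a < x ->
  is_derive x 1 (fun y => fine (v y)) (w1 x * fine (volterra_inner a w2 v x)).
Proof.
move=> ax.
have [|||dI IE] := @continuous_FTC1 R (fun y => w1 y * ir y) (BRight a) x (x + 1) _ (int_i _).
- by rewrite ltrDl.
- exact: ax.
- by apply: cvgM; [exact: cw1|exact: cir].
have D : is_derive x 1 (fun y => \int[mu]_(t in `]a, y]) (w1 t * ir t)) (w1 x * ir x).
  by split; [exact: dI|rewrite -derive1E; exact: IE].
have D1 : is_derive x 1 (fun y => 1 + \int[mu]_(t in `]a, y]) (w1 t * ir t)) (w1 x * ir x).
  by derive_eq; [dtac|rewrite add0r].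
refine (near_eq_is_derive _ D1).
by near=> y; rewrite -vrE//; near: y; exact: near_gt.
Unshelve. all: by end_near. Qed.

End volterra_regularity.

(** * Radial solutions, uniformly in the frequency *)

Section radial_solution.
Context {R : realType} (n : nat) (M mu d : R) (D V : R -> R).
Hypothesis n3 : (3 <= n)%N.
Hypothesis M0 : 0 < M.
Hypothesis mu0 : 0 <= mu.
Hypothesis d0 : 0 < d.
Hypothesis d1 : d <= 2^-1.
Hypothesis cD : forall r, 2 * M < r -> {for r, continuous D}.
Hypothesis cV : forall r, 2 * M < r -> {for r, continuous V}.
Hypothesis D_bnd : forall r, 2 * M < r -> 0 <= D r <= mu * (r `^ (- d) / r).
Hypothesis V_bnd : forall r, 2 * M < r -> 0 <= V r <= mu * (r `^ (- d) / r ^+ 2).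
Implicit Types (r lam : R).
Local Notation F := (lapse M).
Local Notation flux := (flux n M).
Local Notation g := (delay n M).
Local Notation sigma := (sigma n M).
Local Notation wave_coef := (wave_coef n M).

(** The decay exponent k of radial waves, r^(-k) being the size of a radial free
    wave along its cone. *)
Definition half_dim : R := n.-1%:R / 2.
Local Notation k := half_dim.

Lemma half_dim_ge1 : 1 <= k.
Proof.
rewrite /half_dim ler_pdivlMr// mul1r ler_nat; by case: n n3 => [//|[//|[//|m _]]].
Qed.

(** Inserting exp(- lambda w) z(r) in the adjoint equation leaves
    Lap z + 2 lambda flux z' = potential * z, that is
    (weight F z')' = weight * potential * z. *)
Definition potential lam r : R := lam ^+ 2 * wave_coef r + lam * D r + V r.

Definition weight lam r : R := r ^+ n.-1 * expR (- (2 * lam * g r)).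

Section fixed_lambda.
Variable lam : R.
Hypothesis lam0 : 0 <= lam.

Let Bc : R := k * (2 * k - 1).
Let Bc_ge : k ^+ 2 <= Bc.
Proof.
rewrite /Bc expr2; apply: ler_wpM2l; have := half_dim_ge1; lra.
Qed.

(** The logarithmic derivative of the supersolution minus lambda sigma'. *)
Definition ell r : R := - k * lam / (1 + lam * r) +
  k * (2 * k - 1) * lam / (1 + lam * r) ^+ 2 + 4 * mu * (r `^ (- d) / r).

Definition dell r : R := k * lam ^+ 2 / (1 + lam * r) ^+ 2 -
  2 * (k * (2 * k - 1)) * lam ^+ 2 / (1 + lam * r) ^+ 3
  - (1 + d) * (4 * mu * (r `^ (- d) / r ^+ 2)).

Lemma lamr_gt0 r : 2 * M < r -> 0 < 1 + lam * r.
Proof. by move=> hr; rewrite ltr_wpDr// mulr_ge0// ltW// (gt2M_gt0 M0 hr). Qed.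

Lemma powR_derivE r : 0 < r -> - d * r `^ (- d - 1) = - d * (r `^ (- d) / r).
Proof. by move=> r0; congr (_ * _); rewrite powRB ?powRr1 ?(ltW r0)// (gt_eqF r0) implybT. Qed.

Lemma derive_ell r : 2 * M < r -> is_derive r 1 ell (dell r).
Proof.
move=> hr; have r0 := gt2M_gt0 M0 hr; have l0 := lamr_gt0 hr.
rewrite /ell; derive_eq; first by dtac; rewrite ?expf_neq0 ?gt_eqF.
rewrite powR_derivE// /dell /=; move: (r `^ (- d)) => P.
field; rewrite !gt_eqF//.
Qed.

(** The inequality that makes the exponential of log_supersol a supersolution:
    a Riccati inequality for its logarithmic derivative lambda sigma' + ell. The
    terms in lambda^2 cancel identically against lambda^2 wave_coef. *)
Lemma riccati_super r : 2 * M < r ->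
  lam * D r + V r <= hratio M r / r * ell r + F r * dell r + F r * ell r ^+ 2 +
   2 * lam * ell r + n.-1%:R * F r / r * ell r + n.-1%:R * lam / r.
Proof.
move=> hr; have r0 := gt2M_gt0 M0 hr; have l0 := lamr_gt0 hr.
set P := r `^ (- d); have P0 : 0 < P by exact: powR_gt0.
apply: (@le_trans _ _ (lam * (mu * (P / r)) + mu * (P / r ^+ 2))).
  apply: lerD; last by have /andP[] := V_bnd hr.
  by rewrite ler_wpM2l//; have /andP[] := D_bnd hr.
have H := @riccati_algebra R k (F r) (lam * r) (1 + lam * r)^-1 P mu d (r * ell r) half_dim_ge1.
have F01 : 0 < F r < 1 by rewrite lapse_gt0// lapse_lt1.
have lr0 : 0 <= lam * r by rewrite mulr_ge0// ltW.
have uE : (1 + lam * r)^-1 * (1 + lam * r) = 1 by rewrite mulVf// gt_eqF.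
have d01 : 0 < d <= 2^-1 by rewrite d0 d1.
have hE : r * ell r = - k * (lam * r) * (1 + lam * r)^-1 + k * (2 * k - 1) * (lam * r) * (1 + lam * r)^-1 ^+ 2 + 4 * mu * P.
  rewrite /ell -/P; field; rewrite !gt_eqF//.
have {}H := H F01 lr0 uE P0 mu0 d01 hE.
rewrite -(ler_pM2l (exprn_gt0 2 r0)).
have -> : r ^+ 2 * (lam * (mu * (P / r)) + mu * (P / r ^+ 2)) = mu * (lam * r * P + P).
  by field; rewrite gt_eqF.
apply: (le_trans H); rewrite le_eqVlt; apply/orP; left; apply/eqP.
rewrite /dell -/P lapseE.
have -> : n.-1%:R = 2 * k by rewrite /half_dim mulrC divfK.
move: (ell r) (hratio M r) => e x.
by field; rewrite !gt_eqF.
Qed.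

(** F times the logarithmic derivative of the supersolution. *)
Definition log_flux r : R := lam * (1 - flux r) + F r * ell r.

Definition log_supersol r : R := lam * sigma r - k * ln (1 + lam * r) +
  k * (2 * k - 1) * (1 - (1 + lam * r)^-1) - 4 * mu / d * r `^ (- d).

Lemma derive_log_supersol r : 2 * M < r -> is_derive r 1 log_supersol (log_flux r / F r).
Proof.
move=> hr; have r0 := gt2M_gt0 M0 hr; have l0 := lamr_gt0 hr.
have F0 := lapse_gt0 M0 hr.
have ds := derive_sigma n3 M0 hr.
rewrite /log_supersol; derive_eq; first by dtac; rewrite ?gt_eqF.
rewrite powR_derivE// /log_flux /ell; move: (r `^ (- d)) (F r) (flux r) F0 => P f a f0.
field; rewrite !gt_eqF//.
Qed.

(** The supersolution must be increasing, since its flux at the horizon is only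
    estimated from below by 0. The negative term of ell is compensated by
    lambda sigma' >= lambda and by the second term of ell: the quadratic
    1 - k u + k (2k - 1) u^2 is nonnegative because k^2 <= k (2k - 1). *)
Lemma log_flux_ge0 r : 2 * M < r -> 0 <= log_flux r.
Proof.
move=> hr; have r0 := gt2M_gt0 M0 hr; have l0 := lamr_gt0 hr.
apply: (@le_trans _ _ (F r * (lam + ell r))); last first.
  by rewrite /log_flux mulrDr lerD2r mulrC ler_wpM2l// lapse_le_fluxC.
apply: mulr_ge0; first by rewrite ltW// lapse_gt0.
rewrite /ell addrA addr_ge0//; last first.
  by rewrite !mulr_ge0// ?invr_ge0 ?powR_ge0// ltW.
set u := (1 + lam * r)^-1.
have -> : lam + (- k * lam * u + k * (2 * k - 1) * lam / (1 + lam * r) ^+ 2) =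
   lam * (1 - k * u + Bc * u ^+ 2).
  by rewrite /u /Bc; field; rewrite gt_eqF.
apply: mulr_ge0 => //.
have : 0 <= (1 - k * u / 2) ^+ 2 by exact: sqr_ge0.
have : 0 <= (Bc - k ^+ 2) * u ^+ 2 by rewrite mulr_ge0 ?sqr_ge0// subr_ge0.
have : 0 <= k ^+ 2 * u ^+ 2 by rewrite mulr_ge0 ?sqr_ge0.
have -> : (1 - k * u / 2) ^+ 2 = 1 - k * u + k ^+ 2 * u ^+ 2 / 4 by field.
rewrite mulrBl; set a := k ^+ 2 * u ^+ 2; set b := Bc * u ^+ 2; set c := k * u; lra.
Qed.

Lemma potential_ge0 r : 2 * M < r -> 0 <= potential lam r.
Proof.
move=> hr; have /andP[D0 _] := D_bnd hr; have /andP[V0 _] := V_bnd hr.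
have b0 : 0 <= wave_coef r by apply: le_trans ler01 _; exact: wave_coef_ge1.
apply: addr_ge0 => //; apply: addr_ge0; apply: mulr_ge0 => //.
exact: sqr_ge0.
Qed.

Lemma weight_gt0 r : 2 * M < r -> 0 < weight lam r.
Proof. by move=> hr; rewrite mulr_gt0 ?expR_gt0// exprn_gt0// (gt2M_gt0 M0 hr). Qed.

Lemma weight_homo r r' : 2 * M < r -> r <= r' -> weight lam r <= weight lam r'.
Proof.
move=> hr rr'; have r0 := gt2M_gt0 M0 hr.
rewrite ler_pM ?exprn_ge0 ?expR_ge0 ?(ltW r0)//.
  by rewrite lerXn2r// nnegrE ltW// (lt_le_trans r0).
by rewrite ler_expR lerN2 ler_wpM2l ?mulr_ge0// delay_anti.
Qed.

Lemma derive_weight r : 2 * M < r ->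
  is_derive r 1 (weight lam) (weight lam r * (n.-1%:R / r + 2 * lam * flux r / F r)).
Proof.
move=> hr; have r0 := gt2M_gt0 M0 hr; have F0 := lapse_gt0 M0 hr.
have dg := derive_delay n3 M0 hr.
rewrite /weight; derive_eq; first by dtac.
have -> : r ^+ n.-1 = r ^+ n.-1.-1 * r.
  by rewrite -exprSr; case: n n3 => [//|[|m]].
move: (r ^+ n.-1.-1) (expR _) => p e; field; rewrite !gt_eqF//.
Qed.

Variable C0 : R.
Hypothesis C0P : forall r, 2 * M < r -> 0 <= C0 + log_supersol r.

Definition supersol r : R := expR (C0 + log_supersol r).

Lemma derive_supersol r : 2 * M < r -> is_derive r 1 supersol (supersol r * (log_flux r / F r)).
Proof.
move=> hr; have dL := derive_log_supersol hr; rewrite /supersol; derive_eq; first by dtac.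
by rewrite add0r.
Qed.

Definition dlog_flux r : R := lam * (n.-1%:R * flux r / r) + hratio M r / r * ell r + F r * dell r.

Definition dsuper_flux r : R := weight lam r * supersol r *
  ((n.-1%:R / r + 2 * lam * flux r / F r) * log_flux r + log_flux r ^+ 2 / F r + dlog_flux r).

(** weight * log_flux * supersol is the conserved quantity weight F Z' of the
    supersolution Z. *)
Lemma derive_super_flux r : 2 * M < r ->
  is_derive r 1 (fun y => weight lam y * log_flux y * supersol y) (dsuper_flux r).
Proof.
move=> hr; have r0 := gt2M_gt0 M0 hr; have F0 := lapse_gt0 M0 hr.
have dm := derive_weight hr; have dZ := derive_supersol hr.
have df := derive_flux n3 M0 hr; have de := derive_ell hr; have dF := derive_lapse M0 hr.
have dYr : is_derive r 1 log_flux (dlog_flux r).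
  rewrite /log_flux; derive_eq; first by dtac.
  by rewrite /dlog_flux; ring.
derive_eq; first by dtac.
rewrite /dsuper_flux; field; rewrite gt_eqF ?gt_eqF//.
Qed.

Lemma continuous_dsuper_flux r : 2 * M < r -> {for r, continuous dsuper_flux}.
Proof.
move=> hr; have r0 := gt2M_gt0 M0 hr; have F0 := lapse_gt0 M0 hr.
have l0 := lamr_gt0 hr.
have dm := derive_weight hr; have dZ := derive_supersol hr.
have df := derive_flux n3 M0 hr; have de := derive_ell hr; have dF := derive_lapse M0 hr.
have dx := derive_hratio M0 hr.
suff [e de'] : exists e, is_derive r 1 dsuper_flux e by exact: is_derive_continuous de'.
rewrite /dsuper_flux /dlog_flux /log_flux /dell; eexists; dtac; rewrite ?expf_neq0 ?gt_eqF//.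
Qed.

Lemma potential_le_dsuper_flux r : 2 * M < r ->
  weight lam r * potential lam r * supersol r <= dsuper_flux r.
Proof.
move=> hr; have r0 := gt2M_gt0 M0 hr; have F0 := lapse_gt0 M0 hr.
rewrite /dsuper_flux mulrAC ler_wpM2l//.
  by rewrite mulr_ge0 ?expR_ge0// ltW// weight_gt0.
have := riccati_super hr.
move=> H; have {}H := lerD (lexx (lam ^+ 2 * wave_coef r)) H.
rewrite /potential -addrA; apply: (le_trans H).
rewrite le_eqVlt; apply/orP; left; apply/eqP.
rewrite /dlog_flux /log_flux /wave_coef; move: (ell r) (dell r) (F r) (flux r) (hratio M r) F0 => e de f a x f0.
by field; rewrite !gt_eqF.
Qed.

Definition kern1 r : R := (weight lam r * F r)^-1.
Definition kern2 r : R := weight lam r * potential lam r.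

Lemma kern1_ge0 r : 2 * M < r -> 0 <= kern1 r.
Proof. by move=> hr; rewrite invr_ge0 mulr_ge0// ltW// ?weight_gt0 ?lapse_gt0. Qed.

Lemma kern2_ge0 r : 2 * M < r -> 0 <= kern2 r.
Proof. by move=> hr; rewrite mulr_ge0 ?potential_ge0// ltW// weight_gt0. Qed.

Lemma kern1_cont r : 2 * M < r -> {for r, continuous kern1}.
Proof.
move=> hr; have F0 := lapse_gt0 M0 hr; have m0 := weight_gt0 hr.
have dm := derive_weight hr; have dF := derive_lapse M0 hr.
suff [e de'] : exists e, is_derive r 1 kern1 e by exact: is_derive_continuous de'.
by rewrite /kern1; eexists; dtac; rewrite gt_eqF// mulr_gt0.
Qed.

Lemma wave_coef_cont r : 2 * M < r -> {for r, continuous wave_coef}.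
Proof.
move=> hr; have F0 := lapse_gt0 M0 hr.
have dF := derive_lapse M0 hr; have df := derive_flux n3 M0 hr.
suff [e de'] : exists e, is_derive r 1 wave_coef e by exact: is_derive_continuous de'.
by rewrite /wave_coef; eexists; dtac; rewrite gt_eqF// mulr_gt0.
Qed.

Lemma kern2_cont r : 2 * M < r -> {for r, continuous kern2}.
Proof.
move=> hr; apply: cvgM; first exact: is_derive_continuous (derive_weight hr).
apply: cvgD; last exact: cV.
apply: cvgD; last by apply: cvgM; [exact: cvg_cst|exact: cD].
by apply: cvgM; [exact: cvg_cst|exact: wave_coef_cont].
Qed.

(** Integrating the differential inequality from the horizon, where the flux of
    the supersolution is nonnegative. *)
Lemma inner_super r : 2 * M < r ->
  (volterra_inner (2 * M) kern2 (EFin \o supersol) r <= (weight lam r * log_flux r * supersol r)%:E)%E.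
Proof.
move=> hr; apply: (@integral_le_primitive R (fun y => kern2 y * supersol y)
  (fun y => weight lam y * log_flux y * supersol y) dsuper_flux) => //.
- move=> x /andP[hx _]; rewrite mulr_ge0 ?kern2_ge0 ?expR_ge0//=.
  exact: potential_le_dsuper_flux.
- by move=> x /andP[hx _]; exact: derive_super_flux.
- by move=> x /andP[hx _]; exact: continuous_dsuper_flux.
- move=> x /andP[hx _]; rewrite mulr_ge0 ?expR_ge0// mulr_ge0 ?log_flux_ge0//.
  by rewrite ltW// weight_gt0.
Qed.

Lemma outer_super r : 2 * M < r ->
  (volterra (2 * M) kern1 kern2 (EFin \o supersol) r <= (supersol r)%:E)%E.
Proof.
move=> hr; rewrite /volterra.
have -> : ((supersol r)%:E = 1 + (supersol r - 1)%:E)%E by rewrite -EFinD addrC subrK.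
rewrite leeD2l//.
apply: (@le_trans _ _ (\int[lebesgue_measure]_(x in `](2 * M)%R, r])
    (supersol x * (log_flux x / F x))%:E)%E).
  apply: le_integral_nomeas => x /itv_oc_gt hx.
    rewrite mule_ge0 ?lee_fin ?kern1_ge0//.
    by apply: volterra_inner_ge0 => [y|y] hy; rewrite ?kern2_ge0// lee_fin expR_ge0.
  apply: (@le_trans _ _ ((kern1 x)%:E * (weight lam x * log_flux x * supersol x)%:E)%E).
    by rewrite lee_wpmul2l ?lee_fin ?kern1_ge0// inner_super.
  rewrite -EFinM lee_fin /kern1.
  rewrite le_eqVlt; apply/orP; left; apply/eqP.
  have := weight_gt0 hx; have := lapse_gt0 M0 hx.
  move: (weight lam x) (F x) (log_flux x) (supersol x) => w f y z f0 w0.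
  by field; rewrite !gt_eqF.
pose Z' y := supersol y * (log_flux y / F y).
have P1 x : 2 * M < x <= r -> 0 <= Z' x <= Z' x.
  move=> /andP[hx _]; rewrite lexx andbT mulr_ge0 ?expR_ge0// divr_ge0 ?log_flux_ge0//.
  by rewrite ltW// lapse_gt0.
have P2 x : 2 * M < x <= r -> is_derive x 1 (fun y => supersol y - 1) (Z' x).
  move=> /andP[hx _]; have dZ := derive_supersol hx.
  by derive_eq; [dtac|rewrite /Z'; ring].
have P3 x : 2 * M < x <= r -> {for x, continuous Z'}.
  move=> /andP[hx _].
  have F0 := lapse_gt0 M0 hx; have dF := derive_lapse M0 hx.
  have dZ := derive_supersol hx; have df := derive_flux n3 M0 hx; have de := derive_ell hx.
  suff [e de'] : exists e, is_derive x 1 Z' e by exact: is_derive_continuous de'.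
  by rewrite /Z' /log_flux; eexists; dtac; rewrite gt_eqF.
have P4 x : 2 * M < x <= r -> 0 <= supersol x - 1.
  by move=> /andP[hx _]; rewrite subr_ge0 /supersol -[leLHS]expR0 ler_expR C0P.
exact: (integral_le_primitive hr P1 P2 P3 P4).
Qed.

(** The radial solution z, and below its flux weight F z' (zinner) and its
    first two derivatives. zsol2 is read off the differential equation. *)
Definition zsol r : R := fine (volterra_sol (2 * M) kern1 kern2 r).
Definition zinner r : R :=
  fine (volterra_inner (2 * M) kern2 (volterra_sol (2 * M) kern1 kern2) r).
Definition zsol1 r : R := kern1 r * zinner r.

Let mker1 : measurable_fun `](2 * M), +oo[%classic kern1.
Proof.
apply: open_continuous_measurable_fun; first exact: interval_open.
by move=> y; rewrite inE/= in_itv/= andbT; exact: kern1_cont.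
Qed.

Let mker2 : measurable_fun `](2 * M), +oo[%classic kern2.
Proof.
apply: open_continuous_measurable_fun; first exact: interval_open.
by move=> y; rewrite inE/= in_itv/= andbT; exact: kern2_cont.
Qed.

Local Notation v := (volterra_sol (2 * M) kern1 kern2).

Let v_le r : 2 * M < r -> (v r <= (supersol r)%:E)%E.
Proof.
move=> hr; apply: (@volterra_sol_le _ _ _ _ kern1_ge0 kern2_ge0 (EFin \o supersol)) => // x hx.
  by rewrite /= lee_fin /supersol -[leLHS]expR0 ler_expR C0P.
exact: outer_super.
Qed.

Let v_ge1 r : 2 * M < r -> (1 <= v r)%E.
Proof. by move=> hr; exact: (volterra_sol_ge1 kern1_ge0 kern2_ge0). Qed.

Let v_fin r : 2 * M < r -> (v r < +oo)%E.
Proof. by move=> hr; rewrite (le_lt_trans (v_le hr))// ltry. Qed.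

Let inner_fin r : 2 * M < r -> (volterra_inner (2 * M) kern2 v r < +oo)%E.
Proof.
move=> hr; apply: le_lt_trans (ltry (weight lam r * log_flux r * supersol r)).
apply: le_trans (inner_super hr); apply: (volterra_inner_le kern2_ge0) => x hx.
  exact: le_trans (v_ge1 hx).
exact: v_le.
Qed.

Let vE r : 2 * M < r -> volterra (2 * M) kern1 kern2 v r = v r.
Proof. by move=> hr; exact: (volterra_solE kern1_ge0 kern2_ge0 mker1 mker2). Qed.

Lemma zsol_le r : 2 * M < r -> zsol r <= supersol r.
Proof.
move=> hr; rewrite -lee_fin fineK ?v_le// ge0_fin_numE ?v_fin//.
exact: le_trans (v_ge1 hr).
Qed.

Lemma zsol_ge1 r : 2 * M < r -> 1 <= zsol r.
Proof.
move=> hr; rewrite -lee_fin fineK ?v_ge1// ge0_fin_numE ?v_fin//.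
exact: le_trans (v_ge1 hr).
Qed.

Lemma zinner_ge0 r : 2 * M < r -> 0 <= zinner r.
Proof.
move=> hr; apply: fine_ge0; apply: (volterra_inner_ge0 kern2_ge0) => x hx.
exact: le_trans (v_ge1 hx).
Qed.

Lemma zsol1_ge0 r : 2 * M < r -> 0 <= zsol1 r.
Proof. by move=> hr; rewrite mulr_ge0 ?kern1_ge0 ?zinner_ge0. Qed.

Lemma derive_zsol r : 2 * M < r -> is_derive r 1 zsol (zsol1 r).
Proof.
exact: (volterra_derive kern1_ge0 kern2_ge0 kern1_cont kern2_cont vE v_ge1 v_fin inner_fin).
Qed.

Lemma derive_zinner r : 2 * M < r -> is_derive r 1 zinner (kern2 r * zsol r).
Proof.
exact: (volterra_inner_derive kern1_ge0 kern2_ge0 kern1_cont kern2_cont vE v_ge1 v_fin inner_fin).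
Qed.

Definition zsol2 r : R := (potential lam r * zsol r - 2 * flux r * lam * zsol1 r
  - (hratio M r / r + n.-1%:R * F r / r) * zsol1 r) / F r.

Lemma derive_zsol1 r : 2 * M < r -> is_derive r 1 zsol1 (zsol2 r).
Proof.
move=> hr; have r0 := gt2M_gt0 M0 hr; have F0 := lapse_gt0 M0 hr.
have m0 := weight_gt0 hr.
have dm := derive_weight hr; have dF := derive_lapse M0 hr; have dI := derive_zinner hr.
rewrite /zsol1 /kern1; derive_eq; first by dtac; rewrite gt_eqF// mulr_gt0.
rewrite /zsol2 /zsol1 /kern1 /kern2.
move: (weight lam r) (F r) (zinner r) (zsol r) (potential lam r) (flux r) (hratio M r) m0 F0
  => m f i z p a x m0 f0.
by field; rewrite !gt_eqF.
Qed.

Lemma zsol2_cont r : 2 * M < r -> {for r, continuous zsol2}.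
Proof.
move=> hr; have r0 := gt2M_gt0 M0 hr; have F0 := lapse_gt0 M0 hr.
have dF := derive_lapse M0 hr; have df := derive_flux n3 M0 hr.
have dx := derive_hratio M0 hr; have dz1 := derive_zsol1 hr.
apply: cvgM; last first.
  suff [e de'] : exists e, is_derive r 1 (fun y => (F y)^-1) e by exact: is_derive_continuous de'.
  by eexists; dtac; rewrite gt_eqF.
apply: cvgB; last first.
  suff [e de'] : exists e, is_derive r 1 (fun y => (hratio M y / y + n.-1%:R * F y / y) * zsol1 y) e.
    exact: is_derive_continuous de'.
  by eexists; dtac; rewrite gt_eqF.
apply: cvgB; last first.
  suff [e de'] : exists e, is_derive r 1 (fun y => 2 * flux y * lam * zsol1 y) e.
    exact: is_derive_continuous de'.
  by eexists; dtac.
apply: cvgM; last exact: is_derive_continuous (derive_zsol hr).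
apply: cvgD; last exact: cV.
apply: cvgD; last by apply: cvgM; [exact: cvg_cst|exact: cD].
by apply: cvgM; [exact: cvg_cst|exact: wave_coef_cont].
Qed.

Lemma zsol_homo r r' : 2 * M < r -> r <= r' -> zsol r <= zsol r'.
Proof. by move=> hr; apply: (derive_ge0_homo derive_zsol zsol1_ge0 hr). Qed.

(** weight F z' is the integral of weight * potential * z, and the three
    factors are monotone or bounded. So the integral is at most the length
    r - 2M = r F of the interval times their values at r, and the factors F
    cancel. *)
Lemma zsol1_le (Qm : R) r : 2 * M < r ->
  (forall x, 2 * M < x -> potential lam x <= Qm) -> zsol1 r <= Qm * r * zsol r.
Proof.
move=> hr hQ; have r0 := gt2M_gt0 M0 hr; have F0 := lapse_gt0 M0 hr.
have m0 := weight_gt0 hr.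
have Q0 : 0 <= Qm by apply: le_trans (potential_ge0 hr) (hQ _ hr).
have z0 : 0 <= zsol r by apply: le_trans ler01 (zsol_ge1 hr).
have I_le : zinner r <= weight lam r * Qm * zsol r * (r - 2 * M).
  have E x : 2 * M < x -> (zsol x)%:E = v x.
    by move=> hx; rewrite fineK// ge0_fin_numE ?v_fin//; exact: le_trans (v_ge1 hx).
  rewrite -lee_fin fineK; last first.
    rewrite ge0_fin_numE ?inner_fin//; apply: (volterra_inner_ge0 kern2_ge0) => x hx.
    exact: le_trans (v_ge1 hx).
  pose c := weight lam r * Qm * zsol r.
  have c0 : 0 <= c by apply: mulr_ge0 => //; apply: mulr_ge0 => //; exact: ltW.
  have -> : volterra_inner (2 * M) kern2 v r =
     (\int[lebesgue_measure]_(x in `](2 * M)%R, r]) (kern2 x * zsol x)%:E)%E.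
    by apply: eq_integral => x; rewrite inE => /itv_oc_gt hx; rewrite -(E _ hx) -EFinM.
  have P1 x : 2 * M < x <= r -> 0 <= kern2 x * zsol x <= c.
    move=> /andP[hx xr]; have zx : 0 <= zsol x by apply: le_trans ler01 (zsol_ge1 hx).
    rewrite mulr_ge0 ?kern2_ge0//= /kern2 /c; apply: ler_pM => //.
    - by rewrite mulr_ge0 ?potential_ge0// ltW// weight_gt0.
    - by apply: ler_pM; rewrite ?potential_ge0 ?hQ ?weight_homo// ltW// weight_gt0.
    - exact: zsol_homo.
  have P2 x : 2 * M < x <= r -> is_derive x 1 (fun y => c * (y - 2 * M)) c.
    by move=> _; derive_eq; [dtac|rewrite mul0r add0r addr0 mulr1].
  have P3 x : 2 * M < x <= r -> {for x, continuous (fun=> c)}.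
    by move=> _; exact: cvg_cst.
  have P4 x : 2 * M < x <= r -> 0 <= c * (x - 2 * M).
    by move=> /andP[hx _]; rewrite mulr_ge0// subr_ge0 ltW.
  exact: (integral_le_primitive hr P1 P2 P3 P4).
rewrite /zsol1 /kern1.
apply: (@le_trans _ _ ((weight lam r * F r)^-1 * (weight lam r * Qm * zsol r * (r - 2 * M)))).
  by rewrite ler_wpM2l// kern1_ge0.
rewrite le_eqVlt; apply/orP; left; apply/eqP.
have -> : r - 2 * M = r * F r by rewrite /lapse; field; rewrite gt_eqF.
move: (weight lam r) (F r) m0 F0 => m f m0 f0; field; rewrite !gt_eqF//.
Qed.

End fixed_lambda.

Lemma powRN_le r : 2 * M < r -> r `^ (- d) <= (2 * M) `^ (- d).
Proof.
move=> hr; have M20 : 0 < 2 * M by rewrite mulr_gt0.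
rewrite !powRN lef_pV2 ?posrE ?powR_gt0 ?(gt2M_gt0 M0 hr)//.
by apply: ge0_ler_powR; rewrite ?nnegrE ?(ltW d0) ?(ltW hr) ?(ltW M20)// ltW// (gt2M_gt0 M0 hr).
Qed.

Lemma potential_bounded : exists Q, forall lam r, 0 <= lam <= 1 -> 2 * M < r ->
  potential lam r <= Q.
Proof.
have M20 : 0 < 2 * M by rewrite mulr_gt0.
pose P := (2 * M) `^ (- d); have P0 : 0 <= P by exact: powR_ge0.
exists (2 * n%:R + mu * (P / (2 * M)) + mu * (P / (2 * M) ^+ 2)) => lam r /andP[l0 l1] hr.
have r0 := gt2M_gt0 M0 hr.
have Pr : r `^ (- d) <= P by exact: powRN_le.
apply: lerD; first apply: lerD.
- rewrite -[leRHS]mul1r; apply: ler_pM; rewrite ?sqr_ge0 ?wave_coef_le ?exprn_ile1//.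
  by rewrite (le_trans ler01)// wave_coef_ge1.
- have /andP[D0 D1] := D_bnd hr.
  apply: (@le_trans _ _ (D r)); first by rewrite ler_piMl.
  apply: le_trans D1 _; rewrite ler_wpM2l//; apply: ler_pM => //.
  + exact: powR_ge0.
  + by rewrite invr_ge0 ltW.
  + by rewrite lef_pV2 ?posrE// ltW.
- have /andP[V0 V1] := V_bnd hr.
  apply: le_trans V1 _; rewrite ler_wpM2l//; apply: ler_pM => //.
  + exact: powR_ge0.
  + by rewrite invr_ge0 exprn_ge0// ltW.
  + by rewrite lef_pV2 ?posrE ?exprn_gt0// lerXn2r ?nnegrE// ltW.
Qed.

(** The constant added to log_supersol must make the supersolution at least 1
    near the horizon as well as at infinity, independently of lambda. The
    exponential growth lambda sigma, comparable to lambda r, beats the power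
    (1 + lambda r)^k. *)
Lemma log_supersol_lower : exists C, forall lam r, 0 <= lam <= 1 -> 2 * M < r ->
  0 <= C + log_supersol lam r.
Proof.
have M20 : 0 < 2 * M by rewrite mulr_gt0.
have k1 := half_dim_ge1; have k0 : 0 < k by apply: lt_le_trans k1.
exists (`|2 * M * ln (2 * M)| + 1 + k * ln k + 4 * mu / d * (2 * M) `^ (- d)).
move=> lam r /andP[l0 l1] hr.
have r0 := gt2M_gt0 M0 hr; have lr0 : 0 <= lam * r by rewrite mulr_ge0// ltW.
have lr1 : 0 < 1 + lam * r by rewrite ltr_wpDr.
have S1 : lam * r - `|2 * M * ln (2 * M)| <= lam * sigma r.
  apply: (@le_trans _ _ (lam * (r + 2 * M * ln (2 * M)))).
    rewrite mulrDr lerD2l; apply: (@le_trans _ _ (- (lam * `|2 * M * ln (2 * M)|))).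
      by rewrite lerN2; apply: ler_piMl.
    by rewrite -mulrN ler_wpM2l// lerNl ler_normr lexx orbT.
  by rewrite ler_wpM2l// sigma_ge.
(* ln y <= y at y = (1 + lambda r)/k *)
have S2 : k * ln (1 + lam * r) <= 1 + lam * r + k * ln k.
  have E : 1 + lam * r = k * ((1 + lam * r) / k) by rewrite mulrCA divff ?mulr1// gt_eqF.
  have Xk : 0 < (1 + lam * r) / k by rewrite divr_gt0.
  have lE : ln (1 + lam * r) = ln ((1 + lam * r) / k) + ln k.
    by rewrite -lnM ?posrE// divfK// gt_eqF.
  rewrite lE mulrDr lerD2r [leRHS]E ler_pM2l//.
  by rewrite ltW// ln_sublinear.
have S3 : 4 * mu / d * r `^ (- d) <= 4 * mu / d * (2 * M) `^ (- d).
  rewrite ler_wpM2l ?powRN_le// divr_ge0 ?(ltW d0)// mulr_ge0//.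
have S4 : 0 <= k * (2 * k - 1) * (1 - (1 + lam * r)^-1).
  rewrite mulr_ge0//; first by rewrite mulr_ge0// ?(ltW k0)//; lra.
  by rewrite subr_ge0 invf_le1// lerDl.
rewrite /log_supersol; move: S1 S2 S3 S4.
set a := lam * sigma r; set b := k * ln (1 + lam * r); set c := _ * (1 - _).
set e := 4 * mu / d * r `^ _; set f := 4 * mu / d * (2 * M) `^ _.
set X := lam * r; set N := `|_|; set K := k * ln k; lra.
Qed.

(** The constant does not depend on lambda; the critical case uses arbitrarily
    many lambda accumulating at 0. *)
Lemma radial_family : exists2 C : R, 0 < C & forall lam, 0 <= lam <= 1 ->
  exists z z1 z2 : R -> R, forall r, 2 * M < r ->
  [/\ is_derive r 1 z (z1 r), is_derive r 1 z1 (z2 r), {for r, continuous z2},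
      1 <= z r /\ (forall r', r <= r' -> z r <= z r') &
   [/\ 0 <= z1 r <= C * r * z r,
      z r <= C * expR (lam * sigma r) * (1 + lam * r) `^ (- k) &
      F r * z2 r + (hratio M r / r + n.-1%:R * F r / r) * z1 r
       + 2 * flux r * lam * z1 r = potential lam r * z r]].
Proof.
have [Q hQ] := potential_bounded; have [C0 hC] := log_supersol_lower.
pose B := k * (2 * k - 1).
pose C := Num.max Q (expR (C0 + B)).
have C_gt0 : 0 < C by rewrite lt_max expR_gt0 orbT.
exists C => // lam l01; have /andP[l0 l1] := l01.
have CP r : 2 * M < r -> 0 <= C0 + log_supersol lam r by move=> hr; exact: hC.
exists (zsol lam), (zsol1 lam), (zsol2 lam) => r hr.
have r0 := gt2M_gt0 M0 hr; have F0 := lapse_gt0 M0 hr.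
split.
- exact: (derive_zsol l0 CP).
- exact: (derive_zsol1 l0 CP).
- exact: (zsol2_cont l0 CP).
- by split; [exact: (zsol_ge1 l0 CP)|move=> r' rr'; exact: (zsol_homo l0 CP)].
split.
- rewrite (zsol1_ge0 l0 hr)/=.
  apply: (@le_trans _ _ (Q * r * zsol lam r)).
    by apply: (zsol1_le l0 CP) => // x hx; exact: hQ.
  rewrite -!mulrA ler_pM2r ?le_max ?lexx// mulr_gt0//.
  exact: lt_le_trans (zsol_ge1 l0 CP hr).
- apply: le_trans (zsol_le l0 CP hr) _.
  have lr1 : 0 < 1 + lam * r by exact: lamr_gt0.
  rewrite /supersol /powR gt_eqF// -mulrA -expRD.
  apply: (@le_trans _ _ (expR (C0 + B) * expR (lam * sigma r + - k * ln (1 + lam * r)))).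
    rewrite -expRD ler_expR /log_supersol -/B.
    have k1 := half_dim_ge1.
    have B0 : 0 <= B by rewrite /B mulr_ge0//; lra.
    have : B * (1 - (1 + lam * r)^-1) <= B.
      by rewrite ler_piMr// gerBl invr_ge0 ltW.
    have : 0 <= 4 * mu / d * r `^ (- d).
      by rewrite mulr_ge0 ?powR_ge0// divr_ge0 ?(ltW d0)// mulr_ge0.
    set a := lam * sigma r; set b := ln _; set c := _ * (1 - _).
    set e := 4 * mu / d * r `^ _; lra.
  by rewrite ler_pM2r ?expR_gt0// le_max lexx orbT.
- rewrite /zsol2; move: (F r) F0 => f f0; field; rewrite (gt_eqF r0) (gt_eqF f0) //.
Qed.

End radial_solution.

(** * Functions of class C^k and the cutoff *)

Section Ck.
Context {R : realType} {W : normedModType R}.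
Implicit Types (U : set W) (f : W -> R) (k : nat).

Lemma is_Ck_cont U k f : open U -> is_Ck k U f -> forall x, U x -> {for x, continuous f}.
Proof.
move=> oU; case: k => [|k] [cf _] x Ux; move: cf;
  by rewrite continuous_open_subspace// => /(_ x); rewrite inE; exact.
Qed.

Lemma is_CkI U k f : open U -> (forall x, U x -> {for x, continuous f}) ->
  (if k is k'.+1 then
    forall v, (forall x, U x -> derivable f x v) /\ is_Ck k' U ('D_v f) else True) ->
  is_Ck k U f.
Proof.
move=> oU cf; case: k => [_|k H]; split => //; rewrite continuous_open_subspace// => x;
  by rewrite inE; exact: cf.
Qed.

Lemma is_Ck_ext U k f h : open U -> (forall x, U x -> f x = h x) ->
  is_Ck k U f -> is_Ck k U h.
Proof.
move=> oU; elim: k f h => [|k IH] f h fh Cf.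
  apply: is_CkI => // x Ux.
  have cf := is_Ck_cont oU Cf Ux.
  rewrite /prop_for /continuous_at -fh//; apply: cvg_trans cf; apply: near_eq_cvg.
  by move: (open_nbhs_nbhs (conj oU Ux)); apply: filterS => y; exact: fh.
have nfh x : U x -> {near x, f =1 h}.
  by move=> Ux; move: (open_nbhs_nbhs (conj oU Ux)); apply: filterS => y; exact: fh.
apply: is_CkI => // [x Ux|v].
  have cf := is_Ck_cont oU Cf Ux.
  rewrite /prop_for /continuous_at -fh//; apply: cvg_trans cf; apply: near_eq_cvg.
  exact: nfh.
case: Cf => _ /(_ v)[df CDf]; split.
  by move=> x Ux; apply: near_eq_derivable (df _ Ux); exact: nfh.
apply: IH CDf => x Ux; apply: near_eq_derive; exact: nfh.
Qed.

Lemma is_Ck_pred U k f : open U -> is_Ck k.+1 U f -> is_Ck k U f.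
Proof.
move=> oU; elim: k f => [|k IH] f [cf H]; first by split.
by split => // v; have [df Cdf] := H v; split => //; exact: IH.
Qed.

Lemma is_Ck_cst U k (c : R) : open U -> is_Ck k U (fun=> c).
Proof.
move=> oU; elim: k c => [|k IH] c.
  by apply: is_CkI => // x _; exact: cvg_cst.
apply: is_CkI => // [x _|v]; first exact: cvg_cst.
split; first by move=> x _; exact: derivable_cst.
by apply: is_Ck_ext (IH 0) => // x _; rewrite derive_cst.
Qed.

Lemma is_Ck_add U k f h : open U -> is_Ck k U f -> is_Ck k U h ->
  is_Ck k U (fun x => f x + h x).
Proof.
move=> oU; elim: k f h => [|k IH] f h Cf Ch.
  apply: is_CkI => // x Ux.
  by apply: continuousD; [exact: (is_Ck_cont oU Cf Ux)|exact: (is_Ck_cont oU Ch Ux)].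
apply: is_CkI => // [x Ux|v].
  by apply: continuousD; [exact: (is_Ck_cont oU Cf Ux)|exact: (is_Ck_cont oU Ch Ux)].
case: Cf => _ /(_ v)[df CDf]; case: Ch => _ /(_ v)[dh CDh]; split.
  by move=> x Ux; apply: derivableD; [exact: df|exact: dh].
apply: is_Ck_ext (IH _ _ CDf CDh) => // x Ux.
by rewrite deriveD//; [exact: df|exact: dh].
Qed.

Lemma is_Ck_mul U k f h : open U -> is_Ck k U f -> is_Ck k U h ->
  is_Ck k U (fun x => f x * h x).
Proof.
move=> oU; elim: k f h => [|k IH] f h Cf Ch.
  apply: is_CkI => // x Ux.
  by apply: continuousM; [exact: (is_Ck_cont oU Cf Ux)|exact: (is_Ck_cont oU Ch Ux)].
apply: is_CkI => // [x Ux|v].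
  by apply: continuousM; [exact: (is_Ck_cont oU Cf Ux)|exact: (is_Ck_cont oU Ch Ux)].
have Cf' := is_Ck_pred oU Cf; have Ch' := is_Ck_pred oU Ch.
case: Cf => _ /(_ v)[df CDf]; case: Ch => _ /(_ v)[dh CDh]; split.
  by move=> x Ux; apply: derivableM; [exact: df|exact: dh].
apply: is_Ck_ext (is_Ck_add oU (IH _ _ Cf' CDh) (IH _ _ Ch' CDf)) => // x Ux.
by rewrite deriveM//; [exact: df|exact: dh].
Qed.

(** Iterated differentiability on a set of reals, with the derivatives as
    witnesses: it is closed under composition with is_Ck functions by the chain
    rule and is checked with the rules for is_derive. *)
Fixpoint ck1 k (J : set R) (h : R -> R) : Prop :=
  (forall x, J x -> {for x, continuous h}) /\
  if k is k'.+1 then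
    exists2 h', (forall x, J x -> is_derive x 1 h (h' x)) & ck1 k' J h'
  else True.

Lemma derive_dirE f (x v : W) : 'D_v f x = 'D_1 (fun t : R => f (t *: v + x)) 0.
Proof.
rewrite /derive; apply: (congr1 (fun d : R -> R => lim (d @ 0^'))).
apply/funext => t /=.
by rewrite addr0 scale0r add0r [t *: 1]mulr1.
Qed.

Lemma derive_dir_comp (h : R -> R) f (x v : W) (a : R) :
  is_derive (f x) 1 h a -> derivable f x v ->
  derivable (fun y => h (f y)) x v /\ 'D_v (fun y => h (f y)) x = a * 'D_v f x.
Proof.
move=> dh df.
have df1 := (derivable1P _ _ _).1 df.
have idf : is_derive (0 : R) 1 (fun t : R => f (t *: v + x)) ('D_v f x).
  by split => //; rewrite -derive_dirE.
have idh : is_derive (0 : R) 1 (fun t : R => h (f (t *: v + x))) (a * 'D_v f x).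
  have dh' : is_derive (f (0 *: v + x)) 1 h a by rewrite scale0r add0r.
  by notypeclasses refine (@derive_compP _ h (fun t : R => f (t *: v + x)) _ _ _ dh' idf).
split; last by rewrite derive_dirE; case: idh.
by apply/derivable1P; case: idh.
Qed.

Lemma is_Ck_comp U k J h f : open U -> ck1 k J h -> is_Ck k U f ->
  (forall x, U x -> J (f x)) -> is_Ck k U (fun x => h (f x)).
Proof.
move=> oU; elim: k h f => [|k IH] h f Ch Cf UJ.
  case: Ch => ch _; apply: is_CkI => // x Ux.
  by apply: (@continuous_comp _ _ _ f h); [exact: (is_Ck_cont oU Cf Ux)|apply: ch; exact: UJ].
have Cf' := is_Ck_pred oU Cf.
case: Ch => ch [h' dh Ch'].
apply: is_CkI => // [x Ux|v].
  by apply: (@continuous_comp _ _ _ f h); [exact: (is_Ck_cont oU Cf Ux)|apply: ch; exact: UJ].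
case: Cf => _ /(_ v)[df CDf].
have D x (Ux : U x) := derive_dir_comp (dh _ (UJ _ Ux)) (df _ Ux).
split; first by move=> x /D[].
apply: is_Ck_ext (is_Ck_mul oU (IH _ _ Ch' Cf' UJ) CDf) => // x Ux.
by have [_ ->] := D _ Ux.
Qed.

Lemma is_Ck_linear U k f : open U -> (forall x, {for x, continuous f}) ->
  (forall (t : R) x y, f (t *: x + y) = t * f x + f y) -> is_Ck k U f.
Proof.
move=> oU cf lf; case: k => [|k]; apply: is_CkI => // v.
have D x : is_derive x v f (f v).
  have d1 : is_derive (0 : R) 1 (fun t : R => f (t *: v + x)) (f v).
    have -> : (fun t : R => f (t *: v + x)) = fun t => t * f v + f x.
      by apply/funext => t; rewrite lf.
    by derive_eq; [dtac|rewrite mul1r mulr0 !addr0].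
  split; first by apply/derivable1P; case: d1.
  by rewrite derive_dirE; case: d1.
split; first by move=> x _; case: (D x).
by apply: is_Ck_ext (is_Ck_cst k (f v) oU) => // x _; case: (D x).
Qed.

End Ck.

Section positive_part.
Context {R : realType}.
Implicit Types (x : R) (N : nat).

Definition ppos x : R := (x + `|x|) / 2.

Lemma ppos_ge0 x : 0 <= ppos x.
Proof. by rewrite divr_ge0// -lerBlDl sub0r -normrN ler_norm. Qed.

Lemma ppos_id x : 0 <= x -> ppos x = x.
Proof. by move=> x0; rewrite /ppos ger0_norm//; field. Qed.

Lemma ppos_0 x : x <= 0 -> ppos x = 0.
Proof. by move=> x0; rewrite /ppos ler0_norm// subrr mul0r. Qed.

Lemma ppos_cont x : {for x, continuous ppos}.
Proof.
apply: (@continuousM R R (fun y => y + `|y|) (cst 2^-1)); last exact: cvg_cst.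
by apply: (@continuousD R R R id Num.norm); [exact: cvg_id|exact: norm_continuous].
Qed.

Lemma derive_ppos N x : is_derive x 1 (fun y => ppos y ^+ N.+2) (N.+2%:R * ppos x ^+ N.+1).
Proof.
have [x0|x0|->] := ltgtP x 0.
- rewrite ppos_0 ?ltW// expr0n mulr0.
  refine (near_eq_is_derive _ (derive_cstP x 0)).
  by have := lt_nbhsl x0; apply: filterS => y /ltW y0; rewrite ppos_0// expr0n.
- rewrite ppos_id ?ltW//.
  have D : is_derive x 1 (fun y => y ^+ N.+2) (N.+2%:R * x ^+ N.+1).
    by derive_eq; [dtac|rewrite mulr1].
  refine (near_eq_is_derive _ D).
  by have := lt_nbhsr x0; apply: filterS => y /ltW y0; rewrite ppos_id.
- have z0 := ppos_0 (lexx (0 : R)).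
  rewrite z0 expr0n mulr0; apply/is_derive1_caratheodory.
  (* at 0 the difference quotient is again a power of ppos *)
  exists (fun y => ppos y ^+ N.+1); split; last by rewrite z0 expr0n.
  + move=> y; rewrite z0 expr0n/= !subr0.
    by have [y0|/ltW y0] := leP 0 y; [rewrite ppos_id// -exprSr|rewrite ppos_0// !exprS !mul0r].
  + apply: (@continuous_comp _ _ _ ppos (fun y => y ^+ N.+1)); first exact: ppos_cont.
    exact: exprn_continuous.
Qed.

(** The cube makes this function C^2 at x = 1/2. At x = 1 it vanishes to first
    order only, so that its high powers are C^2 and differentiating them costs
    one power each time; Young's inequality then absorbs the derivatives of the
    cutoff into the cutoff itself. *)
Definition cutbase x : R := ppos (1 - ppos (2 * x - 1) ^+ 3).
Definition cutoff N x : R := cutbase x ^+ N.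
Definition cutoff1 N x : R :=
  N%:R * cutbase x ^+ N.-1 * (- (3 * ppos (2 * x - 1) ^+ 2 * 2)).
Definition cutoff2 N x : R :=
  (N%:R * (N.-1)%:R) * cutbase x ^+ N.-2 * (3 * ppos (2 * x - 1) ^+ 2 * 2) ^+ 2
  - N%:R * cutbase x ^+ N.-1 * (3 * (2 * ppos (2 * x - 1) * 2) * 2).

Let dinner x : is_derive x 1 (fun y => 1 - ppos (2 * y - 1) ^+ 3)
  (- (3 * ppos (2 * x - 1) ^+ 2 * 2)).
Proof.
have D := derive_ppos 1 (2 * x - 1).
have -> : (fun y : R => 1 - ppos (2 * y - 1) ^+ 3) =
  fun y => 1 - (fun z => ppos z ^+ 3) (2 * y - 1) by [].
derive_eq.
  notypeclasses refine (derive_addP _ _); first exact: derive_cstP.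
  notypeclasses refine (derive_oppP _).
  notypeclasses refine (@derive_compP _ (fun z => ppos z ^+ 3) (fun y => 2 * y - 1) _ _ _ D _); dtac.
ring.
Qed.

Lemma derive_cutoff N x : (3 <= N)%N -> is_derive x 1 (cutoff N) (cutoff1 N x).
Proof.
case: N => [//|[//|N]] _.
have D := derive_ppos N (1 - ppos (2 * x - 1) ^+ 3).
have Di := dinner x.
derive_eq; first by notypeclasses refine (@derive_compP _ (fun z => ppos z ^+ N.+2) (fun y => 1 - ppos (2 * y - 1) ^+ 3) _ _ _ D Di).
by [].
Qed.

Lemma derive_cutoff1 N x : (3 <= N)%N -> is_derive x 1 (cutoff1 N) (cutoff2 N x).
Proof.
case: N => [//|[//|[//|N]]] _.
have D := derive_ppos N (1 - ppos (2 * x - 1) ^+ 3).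
have Di := dinner x.
have D2 := derive_ppos 0 (2 * x - 1).
have Dc : is_derive x 1 (fun y => cutbase y ^+ N.+2) (N.+2%:R * cutbase x ^+ N.+1 *
    (- (3 * ppos (2 * x - 1) ^+ 2 * 2))).
  by notypeclasses refine (@derive_compP _ (fun z => ppos z ^+ N.+2) (fun y => 1 - ppos (2 * y - 1) ^+ 3) _ _ _ D Di).
have Dp : is_derive x 1 (fun y => ppos (2 * y - 1) ^+ 2) (2 * ppos (2 * x - 1) * 2).
  derive_eq; first by notypeclasses refine (@derive_compP _ (fun z => ppos z ^+ 2) (fun y => 2 * y - 1) _ _ _ D2 _); dtac.
  by rewrite expr1; ring.
rewrite /cutoff1 /=.
derive_eq.
  notypeclasses refine (derive_mulP _ _).
    notypeclasses refine (derive_mulP (derive_cstP _ _) Dc).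
  notypeclasses refine (derive_oppP _).
  notypeclasses refine (derive_mulP _ (derive_cstP _ _)).
  notypeclasses refine (derive_mulP (derive_cstP _ _) Dp).
rewrite /cutoff2 /=; ring.
Qed.

Lemma cutbase_cont x : {for x, continuous cutbase}.
Proof.
apply: (@continuous_comp R R R (fun y : R => 1 - ppos (2 * y - 1) ^+ 3) ppos); last exact: ppos_cont.
exact: is_derive_continuous (dinner x).
Qed.

Lemma cutoff2_cont N x : {for x, continuous (cutoff2 N)}.
Proof.
have cb m : {for x, continuous (fun y => cutbase y ^+ m)}.
  apply: (@continuous_comp _ _ _ cutbase (fun y => y ^+ m)); first exact: cutbase_cont.
  exact: exprn_continuous.
have csq (f : R -> R) : {for x, continuous f} -> {for x, continuous (fun y => f y ^+ 2)}.
  by move=> cf; exact: continuousM.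
have cp : {for x, continuous (fun y : R => ppos (2 * y - 1))}.
  apply: (@continuous_comp R R R (fun y : R => 2 * y - 1) ppos); last exact: ppos_cont.
  suff [e D] : exists e, is_derive x 1 (fun y : R => 2 * y - 1) e by exact: is_derive_continuous D.
  by eexists; dtac.
have cp2 : {for x, continuous (fun y : R => 3 * ppos (2 * y - 1) ^+ 2 * 2)}.
  apply: continuousM; last exact: cvg_cst.
  apply: continuousM; first exact: cvg_cst.
  exact: csq.
apply: continuousB; apply: continuousM.
- by apply: continuousM => //; exact: cvg_cst.
- exact: csq.
- by apply: continuousM => //; exact: cvg_cst.
- apply: continuousM; last exact: cvg_cst.
  apply: continuousM; first exact: cvg_cst.
  by apply: continuousM; [apply: continuousM => //; exact: cvg_cst|exact: cvg_cst].
Qed.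

Lemma cutbase_ge0 x : 0 <= cutbase x. Proof. exact: ppos_ge0. Qed.

Lemma cutbase_le1 x : cutbase x <= 1.
Proof.
have p0 : 0 <= ppos (2 * x - 1) ^+ 3 by rewrite exprn_ge0 ?ppos_ge0.
rewrite /cutbase; have [h|/ltW h] := leP 0 (1 - ppos (2 * x - 1) ^+ 3).
  by rewrite ppos_id// gerBl.
by rewrite ppos_0.
Qed.

Lemma cutbase_left x : x <= 2^-1 -> cutbase x = 1.
Proof.
move=> h; have : 2 * x - 1 <= 0 by lra.
by move=> /ppos_0 e; rewrite /cutbase e expr0n subr0 ppos_id.
Qed.

Lemma cutbase_right x : 1 <= x -> cutbase x = 0.
Proof.
move=> h; rewrite /cutbase ppos_0// subr_le0 exprn_ege1// ppos_id; lra.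
Qed.

Lemma cutoff_ge0 N x : 0 <= cutoff N x. Proof. by rewrite exprn_ge0 ?cutbase_ge0. Qed.

Lemma cutoff_le1 N x : cutoff N x <= 1.
Proof. by rewrite exprn_ile1 ?cutbase_ge0 ?cutbase_le1. Qed.

Lemma cutoff1_le0 N x : cutoff1 N x <= 0.
Proof.
rewrite /cutoff1 mulrN oppr_le0; have := ppos_ge0 (2 * x - 1); have := cutbase_ge0 x.
move: (cutbase x) (ppos _) => y p y0 p0.
by rewrite mulr_ge0// ?mulr_ge0// ?exprn_ge0.
Qed.

(** Two derivatives cost two powers of cutbase. *)
Lemma cutoff_bounds N x : (3 <= N)%N ->
  let c := (if (2^-1 <= x <= 1) then 60 * N%:R ^+ 2 * cutbase x ^+ N.-2 else 0) in
  `|cutoff1 N x| <= c /\ `|cutoff2 N x| <= c.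
Proof.
move=> N3; case: ifPn => [/andP[x0 x1]|]; last first.
  rewrite negb_and -!ltNge => /orP[/ltW h|/ltW h].
    have p0 : ppos (2 * x - 1) = 0 by rewrite ppos_0//; lra.
    by rewrite /= /cutoff1 /cutoff2 p0 !expr0n/= !(mulr0, mul0r, subr0, oppr0, normr0, expr0n).
  have b0 := cutbase_right h.
  have [h1 h2] : (0 < N.-1)%N /\ (0 < N.-2)%N by case: N N3 => [//|[//|[//|N]]].
  by rewrite /= /cutoff1 /cutoff2 b0 !expr0n !gtn_eqF//= !(mulr0, mul0r, subr0, normr0).
have p0 := ppos_ge0 (2 * x - 1).
have p1 : ppos (2 * x - 1) <= 1.
  by rewrite ppos_id; lra.
have y0 := cutbase_ge0 x; have y1 := cutbase_le1 x.
have N1 : (1 : R) <= N%:R by rewrite ler1n (leq_trans _ N3).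
rewrite /= /cutoff1 /cutoff2; move: (cutbase x) (ppos (2 * x - 1)) y0 y1 p0 p1 => y P y0 y1 p0 p1.
have E : y ^+ N.-1 = y ^+ N.-2 * y by rewrite -exprSr; case: N N3 N1 => [//|[//|[//|N]]].
have q0 : 0 <= y ^+ N.-2 by rewrite exprn_ge0.
have PP : P ^+ 2 <= 1 by rewrite exprn_ile1.
have PP0 : 0 <= P ^+ 2 by rewrite exprn_ge0.
have qy0 : 0 <= y ^+ N.-2 * y by rewrite mulr_ge0.
have qy : y ^+ N.-2 * y <= y ^+ N.-2 by rewrite ler_piMr.
have NN : N%:R <= N%:R ^+ 2 :> R by rewrite expr2 ler_peMl// (le_trans ler01).
have N0 : 0 <= N%:R :> R by [].
have T1 : N%:R * (y ^+ N.-2 * y) * P ^+ 2 <= N%:R ^+ 2 * y ^+ N.-2.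
  rewrite -[leRHS]mulr1; apply: ler_pM => //; first by rewrite mulr_ge0.
  exact: ler_pM.
have T1' : N%:R * (y ^+ N.-2 * y) * P <= N%:R ^+ 2 * y ^+ N.-2.
  rewrite -[leRHS]mulr1; apply: ler_pM => //; first by rewrite mulr_ge0.
  exact: ler_pM.
have T2 : N%:R * N.-1%:R * y ^+ N.-2 * (P ^+ 2) ^+ 2 <= N%:R ^+ 2 * y ^+ N.-2.
  rewrite -[leRHS]mulr1; apply: ler_pM => //; last by rewrite exprn_ile1.
  - by rewrite !mulr_ge0.
  - by rewrite exprn_ge0.
  - by rewrite ler_wpM2r// expr2 ler_wpM2l// ler_nat leq_pred.
have T3 : 0 <= N%:R * (y ^+ N.-2 * y) * P ^+ 2 by rewrite !mulr_ge0.
have T3' : 0 <= N%:R * (y ^+ N.-2 * y) * P by rewrite !mulr_ge0.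
have T4 : 0 <= N%:R * N.-1%:R * y ^+ N.-2 * (P ^+ 2) ^+ 2.
  by rewrite !mulr_ge0// exprn_ge0.
split.
  rewrite E.
  have -> : N%:R * (y ^+ N.-2 * y) * - (3 * P ^+ 2 * 2) = - (6 * (N%:R * (y ^+ N.-2 * y) * P ^+ 2)) by ring.
  rewrite normrN ger0_norm; last by rewrite mulr_ge0.
  move: T1 T3; set a := N%:R * (y ^+ N.-2 * y) * _; rewrite -mulrA; set b := _ ^+ 2 * _; lra.
rewrite E.
have -> : N%:R * N.-1%:R * y ^+ N.-2 * (3 * P ^+ 2 * 2) ^+ 2 -
    N%:R * (y ^+ N.-2 * y) * (3 * (2 * P * 2) * 2) =
    36 * (N%:R * N.-1%:R * y ^+ N.-2 * (P ^+ 2) ^+ 2) - 24 * (N%:R * (y ^+ N.-2 * y) * P) by ring.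
apply: le_trans (ler_normB _ _) _.
rewrite !ger0_norm ?mulr_ge0//.
move: T1' T2 T3' T4; set a := N%:R * (y ^+ N.-2 * y) * _; set c := _ * _ ^+ 2.
rewrite -mulrA; set b := _ ^+ 2 * _; lra.
Qed.

End positive_part.

(** * Test functions H(t + g(r)) xi(r) *)

Lemma is_derive_derive1 (R : realType) (f : R -> R) (x a : R) :
  is_derive x 1 f a -> derive1 f x = a.
Proof. by move=> [_ <-]; rewrite derive1E. Qed.

Section sphere_topology.
Context {R : realType} (n : nat).

Lemma enorm_continuous : continuous (@enorm R n).
Proof.
move=> x; apply: (@continuous_comp _ _ _ (fun y : 'rV[R]_n => \sum_i y 0 i ^+ 2) Num.sqrt);
  last exact: sqrt_continuous.
rewrite /prop_for /continuous_at.
apply: (@cvg_big R 'I_n +%R 0 xpredT _ _ _ _ (fun i (y : 'rV[R]_n) => y 0 i ^+ 2)) => [||i _].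
- move=> z; apply: (@continuousD R R (R * R)%type fst snd); [exact: cvg_fst|exact: cvg_snd].
- exact: nbhs_filter.
apply: (@continuousM R 'rV[R]_n (fun y => y 0 i) (fun y => y 0 i));
  exact: coord_continuous.
Qed.

Lemma sphere_closed : closed (@sphere R n).
Proof.
have -> : @sphere R n = @enorm R n @^-1` [set 1] by [].
apply: closed_comp; last exact: closed_eq.
by move=> x _; exact: enorm_continuous.
Qed.

Lemma sphere_coord_le (x : 'rV[R]_n) i : sphere n x -> -1 <= x 0 i <= 1.
Proof.
move=> x1; rewrite -ler_norml.
rewrite -(ler_pXn2r (_ : 0 < 2)%N)// ?nnegrE// expr1n real_normK ?num_real//.
have : \sum_i x 0 i ^+ 2 = 1.
  have s0 : 0 <= \sum_i x 0 i ^+ 2 by apply: sumr_ge0 => j _; exact: sqr_ge0.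
  by rewrite -(sqr_sqrtr s0) -[Num.sqrt _]/(enorm x) x1 expr1n.
move=> <-; rewrite (bigD1 i)//= lerDl sumr_ge0// => j _; exact: sqr_ge0.
Qed.

Lemma sphere_compact : compact (@sphere R n).
Proof.
have cube : compact [set v : 'rV[R]_n | forall i, `[(-1 : R), 1]%classic (v ord0 i)].
  by apply: (@rV_compact R n (fun=> `[(-1 : R), 1]%classic)) => i; exact: segment_compact.
apply: (subclosed_compact sphere_closed cube) => x sx i /=.
by rewrite in_itv/=; exact: sphere_coord_le.
Qed.

Lemma measurable_sphere : measurable (@sphere R n).
Proof.
have -> : @sphere R n = @enorm R n @^-1` [set 1] by [].
by rewrite -[X in measurable X]setTI; exact: measurable_enorm.
Qed.

End sphere_topology.

Section test_functions.
Context {R : realType} (n : nat) (M : R).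
Hypothesis n3 : (3 <= n)%N.
Hypothesis M0 : 0 < M.
Local Notation F := (lapse M).
Local Notation flux := (flux n M).
Local Notation g := (delay n M).
Local Notation wave_coef := (wave_coef n M).
Local Notation spacetime := (R * (R * 'rV[R]_n))%type.
Variables (H H1 H2 xi xi1 xi2 : R -> R).
Hypothesis dH : forall w : R, is_derive w 1 H (H1 w).
Hypothesis dH1 : forall w : R, is_derive w 1 H1 (H2 w).
Hypothesis cH2 : forall w, {for w, continuous H2}.
Hypothesis dxi : forall r, 2 * M < r -> is_derive r 1 xi (xi1 r).
Hypothesis dxi1 : forall r, 2 * M < r -> is_derive r 1 xi1 (xi2 r).
Hypothesis cxi2 : forall r, 2 * M < r -> {for r, continuous xi2}.

(** The time function; its sublevel sets avoid a neighbourhood of the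
    horizon. *)
Definition wtime (z : spacetime) : R := z.1 + g z.2.1.
Definition radial_test (z : spacetime) : R := H (wtime z) * xi z.2.1.
Local Notation phi := radial_test.

Definition radial_laplace (r : R) : R :=
  F r * xi2 r + (hratio M r / r + n.-1%:R * F r / r) * xi1 r.

Lemma dt_radial_test z : dt phi z = H1 (wtime z) * xi z.2.1.
Proof.
apply: is_derive_derive1; rewrite /radial_test /wtime /=.
have D := dH (z.1 + g z.2.1).
derive_eq.
  notypeclasses refine (derive_mulP _ (derive_cstP _ _)).
  by notypeclasses refine (@derive_compP _ H (fun t => t + g z.2.1) _ _ _ D _); dtac.
by rewrite addr0 mulr1 mulr0 addr0.
Qed.

Lemma dtdt_radial_test z : dt (dt phi) z = H2 (wtime z) * xi z.2.1.
Proof.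
rewrite /dt (_ : (fun t => dt phi (t, z.2)) = fun t => H1 (t + g z.2.1) * xi z.2.1); last first.
  by apply/funext => t; rewrite dt_radial_test.
apply: is_derive_derive1.
have D := dH1 (z.1 + g z.2.1).
derive_eq.
  notypeclasses refine (derive_mulP _ (derive_cstP _ _)).
  by notypeclasses refine (@derive_compP _ H1 (fun t => t + g z.2.1) _ _ _ D _); dtac.
by rewrite addr0 mulr1 mulr0 addr0.
Qed.

Lemma laplace_sphere_cst (c : R) w : laplace_sphere (fun _ : 'rV[R]_n => c) w = 0.
Proof.
rewrite /laplace_sphere big1// => i _.
rewrite (_ : 'D_(delta_mx 0 i) ((fun=> c) \o to_sphere (n:=n)) = fun=> 0).
  exact: derive_cst.
by apply/funext => y; exact: derive_cst.
Qed.

(** F g' = - flux and g is harmonic, so the radial part of the operator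
    produces flux^2 / F in front of H'' xi and no term H' xi. *)
Lemma laplace_radial_test z : 2 * M < z.2.1 ->
  laplace_gS M (fun x => phi (z.1, x)) z.2 =
  flux z.2.1 ^+ 2 / F z.2.1 * H2 (wtime z) * xi z.2.1
  - 2 * flux z.2.1 * H1 (wtime z) * xi1 z.2.1 + H (wtime z) * radial_laplace z.2.1.
Proof.
move=> hz; rewrite /laplace_gS (laplace_sphere_cst (phi (z.1, (z.2.1, z.2.2)))) mulr0 addr0.
pose d1 r := H1 (z.1 + g r) * (- flux r / F r) * xi r + H (z.1 + g r) * xi1 r.
have Hg r : 2 * M < r -> is_derive r 1 (fun y => H (z.1 + g y)) (H1 (z.1 + g r) * (- flux r / F r)).
  move=> hr; have dg := derive_delay n3 M0 hr; have D := dH (z.1 + g r).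
  derive_eq.
    by notypeclasses refine (@derive_compP _ H (fun y => z.1 + g y) _ _ _ D _); dtac.
  by rewrite add0r.
have Hg1 r : 2 * M < r -> is_derive r 1 (fun y => H1 (z.1 + g y)) (H2 (z.1 + g r) * (- flux r / F r)).
  move=> hr; have dg := derive_delay n3 M0 hr; have D := dH1 (z.1 + g r).
  derive_eq.
    by notypeclasses refine (@derive_compP _ H1 (fun y => z.1 + g y) _ _ _ D _); dtac.
  by rewrite add0r.
have E1 r : 2 * M < r -> derive1 (fun s => phi (z.1, (s, z.2.2))) r = d1 r.
  move=> hr; apply: is_derive_derive1; rewrite /radial_test /wtime /=.
  have h := Hg _ hr; have dx := dxi hr.
  derive_eq; first by notypeclasses refine (derive_mulP h dx).
  by [].
have r0 := gt2M_gt0 M0 hz; have F0 := lapse_gt0 M0 hz.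
pose P y := - (2 * M) ^+ n.-1 * H1 (z.1 + g y) * xi y + y ^+ n.-1 * F y * H (z.1 + g y) * xi1 y.
have PE y : 2 * M < y -> y ^+ n.-1 * F y * d1 y = P y.
  move=> hy; have y0 := gt2M_gt0 M0 hy; have Fy := lapse_gt0 M0 hy.
  rewrite /d1 /P -(exprn_flux n M0 hy); move: (F y) Fy => f f0; field.
  by rewrite gt_eqF.
rewrite (_ : derive1 _ z.2.1 = derive1 P z.2.1); last first.
  rewrite !derive1E; apply: near_eq_derive.
  by have := lt_nbhsr hz; apply: filterS => y hy; rewrite E1// PE.
set r := z.2.1 in hz r0 F0 *.
have h := Hg _ hz; have h1 := Hg1 _ hz; have dx := dxi hz; have dx1 := dxi1 hz.
have dF := derive_lapse M0 hz.
have D : is_derive r 1 P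
   ((2 * M) ^+ n.-1 * (flux r / F r * H2 (z.1 + g r) * xi r - H1 (z.1 + g r) * xi1 r)
    + r ^+ n.-1 * F r * (H1 (z.1 + g r) * (- flux r / F r) * xi1 r)
    + H (z.1 + g r) * (n.-1%:R * r ^+ n.-1.-1 * F r * xi1 r + r ^+ n.-1 * (hratio M r / r) * xi1 r
      + r ^+ n.-1 * F r * xi2 r)).
  rewrite /P; derive_eq.
    notypeclasses refine (derive_addP _ _).
      notypeclasses refine (derive_mulP _ dx).
      notypeclasses refine (derive_mulP (derive_cstP _ _) h1).
    notypeclasses refine (derive_mulP _ dx1).
    notypeclasses refine (derive_mulP _ h).
    by dtac.
  by rewrite /=; ring.
rewrite (is_derive_derive1 D) -(exprn_flux n M0 hz) /radial_laplace -/r /wtime -/r.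
have -> : r ^+ n.-1 = r ^+ n.-1.-1 * r.
  by rewrite -exprSr; case: n n3 => [//|[|k]].
have e0 : r ^+ n.-1.-1 != 0 by rewrite expf_neq0// gt_eqF.
move: (r ^+ n.-1.-1) e0 (F r) F0 => e e0 f f0.
by field; rewrite e0 !gt_eqF.
Qed.

(** The formal adjoint of the damped wave operator, in which the sign of the
    damping is reversed, applied to H(w) xi(r). *)
Definition adjoint (D V : R -> R) (z : spacetime) : R :=
  wave_coef z.2.1 * H2 (wtime z) * xi z.2.1 + 2 * flux z.2.1 * H1 (wtime z) * xi1 z.2.1
  - H (wtime z) * radial_laplace z.2.1 - D z.2.1 * (H1 (wtime z) * xi z.2.1)
  + V z.2.1 * (H (wtime z) * xi z.2.1).

Lemma adjointE D V z : 2 * M < z.2.1 ->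
  dt (dt phi) z / F z.2.1 - laplace_gS M (fun x => phi (z.1, x)) z.2 -
    D z.2.1 * dt phi z + V z.2.1 * phi z = adjoint D V z.
Proof.
move=> hz; rewrite dtdt_radial_test dt_radial_test laplace_radial_test//.
rewrite /adjoint /wave_coef /radial_test; have F0 := lapse_gt0 M0 hz.
move: (F z.2.1) F0 => f f0; field; by rewrite gt_eqF.
Qed.

Lemma ck1_g : ck1 2 [set r | 2 * M < r] g.
Proof.
split; first by move=> r hr; exact: is_derive_continuous (derive_delay n3 M0 hr).
exists (fun r => - flux r / F r); first by move=> r hr; exact: derive_delay.
have D r : 2 * M < r -> is_derive r 1 (fun r => - flux r / F r)
    (n.-1%:R * flux r / r / F r + flux r * (hratio M r / r) / F r ^+ 2).
  move=> hr; have r0 := gt2M_gt0 M0 hr; have F0 := lapse_gt0 M0 hr.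
  have df := derive_flux n3 M0 hr; have dF := derive_lapse M0 hr.
  derive_eq; first by dtac; rewrite gt_eqF.
  move: (F r) F0 => f f0; field; by rewrite !gt_eqF.
split; first by move=> r hr; exact: is_derive_continuous (D _ hr).
exists (fun r => n.-1%:R * flux r / r / F r + flux r * (hratio M r / r) / F r ^+ 2).
  by move=> r hr; exact: D.
split => // r hr.
have r0 := gt2M_gt0 M0 hr; have F0 := lapse_gt0 M0 hr.
have df := derive_flux n3 M0 hr; have dF := derive_lapse M0 hr; have dx := derive_hratio M0 hr.
suff [e De] : exists e, is_derive r 1 (fun r => n.-1%:R * flux r / r / F r + flux r * (hratio M r / r) / F r ^+ 2) e.
  exact: is_derive_continuous De.
by eexists; dtac; rewrite ?expf_neq0 ?gt_eqF.
Qed.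

Definition test_support (T' r0 B : R) : set spacetime :=
  `[0, T']%classic `*` (`[r0, B]%classic `*` sphere n).

Lemma test_support_compact T' r0 B : compact (test_support T' r0 B).
Proof.
apply: compact_setX; first exact: segment_compact.
by apply: compact_setX; [exact: segment_compact|exact: sphere_compact].
Qed.

(** Below r0 the delay alone exceeds T', so w >= T' there for all t >= 0. *)
Lemma radial_test_outside T T' r0 B z : 2 * M < r0 -> T' < g r0 ->
  (forall w, T' <= w -> H w = 0) -> (forall r, B <= r -> xi r = 0) ->
  slab M T z -> ~ test_support T' r0 B z -> phi z = 0.
Proof.
move=> hr0 gr0 H0 xi0 [/andP[t0 tT] [hr zS]] nK; rewrite /radial_test.
have g0 := delay_ge0 n M0 hr.
have [rB|Br] := ltP z.2.1 B; last by rewrite xi0// mulr0.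
have [tT'|T't] := ltP z.1 T'; last first.
  by rewrite H0 ?mul0r// (le_trans T't)// lerDl.
have [r0r|rr0] := leP r0 z.2.1.
  by case: nK; split; [|split] => //=; rewrite in_itv/= ?t0 ?(ltW tT') ?r0r ?(ltW rB).
rewrite H0 ?mul0r//; apply: (le_trans (ltW gr0)).
by rewrite /wtime ler_wpDl// delay_anti// ltW.
Qed.

Lemma radial_test_function T T' r0 B : T' < T -> 2 * M < r0 -> T' < g r0 ->
  (forall w, T' <= w -> H w = 0) -> (forall r, B <= r -> xi r = 0) ->
  test_function M T phi.
Proof.
move=> T'T hr0 gr0 H0 xi0; split; last first.
  exists (test_support T' r0 B); split; first exact: test_support_compact.
    move=> z [/=]; rewrite !in_itv/= => /andP[t0 tT'] [/andP[r0r rB] zS].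
    by split; [rewrite t0 (le_lt_trans tT')|split => //; rewrite (lt_le_trans hr0)].
  by move=> z; exact: radial_test_outside.
set U := [set z | _].
have c1 : continuous (fun z : spacetime => z.1) by move=> z; exact: cvg_fst.
have c21 : continuous (fun z : spacetime => z.2.1).
  move=> z; apply: (@continuous_comp _ _ _ (fun z : spacetime => z.2) fst).
    exact: cvg_snd.
  exact: cvg_fst.
have c22 : continuous (fun z : spacetime => z.2.2).
  move=> z; apply: (@continuous_comp _ _ _ (fun z : spacetime => z.2) snd).
    exact: cvg_snd.
  exact: cvg_snd.
have oU : open U.
  have -> : U = (fun z : spacetime => z.1) @^-1` [set t | t < T] `&`
     ((fun z : spacetime => z.2.1) @^-1` [set r | r > 2 * M] `&`
      (fun z : spacetime => z.2.2) @^-1` (~` [set 0])).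
    apply/seteqP; split => z /=.
      by move=> [h1 h2 /eqP h3].
    by move=> [h1 [h2 /eqP h3]].
  apply: openI; first by apply: open_comp; [move=> z _; exact: c1|exact: open_lt].
  apply: openI; first by apply: open_comp; [move=> z _; exact: c21|exact: open_gt].
  apply: open_comp; first by move=> z _; exact: c22.
  apply: closed_openC; apply: accessible_closed_set1.
  exact/hausdorff_accessible/norm_hausdorff.
have l1 : is_Ck 2 U (fun z : spacetime => z.1).
  by apply: is_Ck_linear => // z; exact: c1.
have l2 : is_Ck 2 U (fun z : spacetime => z.2.1).
  by apply: is_Ck_linear => // z; exact: c21.
have ckH : ck1 2 setT H.
  split; first by move=> w _; exact: is_derive_continuous (dH w).
  exists H1 => //; split; first by move=> w _; exact: is_derive_continuous (dH1 w).
  by exists H2 => //; split => // w _; exact: cH2.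
have ckxi : ck1 2 [set r | 2 * M < r] xi.
  split; first by move=> r hr; exact: is_derive_continuous (dxi hr).
  exists xi1 => //; split; first by move=> r hr; exact: is_derive_continuous (dxi1 hr).
  by exists xi2 => //; split => // r hr; exact: cxi2.
have UJ z : U z -> [set r | 2 * M < r] z.2.1 by case.
have k1 : is_Ck 2 U (fun z : spacetime => g z.2.1).
  exact: (@is_Ck_comp _ _ U 2 _ g (fun z : spacetime => z.2.1) oU ck1_g l2).
have k2 : is_Ck 2 U (fun z : spacetime => z.1 + g z.2.1) by exact: (is_Ck_add oU l1 k1).
have k3 : is_Ck 2 U (fun z : spacetime => H (z.1 + g z.2.1)).
  exact: (@is_Ck_comp _ _ U 2 setT H (fun z : spacetime => z.1 + g z.2.1) oU ckH k2 (fun _ _ => I)).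
have k4 : is_Ck 2 U (fun z : spacetime => xi z.2.1).
  exact: (@is_Ck_comp _ _ U 2 _ xi (fun z : spacetime => z.2.1) oU ckxi l2).
exact: (is_Ck_mul oU k3 k4).
Qed.

End test_functions.

(** * Solutions vanish outside the cone *)

Lemma le_abs_Rintegral d (T : measurableType d) (R : realType)
    (mu : {measure set T -> \bar R}) (D : set T) (f : T -> R) :
  measurable D -> measurable_fun D f ->
  ((\int[mu]_(x in D) f x)%:E <= \int[mu]_(x in D) `|f x|%:E)%E.
Proof.
move=> mD mf; have [oo|] := ltP (\int[mu]_(x in D) `|f x|%:E)%E +oo%E; last first.
  by rewrite leye_eq => /eqP ->; rewrite leey.
have If : mu.-integrable D (EFin \o f).
  by apply/integrableP; split; [exact/measurable_EFinP|exact: oo].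
rewrite /Rintegral fineK; last exact: integrable_fin_num.
by apply: le_trans (lee_abs _) _; apply: le_abse_integral => //; exact/measurable_EFinP.
Qed.

Section spacetime_measure.
Context {R : realType} (n : nat) (M : R).
Hypothesis n3 : (3 <= n)%N.
Hypothesis M0 : 0 < M.
Local Notation space := (R * 'rV[R]_n)%type.
Local Notation spacetime := (R * (R * 'rV[R]_n))%type.
Local Notation slab := (@slab R n M).
Local Notation Omega := (@Omega R n M).
Local Notation mu2 := (@dr_dw R n).
Local Notation mu3 := (@dt_dr_dw R n).

Lemma measurable_Omega : measurable Omega.
Proof.
have -> : Omega = `](2 * M), +oo[%classic `*` sphere n.
  by apply/seteqP; split => x /=; rewrite in_itv/= andbT.
by apply: measurableX; [exact: measurable_itv|exact: measurable_sphere].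
Qed.

Lemma slabE T : slab T = `[0, T[%classic `*` Omega.
Proof. by apply/seteqP; split => x /=; rewrite in_itv. Qed.

Lemma measurable_slab T : measurable (slab T).
Proof.
rewrite slabE; apply: measurableX; first exact: measurable_itv.
exact: measurable_Omega.
Qed.

Lemma measurable_fun_gt2M (h : R -> R) :
  (forall r, 2 * M < r -> {for r, continuous h}) ->
  measurable_fun `](2 * M), +oo[%classic h.
Proof.
move=> ch; apply: open_continuous_measurable_fun; first exact: interval_open.
by move=> y; rewrite inE/= in_itv/= andbT; exact: ch.
Qed.

Lemma measurable_radial T (h : R -> R) :
  (forall r, 2 * M < r -> {for r, continuous h}) ->
  measurable_fun (slab T) (fun z => h z.2.1).
Proof.
move=> ch; apply: (@measurable_comp _ _ _ _ _ _ `](2 * M), +oo[%classic) => //.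
- by move=> _ /= [z [_ [hz _]] <-]; rewrite in_itv/= hz.
- exact: measurable_fun_gt2M.
- by apply: measurable_funTS; apply: (measurableT_comp (f := fst)).
Qed.

Lemma measurable_radial_space (h : R -> R) :
  (forall r, 2 * M < r -> {for r, continuous h}) ->
  measurable_fun Omega (fun x => h x.1).
Proof.
move=> ch; apply: (@measurable_comp _ _ _ _ _ _ `](2 * M), +oo[%classic) => //.
- by move=> _ /= [z [hz _] <-]; rewrite in_itv/= hz.
- exact: measurable_fun_gt2M.
- exact: measurable_funTS.
Qed.

Lemma measurable_wtime T : measurable_fun (slab T) (wtime M).
Proof.
apply: measurable_funD; first exact: measurable_funTS.
apply: (@measurable_radial T (delay n M)) => r hr.
exact: is_derive_continuous (derive_delay n3 M0 hr).
Qed.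

Lemma measurable_fun_wtime T (H : R -> R) : continuous H ->
  measurable_fun (slab T) (fun z => H (wtime M z)).
Proof.
move=> cH; apply: (measurableT_comp (f := H)); last exact: measurable_wtime.
exact: continuous_measurable_fun.
Qed.

Lemma measurable_slab_tortoise T :
  measurable_fun (slab T) (fun z : spacetime => tortoise M z.2.1).
Proof.
apply: (@measurable_radial T (tortoise M)) => r hr.
exact: is_derive_continuous (derive_tortoise M0 hr).
Qed.

(** Every point of the compact set has a neighbourhood on which the function is
    null; covering compactness is applied to the filter of the sets containing a
    given negligible set, which turns finitely many null sets into one. *)
Lemma ess_supp_compact (f : space -> R) (K : set space) :
  compact K -> K `<=` Omega -> (forall x, K x -> ~ ess_supp M f x) ->
  mu2.-negligible (K `&` [set x | f x != 0]).
Proof.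
move=> cK KO Kf.
pose F : set_system (set space) := [set A | exists2 N, mu2.-negligible N &
  forall N', N `<=` N' -> A N'].
have FF : Filter F.
  split.
  - by exists set0 => //; exact: negligible_set0.
  - move=> P Q [N1 n1 P1] [N2 n2 Q2]; exists (N1 `|` N2); first exact: negligibleU.
    by move=> N' NN'; split; [apply: P1|apply: Q2]; apply: subset_trans NN';
      [exact: subsetUl|exact: subsetUr].
  - by move=> P Q PQ [N nN PN]; exists N => // N' NN'; apply: PQ; exact: PN.
have /(_ _ F (fun N x => Omega x -> f x != 0 -> N x) FF) := (compact_near_coveringP K).1 cK.
have H : forall x, K x -> \forall x' \near x & N \near F, Omega x' -> f x' != 0 -> N x'.
  move=> x Kx; have Ox := KO _ Kx.
  have [U nU aeU] : exists2 U, nbhs x U & ae_Omega M (fun y => U y -> f y = 0).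
    apply: contrapT => nex; apply: (Kf _ Kx); split => // U nU aeU.
    by apply: nex; exists U.
  exists (U, [set N' | [set y | ~ (Omega y -> U y -> f y = 0)] `<=` N']).
    split => //; exists [set y | ~ (Omega y -> U y -> f y = 0)] => //.
  move=> [y N'] /= [Uy NN'] Oy fy; apply: NN' => /= H.
  by move/eqP: fy; apply; exact: H.
move=> /(_ H) [N nN KN].
apply: negligibleS nN => x [Kx fx].
exact: (KN N (@subset_refl _ N) x Kx (KO _ Kx) fx).
Qed.

(** The region is a countable union of compact sets. *)
Lemma ess_supp_beyond (f : space -> R) (a : R) :
  (forall x, Omega x -> a < tortoise M x.1 -> ~ ess_supp M f x) ->
  mu2.-negligible [set x | [/\ Omega x, a < tortoise M x.1 & f x != 0]].
Proof.
move=> Hf.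
pose K (j : nat) : set space :=
  (`[2 * M + j.+1%:R^-1, j%:R] `&` [set r | 2 * M < r /\ a + j.+1%:R^-1 <= tortoise M r])
   `*` sphere n.
have js (j : nat) : 0 < j.+1%:R^-1 :> R by rewrite invr_gt0.
have tor_cont r : 2 * M < r -> {for r, continuous (tortoise M)}.
  by move=> hr; exact: is_derive_continuous (derive_tortoise M0 hr).
have cK j : compact (K j).
  apply: compact_setX; last exact: sphere_compact.
  pose e : R := 2 * M + j.+1%:R^-1.
  (* the tortoise coordinate is continuous beyond 2M only; replacing r by
     max(r, e) gives a function continuous everywhere *)
  have e2 r : 2 * M < e + ppos (r - e).
    by rewrite -[ltLHS]addr0 ltr_leD ?ppos_ge0// ltrDl.
  have -> : `[2 * M + j.+1%:R^-1, j%:R]%classic `&` [set r | 2 * M < r /\ a + j.+1%:R^-1 <= tortoise M r]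
     = `[e, j%:R]%classic `&` ((fun r => tortoise M (e + ppos (r - e))) @^-1` [set y | a + j.+1%:R^-1 <= y]).
    apply/seteqP; split => r /= []; rewrite in_itv/= => /andP[er rj].
      move=> [hr ar]; rewrite er rj; split => //.
      by rewrite ppos_id ?subr_ge0// addrCA subrr addr0.
    rewrite ppos_id ?subr_ge0// addrCA subrr addr0 => ar; rewrite er rj; split => //; split => //.
    by apply: lt_le_trans er; rewrite ltrDl.
  apply: (subclosed_compact _ (@segment_compact R e j%:R)); last by move=> r [].
  apply: closedI; first exact: itv_closed.
  apply: closed_comp; last exact: closed_ge.
  move=> r _; apply: (@continuous_comp R R R (fun r => e + ppos (r - e)) (tortoise M)).
    apply: (@continuousD R R R (cst e) (fun r => ppos (r - e))); first exact: cvg_cst.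
    apply: (@continuous_comp R R R (fun r => r - e) ppos); last exact: ppos_cont.
    by apply: (@continuousB R R R id (cst e)); [exact: cvg_id|exact: cvg_cst].
  exact: tor_cont.
have KO j x : K j x -> Omega x by move=> [[_ [hx _]] sx].
have nK j : mu2.-negligible (K j `&` [set x | f x != 0]).
  apply: ess_supp_compact => //; first exact: KO.
  move=> x Kx; apply: Hf; first exact: KO Kx.
  by case: Kx => [[_ [_ ax]] _]; apply: lt_le_trans ax; rewrite ltrDl.
apply: negligibleS (negligible_bigcup nK) => x [Ox ax fx].
have [j1 hj1] : exists j : nat, (tortoise M x.1 - a)^-1 < j%:R.
  by exists (Num.truncn (tortoise M x.1 - a)^-1).+1; exact: truncnS_gt.
have [j2 hj2] : exists j : nat, (x.1 - 2 * M)^-1 < j%:R.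
  by exists (Num.truncn (x.1 - 2 * M)^-1).+1; exact: truncnS_gt.
have [j3 hj3] : exists j : nat, x.1 < j%:R.
  by exists (Num.truncn x.1).+1; exact: truncnS_gt.
case: (Ox) => hx sx.
have inv_le (y : R) (i j : nat) : 0 < y -> y^-1 < i%:R -> (i <= j)%N -> j.+1%:R^-1 <= y.
  move=> y0 yi ij; rewrite -[leRHS]invrK lef_pV2 ?posrE ?invr_gt0//.
  by rewrite (le_trans (ltW yi))// ler_nat (leq_trans ij).
exists (j1 + j2 + j3)%N => //; split => //; split => //; split => //=.
  rewrite in_itv/=; apply/andP; split.
    rewrite -lerBrDl; apply: (inv_le _ j2) => //; first by rewrite subr_gt0.
    by rewrite -addnA addnCA leq_addr.
  by rewrite (le_trans (ltW hj3))// ler_nat leq_addl.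
split => //; rewrite -lerBrDl; apply: (inv_le _ j1) => //; first by rewrite subr_gt0.
by rewrite -addnA leq_addr.
Qed.

Lemma measurable_mu2_section (B : set spacetime) : measurable B ->
  measurable_fun setT (fun t => mu2 (xsection B t)).
Proof.
by move=> mB; exact: (measurable_fun_xsection (sprod lebesgue_R (sphere_measure n))).
Qed.

(** The support condition concerns the slices u(t, .) separately; by Fubini the
    exceptional sets of the slices together form a null set of spacetime. *)
Lemma slices_null (T : R) (u : spacetime -> R) (a : R -> R) :
  measurable (slab T `&` [set z | u z != 0 /\ a z.1 < tortoise M z.2.1]) ->
  (forall t, 0 < t < T -> forall x, Omega x -> a t < tortoise M x.1 ->
     ~ ess_supp M (fun x => u (t, x)) x) ->
  mu3 (slab T `&` [set z | u z != 0 /\ a z.1 < tortoise M z.2.1]) = 0%E.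
Proof.
set B := _ `&` _ => mB Hu.
have sec0 t : t != 0 -> mu2 (xsection B t) = 0%E.
  move=> t0; have [/andP[t1 t2]|nt] := boolP (0 < t < T); last first.
    rewrite (_ : xsection B t = set0) ?measure0//; apply/seteqP; split => // x.
    rewrite /xsection/= inE => -[[/andP[t1 t2] _] _].
    by move: nt; rewrite /= t2 lt_neqAle eq_sym t0 t1.
  have t12 : 0 < t < T by rewrite t1 t2.
  have nB := ess_supp_beyond (Hu t t12).
  apply/negligibleP; first exact: measurable_xsection.
  apply: negligibleS nB => x; rewrite /xsection/= inE => -[[_ /= Ox] [/= ux ax]].
  by split.
have -> : mu3 B = (\int[lebesgue_R]_t mu2 (xsection B t))%E by [].
rewrite (@ge0_negligible_integral _ _ _ _ setT [set 0 : R])//.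
- apply: integral0_eq => t [_ /= /eqP t0]; exact: sec0.
- exact: measurable_mu2_section.
- exact: (@lebesgue_measure_set1 R 0).
Qed.

End spacetime_measure.

(** * The weak formulation as an inequality *)

Lemma mulr3_ge0 (R : realFieldType) (a b c : R) : 0 <= a -> 0 <= b -> 0 <= c -> 0 <= a * b * c.
Proof. by move=> a0 b0 c0; rewrite mulr_ge0// mulr_ge0. Qed.

Section weak_inequality.
Context {R : realType} (n : nat) (M : R).
Hypothesis n3 : (3 <= n)%N.
Hypothesis M0 : 0 < M.
Local Notation F := (lapse M).
Local Notation flux := (flux n M).
Local Notation g := (delay n M).
Local Notation space := (R * 'rV[R]_n)%type.
Local Notation spacetime := (R * (R * 'rV[R]_n))%type.
Local Notation slab := (@slab R n M).
Local Notation Omega := (@Omega R n M).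
Local Notation mu2 := (@dr_dw R n).
Local Notation mu3 := (@dt_dr_dw R n).
Local Notation w := (wtime M).

Variables (D V : R -> R).
Hypothesis cD : forall r, 2 * M < r -> {for r, continuous D}.
Hypothesis cV : forall r, 2 * M < r -> {for r, continuous V}.
Hypothesis D0 : forall r, 2 * M < r -> 0 <= D r.

Variables (H H1 H2 xi xi1 xi2 : R -> R).
Hypothesis dH : forall w : R, is_derive w 1 H (H1 w).
Hypothesis dH1 : forall w : R, is_derive w 1 H1 (H2 w).
Hypothesis cH2 : forall w : R, {for w, continuous H2}.
Hypothesis dxi : forall r, 2 * M < r -> is_derive r 1 xi (xi1 r).
Hypothesis dxi1 : forall r, 2 * M < r -> is_derive r 1 xi1 (xi2 r).
Hypothesis cxi2 : forall r, 2 * M < r -> {for r, continuous xi2}.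
Hypothesis H_ge0 : forall w, 0 <= H w.
Hypothesis xi_ge0 : forall r, 2 * M < r -> 0 <= xi r.

Local Notation phi := (@radial_test R n M H xi).
Local Notation adj := (adjoint M H H1 H2 xi xi1 xi2 D V).

Lemma measurable_adjoint T : measurable_fun (slab T) adj.
Proof.
have cH : continuous H by move=> y; exact: is_derive_continuous (dH y).
have cH1 : continuous H1 by move=> y; exact: is_derive_continuous (dH1 y).
have mr (h : R -> R) : (forall r, 2 * M < r -> {for r, continuous h}) ->
    measurable_fun (slab T) (fun z : spacetime => h z.2.1) := @measurable_radial R n M T h.
have mw (h : R -> R) : continuous h -> measurable_fun (slab T) (fun z : spacetime => h (w z))
  := @measurable_fun_wtime R n M n3 M0 T h.
have mxi : measurable_fun (slab T) (fun z : spacetime => xi z.2.1).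
  by apply: mr => r hr; exact: is_derive_continuous (dxi hr).
have mxi1 : measurable_fun (slab T) (fun z : spacetime => xi1 z.2.1).
  by apply: mr => r hr; exact: is_derive_continuous (dxi1 hr).
have dfl r : 2 * M < r -> {for r, continuous flux}.
  by move=> hr; exact: is_derive_continuous (derive_flux n3 M0 hr).
have cb r : 2 * M < r -> {for r, continuous (wave_coef n M)}.
  move=> hr; have F0 := lapse_gt0 M0 hr.
  have dF := derive_lapse M0 hr; have df := derive_flux n3 M0 hr.
  suff [e de'] : exists e, is_derive r 1 (wave_coef n M) e by exact: is_derive_continuous de'.
  by rewrite /wave_coef; eexists; dtac; rewrite gt_eqF// mulr_gt0.
have cL r : 2 * M < r -> {for r, continuous (radial_laplace n M xi1 xi2)}.
  move=> hr; have r0 := gt2M_gt0 M0 hr.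
  have dF := derive_lapse M0 hr; have dx := derive_hratio M0 hr.
  apply: continuousD.
    by apply: continuousM; [exact: is_derive_continuous dF|exact: cxi2].
  have dx1 := dxi1 hr.
  suff [e de'] : exists e, is_derive r 1 (fun r => (hratio M r / r + n.-1%:R * F r / r) * xi1 r) e.
    exact: is_derive_continuous de'.
  by eexists; dtac; rewrite gt_eqF.
apply: measurable_funD; last first.
  apply: measurable_funM; first exact: mr.
  by apply: measurable_funM => //; exact: mw.
apply: measurable_funB; last first.
  apply: measurable_funM; first exact: mr.
  by apply: measurable_funM => //; exact: mw.
apply: measurable_funB; last first.
  by apply: measurable_funM; [exact: mw|exact: mr].
apply: measurable_funD; last first.
  apply: measurable_funM => //.
  apply: measurable_funM; last exact: mw.
  by apply: measurable_funM; [exact: measurable_cst|exact: mr].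
apply: measurable_funM => //.
by apply: measurable_funM; [exact: mr|exact: mw].
Qed.

Section solution.
Variables (p eps rho T T' r0 B Cphi : R) (u0 u1 : space -> R) (u : spacetime -> R).
Hypothesis usol : weak_solution M D V p u0 u1 eps T u.
Hypothesis usupp : forall t, 0 < t < T ->
  ess_supp M (fun x => u (t, x)) `<=` tortoise_ball M (t + rho).
Hypothesis T'T : T' < T.
Hypothesis hr0 : 2 * M < r0.
Hypothesis gr0 : T' < g r0.
Hypothesis H0 : forall w, T' <= w -> H w = 0.
Hypothesis xi0 : forall r, B <= r -> xi r = 0.
Hypothesis phi_le : forall z, slab T z -> phi z <= Cphi.

Let phi_ge0 z : slab T z -> 0 <= phi z.
Proof. by move=> [_ [hz _]]; rewrite mulr_ge0 ?xi_ge0. Qed.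

Let r_ge0 z k : slab T z -> 0 <= z.2.1 ^+ k.
Proof. by move=> [_ [hz _]]; rewrite exprn_ge0// ltW// (gt2M_gt0 M0 hz). Qed.

Let mr : measurable_fun (slab T) (fun z : spacetime => z.2.1 ^+ n.-1).
Proof. by apply: (@measurable_radial R n M T (fun r => r ^+ n.-1)) => r _; exact: exprn_continuous. Qed.

(** The test function is bounded and supported in a compact set, on which
    |u|^p is integrable. *)
Lemma source_finite :
  (\int[mu3]_(z in slab T) (`|u z| `^ p * phi z * z.2.1 ^+ n.-1)%:E < +oo)%E.
Proof.
set K := @test_support R n T' r0 B.
have KS : K `<=` slab T.
  move=> z [/=]; rewrite !in_itv/= => /andP[t0 tT'] [/andP[r0r rB] zS].
  by split; [rewrite t0 (le_lt_trans tT')|split => //; rewrite (lt_le_trans hr0)].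
have [_ /(_ K (@test_support_compact R n T' r0 B) KS) /integrableP[mK IK]] := usol.1.
have Cp0 : 0 <= Num.max 0 Cphi by rewrite le_max lexx.
apply: (@le_lt_trans _ _ (\int[mu3]_(z in K) ((Num.max 0 Cphi)%:E * `|(`|u z| `^ p * z.2.1 ^+ n.-1)%:E|))%E).
  rewrite integral_mkcond [leRHS]integral_mkcond; apply: le_integral_nomeas => z _.
    rewrite patchE; case: ifPn => //; rewrite inE => Sz.
    by rewrite lee_fin; apply: mulr3_ge0; rewrite ?powR_ge0 ?phi_ge0 ?r_ge0.
  rewrite !patchE; case: ifPn => [|]; last first.
    by move=> _; case: ifPn => // _; rewrite mule_ge0// lee_fin.
  rewrite inE => Sz; case: ifPn; rewrite ?inE ?notin_setE => Kz; last first.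
    by rewrite (radial_test_outside n3 M0 hr0 gr0 H0 xi0 Sz Kz) mulr0 mul0r.
  rewrite -EFinM lee_fin ger0_norm ?mulr_ge0 ?powR_ge0 ?r_ge0//.
  rewrite mulrAC mulrC ler_wpM2r ?mulr_ge0 ?powR_ge0 ?r_ge0//.
  by rewrite le_max phi_le// orbT.
rewrite ge0_integralZl_EFin//.
- by rewrite lte_mul_pinfty// lee_fin.
- apply: measurableX; first exact: measurable_itv.
  by apply: measurableX; [exact: measurable_itv|exact: measurable_sphere].
- exact: measurableT_comp.
Qed.

Definition data_term : R := \int[mu2]_(x in Omega)
   (((u1 x * phi (0, x) - u0 x * dt phi (0, x)) / lapse M x.1 +
     D x.1 * u0 x * phi (0, x)) * x.1 ^+ n.-1).

Let mu_slab : measurable_fun (slab T) u. Proof. exact: usol.1.1. Qed.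

Let mB : measurable (slab T `&` [set z | u z != 0 /\ z.1 + rho < tortoise M z.2.1]).
Proof.
have -> : slab T `&` [set z | u z != 0 /\ z.1 + rho < tortoise M z.2.1] =
  (slab T `&` u @^-1` (~` [set 0])) `&`
  (slab T `&` (fun z : spacetime => z.1 + rho < tortoise M z.2.1) @^-1` [set true]).
  apply/seteqP; split => z /=.
    by move=> [Sz [/eqP uz h]]; split; split.
  by move=> [[Sz /eqP uz] [_ h]]; split => //; split.
have mS := @measurable_slab R n M T.
apply: measurableI; first by apply: mu_slab => //; exact: measurableC.
have mt : measurable_fun (slab T) (fun z : spacetime => z.1 + rho < tortoise M z.2.1).
  apply: measurable_fun_ltr; last exact: measurable_slab_tortoise.
  by apply: measurable_funD; [exact: measurable_funTS|exact: measurable_cst].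
exact: mt.
Qed.

Let B_null : mu3 (slab T `&` [set z | u z != 0 /\ z.1 + rho < tortoise M z.2.1]) = 0%E.
Proof.
apply: (@slices_null R n M M0 T u (fun t => t + rho)) => // t tT x Ox tx.
move=> /(usupp tT)[_]; apply/negP; rewrite -ltNge.
exact: lt_le_trans tx (ler_norm _).
Qed.

(** The bound G on the adjoint is only needed inside the cone, because u
    vanishes almost everywhere outside it. *)
Lemma weak_inequality (G : spacetime -> R) :
  (forall z, slab T z -> 0 <= G z) ->
  (forall z, slab T z -> tortoise M z.2.1 <= z.1 + rho -> `|adj z| <= G z) ->
  (\int[mu3]_(z in slab T) (`|u z| `^ p * phi z * z.2.1 ^+ n.-1)%:E + (eps * data_term)%:E
   <= \int[mu3]_(z in slab T) (`|u z| * G z * z.2.1 ^+ n.-1)%:E)%E.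
Proof.
move=> G0 hG; have mS := @measurable_slab R n M T.
have tphi : test_function M T phi.
  exact: (radial_test_function n3 M0 dH dH1 cH2 dxi dxi1 cxi2 T'T hr0 gr0 H0 xi0).
have E := usol.2 phi tphi.
have A0 : (0 <= \int[mu3]_(z in slab T) (`|u z| `^ p * phi z * z.2.1 ^+ n.-1)%:E)%E.
  by apply: integral_ge0 => z Sz; rewrite lee_fin; apply: mulr3_ge0; rewrite ?powR_ge0 ?phi_ge0 ?r_ge0.
rewrite -[X in (X + _ <= _)%E]fineK; last by rewrite ge0_fin_numE// source_finite.
rewrite -EFinD -[X in (_ + eps * X)%:E]/data_term.
have {}E : fine (\int[mu3]_(z in slab T) (`|u z| `^ p * phi z * z.2.1 ^+ n.-1)%:E) + eps * data_term
   = \int[mu3]_(z in slab T) (u z * adj z * z.2.1 ^+ n.-1).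
  apply: etrans E _; apply: eq_Rintegral => z; rewrite inE => -[_ [hz _]].
  by rewrite (@adjointE R n M n3 M0 H H1 H2 xi xi1 xi2 dH dH1 dxi dxi1 D V z hz).
rewrite E.
have mf : measurable_fun (slab T) (fun z => u z * adj z * z.2.1 ^+ n.-1).
  apply: measurable_funM => //; apply: measurable_funM => //; exact: measurable_adjoint.
apply: (le_trans (le_abs_Rintegral mu3 mS mf)).
rewrite (ge0_negligible_integral mB mS _ _ B_null)//; last first.
  by apply/measurable_EFinP; exact: measurableT_comp.
set N := (X in slab T `\` X).
apply: (@le_trans _ _ (\int[mu3]_(z in slab T `\` N) (`|u z| * G z * z.2.1 ^+ n.-1)%:E)%E).
  apply: le_integral_nomeas => // z [Sz nz]; rewrite lee_fin.
  rewrite !normrM (ger0_norm (r_ge0 _ Sz)) ler_wpM2r ?r_ge0//.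
  have [uz|uz] := eqVneq (u z) 0; first by rewrite uz normr0 !mul0r.
  rewrite ler_wpM2l//; apply: hG => //; rewrite leNgt; apply/negP => h.
  by apply: nz; split.
apply: subset_integral_nomeas => z; first by case.
by move=> Sz; rewrite lee_fin; apply: mulr3_ge0; rewrite ?G0 ?r_ge0.
Qed.

Hypothesis u0_ge0 : ae_Omega M (fun x => 0 <= u0 x).
Hypothesis u1_ge0 : ae_Omega M (fun x => 0 <= u1 x).
Hypothesis u0_L1 : L1loc_Omega M u0.
Hypothesis u1_L1 : L1loc_Omega M u1.
Hypothesis H1_le0 : forall w, H1 w <= 0.

Let df (x : space) : R := ((u1 x * phi (0, x) - u0 x * dt phi (0, x)) / lapse M x.1 +
     D x.1 * u0 x * phi (0, x)) * x.1 ^+ n.-1.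

Let phi0E (x : space) : phi (0, x) = H (g x.1) * xi x.1.
Proof. by rewrite /radial_test /wtime/= add0r. Qed.

Let dtphi0E (x : space) : dt phi (0, x) = H1 (g x.1) * xi x.1.
Proof. by rewrite (dt_radial_test M xi dH) /wtime/= add0r. Qed.

Let mOm : measurable Omega. Proof. exact: measurable_Omega. Qed.

Let mdf : measurable_fun Omega df.
Proof.
have mg h : continuous h -> measurable_fun Omega (fun x : space => h (g x.1) : R).
  move=> ch; apply: (measurableT_comp (f := h)); first exact: continuous_measurable_fun.
  apply: (@measurable_radial_space R n M g) => r hr.
  exact: is_derive_continuous (derive_delay n3 M0 hr).
have mrs (h : R -> R) : (forall r, 2 * M < r -> {for r, continuous h}) ->
  measurable_fun Omega (fun x : space => h x.1) := @measurable_radial_space R n M h.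
have mxi : measurable_fun Omega (fun x : space => xi x.1).
  by apply: mrs => r hr; exact: is_derive_continuous (dxi hr).
have mphi : measurable_fun Omega (fun x : space => phi (0, x)).
  apply: (@eq_measurable_fun _ _ _ _ _ (fun x : space => H (g x.1) * xi x.1)).
    by move=> x _; rewrite phi0E.
  by apply: measurable_funM => //; apply: mg => y; exact: is_derive_continuous (dH y).
have mdtphi : measurable_fun Omega (fun x : space => dt phi (0, x)).
  apply: (@eq_measurable_fun _ _ _ _ _ (fun x : space => H1 (g x.1) * xi x.1)).
    by move=> x _; rewrite dtphi0E.
  by apply: measurable_funM => //; apply: mg => y; exact: is_derive_continuous (dH1 y).
have [mu0 _] := u0_L1; have [mu1 _] := u1_L1.
apply: measurable_funM; last by apply: (mrs (fun r => r ^+ n.-1)) => r _; exact: exprn_continuous.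
apply: measurable_funD.
  apply: measurable_funM.
    by apply: measurable_funB; exact: measurable_funM.
  apply: (mrs (fun r => (F r)^-1)) => r hr; have dF := derive_lapse M0 hr.
  suff [e de'] : exists e, is_derive r 1 (fun r => (F r)^-1) e by exact: is_derive_continuous de'.
  by eexists; dtac; rewrite gt_eqF// lapse_gt0.
apply: measurable_funM => //; apply: measurable_funM => //; exact: mrs.
Qed.

Let df_ge0 x : Omega x -> 0 <= u0 x -> 0 <= u1 x ->
  u1 x * phi (0, x) * x.1 ^+ n.-1 <= df x /\ 0 <= df x.
Proof.
move=> [hx _] u0x u1x; have F0 := lapse_gt0 M0 hx.
have ph0 : 0 <= phi (0, x) by rewrite phi0E mulr_ge0 ?xi_ge0.
have dph0 : dt phi (0, x) <= 0 by rewrite dtphi0E mulr_le0_ge0 ?xi_ge0.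
have x0 : 0 <= x.1 ^+ n.-1 by rewrite exprn_ge0// ltW// (gt2M_gt0 M0 hx).
have a0 : 0 <= u1 x * phi (0, x) by rewrite mulr_ge0.
have le1 : u1 x * phi (0, x) * x.1 ^+ n.-1 <= df x.
  rewrite /df ler_wpM2r//.
  apply: (@le_trans _ _ (u1 x * phi (0, x) / F x.1)).
    by rewrite ler_pdivlMr// ler_piMr// ltW// lapse_lt1.
  rewrite -[leLHS]addr0 lerD//; last by apply: mulr3_ge0 => //; exact: D0.
  by rewrite ler_wpM2r ?invr_ge0 ?(ltW F0)// lerDl oppr_ge0 mulr_ge0_le0.
by split => //; apply: le_trans le1; rewrite mulr_ge0.
Qed.

Let df_ae : ae_eq mu2 Omega (fun x => (df x)%:E) (fun x => `|df x|%:E).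
Proof.
move: u0_ge0 u1_ge0; rewrite /ae_Omega.
apply: (@filterS2 _ _ (ae_filter_ringOfSetsType mu2)) => x u0x u1x Ox /=.
by rewrite ger0_norm//; case: (df_ge0 Ox (u0x Ox) (u1x Ox)).
Qed.

Let int_df : (\int[mu2]_(x in Omega) (df x)%:E = \int[mu2]_(x in Omega) `|df x|%:E)%E.
Proof.
apply: ae_eq_integral => //; first exact/measurable_EFinP.
by apply/measurable_EFinP; exact: measurableT_comp.
Qed.

(** H1 <= 0, so all three contributions of the nonnegative data to the initial
    term are nonnegative. *)
Lemma data_term_ge0 : 0 <= data_term.
Proof.
rewrite /data_term /Rintegral -/df int_df; apply: fine_ge0.
by apply: integral_ge0 => x _; rewrite lee_fin.
Qed.

Hypothesis H10 : forall w, T' <= w -> H1 w = 0.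

Let shell (a b : R) : set space := `[a, b]%classic `*` sphere n.

Let m_shell a b : measurable (shell a b).
Proof. by apply: measurableX; [exact: measurable_itv|exact: measurable_sphere]. Qed.

Let c_shell a b : compact (shell a b).
Proof. by apply: compact_setX; [exact: segment_compact|exact: sphere_compact]. Qed.

Let shell_Omega a b : 2 * M < a -> shell a b `<=` Omega.
Proof.
by move=> ha x [/=]; rewrite in_itv/= => /andP[ax _] sx; split => //; exact: lt_le_trans ax.
Qed.

Let bounded_shell (h : R -> R) a b : 2 * M < a ->
  (forall r, 2 * M < r -> {for r, continuous h}) ->
  exists2 C, 0 <= C & forall r, a <= r <= b -> `|h r| <= C.
Proof.
move=> ha ch; have [ab|ba] := leP a b; last first.
  exists 0 => // r /andP[ar rb]; have := le_trans ar rb.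
  by rewrite leNgt ba.
have cn : {within `[a, b], continuous (fun r => `|h r|)}.
  apply: continuous_in_subspaceT => r; rewrite inE/= in_itv/= => /andP[ar _].
  apply: (@continuous_comp R R R h Num.norm); last exact: norm_continuous.
  by apply: ch; exact: lt_le_trans ar.
have [c cab hc] := EVT_max ab cn.
by exists `|h c| => // r rab; apply: hc; rewrite in_itv.
Qed.

Let coef1 r : R := H (g r) * xi r / F r.
Let coef0 r : R := - (H1 (g r) * xi r) / F r + D r * (H (g r) * xi r).

Let dfE x : df x = (u1 x * coef1 x.1 + u0 x * coef0 x.1) * x.1 ^+ n.-1.
Proof.
rewrite /df phi0E dtphi0E /coef1 /coef0; move: (F x.1)^-1 => f; ring.
Qed.

Let df_finite : (\int[mu2]_(x in Omega) `|df x|%:E < +oo)%E.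
Proof.
have cg r : 2 * M < r -> {for r, continuous g}.
  by move=> hr; exact: is_derive_continuous (derive_delay n3 M0 hr).
have cF r : 2 * M < r -> {for r, continuous (fun r => (F r)^-1)}.
  move=> hr; have dF := derive_lapse M0 hr.
  suff [e de'] : exists e, is_derive r 1 (fun r => (F r)^-1) e by exact: is_derive_continuous de'.
  by eexists; dtac; rewrite gt_eqF// lapse_gt0.
have cxi r : 2 * M < r -> {for r, continuous xi}.
  by move=> hr; exact: is_derive_continuous (dxi hr).
have cHg r : 2 * M < r -> {for r, continuous (fun r => H (g r))}.
  move=> hr; apply: (@continuous_comp R R R g H); first exact: cg.
  exact: is_derive_continuous (dH (g r)).
have cH1g r : 2 * M < r -> {for r, continuous (fun r => H1 (g r))}.
  move=> hr; apply: (@continuous_comp R R R g H1); first exact: cg.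
  exact: is_derive_continuous (dH1 (g r)).
have [C1 C10 hC1] : exists2 C, 0 <= C & forall r, r0 <= r <= B -> `|coef1 r| <= C.
  apply: bounded_shell => // r hr; apply: continuousM; last exact: cF.
  by apply: continuousM; [exact: cHg|exact: cxi].
have [C2 C20 hC2] : exists2 C, 0 <= C & forall r, r0 <= r <= B -> `|coef0 r| <= C.
  apply: bounded_shell => // r hr; apply: continuousD.
    apply: continuousM; last exact: cF.
    apply: (@continuousN R R R (fun r => H1 (g r) * xi r)).
    by apply: continuousM; [exact: cH1g|exact: cxi].
  apply: continuousM; first exact: cD.
  by apply: continuousM; [exact: cHg|exact: cxi].
have out x : Omega x -> ~ shell r0 B x -> df x = 0.
  move=> [hx sx] nx; rewrite dfE.
  have [rB|Br] := ltP x.1 B; last by rewrite /coef1 /coef0 xi0// !(mulr0, mul0r, oppr0, addr0).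
  have [r0x|xr0] := leP r0 x.1.
    by case: nx; split => //=; rewrite in_itv/= r0x ltW.
  have Tg : T' <= g x.1 by rewrite (le_trans (ltW gr0))// delay_anti// ltW.
  by rewrite /coef1 /coef0 H0// H10// !(mulr0, mul0r, oppr0, addr0).
have [_ /(_ _ (@c_shell r0 B) (shell_Omega hr0)) /integrableP[m0 I0]] := u0_L1.
have [_ /(_ _ (@c_shell r0 B) (shell_Omega hr0)) /integrableP[m1 I1]] := u1_L1.
apply: (@le_lt_trans _ _ (\int[mu2]_(x in shell r0 B)
   (C1%:E * `|(u1 x * x.1 ^+ n.-1)%:E| + C2%:E * `|(u0 x * x.1 ^+ n.-1)%:E|))%E).
  rewrite integral_mkcond [leRHS]integral_mkcond; apply: le_integral_nomeas => x _.
    by rewrite patchE; case: ifPn => // _; rewrite lee_fin.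
  rewrite !patchE; case: ifPn => [|]; last first.
    by move=> _; case: ifPn => // _; rewrite adde_ge0// mule_ge0// lee_fin.
  rewrite inE => Ox; case: ifPn; rewrite ?inE ?notin_setE => Kx; last first.
    by rewrite (out _ Ox Kx) normr0.
  rewrite -!EFinM -EFinD lee_fin dfE mulrDl.
  have xK : r0 <= x.1 <= B by case: Kx => /=; rewrite in_itv.
  apply: le_trans (ler_normD _ _) _; apply: lerD.
    by rewrite mulrAC normrM mulrC ler_wpM2r// hC1.
  by rewrite mulrAC normrM mulrC ler_wpM2r// hC2.
have mm0 := measurableT_comp (@abse_measurable R setT) m0.
have mm1 := measurableT_comp (@abse_measurable R setT) m1.
rewrite ge0_integralD//; last 4 first.
- by move=> x _; rewrite mule_ge0// lee_fin.
- exact: emeasurable_funM.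
- by move=> x _; rewrite mule_ge0// lee_fin.
- exact: emeasurable_funM.
rewrite !ge0_integralZl_EFin//.
by rewrite lte_add_pinfty// lte_mul_pinfty// lee_fin.
Qed.

(** Only the contribution of u1 on a shell is kept, and 1/F >= 1 is used. *)
Lemma data_term_ge a b e : 2 * M < a -> 0 <= e ->
  (forall r, a <= r <= b -> e <= H (g r) * xi r) ->
  e * fine (\int[mu2]_(x in `[a, b]%classic `*` sphere n) `|u1 x * x.1 ^+ n.-1|%:E)%E <= data_term.
Proof.
move=> ha e0 he; rewrite /data_term /Rintegral -/df int_df.
have [_ /(_ _ (@c_shell a b) (shell_Omega ha)) /integrableP[m1 I1]] := u1_L1.
have If : (\int[mu2]_(x in shell a b) `|u1 x * x.1 ^+ n.-1|%:E < +oo)%E by exact: I1.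
have I0 : (0 <= \int[mu2]_(x in shell a b) `|u1 x * x.1 ^+ n.-1|%:E)%E.
  by apply: integral_ge0 => x _; rewrite lee_fin.
rewrite -lee_fin EFinM fineK; last by rewrite ge0_fin_numE.
rewrite fineK; last by rewrite ge0_fin_numE ?df_finite//; apply: integral_ge0 => x _; rewrite lee_fin.
have mm1 := measurableT_comp (@abse_measurable R setT) m1.
rewrite -(@ge0_integralZl_EFin _ _ _ mu2 (shell a b) (m_shell a b) (fun x => `|u1 x * x.1 ^+ n.-1|%:E))//.
have [N [mN N0 hN]] : mu2.-negligible (~` [set x | Omega x -> 0 <= u0 x /\ 0 <= u1 x]).
  have : {ae mu2, forall x, Omega x -> 0 <= u0 x /\ 0 <= u1 x}.
    move: u0_ge0 u1_ge0; rewrite /ae_Omega.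
    apply: (@filterS2 _ _ (ae_filter_ringOfSetsType mu2)) => x u0x u1x Ox.
    by split; [exact: u0x|exact: u1x].
  by [].
rewrite (ge0_negligible_integral mN (m_shell a b) _ _ N0)//; last 2 first.
- by apply: emeasurable_funM => //; exact: measurable_cst.
- by move=> x _; rewrite mule_ge0// lee_fin.
rewrite (ge0_negligible_integral mN mOm _ _ N0)//; last first.
  by apply/measurable_EFinP; exact: measurableT_comp.
rewrite integral_mkcond [leRHS]integral_mkcond; apply: le_integral_nomeas => x _.
  by rewrite patchE; case: ifPn => // _; rewrite mule_ge0// lee_fin.
rewrite !patchE; case: ifPn; rewrite ?inE ?notin_setE => Kx; last first.
  by case: ifPn => // _; rewrite lee_fin.
have Ox : Omega x by have [Kx' _] := Kx; exact: (shell_Omega ha Kx').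
rewrite ifT; last by rewrite inE; split => //; case: Kx.
have [u0x u1x] : 0 <= u0 x /\ 0 <= u1 x.
  apply: contrapT => h; case: Kx => _; apply; apply: hN => /=.
  by move=> /(_ Ox).
have [d1 d2] := df_ge0 Ox u0x u1x.
have x0 : 0 <= x.1 ^+ n.-1 by rewrite exprn_ge0// ltW// (gt2M_gt0 M0 Ox.1).
rewrite -EFinM lee_fin (ger0_norm d2); apply: le_trans d1.
rewrite ger0_norm ?mulr_ge0// mulrA ler_wpM2r// mulrC ler_wpM2l// phi0E.
by apply: he; case: Kx => -[/=]; rewrite in_itv.
Qed.

End solution.

(** A function that is not almost everywhere zero on Omega has positive mass on
    one of the countably many compact shells exhausting Omega. *)
Lemma data_shell (v : space -> R) : L1loc_Omega M v -> ~ ae_Omega M (fun x => v x = 0) ->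
  exists a b, [/\ 2 * M < a, a <= b &
   0 < fine (\int[mu2]_(x in `[a, b]%classic `*` sphere n) `|v x * x.1 ^+ n.-1|%:E)%E].
Proof.
move=> [mv Iv] nv; apply: contrapT => nex; apply: nv.
pose a (j : nat) : R := 2 * M + j.+1%:R^-1.
pose b (j : nat) : R := 2 * M + 1 + j%:R.
have ha j : 2 * M < a j by rewrite ltrDl invr_gt0.
have ab j : a j <= b j.
  rewrite /a /b -addrA lerD2l (@le_trans _ _ 1)// ?lerDl//.
  by rewrite invf_le1 ?ler1n.
pose K j : set space := `[a j, b j]%classic `*` sphere n.
have mK j : measurable (K j).
  by apply: measurableX; [exact: measurable_itv|exact: measurable_sphere].
have KO j : K j `<=` Omega.
  by move=> x [/=]; rewrite in_itv/= => /andP[ax _] sx; split => //; exact: lt_le_trans ax.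
have K0 j : mu2.-negligible (K j `&` [set x | v x != 0]).
  have cK : compact (K j).
    by apply: compact_setX; [exact: segment_compact|exact: sphere_compact].
  have IK := Iv _ cK (KO j).
  have /integrableP[mI II] := IK.
  have Ifin : (\int[mu2]_(x in K j) `|v x * x.1 ^+ n.-1|%:E)%E \is a fin_num.
    by rewrite ge0_fin_numE; [exact: II|apply: integral_ge0 => x _; rewrite lee_fin].
  have I0 : (\int[mu2]_(x in K j) `|v x * x.1 ^+ n.-1|%:E = 0)%E.
    apply/eqP; rewrite -(fineK Ifin) eqe eq_le; apply/andP; split.
      rewrite leNgt; apply/negP => h; apply: nex.
      by exists (a j), (b j); split.
    by apply: fine_ge0; apply: integral_ge0 => x _; rewrite lee_fin.
  have [N [mN N0 hN]] : ae_eq mu2 (K j) (fun x => (v x * x.1 ^+ n.-1)%:E) (cst 0%E).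
    by apply/(ae_eq_integral_abs mu2 (mK j) mI); exact: I0.
  exists N; split => // x [Kx /eqP vx]; apply: hN => /= h.
  have := h Kx => -[] /eqP; rewrite mulf_eq0 expf_eq0 => /orP[/eqP//|/andP[_ /eqP x0]].
  have [hx _] := KO _ _ Kx; have := gt2M_gt0 M0 hx; by rewrite x0 ltxx.
rewrite /ae_Omega; apply: negligibleS (negligible_bigcup K0) => x /= nx.
have Ox : Omega x by apply: contrapT => nO; apply: nx => /nO.
have vx : v x != 0 by apply/eqP => vx; apply: nx.
have [hx sx] := Ox.
have [j1 hj1] : exists j : nat, (x.1 - 2 * M)^-1 < j%:R.
  by exists (Num.truncn (x.1 - 2 * M)^-1).+1; exact: truncnS_gt.
have [j2 hj2] : exists j : nat, x.1 < j%:R.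
  by exists (Num.truncn x.1).+1; exact: truncnS_gt.
exists (j1 + j2)%N => //; split => //; split => //=; rewrite in_itv/=; apply/andP; split.
  rewrite /a -lerBrDl -[leRHS]invrK lef_pV2 ?posrE ?invr_gt0 ?subr_gt0//.
  by rewrite (le_trans (ltW hj1))// ler_nat (leq_trans (leq_addr j2 j1)).
rewrite /b (le_trans (ltW hj2))//.
apply: (@le_trans _ _ (j1 + j2)%:R); first by rewrite ler_nat leq_addl.
by rewrite lerDr addr_ge0// mulr_ge0// ltW.
Qed.

End weak_inequality.

(** * Truncated modes and the key inequality *)

Section exponential_cutoff.
Context {R : realType} (N : nat) (lam T : R).
Hypothesis N3 : (3 <= N)%N.
Hypothesis T_gt0 : 0 < T.
Hypothesis lam_ge0 : 0 <= lam.

(** The time factor of the test function: the cutoff of w/T times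
    exp(- lambda w); expcut1 and expcut2 are its derivatives. *)
Definition expcut (w : R) : R := cutoff N (w / T) * expR (- (lam * w)).
Definition expcut1 (w : R) : R :=
  (cutoff1 N (w / T) / T - lam * cutoff N (w / T)) * expR (- (lam * w)).
Definition expcut2 (w : R) : R :=
  (cutoff2 N (w / T) / T ^+ 2 - 2 * lam * cutoff1 N (w / T) / T
   + lam ^+ 2 * cutoff N (w / T)) * expR (- (lam * w)).

Let dscale (w : R) : is_derive w 1 (fun y => y / T) T^-1.
Proof. by derive_eq; [dtac|rewrite mul1r mulr0 addr0]. Qed.

Let dc (w : R) : is_derive w 1 (fun y => cutoff N (y / T)) (cutoff1 N (w / T) / T).
Proof.
have D := derive_cutoff (w / T) N3; have Ds := dscale w.
by notypeclasses refine (@derive_compP _ (cutoff N) (fun y => y / T) _ _ _ D Ds).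
Qed.

Let dc1 (w : R) : is_derive w 1 (fun y => cutoff1 N (y / T)) (cutoff2 N (w / T) / T).
Proof.
have D := derive_cutoff1 (w / T) N3; have Ds := dscale w.
by notypeclasses refine (@derive_compP _ (cutoff1 N) (fun y => y / T) _ _ _ D Ds).
Qed.

Lemma derive_expcut (w : R) : is_derive w 1 expcut (expcut1 w).
Proof.
have D := dc w; rewrite /expcut; derive_eq.
  by notypeclasses refine (derive_mulP D _); dtac.
rewrite /expcut1; ring.
Qed.

Lemma derive_expcut1 (w : R) : is_derive w 1 expcut1 (expcut2 w).
Proof.
have D := dc w; have D1 := dc1 w; rewrite /expcut1; derive_eq.
  notypeclasses refine (derive_mulP _ _); last by dtac.
  notypeclasses refine (derive_addP _ _).
    by notypeclasses refine (derive_mulP D1 (derive_cstP _ _)).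
  notypeclasses refine (derive_oppP _).
  by notypeclasses refine (derive_mulP (derive_cstP _ _) D).
rewrite /expcut2; field; by rewrite gt_eqF.
Qed.

Lemma expcut2_cont (w : R) : {for w, continuous expcut2}.
Proof.
have D := dc w; have D1 := dc1 w.
apply: continuousM; last first.
  suff [e de] : exists e, is_derive w 1 (fun y => expR (- (lam * y))) e by exact: is_derive_continuous de.
  by eexists; dtac.
apply: continuousD; last first.
  by apply: continuousM; [exact: cvg_cst|exact: is_derive_continuous D].
apply: continuousB; last first.
  apply: continuousM; last exact: cvg_cst.
  by apply: continuousM; [exact: cvg_cst|exact: is_derive_continuous D1].
apply: continuousM; last exact: cvg_cst.
apply: (@continuous_comp R R R (fun y => y / T) (cutoff2 N)); last exact: cutoff2_cont.
exact: is_derive_continuous (dscale w).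
Qed.

Lemma expcut_ge0 w : 0 <= expcut w.
Proof. by rewrite mulr_ge0 ?cutoff_ge0 ?expR_ge0. Qed.

Lemma expcut_le w : expcut w <= expR (- (lam * w)).
Proof. by rewrite ler_piMl ?expR_ge0 ?cutoff_le1. Qed.

Lemma expcut1_le0 w : expcut1 w <= 0.
Proof.
rewrite /expcut1 mulr_le0_ge0 ?expR_ge0// subr_le0 (@le_trans _ _ 0)//.
  by rewrite mulr_le0_ge0 ?cutoff1_le0// invr_ge0 ltW.
by rewrite mulr_ge0 ?cutoff_ge0.
Qed.

Lemma cutoff_right x : 1 <= x ->
  [/\ cutoff N x = 0, cutoff1 N x = 0 & cutoff2 N x = 0 :> R].
Proof.
move=> /cutbase_right x0; rewrite /cutoff /cutoff1 /cutoff2 x0 !expr0n.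
by case: N N3 => [//|[//|[//|m]]] _ /=; split; rewrite ?mulr0 ?mul0r ?subr0.
Qed.

Lemma cutoff_left x : x <= 2^-1 ->
  [/\ cutoff N x = 1, cutoff1 N x = 0 & cutoff2 N x = 0 :> R].
Proof.
move=> x0; have p0 : ppos (2 * x - 1) = 0 by rewrite ppos_0//; lra.
rewrite /cutoff (cutbase_left x0) expr1n /cutoff1 /cutoff2 p0 expr0n/=.
by split; rewrite ?(mulr0, mul0r, oppr0, expr0n, subr0).
Qed.

Lemma expcut_right w : T <= w -> [/\ expcut w = 0, expcut1 w = 0 & expcut2 w = 0].
Proof.
move=> Tw; have w1 : 1 <= w / T by rewrite ler_pdivlMr// mul1r.
rewrite /expcut /expcut1 /expcut2; have [-> -> ->] := cutoff_right w1.
by split; rewrite ?(mulr0, mul0r, subr0, addr0).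
Qed.

End exponential_cutoff.

Section radial_cutoff.
Context {R : realType} (M A : R) (z z1 z2 : R -> R).
Hypothesis A_gt0 : 0 < A.
Hypothesis dz : forall r, 2 * M < r -> is_derive r 1 z (z1 r).
Hypothesis dz1 : forall r, 2 * M < r -> is_derive r 1 z1 (z2 r).
Hypothesis cz2 : forall r, 2 * M < r -> {for r, continuous z2}.

Local Notation c := (fun r => cutoff 3 (r / (2 * A))).
Local Notation c1 := (fun r => cutoff1 3 (r / (2 * A)) / (2 * A)).
Local Notation c2 := (fun r => cutoff2 3 (r / (2 * A)) / (2 * A) / (2 * A)).

(** A radial cutoff at distance A makes the support compact. It is 1 on the part
    of the cone where the time factor does not vanish, so it leaves no trace in
    the estimates. *)
Definition radcut (r : R) : R := z r * c r.
Definition radcut1 (r : R) : R := z1 r * c r + z r * c1 r.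
Definition radcut2 (r : R) : R := z2 r * c r + 2 * (z1 r * c1 r) + z r * c2 r.

Let dscale (w : R) : is_derive w 1 (fun y => y / (2 * A)) (2 * A)^-1.
Proof. by derive_eq; [dtac|rewrite mul1r mulr0 addr0]. Qed.

Let dc (w : R) : is_derive w 1 c (c1 w).
Proof.
have D := derive_cutoff (w / (2 * A)) (leqnn 3); have Ds := dscale w.
by notypeclasses refine (@derive_compP _ (cutoff 3) (fun y => y / (2 * A)) _ _ _ D Ds).
Qed.

Let dc1 (w : R) : is_derive w 1 c1 (c2 w).
Proof.
have D := derive_cutoff1 (w / (2 * A)) (leqnn 3); have Ds := dscale w.
have D1 : is_derive w 1 (fun y => cutoff1 3 (y / (2 * A))) (cutoff2 3 (w / (2 * A)) / (2 * A)).
  by notypeclasses refine (@derive_compP _ (cutoff1 3) (fun y => y / (2 * A)) _ _ _ D Ds).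
derive_eq; first by notypeclasses refine (derive_mulP D1 (derive_cstP _ _)).
by rewrite mulr0 addr0.
Qed.

Lemma derive_radcut (r : R) : 2 * M < r -> is_derive r 1 radcut (radcut1 r).
Proof. by move=> hr; notypeclasses refine (derive_mulP (dz hr) (dc r)). Qed.

Lemma derive_radcut1 (r : R) : 2 * M < r -> is_derive r 1 radcut1 (radcut2 r).
Proof.
move=> hr; rewrite /radcut1; derive_eq.
  notypeclasses refine (derive_addP _ _).
    by notypeclasses refine (derive_mulP (dz1 hr) (dc r)).
  by notypeclasses refine (derive_mulP (dz hr) (dc1 r)).
rewrite /radcut2 /=; ring.
Qed.

Lemma radcut2_cont (r : R) : 2 * M < r -> {for r, continuous radcut2}.
Proof.
move=> hr.
apply: continuousD.
  apply: continuousD.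
    by apply: continuousM; [exact: cz2|exact: is_derive_continuous (dc r)].
  apply: continuousM; first exact: cvg_cst.
  by apply: continuousM; [exact: is_derive_continuous (dz1 hr)|exact: is_derive_continuous (dc1 r)].
apply: continuousM; first exact: is_derive_continuous (dz hr).
apply: continuousM; last exact: cvg_cst.
apply: continuousM; last exact: cvg_cst.
apply: (@continuous_comp R R R (fun y => y / (2 * A)) (cutoff2 3)); last exact: cutoff2_cont.
exact: is_derive_continuous (dscale r).
Qed.

Lemma radcut_inside r : r <= A -> [/\ radcut r = z r, radcut1 r = z1 r & radcut2 r = z2 r].
Proof.
move=> rA; have h : r / (2 * A) <= 2^-1.
  by rewrite ler_pdivrMr ?mulr_gt0// mulrA mulVf// mul1r.
rewrite /radcut /radcut1 /radcut2; have [-> -> ->] := cutoff_left 3 h.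
by split; rewrite ?(mulr1, mulr0, mul0r, addr0).
Qed.

Lemma radcut_outside r : 2 * A <= r -> radcut r = 0.
Proof.
move=> Ar; have h : 1 <= r / (2 * A) by rewrite ler_pdivlMr ?mulr_gt0// mul1r.
by rewrite /radcut; have [-> _ _] := cutoff_right (leqnn 3) h; rewrite mulr0.
Qed.

Lemma radcut_ge0 r : 0 <= z r -> 0 <= radcut r.
Proof. by move=> z0; rewrite mulr_ge0 ?cutoff_ge0. Qed.

Lemma radcut_le r : 0 <= z r -> radcut r <= z r.
Proof. by move=> z0; rewrite ler_piMr ?cutoff_le1. Qed.

End radial_cutoff.

Section key_inequality.
Context {R : realType} (n : nat) (M mu d : R) (D V : R -> R).
Hypothesis n3 : (3 <= n)%N.
Hypothesis M0 : 0 < M.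
Hypothesis mu0 : 0 <= mu.
Hypothesis d0 : 0 < d.
Hypothesis d1 : d <= 2^-1.
Hypothesis cD : forall r, 2 * M < r -> {for r, continuous D}.
Hypothesis cV : forall r, 2 * M < r -> {for r, continuous V}.
Hypothesis D_bnd : forall r, 2 * M < r -> 0 <= D r <= mu * (r `^ (- d) / r).
Hypothesis V_bnd : forall r, 2 * M < r -> 0 <= V r <= mu * (r `^ (- d) / r ^+ 2).
Local Notation F := (lapse M).
Local Notation flux := (flux n M).
Local Notation g := (delay n M).
Local Notation sigma := (sigma n M).
Local Notation k := (half_dim n).
Local Notation space := (R * 'rV[R]_n)%type.
Local Notation spacetime := (R * (R * 'rV[R]_n))%type.
Local Notation slab := (@slab R n M).
Local Notation mu2 := (@dr_dw R n).
Local Notation mu3 := (@dt_dr_dw R n).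
Local Notation w := (wtime M).

(** The region that carries the solution, by the support condition. *)
Definition cone (rho T : R) : set spacetime :=
  slab T `&` [set x | tortoise M x.2.1 <= x.1 + rho].

Definition window (T : R) : set spacetime := [set x | T / 2 <= w x < T].

Definition mode (zf : R -> R -> R) (lam : R) (x : spacetime) : R :=
  expR (- (lam * w x)) * zf lam x.2.1.

Lemma wtime_ge T x : slab T x -> x.1 <= w x.
Proof. by move=> [_ [hx _]]; rewrite lerDl delay_ge0. Qed.

Lemma wtime_ge0 T x : slab T x -> 0 <= w x.
Proof. by move=> Sx; apply: le_trans (wtime_ge Sx); case: Sx => /andP[]. Qed.

Lemma cone_sigma rho T x : cone rho T x -> sigma x.2.1 <= w x + rho.
Proof.
move=> [_ h]; have {}h : tortoise M x.2.1 <= x.1 + rho by [].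
by rewrite /sigma /wtime -[leRHS]addrAC lerD2r.
Qed.

Definition cone_shift (rho : R) : R := rho - 2 * M * ln (2 * M).

(** On the cone w - sigma is bounded below, and sigma is at least r up to a
    constant. Hence the cone up to w = T lies in r <= T + const. *)
Lemma cone_radius rho T x : cone rho T x -> x.2.1 <= w x + cone_shift rho.
Proof.
move=> Cx; have := cone_sigma Cx; case: Cx => -[_ [hx _]] _ h.
by have := sigma_ge n M0 hx; rewrite /cone_shift; lra.
Qed.

(** The conclusions of radial_family with the solutions chosen as functions of
    lambda. *)
Record radial_modes (Cz : R) (zf z1 z2 : R -> R -> R) : Prop := RadialModes {
  rm_dz : forall lam r, 0 <= lam <= 1 -> 2 * M < r -> is_derive r 1 (zf lam) (z1 lam r);
  rm_dz1 : forall lam r, 0 <= lam <= 1 -> 2 * M < r -> is_derive r 1 (z1 lam) (z2 lam r);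
  rm_cz2 : forall lam r, 0 <= lam <= 1 -> 2 * M < r -> {for r, continuous (z2 lam)};
  rm_ge1 : forall lam r, 0 <= lam <= 1 -> 2 * M < r -> 1 <= zf lam r;
  rm_homo : forall lam r r', 0 <= lam <= 1 -> 2 * M < r -> r <= r' -> zf lam r <= zf lam r';
  rm_z1 : forall lam r, 0 <= lam <= 1 -> 2 * M < r -> 0 <= z1 lam r <= Cz * r * zf lam r;
  rm_le : forall lam r, 0 <= lam <= 1 -> 2 * M < r ->
    zf lam r <= Cz * expR (lam * sigma r) * (1 + lam * r) `^ (- k);
  rm_eq : forall lam r, 0 <= lam <= 1 -> 2 * M < r ->
    F r * z2 lam r + (hratio M r / r + n.-1%:R * F r / r) * z1 lam r
       + 2 * flux r * lam * z1 lam r = potential n M D V lam r * zf lam r }.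

Lemma radial_modes_exist : exists Cz zf z1 z2, 0 < Cz /\ radial_modes Cz zf z1 z2.
Proof.
have [Cz Cz0 H] := radial_family n3 M0 mu0 d0 d1 cD cV D_bnd V_bnd.
have H' lam : exists zz : (R -> R) * (R -> R) * (R -> R), 0 <= lam <= 1 -> forall r, 2 * M < r ->
  [/\ is_derive r 1 zz.1.1 (zz.1.2 r), is_derive r 1 zz.1.2 (zz.2 r), {for r, continuous zz.2},
      1 <= zz.1.1 r /\ (forall r', r <= r' -> zz.1.1 r <= zz.1.1 r') &
   [/\ 0 <= zz.1.2 r <= Cz * r * zz.1.1 r,
      zz.1.1 r <= Cz * expR (lam * sigma r) * (1 + lam * r) `^ (- k) &
      F r * zz.2 r + (hratio M r / r + n.-1%:R * F r / r) * zz.1.2 r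
       + 2 * flux r * lam * zz.1.2 r = potential n M D V lam r * zz.1.1 r]].
  have [l01|l01] := boolP (0 <= lam <= 1); last by exists (id, id, id) => l01'; case/negP: l01.
  by have [z [z1 [z2 h]]] := H lam l01; exists (z, z1, z2) => _.
have [f hf] := choice H'.
exists Cz, (fun lam => (f lam).1.1), (fun lam => (f lam).1.2), (fun lam => (f lam).2).
split => //; split => lam r.
- by move=> l01 hr; case: (hf lam l01 r hr).
- by move=> l01 hr; case: (hf lam l01 r hr).
- by move=> l01 hr; case: (hf lam l01 r hr).
- by move=> l01 hr; case: (hf lam l01 r hr) => _ _ _ [].
- by move=> r' l01 hr; case: (hf lam l01 r hr) => _ _ _ [_ h] _; exact: h.
- by move=> l01 hr; case: (hf lam l01 r hr) => _ _ _ _ [].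
- by move=> l01 hr; case: (hf lam l01 r hr) => _ _ _ _ [].
- by move=> l01 hr; case: (hf lam l01 r hr) => _ _ _ _ [].
Qed.

Variables (Cz : R) (zf z1 z2 : R -> R -> R).
Hypothesis Cz0 : 0 < Cz.
Hypothesis rm : radial_modes Cz zf z1 z2.
Variable rho : R.
Variable N : nat.
Hypothesis N3 : (3 <= N)%N.

Lemma mode_gt0 lam T x : 0 <= lam <= 1 -> slab T x -> 0 < mode zf lam x.
Proof.
move=> l01 [_ [hx _]]; rewrite mulr_gt0 ?expR_gt0//.
exact: lt_le_trans (rm_ge1 rm l01 hx).
Qed.

Definition mode_adjoint (lam T A : R) : spacetime -> R :=
  adjoint M (expcut N lam T) (expcut1 N lam T) (expcut2 N lam T)
    (radcut A (zf lam)) (radcut1 A (zf lam) (z1 lam)) (radcut2 A (zf lam) (z1 lam) (z2 lam)) D V.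

(** For the untruncated mode the adjoint vanishes, so each remaining term
    contains a derivative of the cutoff, worth 1/T and supported in the window.
    The terms in H'' give 1/T^2 <= C/(r T) since r <= C T on the cone, and
    lambda/T; the term with z' is small because flux <= C r^(-2) while
    z' <= C r z; the damping is at most C/r. *)
Lemma adjoint_mode_bound : exists2 C, 0 < C & forall (lam T A T0 : R) x,
  0 <= lam <= 1 -> 1 <= T -> T + `|cone_shift rho| <= A -> cone rho T0 x ->
  `|mode_adjoint lam T A x| <= (if T / 2 <= w x < T then
     C * cutbase (w x / T) ^+ N.-2 * mode zf lam x * (x.2.1^-1 + lam) / T else 0).
Proof.
pose P := (2 * M) `^ (- d).
pose C1 : R := 2 * n%:R * (1 + `|cone_shift rho|) + 2 * (2 * n%:R) + mu * P + 2 * Cz * (2 * M) ^+ 2.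
have P0 : 0 <= P by exact: powR_ge0.
have M20 : 0 < 2 * M by rewrite mulr_gt0.
have n0 : 0 < n%:R :> R by rewrite ltr0n (leq_trans _ n3).
have C10 : 0 < C1.
  rewrite /C1 -2!addrA ltr_pwDl//; first by rewrite !mulr_gt0// ltr_pwDl.
  by rewrite !addr_ge0// ?mulr_ge0// ltW// exprn_gt0.
exists (60 * N%:R ^+ 2 * C1); first by rewrite mulr_gt0// mulr_gt0// exprn_gt0// ltr0n (leq_trans _ N3).
move=> lam T A T0 x l01 T1 TA Cx; set adj := mode_adjoint lam T A x.
have [l0 l1] := andP l01; have Tp : 0 < T by exact: lt_le_trans T1.
have [Sx _] := Cx; have [_ [hx _]] := Sx; have r0 := gt2M_gt0 M0 hx.
have rw := cone_radius Cx.
have m0 := mode_gt0 l01 Sx.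
have [wT|Tw] := ltP (w x) T; last first.
  rewrite /adj /mode_adjoint /adjoint; have [-> -> ->] := expcut_right lam N3 Tp Tw.
  rewrite !(mulr0, mul0r, subr0, addr0) normr0; case: ifP => // _.
  move: (mode zf lam x) m0 => m m0; move: C1 C10 => c c0.
  rewrite !mulr_ge0 ?exprn_ge0 ?cutbase_ge0// ?invr_ge0 ?(ltW m0) ?(ltW c0) ?(ltW Tp)//.
  by rewrite addr_ge0// invr_ge0 ltW.
(* on the cone r <= C T, so 1/T is dominated by C/r *)
have rT : x.2.1 <= T * (1 + `|cone_shift rho|).
  rewrite (le_trans rw)// mulrDr mulr1 lerD ?(ltW wT)//.
  by rewrite (le_trans (ler_norm _))// ler_peMl.
have rA : x.2.1 <= A.
  by rewrite (le_trans rw)// (le_trans _ TA)// lerD ?(ltW wT)// ler_norm.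
have [B1 B2] := cutoff_bounds (w x / T) N3.
have zE := rm_eq rm l01 hx; have z0 := lt_le_trans ltr01 (rm_ge1 rm l01 hx).
have /andP[z10 z1le] := rm_z1 rm l01 hx.
have /andP[D0 Dle] := D_bnd hx.
have F0 := lapse_gt0 M0 hx; have a0 := flux_gt0 n M0 hx.
have b1 := wave_coef_ge1 n3 M0 hx; have ble := wave_coef_le n M0 hx.
have ale := flux_le_sqr n3 M0 hx.
have Ple : x.2.1 `^ (- d) <= P by exact: powRN_le.
(* the equation for z removes every term without a derivative of the cutoff *)
have E : adj = expR (- (lam * w x)) * (wave_coef n M x.2.1 * (cutoff2 N (w x / T) / T ^+ 2) * zf lam x.2.1
   - 2 * lam * wave_coef n M x.2.1 * (cutoff1 N (w x / T) / T) * zf lam x.2.1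
   + 2 * flux x.2.1 * (cutoff1 N (w x / T) / T) * z1 lam x.2.1
   - D x.2.1 * (cutoff1 N (w x / T) / T) * zf lam x.2.1).
  have Tn : T != 0 by rewrite gt_eqF.
  rewrite /adj /mode_adjoint /adjoint /radial_laplace.
  have [-> -> ->] := radcut_inside (zf lam) (z1 lam) (z2 lam) (lt_le_trans Tp (le_trans (ler_wpDr (normr_ge0 _) (lexx T)) TA)) rA.
  have -> : F x.2.1 * z2 lam x.2.1 + (hratio M x.2.1 / x.2.1 + n.-1%:R * F x.2.1 / x.2.1) * z1 lam x.2.1
    = potential n M D V lam x.2.1 * zf lam x.2.1 - 2 * flux x.2.1 * lam * z1 lam x.2.1.
    by rewrite -zE addrK.
  rewrite /expcut /expcut1 /expcut2 /potential; move: (expR _) => e.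
  move: (cutoff N _) (cutoff1 N _) (cutoff2 N _) => c c1 c2; field.
  exact: Tn.
have Eabs : `|adj| <= expR (- (lam * w x)) *
   (wave_coef n M x.2.1 * `|cutoff2 N (w x / T)| / T ^+ 2 * zf lam x.2.1
   + 2 * lam * wave_coef n M x.2.1 * `|cutoff1 N (w x / T)| / T * zf lam x.2.1
   + 2 * flux x.2.1 * `|cutoff1 N (w x / T)| / T * z1 lam x.2.1
   + D x.2.1 * `|cutoff1 N (w x / T)| / T * zf lam x.2.1).
  rewrite E normrM (ger0_norm (expR_ge0 _)) ler_wpM2l ?expR_ge0//.
  apply: le_trans (ler_normB _ _) _; apply: lerD; last first.
    by rewrite !normrM (ger0_norm D0) (gtr0_norm z0) (gtr0_norm (x := T^-1)) ?invr_gt0// !mulrA.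
  apply: le_trans (ler_normD _ _) _; apply: lerD; last first.
    by rewrite !normrM (ger0_norm z10) (gtr0_norm a0) (gtr0_norm (x := T^-1)) ?invr_gt0// !mulrA (ger0_norm (x := 2)).
  apply: le_trans (ler_normB _ _) _; apply: lerD; last first.
    by move: (wave_coef n M x.2.1) (le_trans ler01 b1) => b bp; rewrite !normrM (ger0_norm bp) (gtr0_norm z0) (ger0_norm l0) normrV ?unitfE ?gt_eqF// (gtr0_norm Tp) normr_nat !mulrA.
  by move: (wave_coef n M x.2.1) (le_trans ler01 b1) => b bp; rewrite !normrM (ger0_norm bp) (gtr0_norm z0) (gtr0_norm (x := (T ^+ 2)^-1)) ?invr_gt0 ?exprn_gt0// !mulrA.
apply: le_trans Eabs _.
have wE : (2^-1 <= w x / T <= 1) = (T / 2 <= w x) && true.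
  by rewrite ler_pdivlMr// ler_pdivrMr// mul1r (mulrC 2^-1) (ltW wT).
move: B1 B2; rewrite wE.
case: ifPn => _ B1 B2; last first.
  move: B1 B2; rewrite !normr_le0 => /eqP -> /eqP ->.
  by rewrite normr0 !(mulr0, mul0r, addr0).
rewrite /mode.
have -> : 60 * N%:R ^+ 2 * C1 * cutbase (w x / T) ^+ N.-2 * (expR (- (lam * w x)) * zf lam x.2.1)
   * (x.2.1^-1 + lam) / T = expR (- (lam * w x)) * (60 * N%:R ^+ 2 * cutbase (w x / T) ^+ N.-2 *
   (C1 * (x.2.1^-1 + lam) / T * zf lam x.2.1)).
  by move: (cutbase _ ^+ N.-2) => y; move: C1 {C10} => c; ring.
rewrite ler_wpM2l ?expR_ge0//.
set y := 60 * N%:R ^+ 2 * cutbase (w x / T) ^+ N.-2 in B1 B2 *.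
have y0 : 0 <= y by exact: le_trans B1.
have Ti : 0 < T^-1 by rewrite invr_gt0.
have ri : 0 < x.2.1^-1 by rewrite invr_gt0.
have Tr : T^-1 <= (1 + `|cone_shift rho|) / x.2.1.
  by rewrite ler_pdivlMr// mulrC ler_pdivrMr// mulrC.
have h1 : wave_coef n M x.2.1 * `|cutoff2 N (w x / T)| / T ^+ 2 * zf lam x.2.1 <=
   y * (2 * n%:R * (1 + `|cone_shift rho|) * (x.2.1^-1 / T) * zf lam x.2.1).
  move: (wave_coef n M x.2.1) ble (le_trans ler01 b1) => b bl bp.
  rewrite !mulrA ler_wpM2r ?(ltW z0)// expr2 invfM mulrA ler_wpM2r ?(ltW Ti)//.
  have -> : y * 2 * n%:R * (1 + `|cone_shift rho|) / x.2.1 = (2 * n%:R * y) * ((1 + `|cone_shift rho|) / x.2.1) by ring.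
  by apply: ler_pM => //; [exact: mulr_ge0|exact: ltW|exact: ler_pM].
have h2 : 2 * lam * wave_coef n M x.2.1 * `|cutoff1 N (w x / T)| / T * zf lam x.2.1 <=
   y * (2 * (2 * n%:R) * (lam / T) * zf lam x.2.1).
  move: (wave_coef n M x.2.1) ble (le_trans ler01 b1) => b bl bp.
  rewrite !mulrA ler_wpM2r ?(ltW z0)// ler_wpM2r ?(ltW Ti)//.
  have -> : y * 2 * 2 * n%:R * lam = 2 * lam * (2 * n%:R) * y by ring.
  apply: ler_pM => //; first by rewrite !mulr_ge0.
  by apply: ler_wpM2l => //; rewrite mulr_ge0.
have h3 : 2 * flux x.2.1 * `|cutoff1 N (w x / T)| / T * z1 lam x.2.1 <=
   y * (2 * Cz * (2 * M) ^+ 2 * (x.2.1^-1 / T) * zf lam x.2.1).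
  apply: (@le_trans _ _ (2 * (hratio M x.2.1 ^+ 2) * y / T * (Cz * x.2.1 * zf lam x.2.1))).
    apply: ler_pM => //; first by rewrite !mulr_ge0 ?(ltW a0) ?(ltW Ti).
    rewrite ler_wpM2r ?(ltW Ti)//; apply: ler_pM => //; first by rewrite mulr_ge0// ltW.
    by rewrite ler_wpM2l.
  rewrite le_eqVlt; apply/orP; left; apply/eqP; rewrite /hratio; field.
  by rewrite !gt_eqF.
have h4 : D x.2.1 * `|cutoff1 N (w x / T)| / T * zf lam x.2.1 <=
   y * (mu * P * (x.2.1^-1 / T) * zf lam x.2.1).
  rewrite !mulrA ler_wpM2r ?(ltW z0)// ler_wpM2r ?(ltW Ti)//.
  have -> : y * mu * P / x.2.1 = (mu * (P / x.2.1)) * y by ring.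
  rewrite ler_pM// (le_trans Dle)// ler_wpM2l// ler_wpM2r ?(ltW ri)//.
apply: le_trans (lerD (lerD (lerD h1 h2) h3) h4) _.
rewrite -!mulrDr ler_wpM2l// -!mulrDl ler_wpM2r ?(ltW z0)//.
have -> : C1 * (x.2.1^-1 + lam) / T = C1 * (x.2.1^-1 / T) + C1 * (lam / T) by ring.
have q1 : 0 <= x.2.1^-1 / T by rewrite divr_ge0// ltW.
have q2 : 0 <= lam / T by rewrite divr_ge0// ltW.
move: (x.2.1^-1 / T) (lam / T) q1 q2 => a b qa qb.
have k1 : 0 <= 2 * n%:R * (1 + `|cone_shift rho|) by apply: mulr_ge0; [rewrite mulr_ge0// ltW|rewrite addr_ge0].
have k2 : 0 <= 2 * (2 * n%:R) :> R by rewrite mulr_ge0// mulr_ge0// ltW.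
have k3 : 0 <= mu * P by exact: mulr_ge0.
have k4 : 0 <= 2 * Cz * (2 * M) ^+ 2 by rewrite mulr_ge0 ?exprn_ge0 ?(ltW M20)// mulr_ge0// ltW.
rewrite {}/C1 in C10 *; move: k1 k2 k3 k4 C10.
move: (2 * n%:R * _) (2 * (2 * n%:R)) (mu * P) (2 * Cz * _) => c1 c2 c3 c4 k1 k2 k3 k4 _.
rewrite -subr_ge0.
have -> : (c1 + c2 + c3 + c4) * a + (c1 + c2 + c3 + c4) * b - (c1 * a + c2 * b + c4 * a + c3 * a)
  = c2 * a + (c1 + c3 + c4) * b by ring.
by rewrite addr_ge0// mulr_ge0// !addr_ge0.
Qed.

Section solution.
Variables (p eps T0 : R) (u0 u1 : space -> R) (u : spacetime -> R).
Hypothesis usol : weak_solution M D V p u0 u1 eps T0 u.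
Hypothesis usupp : forall t, 0 < t < T0 ->
  ess_supp M (fun x => u (t, x)) `<=` tortoise_ball M (t + rho).
Hypothesis u0_ge0 : ae_Omega M (fun x => 0 <= u0 x).
Hypothesis u1_ge0 : ae_Omega M (fun x => 0 <= u1 x).
Hypothesis u0_L1 : L1loc_Omega M u0.
Hypothesis u1_L1 : L1loc_Omega M u1.

Definition timecut (T : R) (x : spacetime) : R := cutbase (w x / T).

Lemma measurable_cone : measurable (cone rho T0).
Proof.
have -> : cone rho T0 = slab T0 `&` (fun z : spacetime => tortoise M z.2.1 <= z.1 + rho) @^-1` [set true].
  by apply/seteqP; split => z [].
have mS := @measurable_slab R n M T0.
have mt : measurable_fun (slab T0) (fun z : spacetime => tortoise M z.2.1 <= z.1 + rho).
  apply: measurable_fun_ler; first exact: measurable_slab_tortoise.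
  by apply: measurable_funD; [exact: measurable_funTS|exact: measurable_cst].
exact: mt.
Qed.

Lemma measurable_cone_window T : measurable (cone rho T0 `&` window T).
Proof.
have mS := @measurable_slab R n M T0.
have mw : measurable_fun (slab T0) w := @measurable_wtime R n M n3 M0 T0.
have -> : cone rho T0 `&` window T = cone rho T0 `&`
   ((slab T0 `&` w @^-1` `[T / 2, T[%classic)).
  apply/seteqP; split => z.
    by move=> [[Sz h] wz]; split => //; split => //=; rewrite in_itv.
  by move=> [Cz' [_ /=]]; rewrite in_itv.
apply: measurableI; first exact: measurable_cone.
by apply: mw => //; exact: measurable_itv.
Qed.

Lemma measurable_mode lam : 0 <= lam <= 1 -> measurable_fun (slab T0) (mode zf lam).
Proof.
move=> l01; apply: measurable_funM.
  apply: (@measurable_fun_wtime R n M n3 M0 T0 (fun y => expR (- (lam * y)))) => y.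
  suff [e de] : exists e, is_derive y 1 (fun y => expR (- (lam * y))) e by exact: is_derive_continuous de.
  by eexists; dtac.
apply: (@measurable_radial R n M T0 (zf lam)) => r hr.
exact: is_derive_continuous (rm_dz rm l01 hr).
Qed.

Lemma measurable_timecut T : measurable_fun (slab T0) (timecut T).
Proof.
apply: (@measurable_fun_wtime R n M n3 M0 T0 (fun y => cutbase (y / T))) => y.
apply: (@continuous_comp R R R (fun y => y / T) cutbase); last exact: cutbase_cont.
by apply: continuousM; [exact: cvg_id|exact: cvg_cst].
Qed.

(** The integral of |u|^p against the truncated weight W; the domain is the cone
    since u vanishes elsewhere. *)
Definition source_mass (T : R) (W : spacetime -> R) : \bar R :=
  (\int[mu3]_(z in cone rho T0) (`|u z| `^ p * (timecut T z ^+ N * W z) * z.2.1 ^+ n.-1)%:E)%E.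

(** The data term dd is nonnegative for every lambda, which suffices when only
    the mass is estimated; the lower bound on shells is used for lambda = 1
    alone. *)
Lemma key_inequality C : (forall (lam T A T0 : R) x,
   0 <= lam <= 1 -> 1 <= T -> T + `|cone_shift rho| <= A -> cone rho T0 x ->
   `|mode_adjoint lam T A x| <= (if T / 2 <= w x < T then
     C * cutbase (w x / T) ^+ N.-2 * mode zf lam x * (x.2.1^-1 + lam) / T else 0)) ->
  0 < C -> 0 <= eps ->
  forall (lam T : R), 0 <= lam <= 1 -> 1 <= T < T0 ->
  (source_mass T (mode zf lam) < +oo)%E /\
  exists dd : R, [/\ 0 <= dd,
   (source_mass T (mode zf lam) + (eps * dd)%:E <=
   \int[mu3]_(z in cone rho T0 `&` window T)
     (`|u z| * (timecut T z ^+ N.-2 * (C * mode zf lam z * (z.2.1^-1 + lam) / T)) * z.2.1 ^+ n.-1)%:E)%E &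
   forall a b, 2 * M < a -> 2 * g a <= T -> b <= T ->
    expR (- (lam * g a)) * fine (\int[mu2]_(x in `[a, b]%classic `*` sphere n) `|u1 x * x.1 ^+ n.-1|%:E)%E
     <= dd ].
Proof.
move=> adj_bnd C0 eps0 lam T l01 /andP[T1 TT0].
have [l0 l1] := andP l01.
have Tp : 0 < T by exact: lt_le_trans T1.
have [A [Ap TA AM]] : exists A : R, [/\ 0 < A, T + `|cone_shift rho| <= A & 2 * M < A].
  exists (T + `|cone_shift rho| + 2 * M + 1).
  move: (`|cone_shift rho|) (normr_ge0 (cone_shift rho)) => a a0.
  have Ta : 0 < T + a by exact: ltr_pwDl.
  have M2 : 0 < 2 * M by rewrite mulr_gt0.
  by split; [rewrite addr_gt0// addr_gt0|rewrite -addrA lerDl addr_ge0// ltW|apply: ltr_pwDr => //; rewrite lerDr ltW].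
(* below r0 the delay exceeds T, so the time cutoff vanishes there *)
have [r0 [hr0 gr0]] := delay_blowup n M0 T.
have dH := derive_expcut lam T N3.
have dH1 := derive_expcut1 lam N3 Tp.
have cH2 (y : R) : {for y, continuous (expcut2 N lam T)} by exact: expcut2_cont.
have dz := fun r => @rm_dz _ _ _ _ rm lam r l01.
have dz1 := fun r => @rm_dz1 _ _ _ _ rm lam r l01.
have cz2 := fun r => @rm_cz2 _ _ _ _ rm lam r l01.
have dxi (r : R) : 2 * M < r -> is_derive r 1 (radcut A (zf lam)) (radcut1 A (zf lam) (z1 lam) r).
  by move=> hr; exact: derive_radcut hr.
have dxi1 (r : R) : 2 * M < r ->
    is_derive r 1 (radcut1 A (zf lam) (z1 lam)) (radcut2 A (zf lam) (z1 lam) (z2 lam) r).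
  by move=> hr; exact: derive_radcut1 hr.
have cxi2 (r : R) : 2 * M < r -> {for r, continuous (radcut2 A (zf lam) (z1 lam) (z2 lam))}.
  by move=> hr; exact: radcut2_cont hr.
have z0 r : 2 * M < r -> 0 <= zf lam r by move=> hr; exact: le_trans ler01 (rm_ge1 rm l01 hr).
have xi_ge0 r : 2 * M < r -> 0 <= radcut A (zf lam) r by move=> hr; rewrite radcut_ge0// z0.
have H0 y : T <= y -> expcut N lam T y = 0 by move=> /(expcut_right lam N3 Tp)[].
have H10 y : T <= y -> expcut1 N lam T y = 0 by move=> /(expcut_right lam N3 Tp)[].
have xi0 r : 2 * A <= r -> radcut A (zf lam) r = 0 by exact: radcut_outside.
have D0 r : 2 * M < r -> 0 <= D r by move=> hr; case/andP: (D_bnd hr).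
have phi_le z : slab T0 z ->
   radial_test M (expcut N lam T) (radcut A (zf lam)) z <= zf lam (2 * A).
  move=> Sz; have w0 := wtime_ge0 Sz; case: Sz => _ [hx _]; have zr0 := z0 _ hx.
  have gz : expcut N lam T (w z) <= 1.
    by rewrite (le_trans (expcut_le _ _ _ _))// -[leRHS]expR0 ler_expR oppr_le0 mulr_ge0.
  have [rA|Ar] := leP z.2.1 (2 * A); last first.
    by rewrite /radial_test xi0 ?(ltW Ar)// mulr0 z0//; lra.
  apply: (@le_trans _ _ (1 * zf lam z.2.1)); last by rewrite mul1r (rm_homo rm).
  by rewrite /radial_test ler_pM ?expcut_ge0 ?xi_ge0 ?radcut_le ?gz.
have WI := weak_inequality n3 M0 cD cV dH dH1 cH2 dxi dxi1 cxi2 (expcut_ge0 N lam T) xi_ge0 usol usupp TT0 hr0 gr0 H0 xi0 phi_le.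
have SF := source_finite n3 M0 (expcut_ge0 N lam T) xi_ge0 usol TT0 hr0 gr0 H0 xi0 phi_le.
have DP := data_term_ge0 n3 M0 cD D0 dH dH1 dxi (expcut_ge0 N lam T) xi_ge0 u0_ge0 u1_ge0 u0_L1 u1_L1 (expcut1_le0 N Tp l0).
have DG := data_term_ge n3 M0 cD D0 dH dH1 dxi (expcut_ge0 N lam T) xi_ge0 hr0 gr0 H0 xi0 u0_ge0 u1_ge0 u0_L1 u1_L1 (expcut1_le0 N Tp l0) H10.
have SL : (source_mass T (mode zf lam) <= \int[mu3]_(z in slab T0)
    (`|u z| `^ p * radial_test M (expcut N lam T) (radcut A (zf lam)) z * z.2.1 ^+ n.-1)%:E)%E.
  rewrite /source_mass integral_mkcond [leRHS]integral_mkcond; apply: le_integral_nomeas => z _.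
    rewrite patchE; case: ifPn => //; rewrite inE => -[Sz _].
    rewrite lee_fin; apply: mulr3_ge0; rewrite ?powR_ge0//.
      by apply: mulr_ge0; [rewrite exprn_ge0 ?cutbase_ge0|exact: ltW (mode_gt0 l01 Sz)].
    by rewrite exprn_ge0// ltW// (gt2M_gt0 M0 Sz.2.1).
  rewrite !patchE; case: ifPn => [|_]; rewrite ?inE; last first.
    case: ifPn => //; rewrite inE => Sz.
    rewrite lee_fin; apply: mulr3_ge0; rewrite ?powR_ge0//.
      by apply: mulr_ge0; [exact: expcut_ge0|exact: xi_ge0 Sz.2.1].
    by rewrite exprn_ge0// ltW// (gt2M_gt0 M0 Sz.2.1).
  move=> Cz'; have [Sz _] := Cz'; rewrite ifT ?inE// lee_fin.
  rewrite /radial_test /expcut /cutoff -/(timecut T z) le_eqVlt; apply/orP; left; apply/eqP.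
  congr (_ * _ * _); rewrite -mulrA; have [wT|Tw] := ltP (w z) T; last first.
    have -> : timecut T z = 0 by apply: cutbase_right; rewrite ler_pdivlMr// mul1r.
    by rewrite expr0n; case: N N3 => //= *; rewrite !mul0r.
  congr (_ * (_ * _)); have rw := cone_radius Cz'.
  have rA : z.2.1 <= A.
    by rewrite (le_trans rw)// (le_trans _ TA)// lerD ?(ltW wT)// ler_norm.
  by case: (radcut_inside (zf lam) (z1 lam) (z2 lam) Ap rA).
split; first exact: le_lt_trans SL SF.
eexists; split; first exact: DP.
  (* extended by 0 outside the cone and the window, to recover an integral over both *)
  pose G z := if (tortoise M z.2.1 <= z.1 + rho) && (T / 2 <= w z < T) then
     timecut T z ^+ N.-2 * (C * mode zf lam z * (z.2.1^-1 + lam) / T) else 0.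
  have fac_ge0 z : slab T0 z -> 0 <= timecut T z ^+ N.-2 * (C * mode zf lam z * (z.2.1^-1 + lam) / T).
    move=> Sz; have m0 := mode_gt0 l01 Sz; have r0' := gt2M_gt0 M0 Sz.2.1.
    move: (mode zf lam z) m0 => m m0.
    by rewrite !mulr_ge0 ?exprn_ge0 ?cutbase_ge0// ?(ltW C0) ?(ltW m0) ?addr_ge0 ?invr_ge0 ?(ltW Tp)// ltW.
  have G_ge0 z : slab T0 z -> 0 <= G z.
    by move=> Sz; rewrite /G; case: ifP => // _; exact: fac_ge0.
  apply: le_trans (leeD SL (lexx _)) _.
  apply: le_trans (WI G G_ge0 _) _.
    move=> z Sz hz; apply: le_trans (adj_bnd lam T A T0 z l01 T1 TA (conj Sz hz)) _.
    rewrite /G hz /=; case: ifP => // _; rewrite /timecut.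
    by rewrite le_eqVlt; apply/orP; left; apply/eqP; ring.
  rewrite integral_mkcond [leRHS]integral_mkcond; apply: le_integral_nomeas => z _.
    rewrite patchE; case: ifPn => //; rewrite inE => Sz.
    rewrite lee_fin; apply: mulr3_ge0; rewrite ?G_ge0//.
    by rewrite exprn_ge0// ltW// (gt2M_gt0 M0 Sz.2.1).
  rewrite !patchE; case: ifPn; rewrite ?inE ?notin_setE => Sz; last first.
    by case: ifPn; rewrite ?inE => // -[[]].
  rewrite /G; case: ifPn => [/andP[hz hw]|nz].
    by rewrite ifT// inE; split; [split|].
  rewrite mulr0 mul0r; case: ifPn => //; rewrite inE => -[_ _].
  rewrite lee_fin; apply: mulr3_ge0; rewrite ?fac_ge0//.
  by rewrite exprn_ge0// ltW// (gt2M_gt0 M0 Sz.2.1).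
move=> a b ha gaT bT; apply: (DG a b _ ha (expR_ge0 _)).
move=> r /andP[ar rb]; have hr : 2 * M < r by exact: lt_le_trans ar.
have gr : g r <= g a by exact: delay_anti.
have rA : r <= A by rewrite (le_trans rb)// (le_trans bT)// (le_trans _ TA)// lerDl.
have [-> _ _] := radcut_inside (zf lam) (z1 lam) (z2 lam) Ap rA.
rewrite -[leLHS]mulr1; apply: ler_pM; [exact: expR_ge0|exact: ler01| |exact: (rm_ge1 rm l01 hr)].
rewrite /expcut; have h : g r / T <= 2^-1.
  by rewrite ler_pdivrMr// mulrC ler_pdivlMr// mulrC (le_trans _ gaT)// ler_wpM2l.
have [-> _ _] := cutoff_left N h.
by rewrite mul1r ler_expR lerN2 ler_wpM2l.
Qed.

End solution.

End key_inequality.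

(** * Integrals over the cone *)

Lemma lebesgue_R_integral (R : realType) (f : R -> \bar R) :
  measurable_fun setT f -> (forall x, 0 <= f x)%E ->
  (\int[@lebesgue_R R]_x f x = \int[@lebesgue_measure R]_x f x)%E.
Proof.
move=> mf f0.
have mid : measurable_fun [set: measurableTypeR R] (id : measurableTypeR R -> R).
  by move=> _ Y mY; rewrite setTI.
have := @ge0_integral_pushforward _ _ (measurableTypeR R) R R id mid lebesgue_measure setT f.
by rewrite preimage_setT => <-.
Qed.

Lemma lebesgue_R_le_primitive (R : realType) (G G' : R -> R) (a b : R) : a < b ->
  (forall x, a < x <= b -> 0 <= G' x) ->
  (forall x, a < x <= b -> is_derive x 1 G (G' x)) ->
  (forall x, a < x <= b -> {for x, continuous G'}) ->
  (forall x, a < x <= b -> 0 <= G x) ->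
  (\int[@lebesgue_R R]_(x in `]a, b]) (G' x)%:E <= (G b)%:E)%E.
Proof.
move=> ab G'0 dG cG' G0; rewrite integral_mkcond lebesgue_R_integral.
- apply: le_trans (integral_le_primitive (f := G') ab _ dG cG' G0).
    by rewrite [leRHS]integral_mkcond lexx.
  by move=> x h; rewrite G'0/=.
- apply/(measurable_restrictT _ (measurable_itv _)); apply/measurable_EFinP.
  apply: subspace_continuous_measurable_fun; first exact: measurable_itv.
  by apply: continuous_in_subspaceT => s; rewrite inE/= in_itv/=; exact: cG'.
- move=> x; rewrite patchE; case: ifPn => //; rewrite inE/= in_itv/= => h.
  by rewrite lee_fin G'0.
Qed.

Section radial_tonelli.
Context {R : realType} (n : nat) (M : R).
Local Notation space := (R * 'rV[R]_n)%type.
Local Notation spacetime := (R * (R * 'rV[R]_n))%type.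
Local Notation slab := (@slab R n M).
Local Notation mu3 := (@dt_dr_dw R n).

(** The measure of the sphere is finite, so fine loses nothing. *)
Definition sphere_area : R := fine (@sphere_measure R n setT).

Variables (T0 a b B : R) (c psi G K L L' : R -> R).
Hypothesis ab : a < b.
Hypothesis hB : 2 * M < B.
Hypothesis cc : forall r, 2 * M < r -> {for r, continuous c}.
Hypothesis cK : forall r, 2 * M < r -> {for r, continuous K}.
Hypothesis dG : forall s, a < s <= b -> is_derive s 1 G (psi s).
Hypothesis cpsi : forall s, a < s <= b -> {for s, continuous psi}.
Hypothesis psi0 : forall s, a < s <= b -> 0 <= psi s.
Hypothesis G0 : forall s, a < s <= b -> 0 <= G s.
Hypothesis K0 : forall r, 2 * M < r <= B -> 0 <= K r <= L' r.
Hypothesis dL : forall r, 2 * M < r <= B -> is_derive r 1 L (L' r).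
Hypothesis cL' : forall r, 2 * M < r <= B -> {for r, continuous L'}.
Hypothesis L0 : forall r, 2 * M < r <= B -> 0 <= L r.

Let E : set spacetime := slab T0 `&` (fun z => z.1 + c z.2.1) @^-1` `]a, b]%classic
   `&` (fun z : spacetime => z.2.1) @^-1` `]2 * M, B]%classic.

Let mphase : measurable_fun (slab T0) (fun z : spacetime => z.1 + c z.2.1).
Proof.
by apply: measurable_funD; [exact: measurable_funTS|exact: (@measurable_radial R n M T0 c)].
Qed.

Let mE : measurable E.
Proof.
have mS := @measurable_slab R n M T0.
have -> : E = (slab T0 `&` (fun z : spacetime => z.1 + c z.2.1) @^-1` `]a, b]%classic) `&`
   (slab T0 `&` (fun z : spacetime => z.2.1) @^-1` `]2 * M, B]%classic).
  apply/seteqP; split => z; first by move=> [[? ?] ?].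
  by move=> [[? ?] [_ ?]].
apply: measurableI; first by apply: mphase => //; exact: measurable_itv.
have m1 : measurable_fun (slab T0) (fun z : spacetime => z.2.1).
  by apply: (@measurable_radial R n M T0 id) => r _; exact: cvg_id.
by apply: m1 => //; exact: measurable_itv.
Qed.

Let mh : measurable_fun E (fun z : spacetime => K z.2.1 * psi (z.1 + c z.2.1)).
Proof.
have ES : E `<=` slab T0 by move=> z [[]].
have mS := @measurable_slab R n M T0.
apply: measurable_funM.
  by apply: measurable_funS (@measurable_radial R n M T0 K cK).
apply: (@measurable_comp _ _ _ _ _ _ `]a, b]%classic) => //.
- by move=> _ /= [z [[_ zab] _] <-].
- apply: subspace_continuous_measurable_fun; first exact: measurable_itv.
  apply: continuous_in_subspaceT => s; rewrite inE/= in_itv/=; exact: cpsi.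
- exact: measurable_funS mphase.
Qed.

Let inner (r : R) (v : 'rV[R]_n) : 2 * M < r <= B ->
  (\int[@lebesgue_R R]_t (((fun z : spacetime => (K z.2.1 * psi (z.1 + c z.2.1))%:E) \_ E) (t, (r, v)))
   <= (K r * G b)%:E)%E.
Proof.
move=> rB; have [Kr0 _] := andP (K0 rB).
have H : (\int[@lebesgue_R R]_(t in `](a - c r)%R, (b - c r)%R]) (K r * psi (t + c r))%:E
    <= (K r * G (b - c r + c r))%:E)%E.
  have cond t : a - c r < t <= b - c r -> a < t + c r <= b by rewrite ltrBlDr lerBrDr.
  have ds t : is_derive (t : R) 1 (fun t => t + c r) 1.
    by derive_eq; [dtac|rewrite addr0].
  have ct t : {for t, continuous (fun t => t + c r)} by exact: is_derive_continuous (ds t).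
  apply: (@lebesgue_R_le_primitive R (fun t => K r * G (t + c r)) (fun t => K r * psi (t + c r))).
  - by rewrite ltrD2r.
  - by move=> t /cond h; rewrite mulr_ge0// psi0.
  - move=> t /cond h; have Dg := dG h; have Ds := ds t; derive_eq.
      notypeclasses refine (derive_mulP (derive_cstP _ _) _).
      by notypeclasses refine (@derive_compP _ G (fun t => t + c r) _ _ _ Dg Ds).
    by rewrite mul0r add0r mulr1.
  - move=> t /cond h; apply: continuousM; first exact: cvg_cst.
    by apply: (@continuous_comp R R R (fun t => t + c r) psi); [exact: ct|exact: cpsi].
  - by move=> t /cond h; rewrite mulr_ge0// G0.
rewrite subrK in H; apply: le_trans H.
rewrite [leRHS]integral_mkcond; apply: le_integral_nomeas => t _.
  rewrite patchE; case: ifPn => //; rewrite inE => -[[_ /= h] _].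
  by rewrite lee_fin mulr_ge0// psi0// -[_ < _ <= _]/(t + c r \in `]a, b]).
rewrite !patchE; case: ifPn => [|_]; last first.
  case: ifPn => //; rewrite inE/= in_itv/= ltrBlDr lerBrDr => h.
  by rewrite lee_fin mulr_ge0// psi0.
rewrite inE => -[[_ /= h] _]; rewrite in_itv /= in h.
by rewrite ifT// inE/= in_itv/= ltrBlDr lerBrDr.
Qed.

(** Integrating first in t at fixed r turns the phase t + c(r) into the variable
    of psi, with an integral bounded independently of r; what remains is radial.
    The functions G and L are primitives of psi and of a majorant of K. *)
Lemma radial_tonelli (A : set spacetime) (f : spacetime -> R) :
  A `<=` slab T0 -> (forall z, A z -> 0 <= f z) ->
  (forall z, A z -> [/\ a < z.1 + c z.2.1 <= b, z.2.1 <= B &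
     f z <= K z.2.1 * psi (z.1 + c z.2.1)]) ->
  (\int[mu3]_(z in A) (f z)%:E <= (sphere_area * (G b * L B))%:E)%E.
Proof.
move=> AS f0 fle.
pose h := (fun z : spacetime => (K z.2.1 * psi (z.1 + c z.2.1))%:E) \_ E.
have h0 z : (0 <= h z)%E.
  rewrite /h patchE; case: ifPn => //; rewrite inE => -[[_ /=]]; rewrite !in_itv/= => h1 h2.
  by rewrite lee_fin mulr_ge0 ?psi0//; case/andP: (K0 h2).
have mhT : measurable_fun setT h.
  by apply/(measurable_restrictT _ mE); exact/measurable_EFinP.
apply: (@le_trans _ _ (\int[mu3]_z h z)%E).
  rewrite integral_mkcond; apply: le_integral_nomeas => z _.
    by rewrite patchE; case: ifPn => //; rewrite inE => Az; rewrite lee_fin f0.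
  rewrite patchE; case: ifPn => [|_]; last exact: h0.
  rewrite inE => Az; have [zab zB fz] := fle z Az; have Sz := AS z Az.
  rewrite /h patchE ifT ?lee_fin// inE; split; first by split => //=; rewrite in_itv.
  by rewrite /= in_itv/= zB andbT; case: Sz => _ [].
have -> : (\int[mu3]_z h z = \int[sprod lebesgue_R (@sphere_measure R n)]_y
    (\int[lebesgue_R]_t h (t, y)))%E.
  exact: (@fubini_tonelli2 _ _ _ _ R lebesgue_R (sprod lebesgue_R (@sphere_measure R n)) h mhT h0).
pose q (y : space) : \bar R := ((fun r => (K r * G b)%:E) \_ `]2 * M, B]%classic) y.1.
have Gb0 : 0 <= G b by rewrite G0// ab lexx.
have q0 y : (0 <= q y)%E.
  rewrite /q patchE; case: ifPn => //; rewrite inE/= in_itv/= => yB.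
  by rewrite lee_fin mulr_ge0//; case/andP: (K0 yB).
apply: (@le_trans _ _ (\int[sprod lebesgue_R (@sphere_measure R n)]_y q y)%E).
  apply: le_integral_nomeas => -[r v] _; first by apply: integral_ge0 => t _; exact: h0.
  rewrite /q patchE; case: ifPn => [|nr]; first by rewrite inE/= in_itv/= => rB; exact: inner.
  rewrite integral0_eq// => t _; rewrite /h patchE; case: ifPn => //.
  by rewrite inE => -[_ /= hr]; move: nr; rewrite notin_setE => /(_ hr).
have mq1 : measurable_fun setT ((fun r => (K r * G b)%:E) \_ `]2 * M, B]%classic).
  apply/(measurable_restrictT _ (measurable_itv _)); apply/measurable_EFinP.
  apply: measurable_funM => //; apply: measurable_funS (measurable_fun_gt2M cK); first exact: measurable_itv.
  by move=> r /=; rewrite !in_itv/= => /andP[-> _].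
have mq : measurable_fun setT q.
  exact: (measurableT_comp mq1).
have -> : (\int[sprod lebesgue_R (@sphere_measure R n)]_y q y =
   \int[lebesgue_R]_r \int[@sphere_measure R n]_v q (r, v))%E.
  exact: (@fubini_tonelli1 _ _ _ _ R lebesgue_R (@sphere_measure R n) q mq q0).
have area_fin : @sphere_measure R n setT \is a fin_num by exact: fin_num_measure.
have area0 : 0 <= sphere_area by rewrite fine_ge0.
apply: (@le_trans _ _ (\int[@lebesgue_R R]_(r in `](2 * M)%R, B]) (sphere_area * G b * L' r)%:E)%E).
  rewrite [leRHS]integral_mkcond; apply: le_integral_nomeas => r _.
    by apply: integral_ge0 => v _; exact: q0.
  rewrite /q /= !patchE; case: ifPn => hr; last by rewrite integral0.
  have := integral_cst (@sphere_measure R n) measurableT (K r * G b)%:E; rewrite /cst => ->.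
  have areaE : @sphere_measure R n setT = sphere_area%:E by rewrite fineK.
  rewrite [X in (_ * X <= _)%E]areaE -EFinM lee_fin.
  rewrite inE/= in_itv/= in hr; have [K1 K2] := andP (K0 hr).
  by rewrite mulrC -mulrA ler_wpM2l// mulrC ler_wpM2l.
rewrite mulrA; apply: (@lebesgue_R_le_primitive R (fun r => sphere_area * G b * L r) (fun r => sphere_area * G b * L' r)) => //.
- move=> r rB; have [K1 K2] := andP (K0 rB).
  by apply: mulr_ge0; [exact: mulr_ge0|exact: le_trans K2].
- move=> r rB; have Dl := dL rB; derive_eq.
    by notypeclasses refine (derive_mulP (derive_cstP _ _) Dl).
  by rewrite mul0r add0r.
- by move=> r rB; apply: continuousM; [exact: cvg_cst|exact: cL'].
- by move=> r rB; apply: mulr_ge0; [exact: mulr_ge0|exact: L0].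
Qed.

End radial_tonelli.

(** * Young inequality and bounds for a single mode *)

Section weighted_young.
Context {R : realType}.

Lemma powRge0_mono (r x y : R) : 0 <= r -> 0 <= x -> x <= y -> x `^ r <= y `^ r.
Proof. by move=> r0 x0 xy; apply: ge0_ler_powR; rewrite // nnegrE// (le_trans x0). Qed.

Lemma powRneg_mono (r x y : R) : 0 <= r -> 0 < x -> x <= y -> y `^ (- r) <= x `^ (- r).
Proof.
move=> r0 x0 xy; have y0 := lt_le_trans x0 xy.
by rewrite !powRN lef_pV2 ?posrE ?powR_gt0// powRge0_mono// ltW.
Qed.

(** Young's inequality for (dl W)^(1/p) x y^(N-2) and (dl W)^(-1/p) e. The loss
    of two powers of the cutoff y is harmless as soon as (N - 2) p >= N. *)
Lemma young_weighted (p q x y W e dl : R) (N : nat) : 1 < p -> p^-1 + q^-1 = 1 -> 0 < q ->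
  (3 <= N)%N -> N%:R <= N.-2%:R * p ->
  0 <= x -> 0 <= y <= 1 -> 0 < W -> 0 <= e -> 0 < dl ->
  x * (y ^+ N.-2 * e) <= dl * (x `^ p * (y ^+ N * W)) + dl `^ (1 - q) * (e `^ q * W `^ (1 - q)).
Proof.
move=> p1 pq q0 N3 Np x0 /andP[y0 y1] W0 e0 dl0.
have p0 : 0 < p by exact: lt_trans p1.
have dW : 0 < dl * W by rewrite mulr_gt0.
have q1 : 1 <= q.
  by rewrite -(invrK q) -[leLHS]invr1 lef_pV2 ?posrE ?invr_gt0// -pq lerDr invr_ge0 ltW.
have yp : (y ^+ N.-2) `^ p <= y ^+ N.
  have [->|yn] := eqVneq y 0.
    by rewrite expr0n; case: N N3 {Np} => [//|[//|[//|m]]] _ /=; rewrite powR0 ?gt_eqF// exprn_ge0.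
  have yp : 0 < y <= 1 by rewrite lt_neqAle eq_sym yn y0.
  by rewrite -powR_mulrn// -powRrM -powR_mulrn// ger_powR.
pose a := (dl * W) `^ p^-1 * (x * y ^+ N.-2); pose b := (dl * W) `^ (- p^-1) * e.
have ab : x * (y ^+ N.-2 * e) = a * b.
  rewrite /a /b mulrACA -powRD ?subrr ?powRr0 ?mul1r ?mulrA//.
  by rewrite (gt_eqF dW) implybT.
have a0 : 0 <= a by rewrite !mulr_ge0 ?powR_ge0 ?exprn_ge0.
have b0 : 0 <= b by rewrite mulr_ge0 ?powR_ge0.
rewrite ab; apply: le_trans (conjugate_powR a0 b0 p0 q0 pq) _; apply: lerD.
  rewrite (le_trans (_ : _ <= a `^ p))//; first by rewrite ler_piMr ?powR_ge0// invf_le1// ltW.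
  rewrite /a powRM ?powR_ge0 ?mulr_ge0 ?exprn_ge0// -powRrM mulVf ?gt_eqF// powRr1 ?(ltW dW)//.
  rewrite powRM ?exprn_ge0//.
  have -> : dl * (x `^ p * (y ^+ N * W)) = dl * W * (x `^ p * y ^+ N) by ring.
  by rewrite ler_wpM2l ?(ltW dW)// ler_wpM2l ?powR_ge0.
rewrite (le_trans (_ : _ <= b `^ q))//; first by rewrite ler_piMr ?powR_ge0// invf_le1.
rewrite /b powRM ?powR_ge0// -powRrM.
have -> : - p^-1 * q = 1 - q.
  have -> : p^-1 = 1 - q^-1 by rewrite -pq addrK.
  by rewrite mulNr mulrBl mul1r mulVf ?gt_eqF// opprB.
by rewrite powRM ?(ltW W0) ?(ltW dl0)// mulrAC mulrA.
Qed.

End weighted_young.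

(** Polynomial growth in the distance to the light cone is absorbed by half of
    the exponential decay. *)
Lemma powR_exp_le {R : realType} (k y : R) : 1 <= k -> 0 <= y ->
  (1 + y) `^ k <= (2 * k) `^ k * expR (y / 2).
Proof.
move=> k1 y0; have k0 : 0 < k by exact: lt_le_trans k1.
have k20 : 0 < 2 * k by rewrite mulr_gt0.
have h : 1 + y <= 2 * k * expR (y / (2 * k)).
  apply: (@le_trans _ _ (2 * k * (1 + y / (2 * k)))).
    by rewrite mulrDr mulr1 mulrCA divff ?gt_eqF// mulr1; lra.
  by rewrite ler_wpM2l ?(ltW k20)// expR_ge1Dx.
apply: le_trans (powRge0_mono (ltW k0) _ h) _; first by rewrite addr_ge0.
rewrite powRM ?(ltW k20) ?expR_ge0// ler_wpM2l ?powR_ge0// -expRM.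
by rewrite ler_expR invfM mulrA mulrVK// unitfE gt_eqF.
Qed.

Lemma powR1D {R : realType} (x r : R) : 0 < x -> x `^ (1 + r) = x * x `^ r.
Proof. by move=> x0; rewrite powRD ?(gt_eqF x0) ?implybT// powRr1// ltW. Qed.

Section cone_estimates.
Context {R : realType} (n : nat) (M : R) (D V : R -> R).
Hypothesis n3 : (3 <= n)%N.
Hypothesis M0 : 0 < M.
Variables (Cz : R) (zf z1 z2 : R -> R -> R).
Hypothesis Cz0 : 0 < Cz.
Hypothesis rm : radial_modes n M D V Cz zf z1 z2.
Variables (rho T0 : R).
Hypothesis rho0 : 0 < rho.
Local Notation spacetime := (R * (R * 'rV[R]_n))%type.
Local Notation slab := (@slab R n M).
Local Notation mu3 := (@dt_dr_dw R n).
Local Notation w := (wtime M).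
Local Notation cone := (cone M rho T0 : set spacetime).
Local Notation window := (@window R n M).
Local Notation area := (@sphere_area R n).

(** The distance to the light cone t - s = - rho bounding the support, in the
    null coordinate t - s, with s the tortoise coordinate. *)
Definition lag (x : spacetime) : R := x.1 + (rho - tortoise M x.2.1).

Lemma lag_ge0 x : cone x -> 0 <= lag x.
Proof. by move=> [_ h]; rewrite /lag addrA subr_ge0. Qed.

Lemma wtime_lag x : w x = sigma n M x.2.1 + lag x - rho.
Proof. rewrite /wtime /sigma /lag; ring. Qed.

(** Bounds both r and lag on the window, in units of T. *)
Definition cone_const : R := 1 + `|cone_shift M rho| + 2 * M.

Lemma cone_const_gt1 : 1 < cone_const.
Proof. by rewrite /cone_const -addrA ltrDl ltr_wpDl ?normr_ge0// mulr_gt0. Qed.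

Lemma cone_const_gt T : 1 <= T -> 2 * M < cone_const * T.
Proof.
move=> T1; apply: (@lt_le_trans _ _ cone_const).
  by rewrite /cone_const ltrDr ltr_pwDl.
by rewrite ler_peMr// ltW// (lt_trans ltr01 cone_const_gt1).
Qed.

Lemma window_radius T x : 1 <= T -> cone x -> window T x -> x.2.1 <= cone_const * T.
Proof.
move=> T1 Cx /andP[_ wT]; apply: le_trans (cone_radius M0 Cx) _.
have -> : cone_const * T = T + (`|cone_shift M rho| * T + 2 * M * T) by rewrite /cone_const; ring.
apply: lerD; first exact: ltW.
apply: (@le_trans _ _ `|cone_shift M rho|); first exact: ler_norm.
apply: (@le_trans _ _ (`|cone_shift M rho| * T)); first by rewrite ler_peMr.
by rewrite lerDl !mulr_ge0 ?(ltW M0)// (le_trans ler01).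
Qed.

Lemma window_lag T x : 1 <= T -> cone x -> window T x -> lag x <= cone_const * T.
Proof.
move=> T1 Cx /andP[_ wT]; have [[_ [hx _]] _] := Cx.
have sg := sigma_ge n M0 hx; have wE := wtime_lag x; have r0 := gt2M_gt0 M0 hx.
have h : lag x <= T + `|cone_shift M rho|.
  have : cone_shift M rho <= `|cone_shift M rho| by exact: ler_norm.
  by move: (`|_|) => a; rewrite /cone_shift; lra.
apply: le_trans h _.
have -> : cone_const * T = T + (`|cone_shift M rho| * T + 2 * M * T) by rewrite /cone_const; ring.
rewrite lerD2l.
apply: (@le_trans _ _ (`|cone_shift M rho| * T)); first by rewrite ler_peMr.
by rewrite lerDl !mulr_ge0 ?(ltW M0)// (le_trans ler01).
Qed.

Lemma sphere_area_ge0 : 0 <= area.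
Proof. exact: fine_ge0. Qed.

Let window_slab T : (cone `&` window T) `<=` slab T0.
Proof. by move=> x [[]]. Qed.

Lemma integral_window_radial (T : R) (K L L' : R -> R) (f : spacetime -> R) : 1 <= T ->
  (forall r, 2 * M < r -> {for r, continuous K}) ->
  (forall r, 2 * M < r -> 0 <= K r <= L' r) ->
  (forall r, 2 * M < r -> is_derive r 1 L (L' r)) ->
  (forall r, 2 * M < r -> {for r, continuous L'}) ->
  (forall r, 2 * M < r -> 0 <= L r) ->
  (forall z, (cone `&` window T) z -> 0 <= f z <= K z.2.1) ->
  (\int[mu3]_(z in cone `&` window T) (f z)%:E <=
   (area * (T * L (cone_const * T)))%:E)%E.
Proof.
move=> T1 cK K0 dL cL' L0 fK; have T0' : 0 < T by exact: lt_le_trans T1.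
have hB := cone_const_gt T1.
apply: (@radial_tonelli R n M T0 0 T (cone_const * T) (delay n M) (fun=> 1) id K L L') => //.
- by move=> r hr; exact: is_derive_continuous (derive_delay n3 M0 hr).
- by move=> s _; exact: cvg_cst.
- by move=> s /andP[/ltW].
- by move=> r /andP[hr _]; exact: K0.
- by move=> r /andP[hr _]; exact: dL.
- by move=> r /andP[hr _]; exact: cL'.
- by move=> r /andP[hr _]; exact: L0.
- by move=> z /fK /andP[].
move=> z zA; have [zc zw] := zA; split; last by rewrite mulr1; case/andP: (fK z zA).
  by move/andP: zw => [w1 /ltW w2]; rewrite w2 andbT (lt_le_trans _ w1)// divr_gt0.
exact: window_radius.
Qed.

Let dtort (r : R) : 2 * M < r -> {for r, continuous (fun r => rho - tortoise M r)}.
Proof.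
move=> hr; apply: continuousB; first exact: cvg_cst.
exact: is_derive_continuous (derive_tortoise M0 hr).
Qed.

Let n0 : 0 < n%:R :> R. Proof. by rewrite ltr0n (leq_trans _ n3). Qed.

(** Since the lag starts at 0, the primitive G may be taken from -1, which
    leaves an open interval for the phase. *)
Let integral_window_lag (T kap : R) (psi G : R -> R) (f : spacetime -> R) : 1 <= T -> 0 <= kap ->
  (forall s : R, -1 < s -> is_derive s 1 G (psi s)) ->
  (forall s, -1 < s -> {for s, continuous psi}) ->
  (forall s, -1 < s -> 0 <= psi s) ->
  (forall s, -1 < s -> 0 <= G s) ->
  (forall z, (cone `&` window T) z -> 0 <= f z <= kap * z.2.1 ^+ n.-1 * psi (lag z)) ->
  (\int[mu3]_(z in cone `&` window T) (f z)%:E <=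
   (area * (G (cone_const * T) * (kap / n%:R * (cone_const * T) ^+ n)))%:E)%E.
Proof.
move=> T1 kap0 dG cpsi psi0 G0 fK; have T0' : 0 < T by exact: lt_le_trans T1.
have hB := cone_const_gt T1.
have cr (r : R) : {for r, continuous (fun r : R => kap * r ^+ n.-1)}.
  by apply: continuousM; [exact: cvg_cst|exact: exprn_continuous].
apply: (@radial_tonelli R n M T0 (-1) (cone_const * T) (cone_const * T)
  (fun r => rho - tortoise M r) psi G (fun r => kap * r ^+ n.-1)
  (fun r => kap / n%:R * r ^+ n) (fun r => kap * r ^+ n.-1)) => //.
- apply: (@lt_trans _ _ 0) => //; apply: mulr_gt0 => //.
  exact: lt_trans cone_const_gt1.
- by move=> s /andP[hs _]; exact: dG.
- by move=> s /andP[hs _]; exact: cpsi.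
- by move=> s /andP[hs _]; exact: psi0.
- by move=> s /andP[hs _]; exact: G0.
- move=> r /andP[hr _]; rewrite lexx andbT mulr_ge0// exprn_ge0// ltW//.
  exact: gt2M_gt0 hr.
- move=> r _; derive_eq; first by dtac.
  by rewrite mul0r add0r mulr1 mulrA mulrVK// unitfE gt_eqF.
- move=> r /andP[hr _]; apply: mulr_ge0; first by rewrite divr_ge0// ltW.
  by rewrite exprn_ge0// ltW// (gt2M_gt0 M0 hr).
- by move=> z /fK /andP[].
move=> z zA; have [zc zw] := zA; split.
- rewrite -/(lag z) window_lag// andbT; apply: lt_le_trans (lag_ge0 zc).
  by rewrite ltrN10.
- exact: window_radius.
- by case/andP: (fK z zA).
Qed.

Lemma integral_window_exp (T kap : R) (f : spacetime -> R) : 1 <= T -> 0 <= kap ->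
  (forall z, (cone `&` window T) z -> 0 <= f z <= kap * z.2.1 ^+ n.-1 * expR (- (lag z / 2))) ->
  (\int[mu3]_(z in cone `&` window T) (f z)%:E <=
   (area * (2 * expR 1) * cone_const ^+ n * (kap * T ^+ n))%:E)%E.
Proof.
move=> T1 kap0 fK; have T0' : 0 < T by exact: lt_le_trans T1.
have cc1 := cone_const_gt1; have cc0 : 0 < cone_const by exact: lt_trans cc1.
have dd (s : R) : is_derive s 1 (fun s => 2 * (expR 1 - expR (- (s / 2)))) (expR (- (s / 2))).
  derive_eq; first by dtac.
  rewrite !mul0r !add0r.
  by field.
apply: le_trans (integral_window_lag (psi := fun s => expR (- (s / 2)))
   (G := fun s => 2 * (expR 1 - expR (- (s / 2)))) T1 kap0 _ _ _ _ fK) _.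
- move=> s _; suff [e de] : exists e, is_derive s 1 (fun s => expR (- (s / 2))) e.
    exact: is_derive_continuous de.
  by eexists; dtac.
- by move=> s _; exact: expR_ge0.
- by move=> s hs; rewrite mulr_ge0// subr_ge0 ler_expR; lra.
rewrite lee_fin -!mulrA ler_wpM2l ?sphere_area_ge0// ler_wpM2l//.
rewrite exprMn; apply: ler_pM.
- by rewrite subr_ge0 ler_expR; have := mulr_ge0 (ltW cc0) (ltW T0'); lra.
- by rewrite !mulr_ge0 ?exprn_ge0 ?invr_ge0 ?(ltW cc0) ?(ltW T0') ?(ltW n0).
- by rewrite gerBl expR_ge0.
have -> : kap * (n%:R^-1 * (cone_const ^+ n * T ^+ n)) = n%:R^-1 * (cone_const ^+ n * (kap * T ^+ n)) by ring.
rewrite ler_piMl// ?mulr_ge0 ?exprn_ge0 ?(ltW cc0) ?(ltW T0')//.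
by rewrite invf_le1// ler1n (leq_trans _ n3).
Qed.

Lemma integral_window_log (T kap : R) (f : spacetime -> R) : 1 <= T -> 0 <= kap ->
  (forall z, (cone `&` window T) z -> 0 <= f z <= kap * z.2.1 ^+ n.-1 * (2 + lag z)^-1) ->
  (\int[mu3]_(z in cone `&` window T) (f z)%:E <=
   (area * cone_const ^+ n * (ln (2 + cone_const * T) * (kap * T ^+ n)))%:E)%E.
Proof.
move=> T1 kap0 fK; have T0' : 0 < T by exact: lt_le_trans T1.
have cc1 := cone_const_gt1; have cc0 : 0 < cone_const by exact: lt_trans cc1.
have pos s : -1 < s -> 0 < 2 + s :> R by move=> h; lra.
have dd (s : R) : -1 < s -> is_derive s 1 (fun s => ln (2 + s)) ((2 + s)^-1).
  move=> /pos hs; derive_eq; first by dtac.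
  by rewrite add0r mulr1.
apply: le_trans (integral_window_lag (psi := fun s => (2 + s)^-1)
   (G := fun s => ln (2 + s)) T1 kap0 dd _ _ _ fK) _.
- move=> s /pos hs; suff [e de] : exists e, is_derive s 1 (fun s => (2 + s)^-1) e.
    exact: is_derive_continuous de.
  by eexists; dtac; rewrite gt_eqF.
- by move=> s /pos hs; rewrite invr_ge0 ltW.
- by move=> s hs; rewrite ln_ge0//; lra.
rewrite lee_fin -!mulrA ler_wpM2l ?sphere_area_ge0//.
have -> : cone_const ^+ n * (ln (2 + cone_const * T) * (kap * T ^+ n)) =
  ln (2 + cone_const * T) * (cone_const ^+ n * (kap * T ^+ n)) by ring.
apply: ler_wpM2l.
  by rewrite ln_ge0//; have := mulr_ge0 (ltW cc0) (ltW T0'); lra.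
rewrite exprMn.
have -> : kap * (n%:R^-1 * (cone_const ^+ n * T ^+ n)) = n%:R^-1 * (cone_const ^+ n * (kap * T ^+ n)) by ring.
rewrite ler_piMl// ?mulr_ge0 ?exprn_ge0 ?(ltW cc0) ?(ltW T0')//.
by rewrite invf_le1// ler1n (leq_trans _ n3).
Qed.

Section integrated_young.
Variables (u : spacetime -> R) (p q : R) (N : nat).
Hypothesis mu_ : measurable_fun (slab T0) u.
Hypothesis p1 : 1 < p.
Hypothesis pq : p^-1 + q^-1 = 1.
Hypothesis q0 : 0 < q.
Hypothesis N3 : (3 <= N)%N.
Hypothesis Np : N%:R <= N.-2%:R * p.

(** The two resulting integrals are part of the mass and a quantity that no
    longer involves u. *)
Lemma young_integral (T dl : R) (W e : spacetime -> R) : 0 < dl ->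
  measurable_fun (slab T0) W -> measurable_fun (slab T0) e ->
  (forall z, slab T0 z -> 0 < W z) -> (forall z, slab T0 z -> 0 <= e z) ->
  (\int[mu3]_(z in cone `&` window T) (`|u z| * (timecut M T z ^+ N.-2 * e z) * z.2.1 ^+ n.-1)%:E <=
   dl%:E * (\int[mu3]_(z in cone `&` window T) (`|u z| `^ p * (timecut M T z ^+ N * W z) * z.2.1 ^+ n.-1)%:E)
   + (dl `^ (1 - q))%:E *
     (\int[mu3]_(z in cone `&` window T) (e z `^ q * W z `^ (1 - q) * z.2.1 ^+ n.-1)%:E))%E.
Proof.
move=> dl0 mW me W0 e0.
have AS : (cone `&` window T) `<=` slab T0 := @window_slab T.
have mA := measurable_cone_window n3 M0 rho T0 T.
have mS := @measurable_slab R n M T0.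
have mr : measurable_fun (slab T0) (fun z : spacetime => z.2.1 ^+ n.-1).
  by apply: (@measurable_radial R n M T0 (fun r => r ^+ n.-1)) => r _; exact: exprn_continuous.
have mcut : measurable_fun (slab T0) (timecut M T) by exact: measurable_timecut.
have mpow (f : spacetime -> R) a : measurable_fun (slab T0) f -> measurable_fun (slab T0) (fun z => f z `^ a).
  by move=> mf; apply: (measurableT_comp (f := fun x => x `^ a)) => //; exact: measurable_powR.
have r_ge0 z : slab T0 z -> 0 <= z.2.1 ^+ n.-1.
  by move=> [_ [hz _]]; rewrite exprn_ge0// ltW// (gt2M_gt0 M0 hz).
have f1_ge0 z : slab T0 z -> 0 <= `|u z| `^ p * (timecut M T z ^+ N * W z) * z.2.1 ^+ n.-1.
  move=> Sz; rewrite mulr_ge0 ?r_ge0// mulr_ge0 ?powR_ge0// mulr_ge0 ?(ltW (W0 _ Sz))//.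
  by rewrite exprn_ge0 ?cutbase_ge0.
have f2_ge0 z : slab T0 z -> 0 <= e z `^ q * W z `^ (1 - q) * z.2.1 ^+ n.-1.
  by move=> Sz; rewrite !mulr_ge0 ?powR_ge0 ?r_ge0.
have mf1 : measurable_fun (slab T0) (fun z => `|u z| `^ p * (timecut M T z ^+ N * W z) * z.2.1 ^+ n.-1).
  apply: measurable_funM => //; apply: measurable_funM.
    by apply: mpow; exact: measurableT_comp.
  by apply: measurable_funM => //; exact: measurable_funX.
have mf2 : measurable_fun (slab T0) (fun z => e z `^ q * W z `^ (1 - q) * z.2.1 ^+ n.-1).
  by apply: measurable_funM => //; apply: measurable_funM; exact: mpow.
have mf1A := measurable_funS mS AS mf1.
have mf2A := measurable_funS mS AS mf2.
rewrite -!ge0_integralZl_EFin//; last 6 first.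
- by move=> z /AS; exact: f2_ge0.
- exact/measurable_EFinP.
- exact: powR_ge0.
- by move=> z /AS; exact: f1_ge0.
- exact/measurable_EFinP.
- exact: ltW.
rewrite -ge0_integralD//; last 4 first.
- by move=> z /AS Sz; rewrite mule_ge0// lee_fin ?(ltW dl0)// f1_ge0.
- by apply: measurable_funeM; exact/measurable_EFinP.
- by move=> z /AS Sz; rewrite mule_ge0// lee_fin ?powR_ge0// f2_ge0.
- by apply: measurable_funeM; exact/measurable_EFinP.
apply: le_integral_nomeas => z /AS Sz.
  rewrite lee_fin mulr_ge0 ?r_ge0// mulr_ge0// mulr_ge0 ?e0//.
  by rewrite exprn_ge0 ?cutbase_ge0.
rewrite -!EFinM -EFinD lee_fin.
have := young_weighted p1 pq q0 N3 Np (normr_ge0 (u z)) (_ : 0 <= timecut M T z <= 1) (W0 z Sz) (e0 z Sz) dl0.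
rewrite cutbase_ge0 cutbase_le1 => /(_ isT) h.
by apply: le_trans (ler_wpM2r (r_ge0 _ Sz) h) _; rewrite mulrDl !mulrA.
Qed.

End integrated_young.

End cone_estimates.

Section uniform_estimates.
Context {R : realType} (n : nat) (M : R) (D V : R -> R).
Hypothesis n3 : (3 <= n)%N.
Hypothesis M0 : 0 < M.
Variables (Cz : R) (zf z1 z2 : R -> R -> R).
Hypothesis Cz0 : 0 < Cz.
Hypothesis rm : radial_modes n M D V Cz zf z1 z2.
Variable rho : R.
Hypothesis rho0 : 0 < rho.
Local Notation k := (@half_dim R n).
Local Notation spacetime := (R * (R * 'rV[R]_n))%type.
Local Notation slab := (@slab R n M).
Local Notation mu3 := (@dt_dr_dw R n).
Local Notation w := (wtime M).
Local Notation cone T0 := (cone M rho T0 : set spacetime).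
Local Notation window := (@window R n M).
Local Notation mode := (@mode R n M zf).
Local Notation area := (@sphere_area R n).
Local Notation lag := (@lag R n M rho).
Local Notation cone_const := (cone_const M rho).

Let ccst0 : 0 < cone_const.
Proof. by apply: (@lt_trans _ _ 1) => //; exact: cone_const_gt1. Qed.

(** From z <= C exp(lambda sigma)(1 + lambda r)^(-k) and w = sigma + lag - rho:
    the exponentials combine to exp(- lambda lag), and the decay in r is traded
    for decay in w, at the price of (1 + lambda lag)^k, because
    1 + lambda w <= C (1 + lambda r)(1 + lambda lag); half of the exponential
    absorbs this factor. *)
Lemma mode_le : exists2 Cm : R, 0 < Cm & forall (T0 lam : R) x, 0 <= lam <= 1 -> cone T0 x ->
  mode lam x <= Cm * (1 + lam * w x) `^ (- k) * expR (- (lam * lag x / 2)).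
Proof.
have k1 : 1 <= k by exact: half_dim_ge1.
have k0 : 0 < k by exact: lt_le_trans k1.
pose Cs : R := 1 + 2 * M + logtail n 1.
have Cs1 : 1 <= Cs.
  by rewrite /Cs -addrA lerDl addr_ge0 ?logtail_ge0// mulr_ge0// ltW.
have Cs0 : 0 < Cs by exact: lt_le_trans Cs1.
exists (Cz * expR rho * (Cs `^ k * (2 * k) `^ k)).
  by rewrite !mulr_gt0 ?powR_gt0 ?expR_gt0// mulr_gt0.
move=> T0 lam x l01 Cx; have [l0 l1] := andP l01.
have [Sx _] := Cx; have [_ [hx _]] := Sx; have r0 := gt2M_gt0 M0 hx.
have s0 := lag_ge0 Cx; have w0 := wtime_ge0 M0 Sx.
have wE := wtime_lag M rho x; have sle := sigma_le n M0 hx; rewrite -/Cs in sle.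
have zle := rm_le rm l01 hx.
set r := x.2.1 in wE sle zle hx r0 *; set s := lag x in s0 wE *.
have lr0 : 0 < 1 + lam * r by rewrite ltr_pwDl// mulr_ge0// ltW.
have ls0 : 0 < 1 + lam * s by rewrite ltr_pwDl// mulr_ge0.
have lw0 : 0 < 1 + lam * w x by rewrite ltr_pwDl// mulr_ge0.
have A1 : (1 + lam * r) `^ (- k) <= Cs `^ k * (1 + lam * s) `^ k * (1 + lam * w x) `^ (- k).
  rewrite !powRN ler_pdivlMr ?powR_gt0// mulrC ler_pdivrMr ?powR_gt0//.
  rewrite -!powRM ?mulr_ge0 ?(ltW lr0) ?(ltW ls0) ?(ltW Cs0)//.
  apply: powRge0_mono; rewrite ?(ltW k0) ?(ltW lw0)//.
  have h : lam * w x <= lam * (Cs * r + s) by rewrite ler_wpM2l// wE lerBlDr (le_trans (lerD sle (lexx s)))// lerDl ltW.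
  apply: (@le_trans _ _ (1 + lam * (Cs * r + s))); first by rewrite lerD2l.
  rewrite -subr_ge0.
  have -> : Cs * (1 + lam * s) * (1 + lam * r) - (1 + lam * (Cs * r + s)) =
    (Cs - 1) * (1 + lam * s) + Cs * (lam * r) * (lam * s) by ring.
  apply: addr_ge0; first by rewrite mulr_ge0 ?(ltW ls0)// subr_ge0.
  by rewrite !mulr_ge0 ?(ltW Cs0) ?(ltW r0).
have A2 : (1 + lam * s) `^ k <= (2 * k) `^ k * expR (lam * s / 2).
  by apply: powR_exp_le => //; rewrite mulr_ge0.
rewrite /mode -/r.
apply: (@le_trans _ _ (expR (- (lam * w x)) * (Cz * expR (lam * sigma n M r) *
   (Cs `^ k * ((2 * k) `^ k * expR (lam * s / 2)) * (1 + lam * w x) `^ (- k))))).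
  apply: ler_wpM2l; first exact: expR_ge0.
  apply: le_trans zle _; apply: ler_wpM2l; first by rewrite mulr_ge0 ?expR_ge0// ltW.
  by apply: le_trans A1 _; apply: ler_wpM2r; rewrite ?powR_ge0//; apply: ler_wpM2l; rewrite ?powR_ge0.
have E : expR (- (lam * w x)) * expR (lam * sigma n M r) * expR (lam * s / 2) =
   expR (lam * rho) * expR (- (lam * s / 2)).
  rewrite -!expRD; congr expR; rewrite wE; by field.
have -> : expR (- (lam * w x)) * (Cz * expR (lam * sigma n M r) *
   (Cs `^ k * ((2 * k) `^ k * expR (lam * s / 2)) * (1 + lam * w x) `^ (- k)))
  = Cz * (Cs `^ k * (2 * k) `^ k) * (1 + lam * w x) `^ (- k) *
   (expR (- (lam * w x)) * expR (lam * sigma n M r) * expR (lam * s / 2)) by ring.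
rewrite E.
have -> : Cz * expR rho * (Cs `^ k * (2 * k) `^ k) * (1 + lam * w x) `^ (- k) * expR (- (lam * s / 2))
  = Cz * (Cs `^ k * (2 * k) `^ k) * (1 + lam * w x) `^ (- k) * (expR rho * expR (- (lam * s / 2))) by ring.
rewrite ler_wpM2l ?mulr_ge0 ?powR_ge0 ?(ltW Cz0)// ler_wpM2r ?expR_ge0// ler_expR.
by rewrite ler_piMl// ltW.
Qed.

(** The time integral contributes the factor T. For q < n the radial integral is
    a power T^(n-q); for q >= n the integrand is merely bounded by its value at
    the horizon, which costs another T. *)
Lemma window_radial_power (q : R) : 0 < q -> exists2 C : R, 0 < C &
  forall (T0 T kap : R) (f : spacetime -> R), 1 <= T -> 0 <= kap ->
  (forall z, (cone T0 `&` window T) z -> 0 <= f z <= kap * z.2.1 `^ (n.-1%:R - q)) ->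
  (\int[mu3]_(z in cone T0 `&` window T) (f z)%:E <=
    (C * (kap * T `^ (1 + (if q < n%:R then n%:R - q else 1))))%:E)%E.
Proof.
move=> q0; have cc0 := ccst0.
have M20 : 0 < 2 * M by rewrite mulr_gt0.
have n1 : n.-1%:R = n%:R - 1 :> R by rewrite -subn1 natrB// (leq_trans _ n3).
have cpow (a : R) r : 2 * M < r -> {for r, continuous (fun r => r `^ a)}.
  move=> hr; have r0 := gt2M_gt0 M0 hr.
  suff [e de] : exists e, is_derive r 1 (fun r => r `^ a) e by exact: is_derive_continuous de.
  by eexists; dtac.
case: ifPn => [qn|]; last rewrite -leNgt => nq.
  have nq0 : 0 < n%:R - q by rewrite subr_gt0.
  exists ((area + 1) * (cone_const `^ (n%:R - q) / (n%:R - q))).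
    by rewrite mulr_gt0 ?divr_gt0 ?powR_gt0// ltr_wpDl ?sphere_area_ge0.
  move=> T0 T kap f T1 kap0 fK; have T0' : 0 < T by exact: lt_le_trans T1.
  apply: le_trans (integral_window_radial n3 M0 (K := fun r => kap * r `^ (n.-1%:R - q))
    (L' := fun r => kap * r `^ (n.-1%:R - q)) (L := fun r => kap * (r `^ (n%:R - q) / (n%:R - q)))
    T1 _ _ _ _ _ fK) _.
  - by move=> r hr; apply: continuousM; [exact: cvg_cst|exact: cpow].
  - by move=> r hr; rewrite lexx andbT mulr_ge0// powR_ge0.
  - move=> r hr; have r0 := gt2M_gt0 M0 hr; derive_eq; first by dtac.
    rewrite mul0r add0r mulr0 addr0 mulr1 /= mulrAC divff ?gt_eqF// mul1r.
    by rewrite n1 addrAC.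
  - by move=> r hr; apply: continuousM; [exact: cvg_cst|exact: cpow].
  - by move=> r hr; rewrite mulr_ge0// divr_ge0 ?powR_ge0// ltW.
  rewrite lee_fin powRM ?(ltW cc0) ?(ltW T0')// powR1D//.
  set P := cone_const `^ _; set Q := T `^ _.
  have -> : area * (T * (kap * (P * Q / (n%:R - q)))) = area * (P / (n%:R - q) * (kap * (T * Q))) by ring.
  have -> : (area + 1) * (P / (n%:R - q)) * (kap * (T * Q)) = (area + 1) * (P / (n%:R - q) * (kap * (T * Q))) by ring.
  apply: ler_wpM2r; last by rewrite lerDl.
  by rewrite !mulr_ge0 ?powR_ge0 ?invr_ge0 ?(ltW nq0) ?(ltW T0').
exists ((area + 1) * ((2 * M) `^ (n.-1%:R - q) * cone_const)).
  by rewrite mulr_gt0 ?mulr_gt0 ?powR_gt0// ltr_wpDl ?sphere_area_ge0.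
move=> T0 T kap f T1 kap0 fK; have T0' : 0 < T by exact: lt_le_trans T1.
apply: le_trans (integral_window_radial n3 M0 (K := fun r => kap * r `^ (n.-1%:R - q))
    (L' := fun r => kap * (2 * M) `^ (n.-1%:R - q)) (L := fun r => kap * (2 * M) `^ (n.-1%:R - q) * r)
    T1 _ _ _ _ _ fK) _.
- by move=> r hr; apply: continuousM; [exact: cvg_cst|exact: cpow].
- move=> r hr; rewrite mulr_ge0 ?powR_ge0//= ler_wpM2l//.
  have -> : n.-1%:R - q = - (q - n.-1%:R) by rewrite opprB.
  by rewrite powRneg_mono ?(ltW hr)// subr_ge0 (le_trans _ nq)// n1 gerBl.
- move=> r hr; derive_eq; first by dtac.
  by rewrite !mul0r add0r mulr1.
- by move=> r hr; exact: cvg_cst.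
- by move=> r hr; rewrite mulr_ge0 ?mulr_ge0 ?powR_ge0// ltW// (gt2M_gt0 M0 hr).
rewrite lee_fin powR1D// powRr1 ?(ltW T0')//.
set P := (2 * M) `^ _.
have -> : area * (T * (kap * P * (cone_const * T))) = area * (P * cone_const * (kap * (T * T))) by ring.
rewrite -[leRHS]mulrA; apply: ler_wpM2r; last by rewrite lerDl.
by rewrite !mulr_ge0 ?powR_ge0 ?(ltW cc0) ?(ltW T0').
Qed.

(** The bound of adjoint_mode_bound without its cutoff factor. *)
Definition flow (C lam T : R) (z : spacetime) : R := C * mode lam z * (z.2.1^-1 + lam) / T.

Lemma mode_pos (T0 lam : R) z : 0 <= lam <= 1 -> slab T0 z -> 0 < mode lam z.
Proof. exact: mode_gt0 rm _ _ _. Qed.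

Lemma flow_ge0 (C lam T T0 : R) z : 0 <= C -> 0 <= lam <= 1 -> 0 < T -> slab T0 z -> 0 <= flow C lam T z.
Proof.
move=> C0 l01 T1 Sz; have m0 := mode_pos l01 Sz; have r0 := gt2M_gt0 M0 Sz.2.1.
have [l0 _] := andP l01; rewrite /flow; move: (mode lam z) m0 => m m0.
by rewrite !mulr_ge0 ?invr_ge0 ?(ltW m0) ?(ltW T1)// addr_ge0// invr_ge0 ltW.
Qed.

Lemma mode0E z : mode 0 z = zf 0 z.2.1.
Proof. by rewrite /mode mul0r oppr0 expR0 mul1r. Qed.

Lemma mode0_bounds T0 z : slab T0 z -> 1 <= mode 0 z <= Cz.
Proof.
move=> [_ [hz _]]; have l0 : 0 <= (0 : R) <= 1 by rewrite lexx ler01.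
rewrite mode0E (rm_ge1 rm l0 hz)/=; apply: le_trans (rm_le rm l0 hz) _.
by rewrite !mul0r expR0 addr0 powR1 !mulr1.
Qed.

(** For lambda = 0 the mode is bounded above and below, so the integrand is
    (1/(r T))^q r^(n-1). *)
Lemma flow0_estimate (C q : R) : 0 < C -> 0 < q -> exists2 C' : R, 0 < C' &
  forall T0 T : R, 1 <= T ->
  (\int[mu3]_(z in cone T0 `&` window T)
     (flow C 0 T z `^ q * mode 0 z `^ (1 - q) * z.2.1 ^+ n.-1)%:E <=
   (C' * T `^ (1 - q + (if q < n%:R then n%:R - q else 1)))%:E)%E.
Proof.
move=> C0 q0; have [C1 C10 H] := window_radial_power q0.
exists (C1 * (C `^ q * Cz)); first by rewrite !mulr_gt0 ?powR_gt0.
move=> T0 T T1; have T0' : 0 < T by exact: lt_le_trans T1.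
have -> : C1 * (C `^ q * Cz) * T `^ (1 - q + (if q < n%:R then n%:R - q else 1)) =
  C1 * (C `^ q * Cz * T `^ (- q) * T `^ (1 + (if q < n%:R then n%:R - q else 1))).
  rewrite -!mulrA; congr (_ * (_ * (_ * _))); rewrite -powRD ?(gt_eqF T0') ?implybT//.
  congr (_ `^ _); ring.
apply: H => //; first by rewrite !mulr_ge0 ?powR_ge0// ltW.
move=> z [[Sz _] _]; have r0 := gt2M_gt0 M0 Sz.2.1; have /andP[m1 mC] := mode0_bounds Sz.
have l0 : 0 <= (0 : R) <= 1 by rewrite lexx ler01.
have f0 := flow_ge0 (ltW C0) l0 T0' Sz.
apply/andP; split.
  by rewrite !mulr_ge0 ?powR_ge0 ?exprn_ge0// ltW.
rewrite /flow addr0; move: (mode 0 z) m1 mC => m m1 mC {f0}.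
have m0 : 0 < m by exact: lt_le_trans m1.
rewrite !powRM ?mulr_ge0 ?invr_ge0 ?(ltW C0) ?(ltW m0) ?(ltW r0) ?(ltW T0')//.
have mE : m `^ q * m `^ (1 - q) = m.
  by rewrite -powRD ?(gt_eqF m0) ?implybT// addrCA subrr addr0 powRr1// ltW.
have inv_pow x : 0 < x -> x^-1 `^ q = x `^ (- q).
  by move=> x0; rewrite -powR_inv1 ?(ltW x0)// -powRrM mulN1r.
have -> : z.2.1 `^ (n.-1%:R - q) = z.2.1 ^+ n.-1 * z.2.1 `^ (- q).
  by rewrite powRD ?(gt_eqF r0) ?implybT// powR_mulrn// ltW.
rewrite !inv_pow//.
have -> : C `^ q * m `^ q * z.2.1 `^ (- q) * T `^ (- q) * m `^ (1 - q) * z.2.1 ^+ n.-1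
  = C `^ q * (m `^ q * m `^ (1 - q)) * T `^ (- q) * (z.2.1 ^+ n.-1 * z.2.1 `^ (- q)) by ring.
rewrite mE ler_wpM2r ?mulr_ge0 ?powR_ge0 ?exprn_ge0 ?(ltW r0)//.
by rewrite ler_wpM2r ?powR_ge0// ler_wpM2l ?powR_ge0.
Qed.

(** For lambda = 1 the mode is concentrated near the light cone, where it has
    size T^(-k); the integral in the lag is bounded and r^(n-1) dr gives T^n,
    against T^(-q(1+k)). The weight W is arbitrary so that
    the estimate serves both the mode 0 and the superposition. *)
Lemma flow1_estimate (C q : R) : 0 < C -> 1 < q -> exists2 C' : R, 0 < C' &
  forall (T0 T om : R) (W : spacetime -> R), 1 <= T -> 0 < om ->
  (forall z, (cone T0 `&` window T) z -> om <= W z) ->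
  (\int[mu3]_(z in cone T0 `&` window T)
     (flow C 1 T z `^ q * W z `^ (1 - q) * z.2.1 ^+ n.-1)%:E <=
   (C' * (om `^ (1 - q) * T `^ (n%:R - q * (1 + k))))%:E)%E.
Proof.
move=> C0 q1; have q0 : 0 < q by exact: lt_trans q1.
have k0 : 0 < k by apply: lt_le_trans (@half_dim_ge1 R n n3).
have [Cm Cm0 mle] := mode_le.
have M20 : 0 < 2 * M by rewrite mulr_gt0.
pose C1 := C * Cm * ((2 * M)^-1 + 1) * 2 `^ k.
have C10 : 0 < C1 by rewrite !mulr_gt0 ?powR_gt0// addr_gt0// invr_gt0.
exists ((area + 1) * (2 * expR 1) * cone_const ^+ n * C1 `^ q).
  have cc0 := ccst0.
  by rewrite !mulr_gt0 ?expR_gt0 ?exprn_gt0 ?powR_gt0// ltr_wpDl ?sphere_area_ge0.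
move=> T0 T om W T1 om0 Wom; have T0' : 0 < T by exact: lt_le_trans T1.
apply: le_trans (integral_window_exp n3 M0 (kap := C1 `^ q * T `^ (- (q * (1 + k))) * om `^ (1 - q)) T1 _ _) _.
- by rewrite !mulr_ge0 ?powR_ge0.
- move=> z zA; have [zc /andP[zw _]] := zA; have [Sz _] := zc.
  have r0 := gt2M_gt0 M0 Sz.2.1; have hz := Sz.2.1.
  have l1 : 0 <= (1 : R) <= 1 by rewrite ler01 lexx.
  have f0 := flow_ge0 (ltW C0) l1 T0' Sz.
  have Wp := lt_le_trans om0 (Wom z zA).
  have lz := lag_ge0 zc.
  apply/andP; split; first by rewrite !mulr_ge0 ?powR_ge0 ?exprn_ge0// ltW.
  have fle : flow C 1 T z <= C1 * T `^ (- (1 + k)) * expR (- (lag z / 2)).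
    have h1 := mle T0 1 z l1 zc; rewrite !mul1r in h1.
    have h2 : (1 + w z) `^ (- k) <= 2 `^ k * T `^ (- k).
      have -> : 2 `^ k * T `^ (- k) = (T / 2) `^ (- k).
        rewrite powRM ?invr_ge0 ?(ltW T0')// mulrC; congr (_ * _).
        have <- : (2 : R) `^ (- 1) = 2^-1 by rewrite powR_inv1.
        by rewrite -powRrM mulN1r opprK.
      apply: powRneg_mono; rewrite ?(ltW k0) ?divr_gt0//.
      by rewrite (le_trans zw)// lerDr.
    have h3 : z.2.1^-1 <= (2 * M)^-1 by rewrite lef_pV2 ?posrE// ltW.
    rewrite /flow.
    have -> : - (1 + k) = - 1 + - k by rewrite opprD.
    rewrite powRD ?(gt_eqF T0') ?implybT// powR_inv1 ?(ltW T0')//.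
    have -> : C1 * (T^-1 * T `^ (- k)) * expR (- (lag z / 2)) =
      C * (Cm * (2 `^ k * T `^ (- k)) * expR (- (lag z / 2))) * ((2 * M)^-1 + 1) / T.
      by rewrite /C1; ring.
    rewrite ler_wpM2r ?invr_ge0 ?(ltW T0')//.
    apply: ler_pM; rewrite ?lerD2r//.
    + by rewrite mulr_ge0 ?(ltW C0)// ltW// (mode_pos l1 Sz).
    + by rewrite addr_ge0// invr_ge0 ltW.
    rewrite ler_wpM2l ?(ltW C0)// (le_trans h1)// ler_wpM2r ?expR_ge0//.
    by rewrite ler_wpM2l// ltW.
  have fq : flow C 1 T z `^ q <= C1 `^ q * T `^ (- (q * (1 + k))) * expR (- (lag z / 2)).
    apply: le_trans (powRge0_mono (ltW q0) f0 fle) _.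
    rewrite (powRM _ (mulr_ge0 (ltW C10) (powR_ge0 _ _)) (expR_ge0 _)) (powRM _ (ltW C10) (powR_ge0 _ _)) -powRrM.
    have -> : - (1 + k) * q = - (q * (1 + k)) by ring.
    rewrite ler_wpM2l ?mulr_ge0 ?powR_ge0// -expRM ler_expR mulNr lerN2.
    by rewrite ler_peMr ?(ltW q1)// divr_ge0.
  have Wq : W z `^ (1 - q) <= om `^ (1 - q).
    have -> : 1 - q = - (q - 1) by rewrite opprB.
    by rewrite powRneg_mono ?Wom// subr_ge0 ltW.
  have -> : C1 `^ q * T `^ (- (q * (1 + k))) * om `^ (1 - q) * z.2.1 ^+ n.-1 * expR (- (lag z / 2))
    = (C1 `^ q * T `^ (- (q * (1 + k))) * expR (- (lag z / 2))) * om `^ (1 - q) * z.2.1 ^+ n.-1 by ring.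
  rewrite ler_wpM2r ?exprn_ge0 ?(ltW r0)//.
  by apply: ler_pM; rewrite ?powR_ge0.
have -> : T `^ (n%:R - q * (1 + k)) = T ^+ n * T `^ (- (q * (1 + k))).
  by rewrite powRD ?(gt_eqF T0') ?implybT// powR_mulrn// ltW.
rewrite lee_fin.
have -> : (area + 1) * (2 * expR 1) * cone_const ^+ n * C1 `^ q * (om `^ (1 - q) * (T ^+ n * T `^ (- (q * (1 + k)))))
  = (area + 1) * ((2 * expR 1) * cone_const ^+ n * (C1 `^ q * T `^ (- (q * (1 + k))) * om `^ (1 - q) * T ^+ n)) by ring.
rewrite -!mulrA; apply: ler_wpM2r; last by rewrite lerDl.
have cc0 := ccst0.
by rewrite !mulr_ge0 ?powR_ge0 ?exprn_ge0 ?expR_ge0 ?(ltW cc0) ?(ltW T0').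
Qed.

End uniform_estimates.

(** * The subcritical lifespan *)

Lemma cutoff_power {R : realType} (p : R) : 1 < p ->
  exists N : nat, (3 <= N)%N /\ N%:R <= N.-2%:R * p.
Proof.
move=> p1; have p10 : 0 < p - 1 by rewrite subr_gt0.
pose m := (Num.truncn (2 / (p - 1))).+1.
exists m.+2; split => //=.
have h : 2 / (p - 1) < m%:R by exact: truncnS_gt.
rewrite ltr_pdivrMr// in h.
have -> : m.+2%:R = m%:R + 2 :> R by rewrite -addn2 natrD.
lra.
Qed.

Lemma power_time_bound {R : realType} (C T1 kap eps T0 : R) : 0 < C -> 1 <= T1 -> 0 < kap -> 0 < eps ->
  (forall T, T1 <= T < T0 -> eps <= C * T `^ (- kap)) ->
  T0 <= Num.max T1 ((C / eps) `^ kap^-1).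
Proof.
move=> C0 T11 kap0 eps0 H; rewrite leNgt; apply/negP => h.
set m := Num.max _ _ in h.
have T10 : 0 < T1 by exact: lt_le_trans T11.
have m1 : T1 <= m by rewrite le_max lexx.
have m2 : (C / eps) `^ kap^-1 <= m by rewrite le_max lexx orbT.
have m0 : 0 < m by exact: lt_le_trans m1.
pose T := (m + T0) / 2.
have mT : m < T by rewrite /T; lra.
have TT0 : T < T0 by rewrite /T; lra.
have T0' : 0 < T by exact: lt_trans mT.
have := H T; rewrite (le_trans m1 (ltW mT)) TT0 => /(_ isT).
apply/negP; rewrite -ltNge powRN ltr_pdivrMr ?powR_gt0// mulrC -ltr_pdivrMr//.
have -> : C / eps = ((C / eps) `^ kap^-1) `^ kap.
  by rewrite -powRrM mulVf ?gt_eqF// powRr1// divr_ge0// ltW.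
have : (C / eps) `^ kap^-1 < T by exact: le_lt_trans mT.
by apply: gt0_ltr_powR; rewrite // ?nnegrE ?powR_ge0// ltW.
Qed.

Section solutions.
Context {R : realType} (n : nat) (M mu d : R) (D V : R -> R).
Hypothesis n3 : (3 <= n)%N.
Hypothesis M0 : 0 < M.
Hypothesis mu0 : 0 <= mu.
Hypothesis d0 : 0 < d.
Hypothesis d1 : d <= 2^-1.
Hypothesis cD : forall r, 2 * M < r -> {for r, continuous D}.
Hypothesis cV : forall r, 2 * M < r -> {for r, continuous V}.
Hypothesis D_bnd : forall r, 2 * M < r -> 0 <= D r <= mu * (r `^ (- d) / r).
Hypothesis V_bnd : forall r, 2 * M < r -> 0 <= V r <= mu * (r `^ (- d) / r ^+ 2).
Local Notation k := (@half_dim R n).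
Local Notation space := (R * 'rV[R]_n)%type.
Local Notation spacetime := (R * (R * 'rV[R]_n))%type.
Local Notation slab := (@slab R n M).
Local Notation mu3 := (@dt_dr_dw R n).
Variables (rho : R) (u0 u1 : space -> R).
Hypothesis rho0 : 0 < rho.
Hypothesis u0_ge0 : ae_Omega M (fun x => 0 <= u0 x).
Hypothesis u1_ge0 : ae_Omega M (fun x => 0 <= u1 x).
Hypothesis u0_L1 : L1loc_Omega M u0.
Hypothesis u1_L1 : L1loc_Omega M u1.
Hypothesis u1_nt : ~ ae_Omega M (fun x => u1 x = 0).
Local Notation cone T0 := (cone M rho T0 : set spacetime).
Local Notation window := (@window R n M).

Section exponents.
Variables (p q : R).
Hypothesis p1 : 1 < p.
Hypothesis pq : p^-1 + q^-1 = 1.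
Hypothesis q1 : 1 < q.

(** One package of constants, uniform in the solution, in eps and in lambda,
    with the key inequality they satisfy. The lower bound c0 on the data term is
    stated for lambda = 1 alone. *)
Record test_modes (N : nat) (Cz : R) (zf z1 z2 : R -> R -> R) (C c0 T1 : R) : Prop := TestModes {
  tm_Cz : 0 < Cz;
  tm_rm : radial_modes n M D V Cz zf z1 z2;
  tm_N3 : (3 <= N)%N;
  tm_N : N%:R <= N.-2%:R * p;
  tm_C : 0 < C;
  tm_c0 : 0 < c0;
  tm_T1 : 1 <= T1;
  tm_ineq : forall (eps T0 : R) (u : spacetime -> R), 0 < eps ->
    weak_solution M D V p u0 u1 eps T0 u ->
    (forall t, 0 < t < T0 -> ess_supp M (fun x => u (t, x)) `<=` tortoise_ball M (t + rho)) ->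
    forall (lam T : R), 0 <= lam <= 1 -> T1 <= T < T0 ->
    (source_mass M rho N p T0 u T (mode M zf lam) < +oo)%E /\
    exists dd : R, [/\ 0 <= dd,
     (source_mass M rho N p T0 u T (mode M zf lam) + (eps * dd)%:E <=
      \int[mu3]_(z in cone T0 `&` window T)
       (`|u z| * (timecut M T z ^+ N.-2 * flow M zf C lam T z) * z.2.1 ^+ n.-1)%:E)%E &
     lam = 1 -> c0 <= dd] }.

Lemma test_modes_exist : exists N Cz zf z1 z2 C c0 T1, test_modes N Cz zf z1 z2 C c0 T1.
Proof.
have [N [N3 Np]] := cutoff_power p1.
have [Cz [zf [z1 [z2 [Cz0 rm]]]]] := radial_modes_exist n3 M0 mu0 d0 d1 cD cV D_bnd V_bnd.
have [C C0 adjb] := adjoint_mode_bound n3 M0 mu0 d0 D_bnd Cz0 rm rho N3.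
have [a [b [ha ab I0]]] := data_shell M0 u1_L1 u1_nt.
set I := fine _ in I0.
pose c0 := expR (- delay n M a) * I.
pose T1 : R := Num.max 1 (Num.max (2 * delay n M a) b).
exists N, Cz, zf, z1, z2, C, c0, T1; split => //.
- by rewrite mulr_gt0 ?expR_gt0.
- by rewrite le_max lexx.
move=> eps T0 u eps0 usol usupp lam T l01 /andP[T1T TT0].
have [h1 h2 h3] : [/\ 1 <= T, 2 * delay n M a <= T & b <= T].
  by move: T1T; rewrite !ge_max => /and3P[].
have T12 : 1 <= T < T0 by rewrite h1.
have [fin [dd [dd0 ineq dat]]] := key_inequality n3 M0 cD cV D_bnd rm N3 usol usupp
  u0_ge0 u1_ge0 u0_L1 u1_L1 adjb C0 (ltW eps0) l01 T12.
split => //; exists dd; split => // lamE.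
by apply: le_trans (dat a b ha h2 h3); rewrite lamE mul1r.
Qed.

Let window_cone T0 T : (cone T0 `&` window T) `<=` cone T0. Proof. by move=> z []. Qed.

Lemma measurable_flow Cz zf z1 z2 C lam T T0 : radial_modes n M D V Cz zf z1 z2 ->
  0 <= lam <= 1 -> measurable_fun (slab T0) (flow M zf C lam T).
Proof.
move=> rm l01; apply: measurable_funM => //.
apply: measurable_funM.
  apply: measurable_funM; first exact: measurable_cst.
  have mm : measurable_fun (slab T0) (mode M zf lam) by exact: (measurable_mode n3 M0 rm l01).
  exact: mm.
apply: measurable_funD => //; apply: (@measurable_radial R n M T0 (fun r => r^-1)) => r hr.
have r0 := gt2M_gt0 M0 hr.
suff [e de] : exists e, is_derive r 1 (fun r => r^-1) e by exact: is_derive_continuous de.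
by eexists; dtac; rewrite gt_eqF.
Qed.

Let mass_ge0 (N : nat) (T T0 : R) (u W : spacetime -> R) z : (forall z, slab T0 z -> 0 < W z) -> slab T0 z ->
  0 <= `|u z| `^ p * (timecut M T z ^+ N * W z) * z.2.1 ^+ n.-1.
Proof.
move=> W0 Sz; rewrite !mulr_ge0 ?powR_ge0 ?exprn_ge0 ?cutbase_ge0 ?(ltW (W0 _ Sz))//.
by rewrite ltW// (gt2M_gt0 M0 Sz.2.1).
Qed.

Lemma young_step (N : nat) (T0 T dl I : R) (u W e : spacetime -> R) :
  (3 <= N)%N -> N%:R <= N.-2%:R * p -> 0 < dl ->
  measurable_fun (slab T0) u -> measurable_fun (slab T0) W -> measurable_fun (slab T0) e ->
  (forall z, slab T0 z -> 0 < W z) -> (forall z, slab T0 z -> 0 <= e z) ->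
  (\int[mu3]_(z in cone T0 `&` window T) (e z `^ q * W z `^ (1 - q) * z.2.1 ^+ n.-1)%:E <= I%:E)%E ->
  (\int[mu3]_(z in cone T0 `&` window T) (`|u z| * (timecut M T z ^+ N.-2 * e z) * z.2.1 ^+ n.-1)%:E
    <= dl%:E * source_mass M rho N p T0 u T W + (dl `^ (1 - q) * I)%:E)%E.
Proof.
move=> N3 Np dl0 mu_ mW me W0 e0 HI.
have q0 : 0 < q by exact: lt_trans q1.
apply: le_trans (young_integral n3 M0 rho mu_ p1 pq q0 N3 Np T dl0 mW me W0 e0) _.
apply: leeD; last by rewrite EFinM; apply: lee_wpmul2l => //; rewrite lee_fin powR_ge0.
apply: lee_wpmul2l; first by rewrite lee_fin ltW.
apply: subset_integral_nomeas; first exact: window_cone.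
by move=> z [Sz _]; rewrite lee_fin; exact: (mass_ge0 N T u W0 Sz).
Qed.

(** Exponents of T: slope0 for the mass seen by the mode lambda = 0, slope1 for
    the flow of the mode lambda = 1. *)
Definition slope0 : R := 1 - q + (if q < n%:R then n%:R - q else 1).
Definition slope1 : R := n%:R - q * (1 + k).

(** The mode 0 bounds the mass by T^slope0 since its flow can be absorbed. The
    mode 1 carries the data, and its flow is estimated by Young's inequality
    against the mass of the mode 0. *)
Lemma two_scale_inequality : exists C T1 : R, [/\ 0 < C, 1 <= T1 &
  forall eps T0 : R, 0 < eps -> admissible_time M D V p u0 u1 rho eps T0 ->
  forall T dl : R, T1 <= T < T0 -> 0 < dl ->
  eps <= C * (dl * T `^ slope0 + dl `^ (1 - q) * T `^ slope1)].
Proof.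
have q0 : 0 < q by exact: lt_trans q1.
have [N [Cz [zf [z1 [z2 [C [c0 [T1 tm]]]]]]]] := test_modes_exist.
have rm := tm_rm tm; have Cz0 := tm_Cz tm; have C0 := tm_C tm; have c00 := tm_c0 tm.
have [Ca Ca0 ea] := flow0_estimate n3 M0 Cz0 rm rho C0 q0.
have [Cb Cb0 eb] := flow1_estimate n3 M0 Cz0 rm rho0 C0 q1.
pose A0 := 2 * 2 `^ (q - 1) * Ca.
have A00 : 0 < A0 by rewrite !mulr_gt0 ?powR_gt0.
exists ((A0 + Cb) / c0), T1; split; first by rewrite divr_gt0// addr_gt0.
  exact: tm_T1 tm.
move=> eps T0 eps0 [T00 [u usol usupp]] T dl T1T dl0.
have [T1' TT0] := andP T1T; have T1'' : 1 <= T := le_trans (tm_T1 tm) T1'.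
have mu_ : measurable_fun (slab T0) u := usol.1.1.
have l0 : 0 <= (0 : R) <= 1 by rewrite lexx ler01.
have l1 : 0 <= (1 : R) <= 1 by rewrite ler01 lexx.
have T0' : 0 < T by exact: lt_le_trans T1''.
have mW : measurable_fun (slab T0) (mode M zf 0) by exact: (measurable_mode n3 M0 rm l0).
have W0 z : slab T0 z -> 0 < mode M zf 0 z by move=> Sz; exact: (mode_pos rm l0 Sz).
have fl0 lam z : 0 <= lam <= 1 -> slab T0 z -> 0 <= flow M zf C lam T z.
  by move=> l01; exact: (flow_ge0 M0 rm (ltW C0)).
have [fin0 [dd0 [dd00 in0 _]]] := tm_ineq tm eps0 usol usupp l0 T1T.
have [fin1 [dd1 [dd10 in1 cd]]] := tm_ineq tm eps0 usol usupp l1 T1T.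
set m0 := source_mass M rho N p T0 u T (mode M zf 0) in fin0 in0 *.
have m00 : (0 <= m0)%E.
  by apply: integral_ge0 => z [Sz _]; rewrite lee_fin; exact: (mass_ge0 N T u W0 Sz).
have m0fin : m0 \is a fin_num by rewrite ge0_fin_numE.
have h2 : 0 < 2^-1 :> R by rewrite invr_gt0.
have mf0 : measurable_fun (slab T0) (flow M zf C 0 T) by exact: (measurable_flow C T rm l0).
have mf1 : measurable_fun (slab T0) (flow M zf C 1 T) by exact: (measurable_flow C T rm l1).
have Y0 := young_step (tm_N3 tm) (tm_N tm) h2 mu_ mW mf0 W0
   (fun z => fl0 0 z l0) (ea T0 T T1'').
have Y1 := young_step (tm_N3 tm) (tm_N tm) dl0 mu_ mW mf1 W0
   (fun z => fl0 1 z l1) (eb T0 T 1 (mode M zf 0) T1'' ltr01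
   (fun z zA => proj1 (andP (mode0_bounds rm zA.1.1)))).
have {}Y0 := le_trans in0 Y0; have {}Y1 := le_trans in1 Y1.
rewrite -/m0 -(fineK m0fin) -?EFinM -?EFinD lee_fin in Y0.
(* Young with dl = 1/2: half of the mass is absorbed *)
have M0le : fine m0 <= A0 * T `^ slope0.
  have half_pow : 2^-1 `^ (1 - q) = 2 `^ (q - 1) :> R.
    have <- : (2 : R) `^ (- 1) = 2^-1 by rewrite powR_inv1.
    by rewrite -powRrM mulN1r opprB.
  rewrite half_pow in Y0.
  have e1 : 0 <= eps * dd0 by rewrite mulr_ge0// ltW.
  rewrite /A0 /slope0; move: Y0; set X := Ca * _; have -> : 2 * 2 `^ (q - 1) * Ca * T `^ (1 - q + (if q < n%:R then n%:R - q else 1)) = 2 * (2 `^ (q - 1) * X) by rewrite /X; ring.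
  set Z := 2 `^ (q - 1) * X; lra.
have m10 : (0 <= source_mass M rho N p T0 u T (mode M zf 1))%E.
  apply: integral_ge0 => z [Sz _]; rewrite lee_fin; apply: (mass_ge0 N T u _ Sz) => y Sy.
  exact: (mode_pos rm l1 Sy).
have {}Y1 : eps * dd1 <= dl * fine m0 + dl `^ (1 - q) * (Cb * (1 `^ (1 - q) * T `^ slope1)).
  rewrite -lee_fin EFinD (EFinM dl (fine m0)) fineK//.
  by apply: le_trans Y1; rewrite leeDr.
rewrite powR1 mul1r in Y1.
have c1 : eps * c0 <= eps * dd1 by rewrite ler_wpM2l ?(ltW eps0)// cd.
have c2 : dl * fine m0 <= dl * (A0 * T `^ slope0) by rewrite ler_wpM2l// ltW.
rewrite mulrAC ler_pdivlMr//; apply: le_trans (le_trans c1 Y1) _.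
have P0 : 0 <= dl * T `^ slope0 by rewrite mulr_ge0 ?powR_ge0// ltW.
have P1 : 0 <= dl `^ (1 - q) * T `^ slope1 by rewrite mulr_ge0 ?powR_ge0.
rewrite (le_trans (lerD c2 (lexx _)))//.
rewrite (mulrCA dl) (mulrCA (dl `^ _)).
move: (dl * T `^ slope0) (dl `^ (1 - q) * T `^ slope1) P0 P1 => x y x0 y0.
rewrite -subr_ge0; have -> : (A0 + Cb) * (x + y) - (A0 * x + Cb * y) = A0 * y + Cb * x by ring.
by rewrite addr_ge0// mulr_ge0// ltW.
Qed.

(** The choice dl = T^((slope1 - slope0)/q) equalises the two terms. *)
Lemma lifespan_rate (kap : R) : 0 < kap -> kap <= - (slope0 + (slope1 - slope0) / q) ->
  (forall eps, 0 < eps -> (lifespan M D V p u0 u1 rho eps < +oo)%E) /\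
  exists C eps0, [/\ 0 < C, 0 < eps0 & forall eps, 0 < eps <= eps0 ->
    (lifespan M D V p u0 u1 rho eps <= (C * eps `^ (- kap^-1))%:E)%E].
Proof.
move=> kap0 kle; have q0 : 0 < q by exact: lt_trans q1.
have [C [T1 [C0 T11 H]]] := two_scale_inequality.
have bound eps T0 : 0 < eps -> admissible_time M D V p u0 u1 rho eps T0 ->
    T0 <= Num.max T1 ((2 * C / eps) `^ kap^-1).
  move=> eps0 adm; apply: power_time_bound => //; first by rewrite mulr_gt0.
  move=> T TT; have [T1T _] := andP TT; have T1' : 1 <= T by exact: le_trans T1T.
  have T0' : 0 < T by exact: lt_le_trans T1'.
  have := H eps T0 eps0 adm T (T `^ ((slope1 - slope0) / q)) TT; rewrite powR_gt0// => /(_ isT).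
  rewrite -powRrM -!powRD ?(gt_eqF T0') ?implybT//.
  have -> : (slope1 - slope0) / q * (1 - q) + slope1 = (slope1 - slope0) / q + slope0.
    by field; rewrite gt_eqF.
  move=> h; apply: le_trans h _; have -> y : C * (y + y) = 2 * C * y by ring.
  rewrite ler_wpM2l ?mulr_ge0 ?(ltW C0)// ler_powR//.
  by rewrite addrC lerNr.
have lifespan_le eps x : (forall T0, admissible_time M D V p u0 u1 rho eps T0 -> T0 <= x) ->
    (lifespan M D V p u0 u1 rho eps <= x%:E)%E.
  by move=> h; apply: ge_ereal_sup => _ /= [T0 adm <-]; rewrite lee_fin h.
split.
  move=> eps eps0; apply: le_lt_trans (ltry (Num.max T1 ((2 * C / eps) `^ kap^-1))).
  by apply: lifespan_le => T0; exact: bound.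
exists (T1 + (2 * C) `^ kap^-1), 1; split => //.
  by rewrite addr_gt0 ?powR_gt0 ?mulr_gt0// (lt_le_trans ltr01).
move=> eps /andP[eps0 eps1]; apply: lifespan_le => T0 adm.
apply: le_trans (bound eps T0 eps0 adm) _.
have e1 : 1 <= eps `^ (- kap^-1).
  have h1 : eps `^ kap^-1 <= 1 `^ kap^-1 by apply: powRge0_mono => //; [rewrite invr_ge0 ltW|exact: ltW].
  by rewrite powRN -[leLHS]invr1 lef_pV2 ?posrE ?powR_gt0//; rewrite powR1 in h1.
have E : (2 * C / eps) `^ kap^-1 = (2 * C) `^ kap^-1 * eps `^ (- kap^-1).
  rewrite powRM ?invr_ge0 ?(ltW eps0) ?mulr_ge0 ?(ltW C0)//; congr (_ * _).
  have <- : eps `^ (- 1) = eps^-1 by rewrite powR_inv1// ltW.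
  by rewrite -powRrM mulN1r.
rewrite E; move: ((2 * C) `^ kap^-1) (powR_ge0 (2 * C) kap^-1) => y y0.
have e0 := le_trans ler01 e1.
rewrite mulrDl ge_max; apply/andP; split; last by rewrite lerDr mulr_ge0// (le_trans ler01).
rewrite -[leLHS]addr0 lerD ?mulr_ge0// ler_peMr// (le_trans ler01)//.
Qed.

End exponents.

(** p <= n/(n-1) means q >= n, the case distinction of slope0. There the
    available rate exceeds the stated one by (n-2)/p; in the other case they
    coincide. *)
Lemma subcritical_lifespan (p : R) : 1 < p -> 0 < gamma_poly p n ->
  (forall eps, 0 < eps -> (lifespan M D V p u0 u1 rho eps < +oo)%E) /\
  exists C eps0, [/\ 0 < C, 0 < eps0 & forall eps, 0 < eps <= eps0 ->
    (lifespan M D V p u0 u1 rho eps <=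
      (if (p <= n%:R / (n%:R - 1))%R
       then C * eps `^ (- (2 * (p - 1) / (n%:R + 1 - (n%:R - 1) * p)))
       else C * eps `^ (- (2 * p * (p - 1) / gamma_poly p n)))%:E)%E].
Proof.
move=> p1 gp; have p0 : 0 < p by exact: lt_trans p1.
have p10 : 0 < p - 1 by rewrite subr_gt0.
have [q qE] : exists q, q = p / (p - 1) by exists (p / (p - 1)).
have q1 : 1 < q by rewrite qE ltr_pdivlMr// mul1r gtrBl.
have pq : p^-1 + q^-1 = 1.
  by rewrite qE invfM invrK mulrC; field; rewrite gt_eqF.
have n2 : 2 < n%:R :> R by rewrite ltr_nat.
have n10 : 0 < n%:R - 1 :> R by lra.
have kE : k = (n%:R - 1) / 2.
  by rewrite /half_dim -subn1 natrB// (leq_trans _ n3).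
have qn : (q < n%:R) = (n%:R / (n%:R - 1) < p).
  by rewrite qE ltr_pdivrMr// [RHS]ltr_pdivrMr// !mulrBr !mulr1 ltrBrDr -ltrBrDl mulrC.
have [pn|np] := leP p (n%:R / (n%:R - 1)).
  have den : 0 < n%:R + 1 - (n%:R - 1) * p.
    move: pn; rewrite ler_pdivlMr// => h; have : p * (n%:R - 1) = (n%:R - 1) * p by rewrite mulrC.
    lra.
  have -> : 2 * (p - 1) / (n%:R + 1 - (n%:R - 1) * p) = ((n%:R + 1 - (n%:R - 1) * p) / (2 * (p - 1)))^-1.
    by rewrite invfM invrK mulrC.
  apply: (lifespan_rate p1 pq q1); first by rewrite divr_gt0// mulr_gt0.
  rewrite /slope0 /slope1 qn ltNge pn /= kE qE.
  rewrite -subr_ge0.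
  set X := (X in 0 <= X).
  have -> : X = (n%:R - 2) / p.
    by rewrite /X; field; rewrite !gt_eqF.
  by rewrite divr_ge0// ltW// subr_gt0.
have -> : 2 * p * (p - 1) / gamma_poly p n = (gamma_poly p n / (2 * p * (p - 1)))^-1.
  by rewrite invfM invrK mulrC.
apply: (lifespan_rate p1 pq q1); first by rewrite divr_gt0// !mulr_gt0.
rewrite /slope0 /slope1 qn np kE qE /gamma_poly le_eqVlt; apply/orP; left; apply/eqP.
by field; rewrite !gt_eqF.
Qed.

End solutions.

(** * Dyadic sums and discrete growth *)

Lemma powR_ge1 {R : realType} (x r : R) : 1 <= x -> 0 <= r -> 1 <= x `^ r.
Proof. by move=> x1 r0; have := powRge0_mono r0 ler01 x1; rewrite powR1. Qed.

Lemma powR_le1 {R : realType} (x r : R) : 0 <= x <= 1 -> 0 <= r -> x `^ r <= 1.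
Proof. by move=> /andP[x0 x1] r0; have := powRge0_mono r0 x0 x1; rewrite powR1. Qed.

Section dyadic.
Context {R : realType}.

(** min(y, 1/y)^a. *)
Definition peak (a y : R) : R := if 1 <= y then y `^ (- a) else y `^ a.

(** Both halves of the sum are geometric. Instead of splitting the sum at the
    peak, a potential Phi is used with peak a X + Phi (X/2) <= Phi X and
    0 <= Phi <= K, so that the sum telescopes. *)
Lemma dyadic_peak_sum (a : R) : 0 < a -> exists2 K : R, 0 < K &
  forall (J : nat) (X : R), 0 < X -> \sum_(j < J) peak a (X * 2^-1 ^+ j) <= K.
Proof.
move=> a0; pose th : R := 2^-1 `^ a.
have th0 : 0 < th by rewrite powR_gt0// invr_gt0.
have h2 : 0 < 2^-1 :> R by rewrite invr_gt0.
have th1 : th < 1.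
  rewrite /th -[ltRHS](_ : 1 `^ a = 1); last by rewrite powR1.
  apply: gt0_ltr_powR; rewrite ?nnegrE ?(ltW h2)//; by rewrite invf_lt1 // ltr1n.
have th10 : 0 < 1 - th by rewrite subr_gt0.
have thN : 2 `^ a = th^-1.
  have -> : th = (2 : R) `^ (- a).
    rewrite /th; have <- : (2 : R) `^ (- 1) = 2^-1 by rewrite powR_inv1.
    by rewrite -powRrM mulN1r.
  by rewrite powRN invrK.
pose c : R := th / (1 - th).
have c0 : 0 < c by rewrite divr_gt0.
pose K : R := 1 + (1 - th)^-1 + c.
exists K; first by rewrite !addr_gt0// invr_gt0.
(* for X < 1 the exact sum of the geometric series; for X >= 1 a constant
   minus the part of the series already summed *)
pose Phi (X : R) : R := if 1 <= X then K - c * X `^ (- a) else X `^ a / (1 - th).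
have half X : 0 < X -> (X * 2^-1) `^ a = X `^ a * th.
  by move=> X0; rewrite powRM ?(ltW X0) ?(ltW h2).
have PhiK X : 0 < X -> Phi X <= K.
  move=> X0; rewrite /Phi; case: ifPn => [|]; first by rewrite gerBl mulr_ge0 ?powR_ge0 ?(ltW c0).
  rewrite -ltNge => X1; apply: (@le_trans _ _ (1 - th)^-1).
    by rewrite ler_piMl ?invr_ge0 ?(ltW th10)// powR_le1 ?(ltW a0) ?(ltW X0) ?(ltW X1).
  by rewrite /K -addrA addrCA lerDl addr_ge0// ltW.
have step X : 0 < X -> peak a X + Phi (X * 2^-1) <= Phi X.
  move=> X0; rewrite /peak /Phi; have [X1|X1] := leP 1 X; last first.
    have -> : (1 <= X * 2^-1) = false.
      by apply/negbTE; rewrite -ltNge (lt_trans _ X1)// gtr_pMr// invf_lt1 ?ltr1n.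
    rewrite half// le_eqVlt; apply/orP; left; apply/eqP; field; by rewrite gt_eqF.
  have Xa1 : X `^ (- a) <= 1.
    rewrite powRN -[leRHS]invr1 lef_pV2 ?posrE ?powR_gt0//.
    by rewrite powR_ge1// ltW.
  have [X2|X2] := leP 1 (X * 2^-1).
    have -> : (X * 2^-1) `^ (- a) = X `^ (- a) / th.
      by rewrite !powRN half// invfM.
    rewrite le_eqVlt; apply/orP; left; apply/eqP; rewrite /c; field; by rewrite !gt_eqF.
  have h : (X * 2^-1) `^ a / (1 - th) <= (1 - th)^-1.
    by rewrite ler_piMl ?invr_ge0 ?(ltW th10)// powR_le1 ?(ltW a0) ?(ltW X2) ?andbT// mulr_ge0 ?(ltW X0) ?(ltW h2).
  have h' : c * X `^ (- a) <= c by rewrite ler_piMr// ltW.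
  rewrite /K; lra.
suff H J X : 0 < X -> \sum_(j < J) peak a (X * 2^-1 ^+ j) <= Phi X.
  by move=> J X X0; apply: le_trans (H J X X0) (PhiK X X0).
elim: J X => [|J IH] X X0.
  rewrite big_ord0 /Phi; case: ifPn => [X1|_]; last by rewrite divr_ge0 ?powR_ge0 ?(ltW th10).
  have Xa1 : X `^ (- a) <= 1.
    rewrite powRN -[leRHS]invr1 lef_pV2 ?posrE ?powR_gt0//.
    by rewrite powR_ge1// ltW.
  have h' : c * X `^ (- a) <= c by rewrite ler_piMr// ltW.
  have h'' : 0 < (1 - th)^-1 by rewrite invr_gt0.
  rewrite /K; lra.
rewrite big_ord_recl expr0 mulr1; apply: le_trans (step X X0); rewrite lerD2l.
apply: le_trans (IH (X * 2^-1) _); last by rewrite mulr_gt0.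
by apply: ler_sum => j _; rewrite /bump/= exprS mulrA.
Qed.

End dyadic.

Section growth.
Context {R : realType} (p q : R).
Hypothesis p1 : 1 < p.
Hypothesis pq : p^-1 + q^-1 = 1.
Hypothesis q1 : 1 < q.

(** The choice of dl that makes the second term equal to y/2. *)
Lemma riccati_young (y B De : R) : 0 < y -> 0 < B ->
  (forall dl, 0 < dl -> y <= dl * De + dl `^ (1 - q) * B) ->
  (y / 2) * (y / (2 * B)) `^ (p - 1) <= De.
Proof.
move=> y0 B0 H; have B2 : 0 < 2 * B by rewrite mulr_gt0.
have p0 : 0 < p by exact: lt_trans p1.
have q0 : 0 < q by exact: lt_trans q1.
have x0 : 0 < y / (2 * B) by rewrite divr_gt0.
pose dl := (y / (2 * B)) `^ (- (p - 1)).
have dl0 : 0 < dl by rewrite powR_gt0.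
have := H dl dl0.
have E : - (p - 1) * (1 - q) = 1.
  have -> : q = p / (p - 1).
    have : q^-1 = 1 - p^-1 by rewrite -pq addrC addKr.
    by move=> /(congr1 (fun x => x^-1)); rewrite invrK => ->; field; rewrite !gt_eqF// subr_gt0.
  by field; rewrite gt_eqF// subr_gt0.
rewrite /dl -powRrM E powRr1 ?(ltW x0)//.
have -> : y / (2 * B) * B = y / 2 by field; rewrite gt_eqF.
rewrite powRN; set P := _ `^ (p - 1); have P0 : 0 < P by rewrite powR_gt0.
move=> h; have {h} : y / 2 <= P^-1 * De by lra.
by rewrite (mulrC P^-1) ler_pdivlMr.
Qed.

(** Uniform in p > 1: the usual Bernoulli inequality would need p >= 2. *)
Lemma bernoulli_powR (x : R) : 0 <= x <= 1 -> 1 + (p - 1) / 2 * x <= (1 + x) `^ (p - 1).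
Proof.
move=> /andP[x0 x1]; have x10 : 0 < 1 + x by rewrite ltr_pwDl.
rewrite /powR gt_eqF//; apply: le_trans (expR_ge1Dx _); rewrite lerD2l.
rewrite -mulrA ler_wpM2l ?subr_ge0 ?(ltW p1)//.
have h : ln (1 + ((1 + x)^-1 - 1)) <= (1 + x)^-1 - 1.
  by apply: le_ln1Dx; rewrite ltrBrDl subrr invr_gt0.
rewrite addrC subrK lnV ?posrE// lerNl opprB in h; apply: le_trans h.
have -> : 1 - (1 + x)^-1 = x / (1 + x) by field; rewrite gt_eqF.
rewrite mulrC ler_wpM2l// lef_pV2 ?posrE//; lra.
Qed.

(** Optimising dl in the hypotheses gives b_(m+1) - b_m >= c b_m^p m^(1-p) and
    b_(m+1) - b_m >= c eps^p. The second one makes b_L >= c L eps^p. The first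
    one makes b^(1-p) drop by c L^(1-p) at each step between L and 2L; as
    b^(1-p) stays nonnegative, L * L^(1-p) <= C b_L^(1-p) <= C (L eps^p)^(1-p).
    The bound b_m <= K m keeps the relative increments below 1, where
    bernoulli_powR linearises the power. *)
Lemma growth_bound (K c0 : R) : 0 < K -> 0 < c0 -> exists2 C : R, 0 < C &
  forall (eps : R) (b : nat -> R) (m1 L : nat), 0 < eps -> (1 <= L)%N -> (2 * m1 <= L)%N ->
  (forall m, (m1 <= m)%N -> 0 <= b m) ->
  (forall m, (m1 <= m < 2 * L)%N -> b m <= K * m.+1%:R) ->
  (forall m dl, (m1 <= m < 2 * L)%N -> 0 < dl ->
     b m <= dl * (b m.+1 - b m) + dl `^ (1 - q) * (K * m.+1%:R)) ->
  (forall m dl, (m1 <= m < 2 * L)%N -> 0 < dl ->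
     eps * c0 <= dl * (b m.+1 - b m) + dl `^ (1 - q) * K) ->
  L%:R <= C * eps `^ (- (p * (p - 1))).
Proof.
move=> K0 c00.
have p10 : 0 < p - 1 by rewrite subr_gt0.
have p0 : 0 < p by exact: lt_trans p1.
pose c1 := c0 / 2 * (c0 / (2 * K)) `^ (p - 1).
have K20 : 0 < 2 * K by rewrite mulr_gt0.
have c10 : 0 < c1 by apply: mulr_gt0; rewrite ?powR_gt0 ?divr_gt0.
pose ro := (p - 1) / 2; have ro0 : 0 < ro by rewrite divr_gt0.
pose si := ro / (1 + ro) / 2; have si0 : 0 < si by rewrite !divr_gt0// addr_gt0.
pose c2 := si * (4 * K) `^ (- (p - 1)); have c20 : 0 < c2 by apply: mulr_gt0 => //; rewrite powR_gt0// mulr_gt0.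
pose c3 := (c1 / 2) `^ (- (p - 1)); have c30 : 0 < c3 by rewrite powR_gt0 ?divr_gt0.
exists (c3 / c2); first by rewrite divr_gt0.
move=> eps b m1 L eps0 L1 mL b0 bK Hb Heps.
have L0 : 0 < L%:R :> R by rewrite ltr0n.
(* growth forced by the data *)
have incr m : (m1 <= m < 2 * L)%N -> c1 * eps `^ p <= b m.+1 - b m.
  move=> mr; have := riccati_young (mulr_gt0 eps0 c00) K0 (Heps m ^~ mr).
  have -> : eps * c0 / (2 * K) = eps * (c0 / (2 * K)) by rewrite mulrA.
  rewrite powRM ?(ltW eps0) ?divr_ge0 ?(ltW c00) ?(ltW K20)//.
  have -> : eps `^ p = eps * eps `^ (p - 1).
    by rewrite -[X in X * _]powRr1 ?(ltW eps0)// -powRD ?(gt_eqF eps0) ?implybT// addrC subrK.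
  by apply: le_trans; rewrite le_eqVlt; apply/orP; left; apply/eqP; rewrite /c1; ring.
have ep0 : 0 < c1 * eps `^ p by rewrite mulr_gt0 ?powR_gt0.
have mono i : (m1 + i <= 2 * L)%N -> i%:R * (c1 * eps `^ p) <= b (m1 + i)%N.
  elim: i => [|i IH] h; first by rewrite mul0r b0// leq_addr.
  rewrite addnS in h *; have := IH (ltnW h); have := incr (m1 + i)%N.
  rewrite leq_addr h => /(_ isT); rewrite -natr1 mulrDl mul1r; lra.
have m1L : (m1 <= L)%N by rewrite (leq_trans _ mL)// leq_pmull.
have bL : L%:R / 2 * (c1 * eps `^ p) <= b L.
  have := mono (L - m1)%N; rewrite subnKC// leq_pmull// => /(_ isT); apply: le_trans.
  rewrite ler_wpM2r ?(ltW ep0)// natrB// ler_pdivrMr//.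
  have : (2 * m1)%:R <= L%:R :> R by rewrite ler_nat.
  rewrite natrM; lra.
have bL0 : 0 < b L by apply: lt_le_trans bL; rewrite mulr_gt0 ?divr_gt0.
(* the quantity whose decrements are bounded below *)
pose f m := b m `^ (- (p - 1)).
pose s := c2 * L%:R `^ (- (p - 1)).
have key i : (i <= L)%N -> b L <= b (L + i)%N /\ f (L + i)%N <= f L - i%:R * s.
  elim: i => [|i IH] h; first by rewrite addn0 mul0r subr0.
  have [IH1 IH2] := IH (ltnW h).
  have mr : (m1 <= L + i < 2 * L)%N.
    by rewrite (leq_trans m1L (leq_addr _ _))/= mul2n -addnn ltn_add2l.
  set m := (L + i)%N in IH1 IH2 mr *; rewrite addnS -/m.
  have bm0 : 0 < b m by exact: lt_le_trans IH1.
  have Km0 : 0 < K * m.+1%:R by rewrite mulr_gt0.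
  have ric := riccati_young bm0 Km0 (Hb m ^~ mr).
  set P := (b m / (2 * (K * m.+1%:R))) `^ (p - 1) in ric.
  have P0 : 0 <= P by exact: powR_ge0.
  have P1 : P <= 1.
    apply: powR_le1; last exact: ltW.
    rewrite divr_ge0 ?(ltW bm0) ?mulr_ge0 ?(ltW K0)//=.
    rewrite ler_pdivrMr ?mulr_gt0// mul1r (le_trans (bK m mr))// ler_peMl ?(ltW Km0)//.
    by rewrite ler1n.
  have bS : b m * (1 + P / 2) <= b m.+1.
    rewrite mulrDr mulr1 -lerBrDl; apply: le_trans ric.
    by rewrite le_eqVlt; apply/orP; left; apply/eqP; ring.
  split; first by rewrite (le_trans IH1)// (le_trans _ bS)// ler_peMr ?(ltW bm0)// lerDl divr_ge0.
  have x01 : 0 <= P / 2 <= 1 by rewrite divr_ge0//= ler_pdivrMr// mul1r (le_trans P1)// ler1n.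
  have ber := bernoulli_powR x01; rewrite -/ro in ber.
  have x10 : 0 < 1 + P / 2 by rewrite ltr_pwDl// divr_ge0.
  have y0 : 0 <= ro * (P / 2) by rewrite mulr_ge0 ?(ltW ro0)// divr_ge0.
  have fS : f m.+1 <= f m * (1 + ro * (P / 2))^-1.
    apply: (@le_trans _ _ ((b m * (1 + P / 2)) `^ (- (p - 1)))).
      by apply: powRneg_mono; rewrite ?(ltW p10)// mulr_gt0.
    rewrite powRM ?(ltW bm0) ?(ltW x10)// ler_wpM2l ?powR_ge0// powRN.
    by rewrite lef_pV2 ?posrE ?powR_gt0// ltr_pwDl.
  have inv_le : (1 + ro * (P / 2))^-1 <= 1 - si * P.
    have y1 : ro * (P / 2) <= ro by rewrite ler_piMr ?(ltW ro0)//; case/andP: x01.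
    have -> : (1 + ro * (P / 2))^-1 = 1 - ro * (P / 2) / (1 + ro * (P / 2)).
      move: (ro * (P / 2)) y0 => y y0; by field; rewrite gt_eqF// ltr_pwDl.
    rewrite lerD2l lerN2.
    have -> : si * P = ro * (P / 2) / (1 + ro) by rewrite /si; ring.
    by rewrite ler_wpM2l// lef_pV2 ?posrE ?ltr_pwDl ?(ltW ro0)// lerD2l.
  have fP : f m * P = (2 * (K * m.+1%:R)) `^ (- (p - 1)).
    rewrite /P /f powRM ?(ltW bm0) ?invr_ge0 ?mulr_ge0 ?(ltW K0)// mulrA -powRD ?(gt_eqF bm0) ?implybT//.
    rewrite addNr powRr0 mul1r.
    have KK : 0 < 2 * (K * m.+1%:R) by rewrite mulr_gt0.
    have <- : (2 * (K * m.+1%:R)) `^ (- 1) = (2 * (K * m.+1%:R))^-1 by rewrite powR_inv1// ltW.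
    by rewrite -powRrM mulN1r.
  have fPs : s <= si * (f m * P).
    rewrite fP /s /c2 -mulrA ler_wpM2l ?(ltW si0)//.
    rewrite -powRM ?mulr_ge0 ?(ltW K0)//; apply: powRneg_mono; rewrite ?(ltW p10) ?mulr_gt0//.
    have -> : 4 * K * L%:R = 2 * (K * (2 * L%:R)) by ring.
    rewrite !ler_wpM2l ?(ltW K0)// -natrM ler_nat.
    by case/andP: mr.
  apply: le_trans fS _; apply: le_trans (ler_wpM2l (powR_ge0 _ _) inv_le) _.
  rewrite -/(f m) mulrBr mulr1 -natr1 mulrDl mul1r.
  have -> : f m * (si * P) = si * (f m * P) by ring.
  lra.
have [_ fin] := key L (leqnn L).
have fL : f L <= c3 * (L%:R `^ (- (p - 1)) * eps `^ (- (p * (p - 1)))).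
  apply: (@le_trans _ _ ((L%:R / 2 * (c1 * eps `^ p)) `^ (- (p - 1)))).
    apply: powRneg_mono; rewrite ?(ltW p10)//.
    by apply: mulr_gt0 => //; rewrite divr_gt0.
  have -> : L%:R / 2 * (c1 * eps `^ p) = c1 / 2 * (L%:R * eps `^ p) by ring.
  rewrite powRM ?divr_ge0 ?(ltW c10) ?mulr_ge0 ?powR_ge0// ler_wpM2l ?powR_ge0//.
  by rewrite powRM ?powR_ge0// -powRrM mulrN.
have LP : 0 < L%:R `^ (- (p - 1)) :> R by rewrite powR_gt0.
have f0 : 0 <= f (L + L)%N by exact: powR_ge0.
have Ls : L%:R * s <= c3 * (L%:R `^ (- (p - 1)) * eps `^ (- (p * (p - 1)))).
  by apply: le_trans fL; lra.
rewrite mulrAC ler_pdivlMr//.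
rewrite -(ler_pM2r LP); move: Ls; rewrite /s; by apply: etrans; congr (_ <= _); ring.
Qed.

End growth.

(** * Superposition of dyadic modes *)

(** The factor y^a exp(- y/2), appearing when the modes are summed, is a peak. *)
Lemma exp_peak {R : realType} (a y : R) : 0 < a <= 1 -> 0 < y ->
  y `^ a * expR (- (y / 2)) <= 16 * peak a y.
Proof.
move=> /andP[a0 a1] y0; rewrite /peak; have [y1|y1] := leP 1 y; last first.
  rewrite mulrC ler_pM ?powR_ge0 ?expR_ge0//.
  by apply: (@le_trans _ _ 1); [rewrite -[leRHS]expR0 ler_expR; lra|rewrite ler1n].
have E : expR (- (y / 2)) <= 16 / y ^+ 2.
  rewrite expRN -[leRHS]invrK lef_pV2 ?posrE ?expR_gt0 ?invr_gt0 ?divr_gt0 ?exprn_gt0//.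
  have h : 1 + y / 4 <= expR (y / 4) by exact: expR_ge1Dx.
  have -> : expR (y / 2) = expR (y / 4) ^+ 2.
    by rewrite expr2 -expRD; congr expR; field.
  have y4 : 0 <= y / 4 by rewrite divr_ge0// ltW.
  apply: (@le_trans _ _ ((y / 4) ^+ 2)).
    by rewrite le_eqVlt; apply/orP; left; apply/eqP; field; rewrite gt_eqF.
  by rewrite ler_pXn2r// ?nnegrE ?expR_ge0// (le_trans _ h)// lerDr.
apply: (@le_trans _ _ (y `^ a * (16 / y ^+ 2))); first by rewrite ler_wpM2l ?powR_ge0.
have -> : y `^ a * (16 / y ^+ 2) = 16 * (y `^ a * y `^ (- 2%:R)).
  by rewrite powRN powR_mulrn ?(ltW y0)//; ring.
rewrite ler_wpM2l// -powRD ?(gt_eqF y0) ?implybT// ler_powR//; lra.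
Qed.

Lemma ln_dyadic_le {R : realType} (y : R) (m : nat) : 0 < y ->
  ln (2 + y * 2 ^+ m) <= (3 + y) * m.+1%:R.
Proof.
move=> y0; have y2 : 0 < 2 + y by rewrite addr_gt0.
have T1 : 1 <= 2 ^+ m :> R by rewrite exprn_ege1// ler1n.
have T0 : 0 < 2 ^+ m :> R by exact: lt_le_trans T1.
apply: (@le_trans _ _ (ln ((2 + y) * 2 ^+ m))).
  rewrite ler_ln ?posrE ?mulr_gt0//; last by rewrite addr_gt0// mulr_gt0.
  by rewrite mulrDl lerD2r ler_peMr.
rewrite lnM ?posrE// lnXn ?posrE//.
have a1 : ln (2 + y) <= 2 + y by rewrite ltW// ln_sublinear.
have a2 : ln 2 *+ m <= m%:R :> R.
  rewrite -[leLHS]mulr_natl ler_piMr//.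
  have h : ln (1 + 1) <= 1 :> R by apply: le_ln1Dx; rewrite (@lt_trans _ _ 0)// ltrN10.
  exact: h.
apply: le_trans (lerD a1 a2) _; rewrite -[m.+1%:R]natr1 mulrDr mulr1.
have : 0 <= (2 + y) * m%:R by rewrite mulr_ge0// ltW.
rewrite !mulrDl; lra.
Qed.

Section critical_weight.
Context {R : realType} (n : nat) (M : R) (D V : R -> R).
Hypothesis n3 : (3 <= n)%N.
Hypothesis M0 : 0 < M.
Variables (Cz : R) (zf z1 z2 : R -> R -> R).
Hypothesis Cz0 : 0 < Cz.
Hypothesis rm : radial_modes n M D V Cz zf z1 z2.
Variable rho : R.
Hypothesis rho0 : 0 < rho.
Local Notation k := (@half_dim R n).
Local Notation spacetime := (R * (R * 'rV[R]_n))%type.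
Local Notation slab := (@slab R n M).
Local Notation mu3 := (@dt_dr_dw R n).
Local Notation w := (wtime M).
Local Notation cone T0 := (cone M rho T0 : set spacetime).
Local Notation window := (@window R n M).
Local Notation mode := (@mode R n M zf).
Local Notation lag := (@lag R n M rho).
Local Notation flow := (@flow R n M zf).
Variables (p q : R).
Hypothesis p1 : 1 < p.
Hypothesis pq : p^-1 + q^-1 = 1.
Hypothesis q1 : 1 < q.

(** The exponent k - 1/p of the weights, chosen such that the sum over lambda of
    lambda^(k - 1/p) (1 + lambda T)^(-k) lambda exp(- lambda lag / 2) / T decays
    like T^(-1-k) lag^(-1/q), whose q-th power is logarithmically divergent. *)
Definition weight_exp : R := k - p^-1.

Lemma weight_exp_gt0 : 0 < weight_exp.
Proof.
have k1 : 1 <= k := @half_dim_ge1 R n n3.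
have h : p^-1 < 1 by rewrite invf_lt1// (lt_trans ltr01).
by rewrite /weight_exp; move: k1 h; move: k p^-1 => x y; lra.
Qed.

Definition dyad (j : nat) : R := 2^-1 ^+ j.

Lemma dyad_gt0 j : 0 < dyad j. Proof. by rewrite exprn_gt0// invr_gt0. Qed.

Lemma dyad_itv j : 0 <= dyad j <= 1.
Proof. by rewrite ltW ?dyad_gt0//= exprn_ile1 ?invr_ge0// invf_le1 ?ler1n. Qed.

(** The truncation at J terms suffices up to the time w = 2^(J-1). *)
Definition super_mode (J : nat) z : R := \sum_(j < J) dyad j `^ weight_exp * mode (dyad j) z.
Definition super_flow (C : R) (J : nat) (T : R) z : R := \sum_(j < J) dyad j `^ weight_exp * flow C (dyad j) T z.

(** The single term with lambda = 2^-m already gives the bound, since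
    lambda w <= 1. *)
Lemma super_mode_ge (T0 : R) (J m : nat) z : slab T0 z -> (m < J)%N -> w z <= 2 ^+ m ->
  expR (- 1) * (2 ^+ m) `^ (- weight_exp) <= super_mode J z.
Proof.
move=> Sz mJ wz; have w0 := wtime_ge0 M0 Sz.
have term_ge0 j : 0 <= dyad j `^ weight_exp * mode (dyad j) z.
  by rewrite mulr_ge0 ?powR_ge0// ltW// (mode_pos rm (dyad_itv j) Sz).
rewrite /super_mode (bigD1 (Ordinal mJ))//= -[leLHS]addr0 lerD//; last first.
  by apply: sumr_ge0 => j _; exact: term_ge0.
have -> : (2 ^+ m : R) `^ (- weight_exp) = dyad m `^ weight_exp.
  rewrite /dyad exprVn; have <- : (2 ^+ m : R) `^ (- 1) = (2 ^+ m)^-1 by rewrite powR_inv1// exprn_ge0.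
  by rewrite -powRrM mulN1r.
rewrite mulrC ler_wpM2l ?powR_ge0// /mode.
rewrite -[leLHS]mulr1 ler_pM ?expR_ge0//; last exact: (rm_ge1 rm (dyad_itv m) Sz.2.1).
rewrite ler_expR lerN2 /dyad exprVn mulrC ler_pdivrMr ?exprn_gt0// mul1r//.
Qed.

(** The two terms come from lambda and 1/r in flow. Each is a sum over dyadic
    lambda of a function peaked at one scale, lambda = 1/lag for the first and
    lambda = 1/T for the second. *)
Lemma super_flow_le (C : R) : 0 < C -> exists2 K : R, 0 < K &
  forall (T0 : R) (J : nat) (T : R) z, 1 <= T -> (cone T0 `&` window T) z ->
  super_flow C J T z <= K * (T `^ (- (1 + k)) * (2 + lag z) `^ (- q^-1) +
     T `^ (- (1 + weight_exp)) * z.2.1^-1).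
Proof.
move=> C0; have k1 : 1 <= k := @half_dim_ge1 R n n3.
have k0 : 0 < k by exact: lt_le_trans k1.
have kp := weight_exp_gt0.
have p0 : 0 < p by exact: lt_trans p1.
have q0 : 0 < q by exact: lt_trans q1.
have [Cm Cm0 mle] := mode_le n3 M0 Cz0 rm rho0.
pose a1 := q^-1; have a10 : 0 < a1 by rewrite invr_gt0.
have a11 : a1 <= 1 by rewrite invf_le1// ltW.
pose a2 := Num.min weight_exp p^-1; have a20 : 0 < a2 by rewrite lt_min kp invr_gt0.
have [K1 K10 S1] := @dyadic_peak_sum R a1 a10.
have [K2 K20 S2] := @dyadic_peak_sum R a2 a20.
pose B1 : R := 2 `^ k * (16 * expR 1 * K1); pose B2 : R := 2 `^ k * K2.
have B10 : 0 < B1 by rewrite /B1 !mulr_gt0 ?powR_gt0 ?expR_gt0.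
have B20 : 0 < B2 by rewrite /B2 mulr_gt0 ?powR_gt0.
exists (C * Cm * (B1 + B2)); first by rewrite !mulr_gt0// addr_gt0.
move=> T0 J T z T1 zA; have T0' : 0 < T by exact: lt_le_trans T1.
have [zc /andP[zw _]] := zA; have [Sz _] := zc; have hz := Sz.2.1.
have r0 := gt2M_gt0 M0 hz; have l0 := lag_ge0 zc; have w0 := wtime_ge0 M0 Sz.
have X0 : 0 < 2 + lag z by rewrite ltr_pwDl.
have decay j : (1 + dyad j * w z) `^ (- k) <= 2 `^ k * (dyad j * T) `^ (- k).
  have -> : 2 `^ k * (dyad j * T) `^ (- k) = (dyad j * T / 2) `^ (- k).
    rewrite [RHS]powRM ?invr_ge0 ?mulr_ge0 ?(ltW T0') ?(ltW (dyad_gt0 j))// mulrC; congr (_ * _).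
    have <- : (2 : R) `^ (- 1) = 2^-1 by rewrite powR_inv1.
    by rewrite -powRrM mulN1r opprK.
  apply: powRneg_mono; rewrite ?(ltW k0) ?divr_gt0 ?mulr_gt0 ?dyad_gt0//.
  apply: (@le_trans _ _ (dyad j * w z)); last by rewrite lerDr.
  by rewrite -mulrA ler_wpM2l// ltW// dyad_gt0.
have decay1 j : (1 + dyad j * w z) `^ (- k) <= 1.
  rewrite powRN invf_le1 ?powR_gt0 ?ltr_pwDl ?mulr_ge0 ?(ltW (dyad_gt0 j))//.
  by rewrite powR_ge1 ?(ltW k0)// lerDl mulr_ge0// ltW// dyad_gt0.
have term1 j : dyad j `^ weight_exp * dyad j * (1 + dyad j * w z) `^ (- k) * expR (- (dyad j * lag z / 2))
   <= 2 `^ k * (16 * expR 1) * (T `^ (- k) * (2 + lag z) `^ (- a1)) * peak a1 ((2 + lag z) * dyad j).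
  have lj := dyad_gt0 j; set l := dyad j in lj *.
  apply: (@le_trans _ _ (l `^ weight_exp * l * (2 `^ k * (l * T) `^ (- k)) * expR (- (l * lag z / 2)))).
    by rewrite ler_wpM2r ?expR_ge0// ler_wpM2l ?decay// mulr_ge0 ?powR_ge0// ltW.
  have -> : (l * T) `^ (- k) = l `^ (- k) * T `^ (- k) by rewrite powRM// ltW.
  have E1 : l `^ weight_exp * l * l `^ (- k) = l `^ a1.
    rewrite -{2}(powRr1 (ltW lj)) -!powRD ?(gt_eqF lj) ?implybT//; congr (_ `^ _).
    have -> : a1 = 1 - p^-1 by rewrite /a1 -pq addrC addKr.
    by rewrite /weight_exp; ring.
  have -> : l `^ weight_exp * l * (2 `^ k * (l `^ (- k) * T `^ (- k))) * expR (- (l * lag z / 2)) =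
    2 `^ k * T `^ (- k) * ((l `^ weight_exp * l * l `^ (- k)) * expR (- (l * lag z / 2))) by ring.
  rewrite E1.
  have -> : 2 `^ k * (16 * expR 1) * (T `^ (- k) * (2 + lag z) `^ (- a1)) * peak a1 ((2 + lag z) * l)
   = 2 `^ k * T `^ (- k) * ((2 + lag z) `^ (- a1) * expR 1 * (16 * peak a1 ((2 + lag z) * l))) by ring.
  rewrite ler_wpM2l ?mulr_ge0 ?powR_ge0//.
  have y0 : 0 < (2 + lag z) * l by rewrite mulr_gt0.
  have a1b : 0 < a1 <= 1 by rewrite a10.
  apply: le_trans (ler_wpM2l _ (exp_peak a1b y0)); last by rewrite mulr_ge0 ?powR_ge0 ?expR_ge0.
  rewrite (powRM _ (ltW X0) (ltW lj)).
  have -> : (2 + lag z) `^ (- a1) * expR 1 * ((2 + lag z) `^ a1 * l `^ a1 * expR (- ((2 + lag z) * l / 2)))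
    = ((2 + lag z) `^ (- a1) * (2 + lag z) `^ a1) * l `^ a1 * (expR 1 * expR (- ((2 + lag z) * l / 2))) by ring.
  rewrite -powRD ?(gt_eqF X0) ?implybT// addNr powRr0 mul1r -expRD ler_wpM2l ?powR_ge0// ler_expR.
  have /andP[_ l1] := dyad_itv j; rewrite -/l in l1.
  have -> : (2 + lag z) * l / 2 = l + l * lag z / 2 by field.
  by rewrite opprD addrA lerDr subr_ge0.
have term2 j : dyad j `^ weight_exp * (1 + dyad j * w z) `^ (- k) <=
   2 `^ k * T `^ (- weight_exp) * peak a2 (T * dyad j).
  have lj := dyad_gt0 j; have decj := decay j; have decj1 := decay1 j; set l := dyad j in lj decj decj1 *.
  have y0 : 0 < T * l by rewrite mulr_gt0.
  have E1 : l `^ weight_exp = T `^ (- weight_exp) * (T * l) `^ weight_exp.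
    rewrite powRM ?(ltW T0') ?(ltW lj)// mulrA -powRD ?(gt_eqF T0') ?implybT//.
    by rewrite addNr powRr0 mul1r.
  rewrite E1 -mulrA.
  have -> : 2 `^ k * T `^ (- weight_exp) * peak a2 (T * l) = T `^ (- weight_exp) * (2 `^ k * peak a2 (T * l)) by ring.
  rewrite ler_wpM2l ?powR_ge0// /peak; have [y1|y1] := leP 1 (T * l).
    apply: (@le_trans _ _ ((T * l) `^ weight_exp * (2 `^ k * (T * l) `^ (- k)))).
      by rewrite ler_wpM2l ?powR_ge0// (mulrC T).
    rewrite mulrCA ler_wpM2l ?powR_ge0// -powRD ?(gt_eqF y0) ?implybT// ler_powR//.
    have -> : weight_exp - k = - p^-1 by rewrite /weight_exp; ring.
    by rewrite lerN2 /a2 ge_min lexx orbT.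
  rewrite mulrC ler_pM ?powR_ge0//.
    by rewrite (le_trans decj1)// powR_ge1 ?ler1n// ltW.
  by rewrite ger_powR ?y0 ?(ltW y1)// /a2 ge_min lexx.
have termle j : dyad j `^ weight_exp * flow C (dyad j) T z <=
  (C * Cm / T) * (2 `^ k * (16 * expR 1) * (T `^ (- k) * (2 + lag z) `^ (- a1)) * peak a1 ((2 + lag z) * dyad j)
     + 2 `^ k * T `^ (- weight_exp) * peak a2 (T * dyad j) * z.2.1^-1).
  have m1 := mle T0 (dyad j) z (dyad_itv j) zc.
  have lj := dyad_gt0 j.
  have ri : 0 < z.2.1^-1 by rewrite invr_gt0.
  apply: (@le_trans _ _ (dyad j `^ weight_exp * (C * (Cm * (1 + dyad j * w z) `^ (- k) *
     expR (- (dyad j * lag z / 2))) * (z.2.1^-1 + dyad j) / T))).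
    rewrite ler_wpM2l ?powR_ge0// /flow ler_wpM2r ?invr_ge0 ?(ltW T0')//.
    rewrite ler_wpM2r ?addr_ge0 ?(ltW ri) ?(ltW lj)//.
    by rewrite ler_wpM2l ?(ltW C0).
  have -> : dyad j `^ weight_exp * (C * (Cm * (1 + dyad j * w z) `^ (- k) *
     expR (- (dyad j * lag z / 2))) * (z.2.1^-1 + dyad j) / T) =
    (C * Cm / T) * (dyad j `^ weight_exp * dyad j * (1 + dyad j * w z) `^ (- k) * expR (- (dyad j * lag z / 2)) +
     dyad j `^ weight_exp * (1 + dyad j * w z) `^ (- k) * expR (- (dyad j * lag z / 2)) * z.2.1^-1) by ring.
  rewrite ler_wpM2l ?divr_ge0 ?mulr_ge0 ?(ltW C0) ?(ltW Cm0) ?(ltW T0')//.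
  apply: lerD (term1 j) _; rewrite ler_wpM2r ?(ltW ri)//; apply: le_trans (term2 j).
  rewrite ler_piMr ?mulr_ge0 ?powR_ge0// -[leRHS]expR0 ler_expR oppr_le0.
  by rewrite divr_ge0// mulr_ge0// ltW.
have TE a : T `^ (- (1 + a)) = T `^ (- a) / T.
  by rewrite opprD powRD ?(gt_eqF T0') ?implybT// powR_inv1 ?(ltW T0')// mulrC.
rewrite /super_flow (TE k) (TE weight_exp) -/a1.
apply: le_trans; first by apply: ler_sum => j _; exact: termle j.
rewrite -mulr_sumr big_split/= -!mulr_suml -!mulr_sumr.
have s1 := S1 J (2 + lag z) X0; have s2 := S2 J T T0'.
have -> : C * Cm * (B1 + B2) * (T `^ (- k) / T * (2 + lag z) `^ (- a1) + T `^ (- weight_exp) / T / z.2.1)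
 = C * Cm / T * ((B1 + B2) * (T `^ (- k) * (2 + lag z) `^ (- a1)) + (B1 + B2) * (T `^ (- weight_exp) / z.2.1)) by ring.
rewrite ler_wpM2l ?divr_ge0 ?mulr_ge0 ?(ltW C0) ?(ltW Cm0) ?(ltW T0')//.
apply: lerD.
  have -> : 2 `^ k * (16 * expR 1) * (T `^ (- k) * (2 + lag z) `^ (- a1)) *
    (\sum_(i < J) peak a1 ((2 + lag z) * dyad i)) = 2 `^ k * (16 * expR 1 *
    (\sum_(i < J) peak a1 ((2 + lag z) * dyad i))) * (T `^ (- k) * (2 + lag z) `^ (- a1)) by ring.
  rewrite ler_wpM2r ?mulr_ge0 ?powR_ge0//.
  apply: (@le_trans _ _ B1); last by rewrite lerDl ltW.
  by rewrite /B1 ler_wpM2l ?powR_ge0// ler_wpM2l// mulr_ge0 ?expR_ge0.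
have -> : 2 `^ k * T `^ (- weight_exp) * (\sum_(i < J) peak a2 (T * dyad i)) / z.2.1 =
  2 `^ k * (\sum_(i < J) peak a2 (T * dyad i)) * (T `^ (- weight_exp) / z.2.1) by ring.
rewrite ler_wpM2r ?divr_ge0 ?powR_ge0 ?(ltW r0)//.
apply: (@le_trans _ _ B2); last by rewrite lerDr ltW.
by rewrite /B2 ler_wpM2l ?powR_ge0.
Qed.

Lemma powR_sum_le (a x y : R) : 0 <= a -> 0 <= x -> 0 <= y ->
  (x + y) `^ a <= 2 `^ a * (x `^ a + y `^ a).
Proof.
move=> a0; wlog xy : x y / x <= y => [H x0 y0|x0 y0].
  by have [/H|/ltW/H] := leP x y; [exact|rewrite addrC (addrC (x `^ a)); exact].
apply: (@le_trans _ _ ((2 * y) `^ a)).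
  by apply: powRge0_mono; rewrite ?addr_ge0// mulrDl mul1r lerD2r.
by rewrite powRM// ler_wpM2l ?powR_ge0// lerDr powR_ge0.
Qed.

(** The criticality of p, written in terms of the conjugate exponent q: it says
    that gamma_poly p n = 0. *)
Hypothesis crit : n%:R + 2 - 2 * q - k - q^-1 = 0.

Let pE : p^-1 = 1 - q^-1. Proof. by rewrite -pq addrK. Qed.

(** These two identities make all powers of T cancel below. *)
Let expo1 : n%:R - q * (1 + k) + weight_exp * (q - 1) = 0.
Proof.
rewrite -[RHS]crit /weight_exp pE; field; by rewrite gt_eqF// (lt_trans ltr01).
Qed.

Let expo2 : 1 + (n%:R - q) - q * (1 + weight_exp) + weight_exp * (q - 1) = 0.
Proof.
rewrite -[RHS]crit /weight_exp pE; field; by rewrite gt_eqF// (lt_trans ltr01).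
Qed.

Let weight_le (T0 T : R) (J m : nat) z : T = 2 ^+ m -> (m < J)%N -> (cone T0 `&` window T) z ->
  super_mode J z `^ (1 - q) <= expR 1 `^ (q - 1) * T `^ (weight_exp * (q - 1)).
Proof.
move=> -> mJ [[Sz _] /andP[_ /ltW wz]].
have h := super_mode_ge Sz mJ wz; have e0 : 0 < expR (- 1) * (2 ^+ m : R) `^ (- weight_exp).
  by rewrite mulr_gt0 ?expR_gt0 ?powR_gt0 ?exprn_gt0.
have -> : 1 - q = - (q - 1) by rewrite opprB.
apply: le_trans (powRneg_mono _ e0 h) _; first by rewrite subr_ge0 ltW.
rewrite powRM ?expR_ge0 ?powR_ge0//.
have -> : expR (- 1) `^ (- (q - 1)) = expR 1 `^ (q - 1).
  have -> : expR (- 1) = (expR 1 : R) `^ (- 1) by rewrite expRN powR_inv1// expR_ge0.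
  by rewrite -powRrM mulN1r opprK.
by rewrite -powRrM mulrNN.
Qed.

(** The q-th power of the first term of super_flow_le is integrated in the lag,
    where (2 + lag)^(-1) gives the logarithm ln T = O(m); the second one is a
    pure power of r and gives O(1). *)
Lemma super_flow_estimate (C : R) : 0 < C -> q < n%:R -> exists2 K : R, 0 < K &
  forall (T0 T : R) (J m : nat), T = 2 ^+ m -> (m < J)%N ->
  (\int[mu3]_(z in cone T0 `&` window T)
     (super_flow C J T z `^ q * super_mode J z `^ (1 - q) * z.2.1 ^+ n.-1)%:E <=
   (K * m.+1%:R)%:E)%E.
Proof.
move=> C0 qn; have q0 : 0 < q by exact: lt_trans q1.
have [K0 K00 fle] := super_flow_le C0.
have [K1 K10 rad] := window_radial_power n3 M0 rho q0.
have cc1 : 1 < cone_const M rho by exact: cone_const_gt1.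
have cc0 : 0 < cone_const M rho by exact: lt_trans cc1.
have [c [c0 cE]] : exists c : R, 0 < c /\ c = K0 `^ q * 2 `^ q * expR 1 `^ (q - 1).
  by eexists; split; last reflexivity; rewrite !mulr_gt0 ?powR_gt0 ?expR_gt0.
have area0 := @sphere_area_ge0 R n.
pose K2 := (sphere_area n + 1) * cone_const M rho ^+ n * c * (3 + cone_const M rho).
have K20 : 0 < K2.
  apply: mulr_gt0; last by rewrite addr_gt0.
  by apply: mulr_gt0 => //; apply: mulr_gt0; [exact: ltr_wpDl|exact: exprn_gt0].
exists (K2 + K1 * c); first by rewrite addr_gt0// mulr_gt0.
move=> T0 T J m TE mJ; have T1 : 1 <= T by rewrite TE exprn_ege1// ler1n.
have T0' : 0 < T by exact: lt_le_trans T1.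
have mS := @measurable_slab R n M T0.
have mA := measurable_cone_window n3 M0 rho T0 T.
have AS : (cone T0 `&` window T) `<=` slab T0 by move=> z [[]].
have [g1 [g10 g1E]] : exists g1 : R, 0 <= g1 /\ g1 = c * (T `^ (- (1 + k))) `^ q * T `^ (weight_exp * (q - 1)).
  by eexists; split; last reflexivity; rewrite !mulr_ge0 ?powR_ge0 ?(ltW c0).
have [g2 [g20 g2E]] : exists g2 : R, 0 <= g2 /\ g2 = c * (T `^ (- (1 + weight_exp))) `^ q * T `^ (weight_exp * (q - 1)).
  by eexists; split; last reflexivity; rewrite !mulr_ge0 ?powR_ge0 ?(ltW c0).
pose f1 z := g1 * z.2.1 ^+ n.-1 * (2 + lag z) `^ (- 1).
pose f2 (z : spacetime) := g2 * z.2.1 `^ (n.-1%:R - q).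
have r_gt0 z : slab T0 z -> 0 < z.2.1 by move=> [_ [hz _]]; exact: gt2M_gt0 hz.
have f1_ge0 z : slab T0 z -> 0 <= f1 z.
  by move=> Sz; rewrite /f1 mulr_ge0 ?powR_ge0// mulr_ge0// exprn_ge0// ltW// r_gt0.
have f2_ge0 z : slab T0 z -> 0 <= f2 z by move=> Sz; rewrite /f2 mulr_ge0 ?powR_ge0.
have mlag : measurable_fun (slab T0) lag.
  apply: measurable_funD; first exact: measurable_funTS.
  by apply: measurable_funB => //; exact: measurable_slab_tortoise.
have mf1 : measurable_fun (cone T0 `&` window T) f1.
  apply: (measurable_funS mS AS); apply: measurable_funM.
    apply: measurable_funM => //; apply: (@measurable_radial R n M T0 (fun r => r ^+ n.-1)) => r _.
    exact: exprn_continuous.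
  apply: (measurableT_comp (f := fun x => x `^ (- 1))); first exact: measurable_powR.
  by apply: measurable_funD.
have mf2 : measurable_fun (cone T0 `&` window T) f2.
  apply: (measurable_funS mS AS); apply: measurable_funM => //.
  apply: (@measurable_radial R n M T0 (fun r => r `^ (n.-1%:R - q))) => r hr.
  have r0 := gt2M_gt0 M0 hr.
  suff [e de] : exists e, is_derive r 1 (fun r => r `^ (n.-1%:R - q)) e by exact: is_derive_continuous de.
  by eexists; dtac.
apply: (@le_trans _ _ (\int[mu3]_(z in cone T0 `&` window T) ((f1 z)%:E + (f2 z)%:E))%E).
  apply: le_integral_nomeas => z zA; have Sz := AS z zA; have r0 := r_gt0 z Sz.
    by rewrite lee_fin !mulr_ge0 ?powR_ge0 ?exprn_ge0// ltW.
  have [zc _] := zA; have l0 := lag_ge0 zc; have X0 : 0 < 2 + lag z by rewrite ltr_pwDl.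
  rewrite -EFinD lee_fin.
  have h1 := fle T0 J T z T1 zA; have h2 := weight_le TE mJ zA.
  have ri : 0 < z.2.1^-1 by rewrite invr_gt0.
  have s0 : 0 <= super_flow C J T z.
    apply: sumr_ge0 => j _; rewrite mulr_ge0 ?powR_ge0//.
    exact: (flow_ge0 M0 rm (ltW C0) (dyad_itv j) T0' Sz).
  have h3 : super_flow C J T z `^ q <= K0 `^ q * 2 `^ q *
     ((T `^ (- (1 + k))) `^ q * (2 + lag z) `^ (- 1) + (T `^ (- (1 + weight_exp))) `^ q * z.2.1 `^ (- q)).
    apply: le_trans (powRge0_mono (ltW q0) s0 h1) _.
    rewrite powRM ?(ltW K00) ?addr_ge0 ?mulr_ge0 ?powR_ge0 ?(ltW ri)// -mulrA ler_wpM2l ?powR_ge0//.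
    apply: le_trans (powR_sum_le (ltW q0) _ _) _; rewrite ?mulr_ge0 ?powR_ge0 ?(ltW ri)//.
    rewrite !powRM ?powR_ge0 ?(ltW ri)//.
    have -> : ((2 + lag z) `^ (- q^-1)) `^ q = (2 + lag z) `^ (- 1).
      by rewrite -powRrM mulNr mulVf// gt_eqF.
    have -> : z.2.1^-1 `^ q = z.2.1 `^ (- q).
      have <- : z.2.1 `^ (- 1) = z.2.1^-1 by rewrite powR_inv1// ltW.
      by rewrite -powRrM mulN1r.
    exact: lexx.
  apply: (@le_trans _ _ (K0 `^ q * 2 `^ q *
     ((T `^ (- (1 + k))) `^ q * (2 + lag z) `^ (- 1) + (T `^ (- (1 + weight_exp))) `^ q * z.2.1 `^ (- q))
     * (expR 1 `^ (q - 1) * T `^ (weight_exp * (q - 1))) * z.2.1 ^+ n.-1)).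
    by rewrite ler_wpM2r ?exprn_ge0 ?(ltW r0)// ler_pM ?powR_ge0.
  have rE : z.2.1 `^ (n.-1%:R - q) = z.2.1 ^+ n.-1 * z.2.1 `^ (- q).
    by rewrite powRD ?(gt_eqF r0) ?implybT// powR_mulrn// ltW.
  rewrite /f1 /f2 rE g1E g2E cE le_eqVlt; apply/orP; left; apply/eqP.
  move: (K0 `^ q) (2 `^ q) (expR 1 `^ _) ((T `^ (- (1 + k))) `^ q) ((2 + lag z) `^ _)
    ((T `^ (- (1 + weight_exp))) `^ q) (z.2.1 `^ _) (T `^ _) (z.2.1 ^+ _) => x1 x2 x3 x4 x5 x6 x7 x8 x9; ring.
rewrite ge0_integralD//; last 4 first.
- by move=> z /AS; exact: f1_ge0.
- exact/measurable_EFinP.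
- by move=> z /AS; exact: f2_ge0.
- exact/measurable_EFinP.
have I1 : (\int[mu3]_(z in cone T0 `&` window T) (f1 z)%:E <= (K2 * m.+1%:R)%:E)%E.
  apply: le_trans (integral_window_log (kap := g1) n3 M0 T1 g10 _) _.
    move=> z zA; have [zc _] := zA; have l0 := lag_ge0 zc.
    rewrite f1_ge0/=; last exact: AS.
    by rewrite /f1 powR_inv1// addr_ge0.
  rewrite lee_fin.
  have gT : g1 * T ^+ n = c.
    rewrite g1E -powR_mulrn ?(ltW T0')// -powRrM -!mulrA -!powRD ?(gt_eqF T0') ?implybT//.
    have -> : - (1 + k) * q + (weight_exp * (q - 1) + n%:R) = 0 by rewrite -[RHS]expo1; ring.
    by rewrite powRr0 mulr1.
  rewrite gT.
  have lnle : ln (2 + cone_const M rho * T) <= (3 + cone_const M rho) * m.+1%:R.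
    by rewrite TE ln_dyadic_le.
  rewrite /K2.
  have -> : sphere_area n * cone_const M rho ^+ n * (ln (2 + cone_const M rho * T) * c)
    = sphere_area n * (cone_const M rho ^+ n * c * ln (2 + cone_const M rho * T)) by ring.
  have -> : (sphere_area n + 1) * cone_const M rho ^+ n * c * (3 + cone_const M rho) * m.+1%:R
    = (sphere_area n + 1) * (cone_const M rho ^+ n * c * ((3 + cone_const M rho) * m.+1%:R)) by ring.
  apply: ler_pM => //.
  - rewrite !mulr_ge0 ?exprn_ge0 ?(ltW cc0) ?(ltW c0)// ln_ge0//.
    by rewrite (@le_trans _ _ 2) ?ler1n// lerDl mulr_ge0 ?ltW.
  - by rewrite lerDl.
  - by rewrite ler_wpM2l// mulr_ge0 ?exprn_ge0 ?(ltW cc0) ?(ltW c0).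
have I2 : (\int[mu3]_(z in cone T0 `&` window T) (f2 z)%:E <= (K1 * c)%:E)%E.
  apply: le_trans (rad T0 T g2 f2 T1 g20 _) _.
    by move=> z zA; rewrite f2_ge0 ?lexx//; exact: AS.
  rewrite qn lee_fin ler_wpM2l ?(ltW K10)//.
  rewrite g2E -powRrM -!mulrA -!powRD ?(gt_eqF T0') ?implybT//.
  have -> : - (1 + weight_exp) * q + (weight_exp * (q - 1) + (1 + (n%:R - q))) = 0 by rewrite -[RHS]expo2; ring.
  by rewrite powRr0 mulr1.
apply: le_trans (leeD I1 I2) _; rewrite -EFinD lee_fin mulrDl lerD2l.
by rewrite ler_peMr ?mulr_ge0 ?(ltW K10) ?(ltW c0)// ler1n.
Qed.

Lemma critical_flow1_estimate (C : R) : 0 < C -> exists2 K : R, 0 < K &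
  forall (T0 T : R) (J m : nat), T = 2 ^+ m -> (m < J)%N ->
  (\int[mu3]_(z in cone T0 `&` window T)
     (flow C 1 T z `^ q * super_mode J z `^ (1 - q) * z.2.1 ^+ n.-1)%:E <= K%:E)%E.
Proof.
move=> C0; have [K K0 H] := flow1_estimate n3 M0 Cz0 rm rho0 C0 q1.
exists (K * expR (- 1) `^ (1 - q)); first by rewrite mulr_gt0 ?powR_gt0 ?expR_gt0.
move=> T0 T J m TE mJ; have T1 : 1 <= T by rewrite TE exprn_ege1// ler1n.
have T0' : 0 < T by exact: lt_le_trans T1.
have om0 : 0 < expR (- 1) * T `^ (- weight_exp) by rewrite mulr_gt0 ?expR_gt0 ?powR_gt0.
apply: le_trans (H T0 T _ (super_mode J) T1 om0 _) _.
  by move=> z [[Sz _] /andP[_ /ltW wz]]; rewrite TE in wz *; exact: super_mode_ge Sz mJ wz.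
rewrite lee_fin powRM ?expR_ge0 ?powR_ge0// -!mulrA ler_wpM2l ?(ltW K0)//.
rewrite -powRrM -powRD ?(gt_eqF T0') ?implybT//.
have -> : - weight_exp * (1 - q) + (n%:R - q * (1 + k)) = 0 by rewrite -[RHS]expo1; ring.
by rewrite powRr0 mulr1.
Qed.

End critical_weight.

(** * The critical lifespan *)

Lemma ge0_integral_axpy d (T : measurableType d) (R : realType)
    (mu : {measure set T -> \bar R}) (A : set T) (c : R) (f g : T -> R) :
  measurable A -> measurable_fun A f -> measurable_fun A g -> 0 <= c ->
  (forall x, A x -> 0 <= f x) -> (forall x, A x -> 0 <= g x) ->
  (\int[mu]_(x in A) (f x + c * g x)%:E =
   \int[mu]_(x in A) (f x)%:E + c%:E * \int[mu]_(x in A) (g x)%:E)%E.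
Proof.
move=> mA mf mg c0 f0 g0.
rewrite -ge0_integralZl_EFin//; last by exact/measurable_EFinP.
rewrite -ge0_integralD//.
- exact/measurable_EFinP.
- by move=> x Ax; rewrite mule_ge0// lee_fin// g0.
- by apply: measurable_funeM; exact/measurable_EFinP.
Qed.

Section critical_solutions.
Context {R : realType} (n : nat) (M mu d : R) (D V : R -> R).
Hypothesis n3 : (3 <= n)%N.
Hypothesis M0 : 0 < M.
Hypothesis mu0 : 0 <= mu.
Hypothesis d0 : 0 < d.
Hypothesis d1 : d <= 2^-1.
Hypothesis cD : forall r, 2 * M < r -> {for r, continuous D}.
Hypothesis cV : forall r, 2 * M < r -> {for r, continuous V}.
Hypothesis D_bnd : forall r, 2 * M < r -> 0 <= D r <= mu * (r `^ (- d) / r).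
Hypothesis V_bnd : forall r, 2 * M < r -> 0 <= V r <= mu * (r `^ (- d) / r ^+ 2).
Local Notation k := (@half_dim R n).
Local Notation space := (R * 'rV[R]_n)%type.
Local Notation spacetime := (R * (R * 'rV[R]_n))%type.
Local Notation slab := (@slab R n M).
Local Notation mu3 := (@dt_dr_dw R n).
Local Notation w := (wtime M).
Variables (rho : R) (u0 u1 : space -> R).
Hypothesis rho0 : 0 < rho.
Hypothesis u0_ge0 : ae_Omega M (fun x => 0 <= u0 x).
Hypothesis u1_ge0 : ae_Omega M (fun x => 0 <= u1 x).
Hypothesis u0_L1 : L1loc_Omega M u0.
Hypothesis u1_L1 : L1loc_Omega M u1.
Hypothesis u1_nt : ~ ae_Omega M (fun x => u1 x = 0).
Local Notation cone T0 := (cone M rho T0 : set spacetime).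
Local Notation window := (@window R n M).
Variables (p q : R).
Hypothesis p1 : 1 < p.
Hypothesis pq : p^-1 + q^-1 = 1.
Hypothesis q1 : 1 < q.
Variables (N : nat) (Cz : R) (zf z1 z2 : R -> R -> R) (C c0 T1 : R).
Hypothesis tm : test_modes M D V rho u0 u1 p N Cz zf z1 z2 C c0 T1.
Local Notation super_mode := (@super_mode R n M zf p).
Local Notation super_flow := (@super_flow R n M zf p C).
Let rm := tm_rm tm.

Section one_solution.
Variables (eps T0 : R) (u : spacetime -> R).
Hypothesis eps0 : 0 < eps.
Hypothesis usol : weak_solution M D V p u0 u1 eps T0 u.
Hypothesis usupp : forall t, 0 < t < T0 ->
  ess_supp M (fun x => u (t, x)) `<=` tortoise_ball M (t + rho).

Let mass (T : R) (W : spacetime -> R) (z : spacetime) : R := `|u z| `^ p * (timecut M T z ^+ N * W z) * z.2.1 ^+ n.-1.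
Let load (T : R) (e : spacetime -> R) (z : spacetime) : R := `|u z| * (timecut M T z ^+ N.-2 * e z) * z.2.1 ^+ n.-1.

Let mu_ : measurable_fun (slab T0) u. Proof. exact: usol.1.1. Qed.
Let mS : measurable (slab T0). Proof. exact: measurable_slab. Qed.
Let mr : measurable_fun (slab T0) (fun z : spacetime => z.2.1 ^+ n.-1).
Proof. by apply: (@measurable_radial R n M T0 (fun r => r ^+ n.-1)) => r _; exact: exprn_continuous. Qed.
Let mup : measurable_fun (slab T0) (fun z => `|u z| `^ p).
Proof.
apply: (measurableT_comp (f := fun x => x `^ p)); first exact: measurable_powR.
exact: measurableT_comp.
Qed.
Let mcut T : measurable_fun (slab T0) (timecut M T). Proof. exact: measurable_timecut. Qed.

Let r_ge0 z : slab T0 z -> 0 <= z.2.1 ^+ n.-1.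
Proof. by move=> [_ [hz _]]; rewrite exprn_ge0// ltW// (gt2M_gt0 M0 hz). Qed.
Let cut_ge0 (T : R) (z : spacetime) (a : nat) : 0 <= timecut M T z ^+ a. Proof. by rewrite exprn_ge0// cutbase_ge0. Qed.
Let cut_le1 (T : R) (z : spacetime) (a : nat) : timecut M T z ^+ a <= 1.
Proof. by rewrite exprn_ile1 ?cutbase_ge0 ?cutbase_le1. Qed.

Let mass_m T W : measurable_fun (slab T0) W -> measurable_fun (slab T0) (mass T W).
Proof.
move=> mW; apply: measurable_funM => //; apply: measurable_funM => //.
by apply: measurable_funM => //; exact: measurable_funX.
Qed.
Let load_m T e : measurable_fun (slab T0) e -> measurable_fun (slab T0) (load T e).
Proof.
move=> me; apply: measurable_funM => //; apply: measurable_funM; first exact: measurableT_comp.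
by apply: measurable_funM => //; exact: measurable_funX.
Qed.
Let mass_ge0 T (W : spacetime -> R) z : 0 <= W z -> slab T0 z -> 0 <= mass T W z.
Proof. by move=> W0 Sz; rewrite !mulr_ge0 ?powR_ge0 ?cut_ge0 ?r_ge0. Qed.
Let load_ge0 T (e : spacetime -> R) z : 0 <= e z -> slab T0 z -> 0 <= load T e z.
Proof. by move=> W0 Sz; rewrite !mulr_ge0 ?cut_ge0 ?r_ge0. Qed.

Let mode_m lam : 0 <= lam <= 1 -> measurable_fun (slab T0) (mode M zf lam).
Proof. by move=> l01; exact: (measurable_mode n3 M0 rm l01). Qed.
Let flow_m T lam : 0 <= lam <= 1 -> measurable_fun (slab T0) (flow M zf C lam T).
Proof. by move=> l01; exact: (measurable_flow n3 M0 C T rm l01). Qed.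
Let flow0 T lam z : 0 < T -> 0 <= lam <= 1 -> slab T0 z -> 0 <= flow M zf C lam T z.
Proof. by move=> T0' l01; exact: (flow_ge0 M0 rm (ltW (tm_C tm))). Qed.

Lemma super_modeS J z : super_mode J.+1 z = super_mode J z + @dyad R J `^ weight_exp n p * mode M zf (@dyad R J) z.
Proof. by rewrite /super_mode big_ord_recr. Qed.

Lemma super_flowS J T z : super_flow J.+1 T z = super_flow J T z + @dyad R J `^ weight_exp n p * flow M zf C (@dyad R J) T z.
Proof. by rewrite /super_flow big_ord_recr. Qed.

Lemma super_mode_ge0 J z : slab T0 z -> 0 <= super_mode J z.
Proof.
move=> Sz; apply: sumr_ge0 => j _; rewrite mulr_ge0 ?powR_ge0// ltW//.
exact: (mode_pos rm (dyad_itv j) Sz).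
Qed.

Lemma super_flow_ge0 J T z : 0 < T -> slab T0 z -> 0 <= super_flow J T z.
Proof.
move=> T0' Sz; apply: sumr_ge0 => j _; rewrite mulr_ge0 ?powR_ge0//.
exact: (flow0 T0' (dyad_itv j) Sz).
Qed.

Lemma measurable_super_mode J : measurable_fun (slab T0) (super_mode J).
Proof.
apply: measurable_sum => j; apply: measurable_funM => //.
exact: (mode_m (dyad_itv j)).
Qed.

Lemma measurable_super_flow J T : measurable_fun (slab T0) (super_flow J T).
Proof.
apply: measurable_sum => j; apply: measurable_funM => //.
exact: (flow_m T (dyad_itv j)).
Qed.

(** The key inequality is linear in the mode, so it can be summed; the data
    terms are dropped. *)
Lemma superposition J T : T1 <= T < T0 ->
  (source_mass M rho N p T0 u T (super_mode J) < +oo)%E /\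
  (source_mass M rho N p T0 u T (super_mode J) <=
    \int[mu3]_(z in cone T0 `&` window T) (load T (super_flow J T) z)%:E)%E.
Proof.
move=> T1T; have [T1' _] := andP T1T; have T0' : 0 < T.
  by apply: lt_le_trans T1'; apply: lt_le_trans (tm_T1 tm).
have mC := @measurable_cone R n M M0 rho T0.
have mA := measurable_cone_window n3 M0 rho T0 T.
have CS : cone T0 `<=` slab T0 by move=> z [].
have AS : (cone T0 `&` window T) `<=` slab T0 by move=> z [[]].
elim: J => [|J [IH1 IH2]].
  have -> : source_mass M rho N p T0 u T (super_mode 0) = 0%E.
    apply: integral0_eq => z _; by rewrite /super_mode big_ord0 !(mulr0, mul0r).
  split; first exact: ltry.
  apply: integral_ge0 => z /AS Sz; rewrite lee_fin load_ge0//.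
  exact: super_flow_ge0.
have jJ := @dyad_itv R J; set c := @dyad R J `^ weight_exp n p.
have c0' : 0 <= c by exact: powR_ge0.
have [fin1 [dd [dd0 in1 _]]] := tm_ineq tm eps0 usol usupp jJ T1T.
have E1 : source_mass M rho N p T0 u T (super_mode J.+1) =
   (source_mass M rho N p T0 u T (super_mode J) + c%:E * source_mass M rho N p T0 u T (mode M zf (@dyad R J)))%E.
  have a1 z : cone T0 z -> 0 <= mass T (super_mode J) z.
    by move=> /CS Sz; apply: mass_ge0 => //; exact: super_mode_ge0.
  have a2 z : cone T0 z -> 0 <= mass T (mode M zf (dyad J)) z.
    by move=> /CS Sz; apply: mass_ge0 => //; exact: ltW (mode_pos rm jJ Sz).
  have H := @ge0_integral_axpy _ _ R mu3 (cone T0) c _ _ mC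
    (measurable_funS mS CS (mass_m T (measurable_super_mode J)))
    (measurable_funS mS CS (mass_m T (mode_m jJ))) c0' a1 a2.
  apply: etrans H; apply: eq_integral => z _; rewrite super_modeS -/c /mass; congr EFin; ring.
have E2 : (\int[mu3]_(z in cone T0 `&` window T) (load T (super_flow J.+1 T) z)%:E =
  \int[mu3]_(z in cone T0 `&` window T) (load T (super_flow J T) z)%:E +
  c%:E * \int[mu3]_(z in cone T0 `&` window T) (load T (flow M zf C (@dyad R J) T) z)%:E)%E.
  have a1 z : (cone T0 `&` window T) z -> 0 <= load T (super_flow J T) z.
    by move=> /AS Sz; apply: load_ge0 => //; exact: super_flow_ge0.
  have a2 z : (cone T0 `&` window T) z -> 0 <= load T (flow M zf C (dyad J) T) z.
    by move=> /AS Sz; apply: load_ge0 => //; exact: flow0.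
  have H := @ge0_integral_axpy _ _ R mu3 (cone T0 `&` window T) c _ _ mA
    (measurable_funS mS AS (load_m T (measurable_super_flow J T)))
    (measurable_funS mS AS (load_m T (flow_m T jJ))) c0' a1 a2.
  apply: etrans H; apply: eq_integral => z _; rewrite /load super_flowS -/c; congr EFin; ring.
have sm0 : (0 <= source_mass M rho N p T0 u T (mode M zf (@dyad R J)))%E.
  apply: integral_ge0 => z /CS Sz; rewrite lee_fin; apply: mass_ge0 => //.
  exact: ltW (mode_pos rm jJ Sz).
rewrite E1 E2; split.
  by rewrite lte_add_pinfty// lte_mul_pinfty// lee_fin.
apply: leeD => //; apply: lee_wpmul2l; first by rewrite lee_fin.
by apply: le_trans in1; rewrite leeDl// lee_fin mulr_ge0// ltW.
Qed.

Definition past (m : nat) : set spacetime := [set x | w x < 2 ^+ m].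

Definition bulk (J : nat) (z : spacetime) : R := `|u z| `^ p * super_mode J z * z.2.1 ^+ n.-1.

(** Unlike the truncated masses, these have increments equal to the masses of
    disjoint windows; they are dominated by the truncated mass at twice the
    time, where the cutoff is 1. *)
Definition past_mass (J m : nat) : \bar R := (\int[mu3]_(z in cone T0 `&` past m) (bulk J z)%:E)%E.

Let bulk_ge0 J z : slab T0 z -> 0 <= bulk J z.
Proof. by move=> Sz; rewrite !mulr_ge0 ?powR_ge0 ?r_ge0 ?super_mode_ge0. Qed.

Let bulk_m J : measurable_fun (slab T0) (bulk J).
Proof.
apply: measurable_funM => //; apply: measurable_funM => //.
exact: measurable_super_mode.
Qed.

Let m_past m : measurable (cone T0 `&` past m).
Proof.
have mw : measurable_fun (slab T0) w := @measurable_wtime R n M n3 M0 T0.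
have -> : cone T0 `&` past m = cone T0 `&` (slab T0 `&` w @^-1` `]-oo, (2 ^+ m : R)[%classic).
  apply/seteqP; split => z.
    by move=> [[Sz h] wz]; split => //; split => //=; rewrite in_itv.
  by move=> [Cz' [_ /=]]; rewrite in_itv.
apply: measurableI; first exact: (@measurable_cone R n M M0 rho T0).
by apply: mw => //; exact: measurable_itv.
Qed.

Let pow2S m : (2 ^+ m.+1 : R) / 2 = 2 ^+ m.
Proof. by rewrite exprS mulrAC divff ?mul1r// pnatr_eq0. Qed.

Lemma past_mass_le J m :
  (past_mass J m <= source_mass M rho N p T0 u (2 ^+ m.+1) (super_mode J))%E.
Proof.
rewrite /past_mass integral_mkcond [leRHS]integral_mkcond; apply: le_integral_nomeas => z _.
  rewrite patchE; case: ifPn => //; rewrite inE => -[[Sz _] _].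
  by rewrite lee_fin bulk_ge0.
rewrite !patchE; case: ifPn => [|_]; rewrite ?inE; last first.
  case: ifPn => //; rewrite inE => -[Sz _]; rewrite lee_fin.
  by apply: mass_ge0 => //; exact: super_mode_ge0.
move=> [zc wz]; rewrite ifT ?inE// lee_fin /bulk.
have -> : timecut M (2 ^+ m.+1) z = 1.
  apply: cutbase_left; rewrite ler_pdivrMr ?exprn_gt0// [leRHS]mulrC pow2S.
  by apply: ltW; exact: wz.
by rewrite expr1n mul1r.
Qed.

Lemma past_mass_succ J m : past_mass J m.+1 =
  (past_mass J m + \int[mu3]_(z in cone T0 `&` window (2 ^+ m.+1)) (bulk J z)%:E)%E.
Proof.
have E : cone T0 `&` past m.+1 = (cone T0 `&` past m) `|` (cone T0 `&` window (2 ^+ m.+1)).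
  rewrite -setIUr; congr (_ `&` _); apply/seteqP; split => z; rewrite /past /window /= pow2S.
    by move=> h; have [h'|h'] := ltP (w z) (2 ^+ m); [by left|right; apply/andP; split].
  move=> [h|/andP[//]]; apply: lt_le_trans h _; rewrite exprS ler_peMl ?exprn_ge0//.
  by rewrite ler1n.
rewrite /past_mass E ge0_integral_setU//.
- exact: measurable_cone_window.
- rewrite -E; apply/measurable_EFinP; apply: (measurable_funS mS _ (bulk_m J)).
  by move=> z [[]].
- by rewrite -E => z [[Sz _] _]; rewrite lee_fin bulk_ge0.
- apply/disj_setPS => z [[_ h1] [_ /andP[h2 _]]].
  by move: h1; rewrite /past /= ltNge -pow2S h2.
Qed.

Lemma window_mass_le J T : (\int[mu3]_(z in cone T0 `&` window T) (mass T (super_mode J) z)%:E <=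
  \int[mu3]_(z in cone T0 `&` window T) (bulk J z)%:E)%E.
Proof.
apply: le_integral_nomeas => z [[Sz _] _]; rewrite lee_fin.
  by apply: mass_ge0 => //; exact: super_mode_ge0.
rewrite /mass /bulk ler_wpM2r ?r_ge0// ler_wpM2l ?powR_ge0//.
by rewrite ler_piMl ?super_mode_ge0.
Qed.

Variables (K1 K2 : R) (J : nat).
Hypothesis K10 : 0 < K1.
Hypothesis K20 : 0 < K2.
Hypothesis est1 : forall (T : R) (m : nat), T = 2 ^+ m -> (m < J)%N ->
  (\int[mu3]_(z in cone T0 `&` window T)
     (super_flow J T z `^ q * super_mode J z `^ (1 - q) * z.2.1 ^+ n.-1)%:E <=
   (K1 * m.+1%:R)%:E)%E.
Hypothesis est2 : forall (T : R) (m : nat), T = 2 ^+ m -> (m < J)%N ->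
  (\int[mu3]_(z in cone T0 `&` window T)
     (flow M zf C 1 T z `^ q * super_mode J z `^ (1 - q) * z.2.1 ^+ n.-1)%:E <= K2%:E)%E.

Let b m := fine (past_mass J m).

Lemma past_mass_ge0 m : (0 <= past_mass J m)%E.
Proof. by apply: integral_ge0 => z [[Sz _] _]; rewrite lee_fin bulk_ge0. Qed.

Let J0 : (0 < J)%N -> forall z, slab T0 z -> 0 < super_mode J z.
Proof.
move=> J0 z Sz; apply: lt_le_trans (_ : dyad 0 `^ weight_exp n p * mode M zf (dyad 0) z <= _).
  by rewrite mulr_gt0 ?powR_gt0 ?dyad_gt0// (mode_pos rm (@dyad_itv R 0) Sz).
rewrite /super_mode (bigD1 (Ordinal J0))//= lerDl.
apply: sumr_ge0 => j _; rewrite mulr_ge0 ?powR_ge0// ltW//.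
exact: (mode_pos rm (dyad_itv j) Sz).
Qed.

(** At T = 2^(m+1) the window carries b_(m+1) - b_m. The first two inequalities
    are those of the superposition and of the mode lambda = 1, with Young's
    inequality against the weight super_mode; in the third one the window mass
    is absorbed by dl = 1/2. *)
Lemma iteration_step m dl : T1 <= 2 ^+ m.+1 -> 2 ^+ m.+2 < T0 -> (m.+1 < J)%N -> 0 < dl ->
  [/\ b m <= dl * (b m.+1 - b m) + dl `^ (1 - q) * (K1 * m.+2%:R),
      eps * c0 <= dl * (b m.+1 - b m) + dl `^ (1 - q) * K2 &
      b m <= 2 `^ q * (K1 * m.+2%:R)].
Proof.
move=> T1m mT0 mJ dl0; have JJ := J0 (leq_ltn_trans (leq0n _) mJ).
have [T TE] : exists T : R, T = 2 ^+ m.+1 by eexists.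
rewrite -TE in T1m.
have Tp : 0 < T by rewrite TE exprn_gt0.
have TT0 : T < T0.
  apply: le_lt_trans mT0; rewrite TE [leRHS]exprS ler_peMl ?exprn_ge0// ler1n//.
have T1T : T1 <= T < T0 by rewrite T1m.
have T1T' : T1 <= 2 * T < T0.
  rewrite (le_trans T1m) ?ler_peMl ?(ltW Tp) ?ler1n//=.
  by rewrite TE -exprS.
have [fin1 in1] := superposition J T1T.
have [fin2 _] := superposition J T1T'.
have l1 : 0 <= (1 : R) <= 1 by rewrite ler01 lexx.
have [_ [dd [dd0 in2 cd]]] := tm_ineq tm eps0 usol usupp l1 T1T.
have q0 : 0 < q by exact: lt_trans q1.
have AS : (cone T0 `&` window T) `<=` slab T0 by move=> z [[]].
have mW := measurable_super_mode J.
have pastT : (past_mass J m <= source_mass M rho N p T0 u T (super_mode J))%E.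
  by rewrite TE; exact: past_mass_le.
have pastfin : past_mass J m \is a fin_num.
  by rewrite ge0_fin_numE ?past_mass_ge0// (le_lt_trans pastT).
have pastfin1 : past_mass J m.+1 \is a fin_num.
  rewrite ge0_fin_numE ?past_mass_ge0//; apply: le_lt_trans fin2.
  by rewrite TE -exprS; exact: past_mass_le.
have [A [AE A0]] : exists A : R, (\int[mu3]_(z in cone T0 `&` window T) (bulk J z)%:E = A%:E)%E
    /\ A = b m.+1 - b m.
  have := past_mass_succ J m; rewrite -TE => E.
  have Afin : (\int[mu3]_(z in cone T0 `&` window T) (bulk J z)%:E)%E \is a fin_num.
    move: pastfin1; rewrite E fin_numD => /andP[_ //].
  exists (fine (\int[mu3]_(z in cone T0 `&` window T) (bulk J z)%:E)%E); rewrite fineK//; split => //.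
  by rewrite /b E (fineD pastfin Afin) addrAC subrr add0r.
rewrite -A0.
have massA := window_mass_le J T; rewrite AE in massA.
have le_young (e : spacetime -> R) : measurable_fun (slab T0) e -> (forall z, slab T0 z -> 0 <= e z) ->
  forall I : R, (\int[mu3]_(z in cone T0 `&` window T)
     (e z `^ q * super_mode J z `^ (1 - q) * z.2.1 ^+ n.-1)%:E <= I%:E)%E ->
  (\int[mu3]_(z in cone T0 `&` window T) (load T e z)%:E <= (dl * A + dl `^ (1 - q) * I)%:E)%E.
  move=> me e0 I HI.
  apply: le_trans (young_integral n3 M0 rho mu_ p1 pq q0 (tm_N3 tm) (tm_N tm) T dl0 mW me JJ e0) _.
  rewrite EFinD !EFinM; apply: leeD.
    by apply: lee_wpmul2l => //; rewrite lee_fin ltW.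
  by apply: lee_wpmul2l => //; rewrite lee_fin powR_ge0.
have mE := measurable_super_flow J T.
have E0 z : slab T0 z -> 0 <= super_flow J T z by exact: super_flow_ge0.
have mF := flow_m T l1.
have F0 z : slab T0 z -> 0 <= flow M zf C 1 T z by exact: flow0.
split.
- rewrite -lee_fin /b fineK//; apply: le_trans pastT _; apply: le_trans in1 _.
  exact: le_young mE E0 _ (est1 TE mJ).
- have h : (eps * c0 <= eps * dd) by rewrite ler_wpM2l ?(ltW eps0)// cd.
  apply: le_trans h _; rewrite -lee_fin.
  apply: le_trans (le_young _ mF F0 _ (est2 TE mJ)); apply: le_trans in2.
  rewrite leeDr//; apply: integral_ge0 => z [Sz _]; rewrite lee_fin.
  by apply: mass_ge0 => //; exact: ltW (mode_pos rm l1 Sz).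
have h2 : 0 < 2^-1 :> R by rewrite invr_gt0.
have Y0 := young_step n3 M0 p1 pq q1 (tm_N3 tm) (tm_N tm) h2 mu_ mW mE JJ E0 (est1 TE mJ).
have {}Y0 := le_trans in1 Y0.
set sm := source_mass M rho N p T0 u T (super_mode J) in Y0 pastT fin1.
have sm0 : (0 <= sm)%E.
  by apply: integral_ge0 => z [Sz _]; rewrite lee_fin; apply: mass_ge0 => //; exact: super_mode_ge0.
have smfin : sm \is a fin_num by rewrite ge0_fin_numE.
have half_pow : 2^-1 `^ (1 - q) = 2 `^ (q - 1) :> R.
  have <- : (2 : R) `^ (- 1) = 2^-1 by rewrite powR_inv1.
  by rewrite -powRrM mulN1r opprB.
rewrite half_pow -(fineK smfin) -EFinM -EFinD lee_fin in Y0.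
have bs : b m <= fine sm by rewrite /b fine_le.
apply: le_trans bs _.
have -> : 2 `^ q = 2 * 2 `^ (q - 1) :> R.
  by rewrite -powR1D// addrC subrK.
rewrite -mulrA; move: Y0; set X := 2 `^ (q - 1) * _; set y := fine sm.
by move: y X => y X; lra.
Qed.

End one_solution.

Hypothesis qn : q < n%:R.
Hypothesis crit : n%:R + 2 - 2 * q - k - q^-1 = 0.

(** If T0 exceeded exp(CC X), with X = eps^(-p(p-1)), more dyadic times would
    be available than growth_bound permits. *)
Lemma critical_time_bound : exists2 CC : R, 0 < CC & forall eps T0 : R, 0 < eps <= 1 ->
  admissible_time M D V p u0 u1 rho eps T0 ->
  T0 <= expR (CC * eps `^ (- (p * (p - 1)))).
Proof.
have [K1 K10 e1] := super_flow_estimate n3 M0 (tm_Cz tm) rm rho0 p1 pq q1 crit (tm_C tm) qn.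
have [K2 K20 e2] := critical_flow1_estimate n3 M0 (tm_Cz tm) rm rho0 pq q1 crit (tm_C tm).
have q0 : 0 < q by exact: lt_trans q1.
have p10 : 0 < p - 1 by rewrite subr_gt0.
have p0 : 0 < p by exact: lt_trans p1.
have Q1 : 1 <= 2 `^ q :> R by rewrite powR_ge1 ?ler1n// ltW.
have Q0 : 0 < 2 `^ q :> R by exact: lt_le_trans Q1.
pose Kg : R := 2 * (2 `^ q * K1) + K2.
have Kg0 : 0 < Kg by rewrite addr_gt0// !mulr_gt0.
have [Cg Cg0 HG] := growth_bound p1 pq q1 Kg0 (tm_c0 tm).
pose m1 := (Num.truncn T1).+1.
have T1m m : (m1 <= m)%N -> T1 <= 2 ^+ m.+1.
  move=> mm; apply: (@le_trans _ _ m1%:R); first by rewrite ltW// truncnS_gt.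
  rewrite -natrX ler_nat (leq_trans mm)// (leq_trans (ltnW (ltn_expl m (ltnSn 1))))//.
  by rewrite leq_exp2l.
pose CC : R := 2 * Cg + 4 * m1%:R + 3.
have CC0 : 0 < CC by rewrite /CC !addr_gt0 ?mulr_gt0.
exists CC => // eps T0 /andP[eps0 eps1] [T00 [u usol usupp]].
have [X XE] : exists X, X = eps `^ (- (p * (p - 1))) by eexists.
have X1 : 1 <= X.
  rewrite XE powRN -[leLHS]invr1 lef_pV2 ?posrE ?powR_gt0// powR_le1 ?(ltW eps0)//.
  by rewrite mulr_ge0 ?ltW.
have X0 : 0 < X by exact: lt_le_trans X1.
rewrite -XE leNgt; apply/negP => TC.
have CX0 : 0 <= Cg * X by rewrite mulr_ge0 ?ltW.
pose L := ((Num.truncn (Cg * X)).+1 + 2 * m1)%N.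
have LX : Cg * X < L%:R.
  apply: (@lt_le_trans _ _ (Num.truncn (Cg * X)).+1%:R); first exact: truncnS_gt.
  by rewrite ler_nat leq_addr.
have LX2 : L%:R <= Cg * X + 1 + 2 * m1%:R.
  rewrite /L natrD natrM lerD2r -natr1 lerD2r.
  by have /andP[] := truncn_itv CX0.
(* the dyadic times up to 2L fit before T0; e >= 2 compares the two exponentials *)
have big : 2 ^+ (2 * L).+1 < T0.
  apply: le_lt_trans TC; apply: (@le_trans _ _ (expR (2 * L).+1%:R)).
    have e2' : 2 <= expR 1 :> R by have := expR_ge1Dx (1 : R); rewrite -[1 + 1]/2.
    rewrite -[X in expR X]mulr1 expRM_natl.
    by rewrite lerXn2r ?nnegrE ?expR_ge0.
  rewrite ler_expR -natr1 natrM.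
  have Y : (4 * m1%:R + 3) <= (4 * m1%:R + 3) * X by rewrite ler_peMr// addr_ge0// mulr_ge0.
  have -> : CC * X = 2 * (Cg * X) + (4 * m1%:R + 3) * X by rewrite /CC; ring.
  move: (Cg * X) LX2 ((4 * m1%:R + 3) * X) Y => a LX2 y Y; lra.
have L1 : (1 <= L)%N by [].
have mL : (2 * m1 <= L)%N by rewrite /L leq_addl.
have small m : (m < 2 * L)%N -> 2 ^+ m.+2 < T0.
  move=> h; apply: le_lt_trans big; rewrite -!natrX ler_nat leq_exp2l// ltnS.
have est1 T m : T = 2 ^+ m -> (m < (2 * L).+1)%N -> _ := fun TE mJ => e1 T0 T (2 * L).+1 m TE mJ.
have est2 T m : T = 2 ^+ m -> (m < (2 * L).+1)%N -> _ := fun TE mJ => e2 T0 T (2 * L).+1 m TE mJ.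
have it m dl : (m1 <= m < 2 * L)%N -> 0 < dl -> _ := fun mr dl0 =>
  iteration_step eps0 usol usupp est1 est2 (T1m m (proj1 (andP mr))) (small m (proj2 (andP mr)))
   (proj2 (andP mr)) dl0.
have m2 m : K1 * m.+2%:R <= 2 * K1 * m.+1%:R.
  rewrite (mulrC 2) -mulrA ler_wpM2l ?(ltW K10)// -natrM ler_nat.
  by rewrite mul2n -addnn addSn addnS !ltnS leq_addl.
have K1g m : 2 `^ q * (K1 * m.+2%:R) <= Kg * m.+1%:R.
  apply: (@le_trans _ _ (2 `^ q * (2 * K1 * m.+1%:R))); first by rewrite ler_wpM2l ?(ltW Q0).
  have -> : 2 `^ q * (2 * K1 * m.+1%:R) = 2 * (2 `^ q * K1) * m.+1%:R by ring.
  by rewrite ler_wpM2r// /Kg lerDl ltW.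
have K1g' m : K1 * m.+2%:R <= Kg * m.+1%:R.
  by apply: le_trans (K1g m); rewrite ler_peMl// mulr_ge0// ltW.
have K2g : K2 <= Kg by rewrite /Kg lerDr !mulr_ge0// ltW.
have := HG eps (fun m => fine (past_mass T0 u (2 * L).+1 m)) m1 L eps0 L1 mL.
rewrite -XE => H; have : L%:R <= Cg * X; last by rewrite leNgt LX.
apply: H.
- by move=> m _; apply: fine_ge0; exact: past_mass_ge0.
- by move=> m mr; have [_ _ h] := it m 1 mr ltr01; exact: le_trans h (K1g m).
- move=> m dl mr dl0; have [h _ _] := it m dl mr dl0; apply: le_trans h _.
  by rewrite lerD2l ler_wpM2l ?powR_ge0.
move=> m dl mr dl0; have [_ h _] := it m dl mr dl0; apply: le_trans h _.
by rewrite lerD2l ler_wpM2l ?powR_ge0.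
Qed.

End critical_solutions.

(** * Blow-up and lifespan bounds *)

Lemma within_gt_continuous (R : realType) (a : R) (f : R -> R) :
  {within `]a, +oo[, continuous f} -> forall r, a < r -> {for r, continuous f}.
Proof.
have oI : open (`]a, +oo[%classic : set R) by exact: interval_open.
rewrite (continuous_open_subspace f oI) => cf r ar; apply: cf.
by rewrite inE/= in_itv/= ar.
Qed.

(** Since r > a, a surplus of decay may be given up. A common small exponent d
    for damping and potential keeps the supersolution explicit. *)
Lemma decay_rate (R : realType) (a mu b d c r : R) : 0 < a -> a < r -> 0 <= mu ->
  d + c <= b -> mu * r `^ (- b) <= mu * a `^ (- (b - c - d)) * (r `^ (- d) * r `^ (- c)).
Proof.
move=> a0 ar mu0 h; have r0 := lt_trans a0 ar; rewrite -mulrA ler_wpM2l//.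
have -> : - b = - (b - c - d) + (- d + - c) by ring.
rewrite powRD ?(gt_eqF r0) ?implybT// [X in _ * X <= _]powRD ?(gt_eqF r0) ?implybT//.
rewrite ler_wpM2r ?mulr_ge0 ?powR_ge0//; apply: powRneg_mono => //; last exact: ltW.
by rewrite subr_ge0 lerBrDr.
Qed.

Lemma strauss_above (R : realType) (n : nat) (pS : R) : (3 <= n)%N ->
  strauss_exponent n pS -> n%:R / (n%:R - 1) < pS.
Proof.
move=> n3 [pS0]; rewrite /gamma_poly => E.
have n2 : 2 < n%:R :> R by rewrite ltr_nat.
have n10 : 0 < n%:R - 1 :> R by lra.
rewrite ltNge; apply/negP; rewrite ler_pdivlMr// => h.
have := ler_wpM2l (ltW pS0) h.
have -> : pS * (pS * (n%:R - 1)) = (n%:R - 1) * pS ^+ 2 by ring.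
move: E; have -> : 2 + (n%:R + 1) * pS = 2 + pS + pS * n%:R by ring.
move: (_ * pS ^+ 2) (pS * n%:R) => x y; lra.
Qed.

Lemma gamma_poly_gt0 (R : realType) (n : nat) (p pS : R) : (3 <= n)%N ->
  strauss_exponent n pS -> 0 < p < pS -> 0 < gamma_poly p n.
Proof.
move=> n3 [pS0 E] /andP[p0 ppS].
have n2 : 2 < n%:R :> R by rewrite ltr_nat.
have n10 : 0 < n%:R - 1 :> R by lra.
have pd : 0 < pS - p by rewrite subr_gt0.
rewrite -(pmulr_lgt0 _ pS0).
have -> : gamma_poly p n * pS = gamma_poly pS n * p + (pS - p) * (2 + (n%:R - 1) * p * pS).
  by rewrite /gamma_poly; ring.
by rewrite E mul0r add0r mulr_gt0// addr_gt0// !mulr_gt0.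
Qed.

Theorem theorem1p1 (R : realType) (n : nat) (M mu1 mu2 beta gamma : R)
    (D V : R -> R) (u0 u1 : R * 'rV[R]_n -> R) (R1 R2 rho pS : R) :
  (3 <= n)%N -> 0 < M ->
  {within `]2 * M, +oo[, continuous D} ->
  {within `]2 * M, +oo[, continuous V} ->
  0 <= mu1 -> 0 <= mu2 -> 1 < beta -> 2 < gamma ->
  (forall r, 2 * M < r -> 0 <= D r <= mu1 * r `^ (- beta)) ->
  (forall r, 2 * M < r -> 0 <= V r <= mu2 * r `^ (- gamma)) ->
  L1loc_Omega M u0 -> L1loc_Omega M u1 ->
  ae_Omega M (fun x => 0 <= u0 x) -> ae_Omega M (fun x => 0 <= u1 x) ->
  ~ ae_Omega M (fun x => u0 x = 0) -> ~ ae_Omega M (fun x => u1 x = 0) ->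
  0 < R1 -> R1 < R2 ->
  ess_supp M u0 `<=` annulus M R1 R2 -> ess_supp M u1 `<=` annulus M R1 R2 ->
  0 < rho ->
  ess_supp M u0 `<=` tortoise_ball M rho ->
  ess_supp M u1 `<=` tortoise_ball M rho ->
  strauss_exponent n pS ->
  (forall p, 1 < p < pS ->
    (forall eps, 0 < eps -> (lifespan M D V p u0 u1 rho eps < +oo)%E) /\
    exists C eps0, [/\ 0 < C, 0 < eps0 &
      forall eps, 0 < eps <= eps0 ->
        (lifespan M D V p u0 u1 rho eps <=
         (if (p <= n%:R / (n%:R - 1))%R
          then C * eps `^ (- (2 * (p - 1) / (n%:R + 1 - (n%:R - 1) * p)))
          else C * eps `^ (- (2 * p * (p - 1) / gamma_poly p n)))%:E)%E]) /\
  ((forall r, 2 * M < r -> V r = 0) ->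
    exists C eps0, [/\ 0 < C, 0 < eps0 &
      forall eps, 0 < eps <= eps0 ->
        (lifespan M D V pS u0 u1 rho eps <=
         (expR (C * eps `^ (- (pS * (pS - 1)))))%:E)%E]).
Proof.
move=> n3 M0 cD cV mu1_0 mu2_0 beta1 gamma2 D_bnd V_bnd u0_L1 u1_L1 u0_ge0 u1_ge0 _ u1_nt _ _ _ _ rho0 _ _ hS.
have M20 : 0 < 2 * M by rewrite mulr_gt0.
have {}cD := within_gt_continuous cD; have {}cV := within_gt_continuous cV.
pose d : R := Num.min 2^-1 (Num.min (beta - 1) (gamma - 2)).
have d0 : 0 < d by rewrite !lt_min invr_gt0 ltr0n !subr_gt0 beta1 gamma2.
have d1 : d <= 2^-1 by rewrite ge_min lexx.
have db : d + 1 <= beta by rewrite -lerBrDr !ge_min lexx !orbT.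
have dg : d + 2 <= gamma by rewrite -lerBrDr !ge_min lexx !orbT.
pose mu : R := Num.max (mu1 * (2 * M) `^ (- (beta - 1 - d))) (mu2 * (2 * M) `^ (- (gamma - 2 - d))).
have mu0 : 0 <= mu by rewrite le_max mulr_ge0 ?powR_ge0.
have {}D_bnd r : 2 * M < r -> 0 <= D r <= mu * (r `^ (- d) / r).
  move=> hr; have /andP[-> h] := D_bnd r hr; rewrite /=; apply: le_trans h _.
  have r0 := lt_trans M20 hr.
  apply: le_trans (decay_rate M20 hr mu1_0 db) _; rewrite powR_inv1 ?(ltW r0)//.
  by rewrite ler_wpM2r ?divr_ge0 ?powR_ge0 ?(ltW r0)// le_max lexx.
have {}V_bnd r : 2 * M < r -> 0 <= V r <= mu * (r `^ (- d) / r ^+ 2).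
  move=> hr; have /andP[-> h] := V_bnd r hr; rewrite /=; apply: le_trans h _.
  have r0 := lt_trans M20 hr.
  apply: le_trans (decay_rate M20 hr mu2_0 dg) _;
  have -> : r `^ (- 2) = (r ^+ 2)^-1 by rewrite powRN powR_mulrn// ltW.
  by rewrite ler_wpM2r ?divr_ge0 ?powR_ge0 ?exprn_ge0 ?(ltW r0)// le_max lexx orbT.
split=> [p /andP[p1 ppS]|_].
  apply: (subcritical_lifespan n3 M0 mu0 d0 d1 cD cV D_bnd V_bnd rho0 u0_ge0 u1_ge0 u0_L1 u1_L1 u1_nt p1).
  by apply: gamma_poly_gt0 hS _ => //; rewrite ppS andbT (lt_trans ltr01).
have pSn := strauss_above n3 hS; have [pS0 gS] := hS.
have n2 : 2 < n%:R :> R by rewrite ltr_nat.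
have n10 : 0 < n%:R - 1 :> R by rewrite subr_gt0 (lt_trans _ n2)// ltr1n.
have p1 : 1 < pS by apply: lt_trans pSn; rewrite ltr_pdivlMr// mul1r gtrBl.
have p10 : 0 < pS - 1 by rewrite subr_gt0.
have [q qE] : exists q, q = pS / (pS - 1) by eexists.
have q1 : 1 < q by rewrite qE ltr_pdivlMr// mul1r gtrBl.
have pq : pS^-1 + q^-1 = 1 by rewrite qE; field; rewrite !gt_eqF.
have qn : q < n%:R.
  move: pSn; rewrite qE !ltr_pdivrMr// !mulrBr !mulr1 => h.
  by rewrite ltrBrDr -ltrBrDl (mulrC n%:R).
have crit : n%:R + 2 - 2 * q - half_dim n - q^-1 = 0.
  have -> : @half_dim R n = (n%:R - 1) / 2.
    by rewrite /half_dim -subn1 natrB// (leq_trans _ n3).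
  have -> : n%:R + 2 - 2 * q - (n%:R - 1) / 2 - q^-1 = - gamma_poly pS n / (2 * pS * (pS - 1)).
    by rewrite qE /gamma_poly; field; rewrite !gt_eqF.
  by rewrite gS oppr0 mul0r.
have [N [Cz [zf [z1 [z2 [C [c0 [T1 tm]]]]]]]] :=
  test_modes_exist n3 M0 mu0 d0 d1 cD cV D_bnd V_bnd rho u0_ge0 u1_ge0 u0_L1 u1_L1 u1_nt p1.
have [CC CC0 H] := critical_time_bound n3 M0 rho0 p1 pq q1 tm qn crit.
exists CC, 1; split => // eps eps1.
by apply: ge_ereal_sup => _ /= [T0 adm <-]; rewrite lee_fin; exact: H eps1 adm.
Qed.
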